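(* Let $M$ be a smooth manifold, $(h,X)$ a Morse–Smale pair on $M$, and $v\in\mathrm{Crit}(h)$. Then: (i) $\hat W^-_v$ has a canonical structure of a smooth manifold with corners. (ii) $\hat W^-_v$ is of dimension $i(v)$, and for any $1\le k\le\dim\hat W^-_v$, $$\partial_k\hat W^-_v=\bigsqcup_{w<v}\partial_{k-1}\mathcal B(v,w)\times W^-_w,$$ whereas $\partial_0\hat W^-_v=W^-_v$. (iii) The extension $\hat i_v:\hat W^-_v\to M$ of the inclusion $i_v:W^-_v\to M$ is smooth, where $\hat i_v$ is given on $\mathcal B(v,w)\times W^-_w$, for any $w<v$, by the composition of the projection $\mathcal B(v,w)\times W^-_w\to W^-_w$ with the inclusion $W^-_w\hookrightarrow M$.
   Context: **Morse–Smale pair.** Let $M$ be a smooth $n$-dimensional manifold without boundary and $h:M\to\mathbb R$ a smooth Morse function; $i(v)$ is the index of $v\in\mathrm{Crit}(h)$. A smooth vector field $X$ is gradient-like with respect to $h$ if (GL1) $X(h)(x)<0$ for all $x\in M\setminus\mathrm{Crit}(h)$, and (GL2) for each $v\in\mathrm{Crit}(h)$ there are an open neighborhood $U_v$ of $v$ and a coordinate map (diffeomorphism) $\varphi_v:B_r\to U_v$ from the open ball $B_r\subset\mathbb R^n$ of some radius $r=r(v)>0$ about $0$ with $h\circ\varphi_v(x)=h(v)-\frac12\sum_{j\le i(v)}x_j^2+\frac12\sum_{j>i(v)}x_j^2$ and $\varphi_v^*X=\sum_{j\le i(v)}x_j\partial_{x_j}-\sum_{j>i(v)}x_j\partial_{x_j}$.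 $X$ is assumed complete, with flow $\Phi_t$. Put $W^\pm_v=\{x\in M:\lim_{t\to\pm\infty}\Phi_t(x)=v\}$ (submanifolds of $M$). $(h,X)$ is a Morse–Smale pair if $h$ is a smooth proper Morse function, $X$ is gradient-like with respect to $h$, and $W^-_v$ and $W^+_w$ intersect transversally for all $v,w\in\mathrm{Crit}(h)$. **Trajectories.** For $v\ne w$, $\mathcal T(v,w)=(W^-_v\cap W^+_w)/\mathbb R$, the quotient manifold by the flow. Write $w<v$ iff $i(w)<i(v)$ and $h(w)<h(v)$; $w\le v$ iff $w<v$ or $w=v$. For $w<v$, $\mathcal B(v,w)=\bigcup_{w<v_\ell<\dots<v_1<v}\mathcal T(v,v_1)\times\dots\times\mathcal T(v_\ell,w)$ (union over all finite, possibly empty, chains of critical points), and $\mathcal B(v,v)=\{v\}$. It is a manifold with corners with $\partial_k\mathcal B(v,w)=\bigsqcup_{w<v_k<\dots<v_1<v}\mathcal T(v,v_1)\times\dots\times\mathcal T(v_k,w)$. $\hat W^-_v=\bigsqcup_{w\le v}\mathcal B(v,w)\times W^-_w$, where $\{v\}\times W_v^-$ is identified with $W^-_v$ and $\hat i_v$ restricted to it is the inclusion $i_v$; $\hat h_v=h\circ\hat i_v$. Each $(\gamma,x)\in\hat W^-_v$ is identified with the continuous path $\gamma_x:[h(x),h(v)]\to M$ along the (broken) trajectory from $v$ to $x$ with $h(\gamma_x(s))=s$. **Manifolds with corners.** An $\mathbb R^n_{\ge0}$-manifold is a paracompact Hausdorff space with a maximal atlas of charts that are homeomorphisms onto open subsets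 of $\mathbb R^n_{\ge0}=\{x\in\mathbb R^n:x_i\ge0\ \forall i\}$ with smooth transition maps (a map on an open subset of $\mathbb R^n_{\ge0}$ is smooth if it extends smoothly to an open subset of $\mathbb R^n$). For such a manifold $N$, $\partial_kN$ is the set of points having exactly $k$ vanishing coordinates in a (any) chart. A $k$-face is the closure of a connected component of $\partial_kN$. $N$ is an $n$-dimensional manifold with corners if each $k$-face, $0\le k\le n$, is a smooth $\mathbb R^{n-k}_{\ge0}$-manifold. **Meaning of ''canonical''.** List the critical values in decreasing order $\dots<c_{j+1}<c_j<\dots$ (with $c_{j+1}=-\infty$ or $c_{j-1}=+\infty$ if there is no critical value below, resp. above, $c_j$). Let $h(v)=c_{\ell_0-1}$. For $\ell\ge\ell_0-1$ put $\hat W^-_{v,\ell}=\{(\gamma,x)\in\hat W^-_v:c_{\ell+1}<h(x)<c_{\ell-1}\}$; these sets cover $\hat W^-_v$ and are open in its topology. $\hat W^-_{v,\ell_0-1}$ is identified with an open subset of $W^-_v$. For $\ell\ge\ell_0$ and $\varepsilon>0$ sufficiently small let $M_j^\pm=h^{-1}(c_j\pm\varepsilon)$ and consider the injective map $$\hat J_\ell:\hat W^-_{v,\ell}\to\Big(\prod_{j=\ell_0}^{\ell-1}M_j^+\times M_j^-\Big)\times M_\ell^+\times h^{-1}((c_{\ell+1},c_{\ell-1})),\quad \gamma_x\mapsto\big((x_j^+,x_j^-)_{\ell_0\le j\le\ell-1},x_\ell^+,x\big),$$ where $x_j^\pm$ is the intersection point of $\gamma_x$ with $M_j^\pm$ ($\gamma_x$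 being prolonged beyond $x$ by the forward trajectory of $X$ through $x$ when the level set lies below $h(x)$). The topology and smooth structure of $\hat W^-_v$ are those for which each $\hat W^-_{v,\ell}$ is open, $\hat W^-_{v,\ell_0-1}$ has the structure of an open subset of $W^-_v$, and each $\hat J_\ell$, $\ell\ge\ell_0$, is a smooth embedding (injective differentials, homeomorphism onto its image). This structure does not depend on $\varepsilon$. *)

(* Defs.v *)
From HB Require Import structures.
From mathcomp Require Import all_boot all_order all_algebra.
From mathcomp Require Import all_classical all_reals all_analysis.
Set Implicit Arguments.
Unset Strict Implicit.
Unset Printing Implicit Defensive.
Import Order.TTheory GRing.Theory Num.Theory.
Import numFieldNormedType.Exports.
Local Open Scope classical_set_scope.
Local Open Scope ring_scope.

(* ** Smooth maps between Euclidean spaces, in coordinates *)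

Section Calculus.
Context {R : realType}.

Definition partial n (i : 'I_n) (f : 'rV[R]_n -> R) (x : 'rV[R]_n) : R :=
  derive1 (fun t : R => f (x + t *: delta_mx 0 i)) 0.

Definition jacobian n m (f : 'rV[R]_n -> 'rV[R]_m) (x : 'rV[R]_n) :
  'M[R]_(n, m) := \matrix_(i, j) partial i (fun y => f y 0 j) x.

Definition hessian n (f : 'rV[R]_n -> R) (x : 'rV[R]_n) : 'M[R]_n :=
  \matrix_(i, j) partial i (partial j f) x.

(* [f] is of class C^k on [V]; only used for open [V]. *)
Fixpoint Ck (k : nat) n (V : set 'rV[R]_n) (f : 'rV[R]_n -> R) : Prop :=
  (forall x, V x -> {for x, continuous f}) /\
  match k with
  | 0%N => True
  | k'.+1 => forall i : 'I_n,
      (forall x, V x ->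
         derivable (fun t : R => f (x + t *: delta_mx 0 i)) 0 1) /\
      Ck k' V (partial i f)
  end.

Definition smooth_extension n m (O : set 'rV[R]_n)
    (f g : 'rV[R]_n -> 'rV[R]_m) : Prop :=
  (exists V : set 'rV[R]_n, [/\ open V, O `<=` V &
     forall (k : nat) (j : 'I_m), Ck k V (fun x => g x 0 j)]) /\
  (forall x, O x -> f x = g x).

(* Smoothness on a set which need not be open in R^n (e.g. a relatively open
   subset of an orthant) *)
Definition smooth_on n m (O : set 'rV[R]_n) (f : 'rV[R]_n -> 'rV[R]_m) :=
  exists g, smooth_extension O f g.

Definition orthant n : set 'rV[R]_n :=
  [set x : 'rV[R]_n | forall i, 0 <= x 0 i].

End Calculus.

(* ** Manifolds modelled on a subset [E] of R^n: [E] is R^n for manifolds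
   without boundary and [orthant n] for R^n_{>=0}-manifolds *)

(* Only the values of [cmap] on [cdom] and of [cinv] on [cmap @` cdom]
   matter. *)
Record chart (R : realType) (n : nat) (T : Type) := Chart {
  cdom : set T;
  cmap : T -> 'rV[R]_n;
  cinv : 'rV[R]_n -> T }.

Section Atlas.
Context {R : realType} {n : nat}.

Definition cimg (T : Type) (c : chart R n T) : set 'rV[R]_n :=
  cmap c @` cdom c.

Definition chart_of (E : set 'rV[R]_n) (T : topologicalType)
    (c : chart R n T) : Prop :=
  [/\ open (cdom c),
      exists2 O : set 'rV[R]_n, open O & cimg c = O `&` E,
      forall x, cdom c x -> cinv c (cmap c x) = x,
      {within cdom c, continuous (cmap c)} &
      {within cimg c, continuous (cinv c)}].

Definition compatible (T : Type) (c d : chart R n T) : Prop :=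
  smooth_on (cmap c @` (cdom c `&` cdom d)) (cmap d \o cinv c) /\
  smooth_on (cmap d @` (cdom c `&` cdom d)) (cmap c \o cinv d).

Definition maximal_atlas (E : set 'rV[R]_n) (T : topologicalType)
    (A : set (chart R n T)) : Prop :=
  [/\ forall c, A c -> chart_of E c,
      forall x, exists2 c, A c & cdom c x,
      forall c d, A c -> A d -> compatible c d &
      forall c, chart_of E c -> (forall d, A d -> compatible c d) -> A c].

End Atlas.

Definition paracompact (T : topologicalType) : Prop :=
  forall C : set (set T), C `<=` open -> \bigcup_(U in C) U = setT ->
  exists D : set (set T),
    [/\ D `<=` open, \bigcup_(V in D) V = setT,
        forall V, D V -> exists2 U, C U & V `<=` U &
        forall x : T, exists2 O : set T, nbhs x O &
          finite_set [set V | D V /\ V `&` O !=set0]].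

Record manifold (R : realType) (n : nat) (E : set 'rV[R]_n) := Manifold {
  mspace :> topologicalType;
  atlas : set (chart R n mspace);
  mhausdorff : hausdorff_space mspace;
  mparacompact : paracompact mspace;
  matlas : maximal_atlas E atlas }.
Arguments atlas {R n E} m.

Notation smooth_manifold R n := (@manifold R n setT).
Notation orthant_manifold R n := (@manifold R n (@orthant R n)).

Section Maps.
Context {R : realType} {n m : nat} {E : set 'rV[R]_n} {E' : set 'rV[R]_m}.
Variables (N : manifold E) (P : manifold E').

Definition overlap (U : set N) (f : N -> P) (c : chart R n N)
    (d : chart R m P) : set 'rV[R]_n :=
  cmap c @` (U `&` cdom c `&` f @^-1` cdom d).

(* Smoothness of [f] on the open subset [U] *)
Definition smooth_map (U : set N) (f : N -> P) : Prop :=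
  (forall x, U x -> {for x, continuous f}) /\
  (forall c d, atlas N c -> atlas P d ->
     smooth_on (overlap U f c d) (cmap d \o f \o cinv c)).

(* The map [x |-> (F i x)_i] from [U] to the product manifold [P^I] has
   injective differentials. The differential at a boundary point is that of
   any smooth extension of the local expression. *)
Definition injective_differentials (I : Type) (U : set N) (F : I -> N -> P) :=
  forall (x : N) (c : chart R n N) (d : I -> chart R m P)
         (G : I -> 'rV[R]_n -> 'rV[R]_m),
    U x -> atlas N c -> cdom c x ->
    (forall i, atlas P (d i) /\ cdom (d i) (F i x)) ->
    (forall i, smooth_extension (overlap U (F i) c (d i))
                 (cmap (d i) \o F i \o cinv c) (G i)) ->
    forall u : 'rV[R]_n,
      (forall i, u *m jacobian (G i) (cmap c x) = 0) -> u = 0.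

(* The map [x |-> (F i x)_i] from the open subset [U] of [N] to the product
   of the [Y i], [i : I] (with [I] finite), is a smooth embedding. Here the
   [Y i] are submanifolds of [P], so that smoothness, injectivity of the
   differentials and the induced topology may be tested in [P^I]. *)
Definition smooth_embedding (I : Type) (U : set N) (F : I -> N -> P)
    (Y : I -> set P) : Prop :=
  [/\ forall x i, U x -> Y i (F i x),
      forall i, smooth_map U (F i),
      injective_differentials U F,
      set_inj U (fun x i => F i x) &
      forall V : set N, open V -> V `<=` U ->
        exists2 O : set (prod_topology (fun _ : I => P)), open O &
          V = U `&` [set x | O (fun i => F i x)]].

End Maps.

Definition diffeomorphism (R : realType) (n m : nat) (E : set 'rV[R]_n)
    (E' : set 'rV[R]_m) (N : manifold E) (P : manifold E')
    (f : N -> P) : Prop :=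
  smooth_map setT f /\
  exists g : P -> N, [/\ cancel f g, cancel g f & smooth_map setT g].

Section Corners.
Context {R : realType}.

Definition boundary n (N : orthant_manifold R n) (k : nat) : set N :=
  [set x | exists c, [/\ atlas N c, cdom c x &
             #|[set i : 'I_n | cmap c x 0 i == 0]%SET| = k]].

Arguments boundary {n} N k _.

Definition is_face n (N : orthant_manifold R n) (k : nat) (F : set N) :=
  exists2 x : N, boundary N k x &
    F = closure (connected_component (boundary N k) x).

(* The k-face [F], as a subset of [N], is an R^{n-k}_{>=0}-manifold. *)
Definition manifold_with_corners n (N : orthant_manifold R n) : Prop :=
  forall (k : nat) (F : set N), (k <= n)%N -> is_face k F ->
    exists (Q : orthant_manifold R (n - k)) (j : Q -> N),
      range j = F /\
      smooth_embedding setT (fun _ : unit => j) (fun _ => F).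

End Corners.

Arguments boundary {R n} N k _.

(* ** Morse functions and gradient-like vector fields *)

Section Morse.
Context {R : realType} {n : nat}.
Variable M : smooth_manifold R n.

(* A smooth vector field: [vf c x] is the row of coordinates of the tangent
   vector at [x] in the chart [c]. *)
Record vector_field := VectorField {
  vf :> chart R n M -> M -> 'rV[R]_n;
  vf_change : forall c d x, atlas M c -> atlas M d -> cdom c x -> cdom d x ->
    vf d x = vf c x *m jacobian (cmap d \o cinv c) (cmap c x);
  vf_smooth : forall c, atlas M c -> smooth_on (cimg c) (vf c \o cinv c) }.

Variables (h : M -> R) (X : vector_field) (Phi : R -> M -> M).

Definition smooth_function : Prop :=
  forall c, atlas M c ->
    smooth_on (cimg c) (fun y => \row_(j < 1) h (cinv c y)).

Definition crit : set M := [set x | forall c, atlas M c -> cdom c x ->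
  forall i, partial i (h \o cinv c) (cmap c x) = 0].

Definition morse : Prop :=
  smooth_function /\
  forall v c, crit v -> atlas M c -> cdom c v ->
    hessian (h \o cinv c) (cmap c v) \in unitmx.

(* The largest dimension of a subspace on which the Hessian of [h] at [v] is
   negative definite *)
Definition morse_index (v : M) : nat :=
  \max_(k < n.+1 | `[< exists c (B : 'M[R]_(k, n)),
      [/\ atlas M c, cdom c v, row_free B &
          forall u : 'rV[R]_k, u != 0 ->
            ((u *m B) *m hessian (h \o cinv c) (cmap c v) *m (u *m B)^T) 0 0
              < 0] >]) k.

(* X(h)(x), computed in the chart [c] *)
Definition lie_derivative (c : chart R n M) (x : M) : R :=
  \sum_(i < n) X c x 0 i * partial i (h \o cinv c) (cmap c x).

Definition gradient_like : Prop :=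
  (forall x c, ~ crit x -> atlas M c -> cdom c x -> lie_derivative c x < 0) /\
  (forall v, crit v -> exists c (r : R),
     [/\ atlas M c /\ cdom c v, 0 < r,
         cimg c = [set y : 'rV[R]_n | \sum_(j < n) y 0 j ^+ 2 < r ^+ 2],
         forall y, cimg c y -> h (cinv c y) =
           h v - 2^-1 * (\sum_(j < n | (j < morse_index v)%N) y 0 j ^+ 2)
               + 2^-1 * (\sum_(j < n | (morse_index v <= j)%N) y 0 j ^+ 2) &
         forall y, cimg c y -> forall j : 'I_n,
           X c (cinv c y) 0 j =
             if (j < morse_index v)%N then y 0 j else - y 0 j]).

(* [Phi] is the (global) flow of [X], which is therefore complete. *)
Definition is_flow : Prop :=
  forall x,
    [/\ Phi 0 x = x, continuous (fun t : R => Phi t x) &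
        forall t c, atlas M c -> cdom c (Phi t x) -> forall j,
          is_derive t 1 (fun s : R => cmap c (Phi s x) 0 j : R)
            (X c (Phi t x) 0 j)].

Definition Wminus (v : M) : set M := [set x | Phi t x @[t --> -oo] --> v].
Definition Wplus (v : M) : set M := [set x | Phi t x @[t --> +oo] --> v].

(* [u] gives the coordinates in [c] of a vector tangent at [x] to the
   submanifold [S]: the velocity of a smooth curve of [M] lying in [S]. *)
Definition tangent (S : set M) (x : M) (c : chart R n M) (u : 'rV[R]_n) :=
  exists (g : R -> M) (a : R),
    [/\ 0 < a, g 0 = x,
        forall t, `|t| < a -> S (g t) /\ cdom c (g t),
        forall t (k : nat) (j : 'I_n), `|t| < a ->
          derivable (derive1n k (fun s : R => cmap c (g s) 0 j : R)) t 1 &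
        forall j, derive1 (fun s : R => cmap c (g s) 0 j : R) 0 = u 0 j].

Definition transverse (S S' : set M) : Prop :=
  forall x c, S x -> S' x -> atlas M c -> cdom c x ->
    forall u : 'rV[R]_n, exists u1 u2,
      [/\ tangent S x c u1, tangent S' x c u2 & u = u1 + u2].

Definition proper_function : Prop :=
  forall K : set R, compact K -> compact (h @^-1` K).

Definition morse_smale : Prop :=
  [/\ morse, proper_function, gradient_like &
      forall v w, crit v -> crit w -> transverse (Wminus v) (Wplus w)].

(* ** Broken trajectories *)

Definition crit_lt (w v : M) : Prop :=
  (morse_index w < morse_index v)%N /\ h w < h v.
Definition crit_le (w v : M) : Prop := crit_lt w v \/ w = v.

Definition flow_line (x : M) : set M := range (Phi ^~ x).

(* T(v, w), for [v <> w]: its elements are the flow lines in W^-_v `&` W^+_w. *)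
Definition traj (v w : M) : set (set M) :=
  [set o | exists2 x, (Wminus v `&` Wplus w) x & o = flow_line x].

(* A broken trajectory from [v] is encoded by the list of its flow lines, each
   paired with the critical point at which it ends. *)
Definition broken : Type := seq (set M * M).

Fixpoint is_broken (v : M) (s : broken) (w : M) : Prop :=
  match s with
  | [::] => v = w
  | (o, u) :: s' => [/\ crit u, crit_lt u v, traj v u o & is_broken u s' w]
  end.

(* B(v, w); for [w = v] its only element is [[::]], i.e. the point [v]. *)
Definition Bset (v w : M) : set broken := [set s | is_broken v s w].

(* The stratum of B(v, w), for [w < v], made of the products
   T(v, v_1) x ... x T(v_k, w) over the chains w < v_k < ... < v_1 < v *)
Definition Bboundary (k : nat) (v w : M) : set broken :=
  [set s | Bset v w s /\ size s = k.+1].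

(* The point [w] such that (s, x) lies in B(v, w) x W^-_w is determined by
   [x], hence is not recorded. *)
Definition What (v : M) : set (broken * M) :=
  [set p | exists w, [/\ crit w, crit_le w v, Bset v w p.1 & Wminus w p.2]].

Fixpoint broken_points (v : M) (s : broken) : set M :=
  match s with
  | [::] => [set v]
  | (o, u) :: s' => v |` (o `|` broken_points u s')
  end.

(* The image of the path [gamma_x], prolonged beyond [x] by the forward
   trajectory through [x] *)
Definition prolonged_path (v : M) (p : broken * M) : set M :=
  broken_points v p.1 `|` flow_line p.2.

(* The point of (prolonged) [gamma_x] on the level [a]; the default value [v]
   is irrelevant where such a point exists. It is unique since [h] decreases
   strictly along the path. *)
Definition path_point (v : M) (p : broken * M) (a : R) : M :=
  xget v [set y | prolonged_path v p y /\ h y = a].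

(* ** The canonical structure *)

Definition critval (c : R) : Prop := exists2 u, crit u & h u = c.

(* The neighbouring critical values of [c] (the critical values of a proper
   Morse function being discrete), or -oo, +oo if there is none *)
Definition crit_below (c : R) : \bar R :=
  ereal_sup [set a%:E | a in [set a : R | critval a /\ a < c]].
Definition crit_above (c : R) : \bar R :=
  ereal_inf [set a%:E | a in [set a : R | critval a /\ c < a]].

(* h^-1((c_{l+1}, c_{l-1})) for [c = c_l] *)
Definition slab (c : R) : set M :=
  [set x | (crit_below c < (h x)%:E)%E /\ ((h x)%:E < crit_above c)%E].

(* The levels of M_j^+, M_j^- (for c_j in [cs]) and M_l^+ (for [c = c_l]) *)
Definition levels (cs : seq R) (c eps : R) : seq R :=
  rcons (flatten [seq [:: a + eps; a - eps] | a <- cs]) (c + eps).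

(* The components of the map \hat J_l and of its target: one for each of the
   above levels, and [None] for the end point of the path *)
Definition J_map (v : M) (ls : seq R) (i : option 'I_(size ls))
    (p : broken * M) : M :=
  if i is Some j then path_point v p (nth 0 ls j) else p.2.
Definition J_target (c : R) (ls : seq R) (i : option 'I_(size ls)) : set M :=
  if i is Some j then h @^-1` [set nth 0 ls j] else slab c.

Section Canonical.
Context {m : nat} {E : set 'rV[R]_m}.
Variables (v : M) (N : manifold E) (e : N -> broken * M).

(* The part \hat W^-_{v,l} of [N], for [c = c_l] *)
Definition What_slab (c : R) : set N := e @^-1` [set p | slab c p.2].

(* [e] identifies [N] with \hat W^-_v, and the topology and smooth structure
   of [N] are then the canonical ones. The first embedding below expresses
   that the part with c_{l_0} < h has the structure of an open subset of
   W^-_v; in the second one, [cs] lists c_{l_0}, ..., c_{l-1}. *)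
Definition canonical_structure : Prop :=
  [/\ set_bij setT (What v) e,
      forall c, critval c -> c <= h v -> open (What_slab c),
      smooth_embedding (What_slab (h v)) (fun (_ : unit) x => (e x).2)
        (fun _ => Wminus v) &
      forall (c : R) (cs : seq R), critval c -> c < h v ->
        sorted (fun a b => b < a) cs ->
        (forall a, a \in cs <-> critval a /\ c < a < h v) ->
        \forall eps \near 0^'+,
          smooth_embedding (What_slab c)
            (fun i x => @J_map v (levels cs c eps) i (e x))
            (@J_target c (levels cs c eps))].

End Canonical.

End Morse.

(* Main.v *)
(** A point of \hat W^-_v is determined by the end point of its path together
    with the points in which the path meets finitely many regular levels of [h].
    Around each broken trajectory there is a chart in which all these
    observations are smooth and whose inverse is a smooth function of finitely
    many of them; changes of charts are therefore smooth. The charts are built by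
    induction along the path, starting from the unstable disc of [v]: they are
    transported along the flow and, near each critical point [u] where the path
    breaks, blown up. There the flow is linear, so that a trajectory entering at
    a point with unstable coordinates [rho y] and stable coordinates [z] leaves at
    [(y, rho z)]; the new boundary coordinate [rho >= 0] vanishes exactly on the
    paths broken at [u], and by transversality the unstable coordinates of the
    entrance point are part of a coordinate system.

    The components of the maps \hat J_l and the observations determine each other
    through the flow, which shows that these maps are embeddings and that any
    canonical structure is the one defined by the charts. The vanishing boundary
    coordinates at a point correspond to the critical points at which its path
    breaks. The list of these critical points is locally constant on each
    [boundary N k], so that in a chart a k-face is the vanishing locus of a fixed
    set of [k] coordinates. *)

From Pilot Require Import Defs.
From HB Require Import structures.
From mathcomp Require Import all_boot all_order all_algebra fingroup perm.
From mathcomp Require Import all_classical all_reals all_analysis.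
From mathcomp Require Import ring lra.
Import Pilot.Defs.
Set Implicit Arguments.
Unset Strict Implicit.
Unset Printing Implicit Defensive.
Import Order.TTheory GRing.Theory Num.Theory.
Import numFieldNormedType.Exports.
Local Open Scope classical_set_scope.
Local Open Scope ring_scope.

(** * Calculus in coordinates *)

(** The obstacle is that smoothness at a corner means the existence of a smooth extension to a full
    neighbourhood in R^m, whereas paths exist only over the orthant. This is why the inverse [gL] of
    a parametrization takes arbitrary points of M as arguments: being smooth on a full
    neighbourhood, it is composed and differentiated without boundary cases. Local extensions
    ([rel_cinfv]) are the working notion, and a partition of unity turns them into the single
    extension that [smooth_on] demands. Everything on M is tested on smooth plots R^q -> M, so that
    inverse functions and flows need to be studied for row vectors only. That the index drops along
    a trajectory, as the order [crit_lt] requires, is no assumption on a Morse-Smale pair: it comes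
    out of the rank count that straightens the coordinates of a chart. Properness of [h] enters
    through the isolation of critical values, the descent of flow lines to lower regular levels, and
    a countable atlas, from which paracompactness follows. *)

Lemma differentiable_by (R : realType) (V W : normedModType R) (f : V -> W) x
    (df : {linear V -> W}) : continuous df ->
  (forall e, 0 < e -> \forall h \near (0 : V), `|f (x + h) - f x - df h| <= e * `|h|) ->
  differentiable f x /\ 'd f x = df :> (V -> W).
Proof.
move=> cdf H.
have E : f \o shift x = cst (f x) + df +o_ 0 id.
  apply/eqaddoP => e e0.
  have := H _ e0; apply: filterS => h.
  by apply: le_trans; rewrite !fctE /= opprD addrA [h + x]addrC.
have D : 'd f x = df :> (V -> W) by exact: diff_unique.
by split => //; apply/diff_locallyP; rewrite D.
Qed.

Section Line.
Context {R : realType} {V : normedModType R}.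
Implicit Types (f : V -> R) (y e : V).

Lemma line_quot f y e (t : R) :
  (fun h : R => h^-1 *: (((fun s : R => f (y + s *: e)) \o shift t) (h *: 1) - f (y + t *: e)))
  = (fun h : R => h^-1 *: ((f \o shift (y + t *: e)) (h *: e) - f (y + t *: e))).
Proof.
apply/funext => h /=; congr (_ *: (f _ - _)).
by rewrite [h *: 1]mulr1 scalerDl addrCA.
Qed.

Lemma line_derivable f y e (t : R) :
  derivable (fun s : R => f (y + s *: e)) t 1 = derivable f (y + t *: e) e.
Proof. by rewrite /derivable line_quot. Qed.

Lemma line_derive f y e (t : R) :
  'D_1 (fun s : R => f (y + s *: e)) t = 'D_e f (y + t *: e).
Proof. by rewrite /derive line_quot. Qed.

Lemma line_is_derive f y e (t : R) : derivable f (y + t *: e) e ->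
  is_derive t 1 (fun s : R => f (y + s *: e)) ('D_e f (y + t *: e)).
Proof. by move=> H; split; rewrite ?line_derivable ?line_derive. Qed.

Lemma line_mvt f y e (s : R) :
  (forall t, `|t| <= `|s| -> derivable f (y + t *: e) e) ->
  exists2 c, `|c| <= `|s| & f (y + s *: e) - f y = s * 'D_e f (y + c *: e).
Proof.
move=> H.
have H0 a b : `|a| <= `|s| -> `|b| <= `|s| -> a <= b -> exists2 c : R, c \in `[a, b] &
    f (y + b *: e) - f (y + a *: e) = 'D_e f (y + c *: e) * (b - a).
  move=> ha hb ab.
  have D t : t \in `[a, b] -> is_derive t 1 (fun s : R => f (y + s *: e)) ('D_e f (y + t *: e)).
    rewrite in_itv /= => /andP[t1 t2]; apply: line_is_derive; apply: H.
    move: ha hb; rewrite !ler_norml => /andP[a1 a2] /andP[b1 b2].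
    by rewrite (le_trans a1) // (le_trans t2).
  have D' t : t \in `]a, b[ -> is_derive t 1 (fun s : R => f (y + s *: e)) ('D_e f (y + t *: e)).
    by move=> /subset_itv_oo_cc; exact: D.
  have C : {within `[a, b], continuous (fun s : R => f (y + s *: e))}.
    by apply: derivable_within_continuous => t /D [].
  exact: (MVT_segment ab D' C).
have [s0|s0] := leP 0 s.
- have [|||c] := H0 0 s; rewrite ?normr0 //.
  rewrite in_itv /= scale0r addr0 subr0 => /andP[c1 c2] E; exists c; last by rewrite E mulrC.
  by rewrite !ger0_norm.
- have [|||c] := H0 s 0; rewrite ?normr0 //; first exact: ltW.
  rewrite in_itv /= scale0r addr0 sub0r => /andP[c1 c2] E; exists c.
    by rewrite ler0_norm // ltr0_norm // lerN2.
  by rewrite -opprB E; ring.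
Qed.

End Line.

Section Coord.
Context {R : realType}.
Local Notation E n := 'rV[R]_n.

Lemma partialE n (i : 'I_n) (f : E n -> R) x : partial i f x = 'D_(delta_mx 0 i) f x.
Proof. by rewrite /partial derive1E line_derive scale0r addr0. Qed.

Lemma pline_derivable n (i : 'I_n) (f : E n -> R) x :
  derivable (fun t : R => f (x + t *: delta_mx 0 i)) 0 1 = derivable f x (delta_mx 0 i).
Proof. by rewrite line_derivable scale0r addr0. Qed.

Lemma coordB n (x y : E n) i : (x - y) 0 i = x 0 i - y 0 i.
Proof. by rewrite !mxE. Qed.

Lemma coordD n (x y : E n) i : (x + y) 0 i = x 0 i + y 0 i.
Proof. by rewrite mxE. Qed.

Lemma coordZ n c (x : E n) i : (c *: x) 0 i = c * x 0 i.
Proof. by rewrite mxE. Qed.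

Lemma coord_le_norm n (x : E n) i : `|x 0 i| <= `|x|.
Proof.
rewrite [`|x|]/Num.norm /= mx_normrE.
by apply/bigmax_geP; right; exists (0, i).
Qed.

Lemma norm_le_coord n (x : E n) (b : R) : 0 <= b -> (forall i, `|x 0 i| <= b) -> `|x| <= b.
Proof.
move=> b0 H; rewrite [`|x|]/Num.norm /= mx_normrE.
by apply/bigmax_leP; split => // -[i j] _; rewrite ord1 /=.
Qed.

Lemma norm_lt_coord n (x : E n) (b : R) : 0 < b -> (forall i, `|x 0 i| < b) -> `|x| < b.
Proof.
move=> b0 H; rewrite [`|x|]/Num.norm /= mx_normrE.
by apply/bigmax_ltP; split => // -[i j] _; rewrite ord1 /=.
Qed.

Lemma norm_delta n (i : 'I_n) : `|delta_mx 0 i : E n| <= 1.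
Proof.
apply: norm_le_coord => // j; rewrite mxE /=.
by case: (j == i); rewrite ?normr1 ?normr0.
Qed.

(** The filter [nbhs x] with an explicit radius (see [nrP]). The predicate lives on all of R^n, so
    statements near a corner take the form [nr x (fun z => D z -> ...)]. *)
Definition nr n (x : E n) (P : E n -> Prop) :=
  exists2 d : R, 0 < d & forall y, `|y - x| < d -> P y.

Lemma nrP n (x : E n) P : nr x P <-> nbhs x P.
Proof.
split=> [[d d0 H]|/nbhs_ballP [d /= d0 H]].
  apply/nbhs_ballP; exists d => // y; rewrite -ball_normE /= distrC; exact: H.
by exists d => // y; rewrite distrC => yx; apply: H; rewrite -ball_normE.
Qed.

Lemma nrW n (x : E n) (P Q : E n -> Prop) : (forall y, P y -> Q y) -> nr x P -> nr x Q.
Proof. by move=> PQ [d d0 H]; exists d => // y /H /PQ. Qed.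

Lemma nrT n (x : E n) (P : E n -> Prop) : (forall y, P y) -> nr x P.
Proof. by move=> H; exists 1. Qed.

Lemma nrI n (x : E n) (P Q : E n -> Prop) : nr x P -> nr x Q -> nr x (fun y => P y /\ Q y).
Proof.
move=> [d d0 H] [d' d'0 H']; exists (Num.min d d'); first by rewrite lt_min d0.
by move=> y; rewrite lt_min => /andP[/H ? /H' ?].
Qed.

Lemma nr_forall n (x : E n) (I : finType) (P : I -> E n -> Prop) :
  (forall i, nr x (P i)) -> nr x (fun y => forall i, P i y).
Proof.
move=> H; apply/nrP.
have : \forall y \near nbhs x, forall i, P i y by apply: filter_forall => i; apply/nrP.
by [].
Qed.

Lemma nr_self n (x : E n) (P : E n -> Prop) : nr x P -> P x.
Proof. by move=> [d d0]; apply; rewrite subrr normr0. Qed.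

Lemma nr_open n (W : set (E n)) : open W <-> forall x, W x -> nr x W.
Proof.
rewrite openE; split=> H x Wx; first by apply/nrP; exact: H.
by apply/nrP; exact: H.
Qed.

Lemma nr_nr n (x : E n) (P : E n -> Prop) : nr x P -> nr x (fun y => nr y P).
Proof.
move=> [d d0 H]; exists d => // y xy; exists (d - `|y - x|); first by rewrite subr_gt0.
move=> z zy; apply: H; rewrite -(subrK y z) -addrA.
by apply: le_lt_trans (ler_normD _ _) _; rewrite -ltrBrDr.
Qed.

Lemma ctsP n (f : E n -> R) x :
  {for x, continuous f} <-> forall e, 0 < e -> nr x (fun y => `|f y - f x| < e).
Proof.
split=> [/cvgrPdist_lt H e e0|H].
  by apply/nrP; have := H e e0; apply: filterS => y /=; rewrite distrC.
apply/(@cvgrPdist_lt _ _ _ (nbhs x) (nbhs_filter x)) => e e0; have /nrP := H e e0.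
by apply: filterS => y /=; rewrite distrC.
Qed.

Definition lform n (a : 'I_n -> R) (h : E n) : R := \sum_i h 0 i * a i.

Fact lform_linear n (a : 'I_n -> R) : linear (lform a).
Proof.
move=> c x y; rewrite /lform scaler_sumr -big_split /=; apply: eq_bigr => i _.
by rewrite !mxE mulrDl [_ *: _]mulrA.
Qed.
HB.instance Definition _ n (a : 'I_n -> R) :=
  GRing.isLinear.Build R (E n) R _ (lform a) (lform_linear a).

Lemma lform_norm n (a : 'I_n -> R) (h : E n) : `|lform a h| <= (\sum_i `|a i|) * `|h|.
Proof.
rewrite mulr_suml; apply: le_trans (ler_norm_sum _ _ _) _; apply: ler_sum => i _.
by rewrite normrM mulrC ler_wpM2l // coord_le_norm.
Qed.

Lemma continuous_lform n (a : 'I_n -> R) : continuous (lform a).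
Proof.
move=> x; apply/ctsP => e e0; exists (e / (\sum_i `|a i| + 1)).
  by rewrite divr_gt0 // ltr_wpDl // sumr_ge0.
move=> y; rewrite ltr_pdivlMr ?ltr_wpDl ?sumr_ge0 // => yx.
rewrite -raddfB /=; apply: le_lt_trans (lform_norm _ _) _.
by apply: le_lt_trans yx; rewrite mulrC ler_wpM2l // lerDl.
Qed.

(** The vertices of the path from [0] to [h] that changes one coordinate at a time. *)
Definition trunc n (k : nat) (h : E n) : E n := \row_j (if (j < k)%N then h 0 j else 0).

Lemma norm_trunc n k (h : E n) : `|trunc k h| <= `|h|.
Proof.
apply: norm_le_coord => // i; rewrite mxE; case: ifP => _; first exact: coord_le_norm.
by rewrite normr0.
Qed.

Lemma truncS n (k : 'I_n) (h : E n) : trunc k.+1 h = trunc k h + h 0 k *: delta_mx 0 k.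
Proof.
apply/rowP => j; rewrite !mxE eqxx /= ltnS leq_eqVlt.
have [->|jk] := eqVneq j k; first by rewrite eqxx ltnn mulr1 add0r.
by rewrite (negbTE (_ : nat_of_ord j != k)) //= mulr0 addr0.
Qed.

Lemma telescope_coord n (f : E n -> R) x h :
  f (x + h) - f x = \sum_(k < n) (f (x + trunc k h + h 0 k *: delta_mx 0 k) - f (x + trunc k h)).
Proof.
have -> : f (x + h) - f x = f (x + trunc n h) - f (x + trunc 0 h).
  congr (f (_ + _) - f _); first by apply/rowP => j; rewrite mxE ltn_ord.
  by rewrite (_ : trunc 0 h = 0) ?addr0 //; apply/rowP => j; rewrite !mxE.
rewrite -(telescope_sumr (fun k => f (x + trunc k h)) (leq0n n)) big_mkord.
by apply: eq_bigr => k _; rewrite truncS addrA.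
Qed.

(** Along the points [x + trunc k h] only one coordinate changes at a time, so the mean value
    theorem writes each increment with a partial derivative at a point close to [x]; continuity of
    the partials bounds the total error. *)
Lemma C1_differentiable n (f : E n -> R) x :
  nr x (fun y => forall i, derivable f y (delta_mx 0 i)) ->
  (forall i, {for x, continuous (partial i f)}) ->
  differentiable f x /\ 'd f x = lform (fun i => partial i f x) :> (E n -> R).
Proof.
move=> H1 H2; apply: differentiable_by; first exact: continuous_lform.
move=> e e0.
(* There are [n] increments, each with error [e' * |h|]; [n.+1] keeps the denominator nonzero when
   [n = 0]. *)
pose e' := e / n.+1%:R.
have e'0 : 0 < e' by rewrite divr_gt0.
have [d d0 H3] := nrI H1 (nr_forall (fun i => (ctsP (partial i f) x).1 (H2 i) e' e'0)).
have H3' y : `|x - y| < d -> (forall i, derivable f y (delta_mx 0 i)) /\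
    forall i, `|partial i f x - partial i f y| < e'.
  by rewrite distrC => /H3 [h1 h2]; split => // i; rewrite distrC; exact: h2.
(* The intermediate points differ from [x] by a truncation of [h] plus a multiple of a basis vector,
   both of norm at most [|h| < d / 2]. *)
apply/nbhs_ballP; exists (d / 2); first by rewrite /= divr_gt0.
move=> h; rewrite -ball_normE /= sub0r normrN => hd.
rewrite telescope_coord /lform -sumrB.
apply: le_trans (ler_norm_sum _ _ _) _.
have K (k : 'I_n) : `|f (x + trunc k h + h 0 k *: delta_mx 0 k) - f (x + trunc k h)
    - h 0 k * partial k f x| <= e' * `|h|.
  have Z t : `|t| <= `|h 0 k| -> `|x - (x + trunc k h + t *: delta_mx 0 k)| < d.
    move=> tk; rewrite opprD addrA opprD addrA subrr add0r -opprD normrN.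
    apply: le_lt_trans (ler_normD _ _) _; rewrite [d]splitr.
    apply: ltr_leD; first exact: le_lt_trans (norm_trunc _ _) hd.
    rewrite normrZ; apply: le_trans (ltW hd).
    apply: le_trans (coord_le_norm h k); apply: le_trans tk.
    by rewrite ler_piMr // norm_delta.
  have [|c cs ->] := @line_mvt _ _ f (x + trunc k h) (delta_mx 0 k) (h 0 k).
    by move=> t /Z /H3' [].
  rewrite -mulrBr normrM mulrC; apply: ler_pM => //; last exact: coord_le_norm.
  by rewrite -partialE distrC; apply/ltW; have [_] := H3' _ (Z _ cs); apply.
apply: le_trans (ler_sum _ (fun k _ => K k)) _.
rewrite sumr_const card_ord -mulr_natl mulrA ler_wpM2r // /e' mulrCA.
by rewrite ger_pMr // ler_pdivrMr // mul1r ler_nat.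
Qed.

End Coord.

(** * Functions of class C^k on open sets *)

Section CkTheory.
Context {R : realType}.
Local Notation E n := 'rV[R]_n.

Lemma nr_cts_comp n m (f : E m -> R) (g : E n -> E m) x :
  {for g x, continuous f} -> (forall j, {for x, continuous (fun y => g y 0 j)}) ->
  {for x, continuous (f \o g)}.
Proof.
move=> cf cg; apply/ctsP => e e0.
have [d d0 H] := (ctsP _ _).1 cf e e0.
have := nr_forall (fun j => (ctsP _ _).1 (cg j) d d0).
apply: nrW => y Hy /=; apply: H.
by apply: norm_lt_coord => // i; rewrite !mxE.
Qed.

Lemma cts_coord n (i : 'I_n) (x : E n) : {for x, continuous (fun y : E n => y 0 i)}.
Proof.
apply/ctsP => e e0; exists e => // y; apply: le_lt_trans.
by rewrite (_ : _ - _ = (y - x) 0 i) ?coord_le_norm // !mxE.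
Qed.

(* A vector-valued map is compared with [f] along the line [t |-> x + t v]. *)
Lemma C1_chain (V : normedModType R) m (f : E m -> R) (g : V -> E m) x v :
  nr (g x) (fun y => forall i, derivable f y (delta_mx 0 i)) ->
  (forall i, {for g x, continuous (partial i f)}) ->
  (forall j, derivable (fun y => g y 0 j) x v) ->
  is_derive x v (f \o g) (\sum_j 'D_v (fun y => g y 0 j) x * partial j f (g x)).
Proof.
move=> f1 f2 dg.
pose c := fun t : R => g (x + t *: v).
have c0 : c 0 = g x by rewrite /c scale0r addr0.
have dc j : derivable (fun t => c t 0 j) 0 1.
  by rewrite (line_derivable (fun y => g y 0 j)) scale0r addr0.
have Dc : derivable c 0 1 by apply/derivable_mxP => i j; rewrite ord1; exact: dc.
have dfc : differentiable c 0 by apply/derivable1_diffP.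
have [df dfE] := C1_differentiable f1 f2.
have dcomp : differentiable (f \o c) 0 by apply: differentiable_comp => //; rewrite c0.
split.
  have := line_derivable (f \o g) x v 0; rewrite scale0r addr0 => <-.
  exact: diff_derivable.
have := line_derive (f \o g) x v 0; rewrite scale0r addr0 => <-.
rewrite (deriveE _ dcomp) diff_comp ?c0 //= dfE -deriveE //.
rewrite (derive_mx Dc); apply: eq_bigr => j _; rewrite mxE; congr (_ * _).
by rewrite (line_derive (fun y => g y 0 j)) scale0r addr0.
Qed.

Lemma nr_ctsD n (f g : E n -> R) x : {for x, continuous f} -> {for x, continuous g} ->
  {for x, continuous (fun y => f y + g y)}.
Proof. exact: (@cvgD _ _ _ (nbhs x) (nbhs_filter x)). Qed.

Lemma nr_ctsM n (f g : E n -> R) x : {for x, continuous f} -> {for x, continuous g} ->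
  {for x, continuous (fun y => f y * g y)}.
Proof. exact: (@cvgM _ _ (nbhs x) (nbhs_filter x)). Qed.

Lemma nr_ctsV n (f : E n -> R) x : f x != 0 -> {for x, continuous f} ->
  {for x, continuous (fun y => (f y)^-1)}.
Proof. exact: (@cvgV _ _ (nbhs x) (nbhs_filter x)). Qed.

Lemma Ck_cts k n (V : set (E n)) f x : Ck k V f -> V x -> {for x, continuous f}.
Proof. by case: k => [|k] [H _] /H. Qed.

Lemma Ck_sub k n (V W : set (E n)) f : W `<=` V -> Ck k V f -> Ck k W f.
Proof.
move=> WV; elim: k f => [|k IH] f [H1 H2]; split => //; try by move=> x /WV; exact: H1.
by move=> i; have [h1 h2] := H2 i; split; [move=> x /WV; exact: h1|exact: IH].
Qed.

Lemma Ck_pred k n (V : set (E n)) f : Ck k.+1 V f -> Ck k V f.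
Proof.
elim: k f => [|k IH] f [H1 H2]; split => //.
by move=> i; have [h1 h2] := H2 i; split => //; apply: IH.
Qed.

Lemma Ck_derivable k n (V : set (E n)) f i x : Ck k.+1 V f -> V x ->
  derivable f x (delta_mx 0 i).
Proof. by move=> [_ H] Vx; rewrite -pline_derivable; exact: (H i).1. Qed.

Lemma Ck_partial k n (V : set (E n)) f i : Ck k.+1 V f -> Ck k V (partial i f).
Proof. by move=> [_ H]; exact: (H i).2. Qed.

Lemma CkS k n (V : set (E n)) f : (forall x, V x -> {for x, continuous f}) ->
  (forall i x, V x -> derivable f x (delta_mx 0 i)) ->
  (forall i, Ck k V (partial i f)) -> Ck k.+1 V f.
Proof. by move=> H1 H2 H3; split => // i; split => // x Vx; rewrite pline_derivable; exact: H2. Qed.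

Lemma nr_cts_eq n (f g : E n -> R) x : nr x (fun y => f y = g y) ->
  {for x, continuous f} -> {for x, continuous g}.
Proof.
move=> fg /ctsP H; apply/ctsP => e e0; have := nrI fg (H e e0).
by apply: nrW => y [<-]; rewrite (nr_self fg).
Qed.

Lemma nr_derivable n (f g : E n -> R) x v : nr x (fun y => f y = g y) ->
  derivable f x v -> derivable g x v.
Proof. move=> fg; have fg' : \near x, f x = g x by apply/nrP.
exact: near_eq_derivable fg'. Qed.

Lemma nr_derive n (f g : E n -> R) x v : nr x (fun y => f y = g y) -> 'D_v f x = 'D_v g x.
Proof. by move=> fg; apply: near_eq_derive; apply/nrP. Qed.

Lemma nr_partial n (f g : E n -> R) x i : nr x (fun y => f y = g y) -> partial i f x = partial i g x.
Proof. by move=> fg; rewrite !partialE; apply: nr_derive. Qed.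

Lemma Ck_eq k n (V : set (E n)) f g : open V -> (forall x, V x -> f x = g x) ->
  Ck k V f -> Ck k V g.
Proof.
move=> /nr_open oV fg.
elim: k f g fg => [|k IH] f g fg [H1 H2].
  by split => // x Vx; apply: (@nr_cts_eq _ f) (H1 x Vx); apply: nrW (oV x Vx).
apply: CkS => [x Vx|i x Vx|i].
- by apply: (@nr_cts_eq _ f) (H1 x Vx); apply: nrW (oV x Vx).
- apply: (@nr_derivable _ f); first by apply: nrW (oV x Vx).
  by rewrite -pline_derivable; exact: (H2 i).1.
- apply: (IH (partial i f)); last exact: (H2 i).2.
  by move=> x Vx; apply: nr_partial; apply: nrW (oV x Vx).
Qed.

(** The way back from germs to open sets, used in [cinf_Ck]. *)
Lemma Ck_loc k n (V : set (E n)) f :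
  (forall x, V x -> exists W : set (E n), [/\ open W, W x & Ck k W f]) -> Ck k V f.
Proof.
elim: k f => [|k IH] f H.
  by split => // x /H [W [_ Wx [h _]]]; exact: h.
apply: CkS => [x /H [W [_ Wx [h _]]]|i x /H [W [_ Wx h]]|i]; first exact: h.
  exact: Ck_derivable h Wx.
by apply: IH => x /H [W [oW Wx h]]; exists W; split => //; exact: Ck_partial h.
Qed.

Lemma Ck_cst k n (V : set (E n)) (c : R) : Ck k V (fun=> c).
Proof.
elim: k c => [|k IH] c; first by split => // x _; exact: cst_continuous.
apply: CkS => [x _|i x _|i]; [exact: cst_continuous|exact: derivable_cst|].
by rewrite (_ : partial i _ = fun=> 0) //; apply/funext => x; rewrite partialE derive_cst.
Qed.

Lemma Ck_coord k n (V : set (E n)) (j : 'I_n) : Ck k V (fun x => x 0 j).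
Proof.
have D i (x : E n) : is_derive x (delta_mx 0 i : E n) (fun x : E n => x 0 j) ((i == j)%:R).
  have Q (y e : E n) : (fun h : R => h^-1 *: (((fun x : E n => x 0 j) \o shift y) (h *: e) - y 0 j))
      @ 0^' --> e 0 j.
    apply: (@cvg_trans _ ((fun=> e 0 j) @ (0 : R)^')); last exact: cvg_cst.
    apply: near_eq_cvg; near=> h; rewrite /= !mxE addrK.
    have h0 : h != 0 by near: h; exact: nbhs_dnbhs_neq.
    by rewrite [_ *: _]mulKf.
  split; first by apply/cvg_ex; exists ((delta_mx 0 i : E n) 0 j); exact: Q.
  apply: cvg_lim => //; rewrite eq_sym (_ : (j == i)%:R = (delta_mx 0 i : E n) 0 j) //.
  by rewrite mxE eqxx.
case: k => [|k]; first by split => // x _; exact: cts_coord.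
apply: CkS => [x _|i x _|i]; [exact: cts_coord|by have [] := D i x|].
rewrite (_ : partial i _ = fun=> (i == j)%:R); first exact: Ck_cst.
by apply/funext => x; rewrite partialE; have [_ ->] := D i x.
Unshelve. all: by end_near. Qed.

Lemma Ck_add k n (V : set (E n)) f g : open V -> Ck k V f -> Ck k V g -> Ck k V (fun x => f x + g x).
Proof.
move=> oV; elim: k f g => [|k IH] f g F G.
  by split => // x Vx; apply: nr_ctsD; [exact: Ck_cts F Vx|exact: Ck_cts G Vx].
apply: CkS => [x Vx|i x Vx|i].
- by apply: nr_ctsD; [exact: Ck_cts F Vx|exact: Ck_cts G Vx].
- by apply: derivableD; [exact: Ck_derivable F Vx|exact: Ck_derivable G Vx].
- apply: (Ck_eq oV _ (IH _ _ (Ck_partial i F) (Ck_partial i G))) => x Vx.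
  rewrite !partialE -deriveD //; [exact: Ck_derivable F Vx|exact: Ck_derivable G Vx].
Qed.

Lemma Ck_mul k n (V : set (E n)) f g : open V -> Ck k V f -> Ck k V g -> Ck k V (fun x => f x * g x).
Proof.
move=> oV; elim: k f g => [|k IH] f g F G.
  by split => // x Vx; apply: nr_ctsM; [exact: Ck_cts F Vx|exact: Ck_cts G Vx].
apply: CkS => [x Vx|i x Vx|i].
- by apply: nr_ctsM; [exact: Ck_cts F Vx|exact: Ck_cts G Vx].
- by apply: derivableM; [exact: Ck_derivable F Vx|exact: Ck_derivable G Vx].
- apply: (Ck_eq oV _ (Ck_add oV (IH _ _ (Ck_pred F) (Ck_partial i G))
    (IH _ _ (Ck_pred G) (Ck_partial i F)))) => x Vx.
  rewrite !partialE (@deriveM _ _ f g); [by []|exact: Ck_derivable F Vx|exact: Ck_derivable G Vx].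
Qed.

Lemma Ck_inv k n (V : set (E n)) f : open V -> (forall x, V x -> f x != 0) ->
  Ck k V f -> Ck k V (fun x => (f x)^-1).
Proof.
move=> oV f0; elim: k => [|k IH] F.
  by split => // x Vx; apply: nr_ctsV; [exact: f0|exact: Ck_cts F Vx].
have C1 := IH (Ck_pred F).
apply: CkS => [x Vx|i x Vx|i].
- by apply: nr_ctsV; [exact: f0|exact: Ck_cts F Vx].
- by apply: derivableV; [exact: f0|exact: Ck_derivable F Vx].
- apply: (Ck_eq oV _ (Ck_mul oV (Ck_mul oV (Ck_cst k V (-1)) (Ck_mul oV C1 C1)) (Ck_partial i F))) => x Vx.
  rewrite !partialE (@deriveV _ _ f); [|exact: f0|exact: Ck_derivable F Vx].
  by rewrite -exprVn expr2 mulN1r.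
Qed.

Lemma Ck_sum k n (V : set (E n)) m (F : 'I_m -> E n -> R) : open V ->
  (forall i, Ck k V (F i)) -> Ck k V (fun x => \sum_i F i x).
Proof.
move=> oV; elim: m F => [|m IH] F H.
  by apply: (Ck_eq oV _ (Ck_cst k V 0)) => x _; rewrite big_ord0.
apply: (Ck_eq oV _ (Ck_add oV (H ord0) (IH (fun i => F (lift ord0 i)) (fun i => H _)))).
by move=> x _; rewrite big_ord_recl.
Qed.

Lemma Ck_C1 k n (V : set (E n)) f x : open V -> Ck k.+1 V f -> V x ->
  nr x (fun y => forall i, derivable f y (delta_mx 0 i)) /\
  (forall i, {for x, continuous (partial i f)}).
Proof.
move=> /nr_open oV F Vx; split; last by move=> i; exact: Ck_cts (Ck_partial i F) Vx.
by apply: nrW (oV x Vx) => y Vy i; exact: Ck_derivable F Vy.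
Qed.

(** By the chain rule the partials of [f \o g] are sums of products of partials of [g] with the
    functions [partial j f \o g]. These involve one order less, so the induction on [k] is made for
    all [f]. *)
Lemma Ck_comp k n m (V : set (E n)) (W : set (E m)) f (g : E n -> E m) :
  open V -> open W -> (forall x, V x -> W (g x)) ->
  Ck k W f -> (forall j, Ck k V (fun x => g x 0 j)) -> Ck k V (f \o g).
Proof.
move=> oV oW VW; elim: k f => [|k IH] f F G.
  split => // x Vx; apply: nr_cts_comp; first exact: Ck_cts F (VW x Vx).
  by move=> j; exact: Ck_cts (G j) Vx.
have D i x (Vx : V x) := C1_chain (v := delta_mx 0 i) (Ck_C1 oW F (VW x Vx)).1 (Ck_C1 oW F (VW x Vx)).2
  (fun j => Ck_derivable (i:=i) (G j) Vx).
apply: CkS => [x Vx|i x Vx|i].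
- apply: nr_cts_comp; first exact: Ck_cts F (VW x Vx).
  by move=> j; exact: Ck_cts (G j) Vx.
- by have [] := D i x Vx.
- have G' j := Ck_pred (G j).
  apply: (Ck_eq oV _ (Ck_sum oV (fun j => Ck_mul oV (Ck_partial i (G j)) (IH _ (Ck_partial j F) G')))).
  move=> x Vx; rewrite partialE; have [_ ->] := D i x Vx.
  by apply: eq_bigr => j _; rewrite partialE.
Qed.

End CkTheory.

(** * Germs of smooth maps *)

Section Germs.
Context {R : realType}.
Local Notation E n := 'rV[R]_n.

(** One neighbourhood serves all orders [k]. Smoothness at a point is thus an open condition
    ([cinf_nr]), and domains need not be carried along. *)
Definition cinf n (f : E n -> R) (x : E n) :=
  exists W : set (E n), [/\ open W, W x & forall k, Ck k W f].

Definition cinfv n m (f : E n -> E m) (x : E n) := forall j, cinf (fun y => f y 0 j) x.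

Lemma cinf_nr n (f : E n -> R) x : cinf f x -> nr x (cinf f).
Proof.
move=> [W [/nr_open oW Wx H]]; apply: nrW (oW x Wx) => y Wy.
by exists W; split => //; apply/nr_open.
Qed.

Lemma cinfv_nr n m (f : E n -> E m) x : cinfv f x -> nr x (cinfv f).
Proof. by move=> H; apply: nr_forall => j; exact: cinf_nr. Qed.

Lemma cinf_Ck n (f : E n -> R) V : (forall x, V x -> cinf f x) -> forall k, Ck k V f.
Proof.
move=> H k; apply: Ck_loc => x /H [W [oW Wx h]]; exists W; split => //; exact: Ck_sub (h k).
Qed.

Lemma openI2 n (V W : set (E n)) x : open V -> open W -> V x -> W x ->
  exists U : set (E n), [/\ open U, U x, U `<=` V & U `<=` W].
Proof.
move=> oV oW Vx Wx; exists (V `&` W); split => //; exact: openI.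
Qed.

Lemma nrW_open n (x : E n) P : nr x P -> exists W : set (E n), [/\ open W, W x & W `<=` P].
Proof.
move=> H; exists [set y | nr y P]; split; first by apply/nr_open => y /nr_nr.
  by [].
by move=> y /nr_self.
Qed.

Lemma cinfC n (c : R) (x : E n) : cinf (fun=> c) x.
Proof. by exists setT; split => // [|k]; [exact: openT|exact: Ck_cst]. Qed.

Lemma cinf_coord n (x : E n) j : cinf (fun y => y 0 j) x.
Proof. by exists setT; split => // [|k]; [exact: openT|exact: Ck_coord]. Qed.

Lemma cinf2 n (f g h : E n -> R) x :
  (forall (V : set (E n)) k, open V -> Ck k V f -> Ck k V g -> Ck k V h) ->
  cinf f x -> cinf g x -> cinf h x.
Proof.
move=> H [V [oV Vx F]] [W [oW Wx G]].
have [U [oU Ux UV UW]] := openI2 oV oW Vx Wx.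
by exists U; split => // k; apply: H => //; [exact: Ck_sub (F k)|exact: Ck_sub (G k)].
Qed.

Lemma cinfD n (f g : E n -> R) x : cinf f x -> cinf g x -> cinf (fun y => f y + g y) x.
Proof. by apply: cinf2 => V k; exact: Ck_add. Qed.

Lemma cinfM n (f g : E n -> R) x : cinf f x -> cinf g x -> cinf (fun y => f y * g y) x.
Proof. by apply: cinf2 => V k; exact: Ck_mul. Qed.

Lemma cinf_eq n (f g : E n -> R) x : nr x (fun y => f y = g y) -> cinf f x -> cinf g x.
Proof.
move=> /nrW_open [V [oV Vx fg]] [W [oW Wx F]].
have [U [oU Ux UV UW]] := openI2 oV oW Vx Wx.
by exists U; split => // k; apply: (Ck_eq oU) (Ck_sub UW (F k)) => y /UV /fg.
Qed.

Lemma cinf_ext n (f g : E n -> R) x : f =1 g -> cinf f x -> cinf g x.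
Proof. by move=> fg; apply: cinf_eq; exists 1. Qed.

Lemma cinfN n (f : E n -> R) x : cinf f x -> cinf (fun y => - f y) x.
Proof. by move=> /(cinfM (cinfC (-1) x)); apply: cinf_ext => y; rewrite mulN1r. Qed.

Lemma cinfB n (f g : E n -> R) x : cinf f x -> cinf g x -> cinf (fun y => f y - g y) x.
Proof. by move=> F G; apply: cinfD => //; exact: cinfN. Qed.

Lemma cinf_cts n (f : E n -> R) x : cinf f x -> {for x, continuous f}.
Proof. by move=> [W [_ Wx /(_ 0%N) H]]; exact: Ck_cts H Wx. Qed.

Lemma cinf_cts_nr n (f : E n -> R) x e : cinf f x -> 0 < e -> nr x (fun y => `|f y - f x| < e).
Proof. by move=> /cinf_cts /ctsP; apply. Qed.

Lemma cinfv_cts n m (f : E n -> E m) x e : cinfv f x -> 0 < e -> nr x (fun y => `|f y - f x| < e).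
Proof.
move=> F e0; have := nr_forall (fun j => cinf_cts_nr (F j) e0).
by apply: nrW => y H; apply: norm_lt_coord => // i; rewrite !mxE.
Qed.

Lemma cinfv_nr_pre n m (f : E n -> E m) x P : cinfv f x -> nr (f x) P -> nr x (fun y => P (f y)).
Proof. by move=> F [d d0 H]; apply: nrW (cinfv_cts F d0) => y /H. Qed.

Lemma cinf_gt n (f : E n -> R) x c : cinf f x -> c < f x -> nr x (fun y => c < f y).
Proof.
move=> F fx; have e0 : 0 < f x - c by rewrite subr_gt0.
apply: nrW (cinf_cts_nr F e0) => y; rewrite ltr_norml opprB => /andP[+ _]; lra.
Qed.

Lemma cinf_lt n (f : E n -> R) x c : cinf f x -> f x < c -> nr x (fun y => f y < c).
Proof.
move=> F fx; have e0 : 0 < c - f x by rewrite subr_gt0.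
apply: nrW (cinf_cts_nr F e0) => y; rewrite ltr_norml => /andP[_]; lra.
Qed.

Lemma cinf_neq0 n (f : E n -> R) x : cinf f x -> f x != 0 -> nr x (fun y => f y != 0).
Proof.
move=> F; rewrite neq_lt => /orP[h|h].
  by apply: nrW (cinf_lt F h) => y /lt_eqF ->.
by apply: nrW (cinf_gt F h) => y /gt_eqF ->.
Qed.

Lemma cinfV n (f : E n -> R) x : cinf f x -> f x != 0 -> cinf (fun y => (f y)^-1) x.
Proof.
move=> F fx; have /nrW_open [V [oV Vx H]] := cinf_neq0 F fx.
have [W [oW Wx {}F]] := F.
have [U [oU Ux UV UW]] := openI2 oV oW Vx Wx.
exists U; split => // k; apply: Ck_inv => //; last exact: Ck_sub (F k).
by move=> y /UV /H.
Qed.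

Lemma cinf_big n (I : Type) (r : seq I) (P : pred I) (f : I -> E n -> R) x :
  (forall i, P i -> cinf (f i) x) -> cinf (fun y => \sum_(i <- r | P i) f i y) x.
Proof.
move=> H; elim: r => [|i r IH]; first by apply: cinf_ext (cinfC 0 x) => y; rewrite big_nil.
case Pi : (P i); last by apply: cinf_ext IH => y; rewrite big_cons Pi.
by apply: cinf_ext (cinfD (H i Pi) IH) => y; rewrite big_cons Pi.
Qed.

Lemma cinf_prod n (I : Type) (r : seq I) (P : pred I) (f : I -> E n -> R) x :
  (forall i, P i -> cinf (f i) x) -> cinf (fun y => \prod_(i <- r | P i) f i y) x.
Proof.
move=> H; elim: r => [|i r IH]; first by apply: cinf_ext (cinfC 1 x) => y; rewrite big_nil.
case Pi : (P i); last by apply: cinf_ext IH => y; rewrite big_cons Pi.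
by apply: cinf_ext (cinfM (H i Pi) IH) => y; rewrite big_cons Pi.
Qed.

Lemma cinf_comp n m (f : E m -> R) (g : E n -> E m) x :
  cinf f (g x) -> cinfv g x -> cinf (f \o g) x.
Proof.
move=> [W [oW Wgx F]] G.
have /nrW_open [V [oV Vx H]] := nrI (cinfv_nr G) (cinfv_nr_pre G ((nr_open W).1 oW _ Wgx)).
exists V; split => // k; apply: (Ck_comp oV oW) (F k) _; first by move=> y /H [].
by move=> j; apply: cinf_Ck => y /H [+ _]; exact.
Qed.

Lemma cinfv_comp n m p (f : E m -> E p) (g : E n -> E m) x :
  cinfv f (g x) -> cinfv g x -> cinfv (f \o g) x.
Proof. by move=> F G j; exact: (cinf_comp (F j) G). Qed.

Lemma cinfv_eq n m (f g : E n -> E m) x : nr x (fun y => f y = g y) -> cinfv f x -> cinfv g x.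
Proof. by move=> fg F j; apply: cinf_eq (F j); apply: nrW fg => y ->. Qed.

Lemma cinfv_id n (x : E n) : cinfv id x.
Proof. by move=> j; exact: cinf_coord. Qed.

Lemma cinfv_cst n m (c : E m) (x : E n) : cinfv (fun=> c) x.
Proof. by move=> j; exact: cinfC. Qed.

Lemma cinfv_mulmx n m p (f : E n -> E m) (B : 'M[R]_(m, p)) x :
  cinfv f x -> cinfv (fun y => f y *m B) x.
Proof.
move=> F j; apply: (@cinf_ext _ (fun y => \sum_k f y 0 k * B k j)).
  by move=> y; rewrite mxE.
by apply: cinf_big => k _; apply: cinfM => //; exact: cinfC.
Qed.

Lemma cinfvD n m (f g : E n -> E m) x : cinfv f x -> cinfv g x -> cinfv (fun y => f y + g y) x.
Proof. by move=> F G j; apply: cinf_ext (cinfD (F j) (G j)) => y; rewrite mxE. Qed.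

Lemma cinfvN n m (f : E n -> E m) x : cinfv f x -> cinfv (fun y => - f y) x.
Proof. by move=> F j; apply: cinf_ext (cinfN (F j)) => y; rewrite mxE. Qed.

Lemma cinfvB n m (f g : E n -> E m) x : cinfv f x -> cinfv g x -> cinfv (fun y => f y - g y) x.
Proof. by move=> F G; apply: cinfvD => //; exact: cinfvN. Qed.

Lemma cinfv_row n m (f : 'I_m -> E n -> R) x : (forall j, cinf (f j) x) ->
  cinfv (fun y => \row_j f j y) x.
Proof. by move=> F j; apply: cinf_ext (F j) => y; rewrite mxE. Qed.

Lemma cinf_det n p (B : E n -> 'M[R]_p) x : (forall i j, cinf (fun y => B y i j) x) ->
  cinf (fun y => \det (B y)) x.
Proof.
move=> H; rewrite /determinant; apply: cinf_big => s _; apply: cinfM; first exact: cinfC.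
by apply: cinf_prod.
Qed.

(** Cramer's formula: the entries of the inverse are cofactors divided by the determinant, which
    stays nonzero near [x]. *)
Lemma cinf_invmx n p (B : E n -> 'M[R]_p) x i j : (forall i j, cinf (fun y => B y i j) x) ->
  B x \in unitmx -> cinf (fun y => invmx (B y) i j) x.
Proof.
move=> H; rewrite unitmxE unitfE => d0.
apply: (@cinf_eq _ (fun y => (\det (B y))^-1 * cofactor (B y) j i)).
  apply: nrW (cinf_neq0 (cinf_det H) d0) => y dy.
  by rewrite /invmx unitmxE unitfE dy !mxE.
apply: cinfM; first by apply: cinfV => //; exact: cinf_det.
rewrite /cofactor; apply: cinfM; first exact: cinfC.
by apply: cinf_det => k l; apply: cinf_ext (H (lift j k) (lift i l)) => y; rewrite !mxE.
Qed.

Lemma cinf_partial n (f : E n -> R) x i : cinf f x -> cinf (partial i f) x.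
Proof. by move=> [W [oW Wx F]]; exists W; split => // k; exact: (Ck_partial i (F k.+1)). Qed.

Lemma cinf_C1 n (f : E n -> R) x : cinf f x ->
  nr x (fun y => forall i, derivable f y (delta_mx 0 i)) /\
  (forall i, {for x, continuous (partial i f)}).
Proof. by move=> [W [oW Wx F]]; exact: Ck_C1 oW (F 1%N) Wx. Qed.

Lemma cinf_dir n (f : E n -> R) x v : cinf f x ->
  is_derive x v f (lform (fun i => partial i f x) v).
Proof.
move=> /cinf_C1 [h1 h2]; have [d e] := C1_differentiable h1 h2.
by split; [exact: diff_derivable|rewrite deriveE // e].
Qed.

Lemma cinf_derivable n (f : E n -> R) x v : cinf f x -> derivable f x v.
Proof. by move=> /(cinf_dir v) []. Qed.

Lemma cinf_chain (V : normedModType R) m (f : E m -> R) (g : V -> E m) x v :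
  cinf f (g x) -> (forall j, derivable (fun y => g y 0 j) x v) ->
  is_derive x v (f \o g) (\sum_j 'D_v (fun y => g y 0 j) x * partial j f (g x)).
Proof. by move=> /cinf_C1 [h1 h2]; exact: C1_chain. Qed.

Lemma jacobian_comp n m p (f : E m -> E p) (g : E n -> E m) x :
  cinfv f (g x) -> cinfv g x -> jacobian (f \o g) x = jacobian g x *m jacobian f (g x).
Proof.
move=> F G; apply/matrixP => i j; rewrite !mxE partialE.
have [_ ->] := cinf_chain (F j) (fun k => cinf_derivable (v := delta_mx 0 i) (G k)).
by apply: eq_bigr => k _; rewrite !mxE !partialE.
Qed.

Lemma jacobian_eq n m (f g : E n -> E m) x : nr x (fun y => f y = g y) -> jacobian f x = jacobian g x.
Proof.
move=> fg; apply/matrixP => i j; rewrite !mxE; apply: nr_partial.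
by apply: nrW fg => y ->.
Qed.

Lemma dir_jacobian n m (f : E n -> E m) x v : cinfv f x ->
  forall j, 'D_v (fun y => f y 0 j) x = (v *m jacobian f x) 0 j.
Proof.
move=> F j; have [_ ->] := cinf_dir v (F j).
by rewrite mxE; apply: eq_bigr => i _; rewrite mxE.
Qed.

Lemma lform_delta n (a : 'I_n -> R) i : lform a (delta_mx 0 i) = a i.
Proof.
rewrite /lform (bigD1 i) //= mxE !eqxx mul1r big1 ?addr0 //.
by move=> k ki; rewrite mxE (negbTE ki) andbF mul0r.
Qed.

Lemma is_derive_eps (V : normedModType R) (f : V -> R) x v (l : R) :
  (forall e, 0 < e -> exists2 d, 0 < d &
     forall h : R, `|h| < d -> `|f (x + h *: v) - f x - h * l| <= e * `|h|) ->
  is_derive x v f l.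
Proof.
move=> H.
have Q : (fun h : R => h^-1 *: ((f \o shift x) (h *: v) - f x)) @ 0^' --> l.
  apply/cvgrPdist_le => e e0; have [d d0 K] := H e e0.
  near=> h; have h0 : h != 0 by near: h; exact: nbhs_dnbhs_neq.
  rewrite -(mulKf h0 l) -mulrBr normrM normfV mulrC ler_pdivrMr ?normr_gt0 //.
  rewrite distrC /= [h *: v + x]addrC; apply: K.
  by near: h; apply: dnbhs0_lt.
by split; [apply/cvg_ex; exists l; exact: Q|exact: cvg_lim Q].
Unshelve. all: by end_near. Qed.

Lemma lform_derive n (a : 'I_n -> R) x v : is_derive x v (lform a) (lform a v).
Proof.
apply: is_derive_eps => e e0; exists 1 => // h _.
by rewrite -raddfB /= [x + _]addrC addrK linearZ /= subrr normr0 mulr_ge0 // ltW.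
Qed.

Lemma cinf_eps n (f : E n -> R) x e : cinf f x -> 0 < e ->
  nr 0 (fun h => `|f (x + h) - f x - lform (fun i => partial i f x) h| <= e * `|h|).
Proof.
move=> /cinf_C1 [h1 h2] e0; have [d de] := C1_differentiable h1 h2.
have /eqaddoP/(_ e e0) H := diff_locally d.
apply/nrP; apply: filterS H => h; rewrite !fctE /= de.
by rewrite [h + x]addrC opprD addrA.
Qed.

Lemma jacobianB n m (f g : E n -> E m) x : cinfv f x -> cinfv g x ->
  jacobian (fun y => f y - g y) x = jacobian f x - jacobian g x.
Proof.
move=> F G; apply/matrixP => i j; rewrite !mxE !partialE.
have [_ ->] := cinf_dir (delta_mx 0 i) (F j).
have [_ ->] := cinf_dir (delta_mx 0 i) (G j).
have [_ <-] := is_deriveB (cinf_dir (delta_mx 0 i) (F j)) (cinf_dir (delta_mx 0 i) (G j)).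
by congr (derive _ _ _); apply/funext => y; rewrite !mxE.
Qed.

Lemma jacobian_mulmx n m (B : 'M[R]_(n, m)) x : jacobian (fun y : E n => y *m B) x = B.
Proof.
apply/matrixP => i j; rewrite mxE partialE.
have -> : (fun y : E n => (y *m B) 0 j) = lform (fun k => B k j).
  by apply/funext => y; rewrite mxE.
by have [_ ->] := lform_derive (fun k => B k j) x (delta_mx 0 i); rewrite lform_delta.
Qed.

Lemma jacobian_id n (x : E n) : jacobian id x = 1%:M.
Proof.
rewrite -(jacobian_mulmx 1%:M x); apply: jacobian_eq; exists 1 => // y _.
by rewrite mulmx1.
Qed.

End Germs.

(** * Inverse functions and smooth dependence of flows *)

Section InverseFunction.
Context {R : realType}.
Local Notation E n := 'rV[R]_n.

Lemma nr_ball n (a y : E n) d : `|y - a| < d -> nr y (fun z => `|z - a| < d).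
Proof.
move=> ya; exists (d - `|y - a|); first by rewrite subr_gt0.
move=> z zy; rewrite -[z](subrK y) -addrA.
by apply: le_lt_trans (ler_normD _ _) _; rewrite -ltrBrDr.
Qed.

Lemma mean01 (V : normedModType R) (f : V -> R) y e :
  (forall t, 0 <= t <= 1 -> derivable f (y + t *: e) e) ->
  exists2 c, 0 <= c <= 1 & f (y + e) - f y = 'D_e f (y + c *: e).
Proof.
move=> H.
have D (t : R) : t \in `[0, 1 : R] -> is_derive t 1 (fun s : R => f (y + s *: e)) ('D_e f (y + t *: e)).
  by rewrite in_itv /= => /H; exact: line_is_derive.
have D' (t : R) : t \in `]0, 1 : R[ -> is_derive t 1 (fun s : R => f (y + s *: e)) ('D_e f (y + t *: e)).
  by move=> /subset_itv_oo_cc; exact: D.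
have C : {within `[0, 1], continuous (fun s : R => f (y + s *: e))}.
  by apply: derivable_within_continuous => t /D [].
have [c] := MVT_segment ler01 D' C.
by rewrite in_itv /= scale0r addr0 scale1r subr0 mulr1; exists c.
Qed.

Lemma ball_convex n (a y y' : E n) d t : `|y - a| < d -> `|y' - a| < d -> 0 <= t <= 1 ->
  `|y + t *: (y' - y) - a| < d.
Proof.
move=> ya y'a /andP[t0 t1].
have -> : y + t *: (y' - y) - a = (1 - t) *: (y - a) + t *: (y' - a).
  by apply/rowP => i; rewrite !mxE; ring.
apply: le_lt_trans (ler_normD _ _) _; rewrite !normrZ.
rewrite (ger0_norm t0) ger0_norm ?subr_ge0 //.
have [->|tn0] := eqVneq t 0; first by rewrite subr0 mul1r mul0r addr0.
have tp : 0 < t by rewrite lt_neqAle eq_sym tn0.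
have : (1 - t) * `|y - a| <= (1 - t) * d by rewrite ler_wpM2l ?subr_ge0 // ltW.
have : t * `|y' - a| < t * d by rewrite ltr_pM2l.
by lra.
Qed.

Lemma lip_ball n (f : E n -> R) a d K : 0 <= K ->
  (forall y, `|y - a| < d -> cinf f y /\ forall i, `|partial i f y| <= K) ->
  forall y y', `|y - a| < d -> `|y' - a| < d -> `|f y' - f y| <= n%:R * K * `|y' - y|.
Proof.
move=> K0 H y y' ya y'a.
have B t : 0 <= t <= 1 -> `|y + t *: (y' - y) - a| < d by exact: ball_convex.
have [|c c01] := @mean01 _ f y (y' - y).
  by move=> t /B /H [h _]; exact: cinf_derivable.
rewrite [y + _]addrC subrK => ->.
have [/(cinf_dir (y' - y)) [_ ->] Hi] := H _ (B c c01).
apply: le_trans (lform_norm _ _) _; rewrite ler_wpM2r //.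
apply: le_trans (ler_sum _ (fun i _ => Hi i)) _.
by rewrite sumr_const card_ord mulr_natl.
Qed.

Lemma mulmx_norm n m (B : 'M[R]_(n, m)) : exists2 C, 0 < C & forall h : E n, `|h *m B| <= C * `|h|.
Proof.
exists (1 + \sum_j \sum_i `|B i j|).
  by rewrite ltr_wpDr // sumr_ge0 // => j _; rewrite sumr_ge0.
move=> h; apply: norm_le_coord.
  by rewrite mulr_ge0 // addr_ge0 // sumr_ge0 // => j _; rewrite sumr_ge0.
move=> j; rewrite mxE; apply: le_trans (lform_norm (fun i => B i j) h) _.
rewrite ler_wpM2r // (bigD1 j) //= addrCA lerDl addr_ge0 // sumr_ge0 // => k _.
by rewrite sumr_ge0.
Qed.

Lemma within_cts n (U : set (E n)) (f : E n -> R) :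
  (forall x, U x -> forall e, 0 < e -> nr x (fun y => U y -> `|f y - f x| < e)) ->
  {within U, continuous f}.
Proof.
move=> H; apply/subspace_continuousP => x Ux; apply/cvgrPdist_lt => e e0.
have /nrP := H x Ux e e0; rewrite /within /=.
by apply: filterS => y h Uy /=; rewrite distrC; exact: h.
Qed.

(** Compactness replaces iteration: [|T x - x|] attains its minimum on the closed ball, and one more
    application of [T] would halve it, so the minimum is zero. *)
Lemma contraction_fix n (a : E n) r (T : E n -> E n) : 0 < r ->
  (forall x, `|x - a| <= r -> `|T x - a| <= r) ->
  (forall x x', `|x - a| <= r -> `|x' - a| <= r -> `|T x' - T x| <= 2^-1 * `|x' - x|) ->
  exists2 x, `|x - a| <= r & T x = x.
Proof.
move=> r0 TU TL.
pose U := closed_ball a r.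
have UE x : U x <-> `|x - a| <= r by rewrite /U closed_ballE // /closed_ball_ /= distrC.
have cU : compact U.
  apply: bounded_closed_compact; last exact: closed_ball_closed.
  exists (`|a| + r); split; first by rewrite num_real.
  move=> b ab x /UE xa /=; apply: le_trans (ltW ab).
  rewrite -[x](subrK a) addrC; apply: le_trans (ler_normD _ _) _.
  by rewrite lerD2l.
have cT : {within U, continuous (fun x => `|T x - x|)}.
  apply: within_cts => x /UE Ux e e0; exists (e / 2); first by rewrite divr_gt0.
  move=> y yx /UE Uy; have := TL _ _ Ux Uy; have := TL _ _ Uy Ux.
  move=> h1 h2; apply: le_lt_trans (ler_dist_dist _ _) _.
  have -> : T y - y - (T x - x) = (T y - T x) - (y - x).
    by rewrite !opprB addrACA [RHS]addrACA; congr (_ + _); rewrite addrC.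
  have := ler_normB (T y - T x) (y - x); lra.
have [|x Ux xmin] := @EVT_min_rV R n (fun x => `|T x - x|) U _ cU cT.
  by exists a; apply/UE; rewrite subrr normr0 ltW.
move: Ux; rewrite inE => /UE Ux; exists x => //.
have := xmin (T x); rewrite inE => /(_ ((UE _).2 (TU _ Ux))).
have := TL _ _ Ux (TU _ Ux); have := normr_ge0 (T x - x) => h1 h2 h3.
by apply/eqP; rewrite -subr_eq0 -normr_le0; lra.
Qed.

(** With [A] the inverse of the Jacobian at [a], the map [phi x = x - F x *m A] has zero derivative
    at [a] and is a contraction nearby; [F x = y] says that [x] is a fixed point of [phi + y *m A].
    The same estimate bounds [|x' - x|] by a multiple of [|F x' - F x|], so the inverse is
    Lipschitz, and its derivatives follow from this. *)
Theorem inverse_function m (F : E m -> E m) a : cinfv F a -> jacobian F a \in unitmx ->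
  exists G : E m -> E m, [/\ cinfv G (F a), nr (F a) (fun y => F (G y) = y) &
    nr a (fun x => G (F x) = x)].
Proof.
move=> Fa Ja; pose A := invmx (jacobian F a).
pose phi := fun x => x - F x *m A.
have phiS x : cinfv F x -> cinfv phi x.
  by move=> Fx; apply: cinfvB; [exact: cinfv_id|exact: cinfv_mulmx].
have phi0 i j : partial i (fun y => phi y 0 j) a = 0.
  have : jacobian phi a = 0.
    rewrite jacobianB; [|exact: cinfv_id|exact: cinfv_mulmx].
    rewrite jacobian_id (@jacobian_comp _ _ _ _ (fun y => y *m A)) //; last first.
      exact: (cinfv_mulmx A (cinfv_id _)).
    by rewrite jacobian_mulmx mulmxV // subrr.
  by move/matrixP/(_ i j); rewrite !mxE.
(* With all partials below [e], the [m] variables contribute at most [m * e <= 1 / 2] to the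
   Lipschitz constant of [phi]. *)
pose e := (2 * m.+1%:R)^-1 : R.
have e0 : 0 < e by rewrite invr_gt0 mulr_gt0.
have [d d0 Hd] : nr a (fun x => [/\ cinfv F x, jacobian F x \in unitmx &
    forall i j, `|partial i (fun y => phi y 0 j) x| < e]).
  have h1 := cinfv_nr Fa.
  have Jc i j x : cinfv F x -> cinf (fun y => jacobian F y i j) x.
    by move=> Fx; apply: cinf_ext (cinf_partial i (Fx j)) => y; rewrite mxE.
  have h2 : nr a (fun x => \det (jacobian F x) != 0).
    apply: cinf_neq0; last by rewrite unitmxE unitfE in Ja.
    by apply: cinf_det => i j; exact: Jc.
  have h3 : nr a (fun x => forall i, forall j, `|partial i (fun y => phi y 0 j) x| < e).
    apply: nr_forall => i; apply: nr_forall => j.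
    have := cinf_cts_nr (cinf_partial i (phiS _ Fa j)) e0.
    by apply: nrW => x; rewrite phi0 subr0.
  apply: nrW (nrI (nrI h1 h2) h3) => x [[x1 x2] x3]; split => //.
  by rewrite unitmxE unitfE.
have half x x' : `|x - a| < d -> `|x' - a| < d -> `|phi x' - phi x| <= 2^-1 * `|x' - x|.
  move=> xa x'a; apply: norm_le_coord; first by rewrite mulr_ge0.
  move=> j; rewrite coordB.
  have L := @lip_ball _ (fun y => phi y 0 j) a d e (ltW e0).
  move: L => /(_ _ x x' xa x'a).
  move=> L; apply: le_trans (L _) _.
    move=> y /Hd [y1 _ y2]; split; first exact: phiS.
    by move=> i; exact/ltW.
  rewrite ler_wpM2r // /e invfM mulrCA ger_pMr ?invr_gt0 //.
  by rewrite ler_pdivrMr // mul1r ler_nat.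
have [C C0 HC] := mulmx_norm A.
have inj x x' : `|x - a| < d -> `|x' - a| < d -> `|x' - x| <= 2 * C * `|F x' - F x|.
  move=> xa x'a; have := half x x' xa x'a.
  have -> : phi x' - phi x = (x' - x) - (F x' - F x) *m A.
    by rewrite /phi mulmxBl !opprB; apply/rowP => i; rewrite !mxE; ring.
  have h := HC (F x' - F x).
  have := ler_normD ((x' - x) - (F x' - F x) *m A) ((F x' - F x) *m A).
  by rewrite subrK; lra.
pose r := d / 2.
have r0 : 0 < r by rewrite divr_gt0.
have rd : r < d by rewrite /r; lra.
(* Then [|(y - F a) *m A| <= r / 2]; as [phi] keeps the ball of radius [r] within [r / 2] of
   [phi a], this ball is mapped into itself by [T]. *)
pose rho := r / (2 * C).
have rho0 : 0 < rho by rewrite divr_gt0 // mulr_gt0.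
have ex y : `|y - F a| < rho -> exists x, `|x - a| <= r /\ F x = y.
  move=> ya.
  have yA : `|(y - F a) *m A| <= r / 2.
    apply: le_trans (HC _) _; move: ya; rewrite /rho ltr_pdivlMr ?mulr_gt0 //.
    by lra.
  pose T x := phi x + y *m A.
  have [||x xa Tx] := @contraction_fix _ a r T r0.
  - move=> x xa; have -> : T x - a = (phi x - phi a) + (y - F a) *m A.
      by rewrite /T /phi mulmxBl; apply/rowP => i; rewrite !mxE; ring.
    apply: le_trans (ler_normD _ _) _.
    have := half a x; rewrite subrr normr0 => /(_ d0 (le_lt_trans xa rd)); lra.
  - move=> x x' xa x'a; rewrite /T opprD addrACA subrr addr0.
    by apply: half; apply: le_lt_trans rd.
  exists x; split => //.
  have : (y - F x) *m A = 0.
    by move: Tx; rewrite /T /phi mulmxBl => /(congr1 (fun z => z - x)) /rowP Tx; apply/rowP => i;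
       move: (Tx i); rewrite !mxE; lra.
  move=> /(congr1 (fun z => z *m jacobian F a)); rewrite mul0mx -mulmxA mulVmx // mulmx1.
  by move/subr0_eq.
pose G y := xget a [set x | `|x - a| <= r /\ F x = y].
have GP y : `|y - F a| < rho -> `|G y - a| <= r /\ F (G y) = y.
  by move=> /ex [x xP]; rewrite /G; case: xgetP => [z _ //|/(_ x)].
have GL y y' : `|y - F a| < rho -> `|y' - F a| < rho -> `|G y' - G y| <= 2 * C * `|y' - y|.
  move=> /GP [h1 h2] /GP [h3 h4].
  by have := inj (G y) (G y') (le_lt_trans h1 rd) (le_lt_trans h3 rd); rewrite h2 h4.
pose N0 := [set y | `|y - F a| < rho].
have N0nr y : N0 y -> nr y N0 by exact: nr_ball.
have oN0 : open N0 by apply/nr_open.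
have GLn y : N0 y -> nr y (fun y' => N0 y' /\ `|G y' - G y| <= 2 * C * `|y' - y|).
  by move=> h; apply: nrW (N0nr y h) => y' h'; split => //; exact: GL.
(* With [dl] the increment of [G], the expansion of [F] at [x = G y] reads [h v = dl DF(x) + o(dl)],
   and [dl = O(h)] by the Lipschitz bound; applying the inverse matrix gives the derivative of
   [G]. *)
have GD y v i : N0 y -> is_derive y v (fun y => G y 0 i) ((v *m invmx (jacobian F (G y))) 0 i).
  move=> Ny; have [h1 h2] := GP y Ny; have [f1 f2 _] := Hd _ (le_lt_trans h1 rd).
  set x := G y in h1 h2 f1 f2 *; set B := invmx _.
  have [CB CB0 HB] := mulmx_norm B.
  apply: is_derive_eps => e1 e10.
  pose v1 := `|v| + 1; have v10 : 0 < v1 by rewrite ltr_wpDl.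
  pose e2 := e1 / (CB * (2 * C) * v1).
  have e20 : 0 < e2 by rewrite divr_gt0 // !mulr_gt0.
  have [d1 d10 D1] := nr_forall (fun j => cinf_eps (f1 j) e20).
  have [d2 d20 D2] := GLn y Ny.
  pose d3 := Num.min d2 (d1 / (2 * C)) / v1.
  exists d3; first by rewrite divr_gt0 // lt_min d20 divr_gt0 // mulr_gt0.
  move=> h; rewrite /d3 ltr_pdivlMr // => hd.
  have hv : `|h *: v| <= `|h| * v1 by rewrite normrZ ler_wpM2l // lerDl.
  have {}hd : `|h *: v| < Num.min d2 (d1 / (2 * C)) by exact: le_lt_trans hd.
  move: hd; rewrite lt_min => /andP[hd2 hd1].
  have [|N1 L1] := D2 (y + h *: v); first by rewrite addrC addKr.
  move: L1; rewrite [y + _ - y]addrC addKr => L1.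
  set dl := G (y + h *: v) - x in L1.
  have dl1 : `|dl| < d1.
    by apply: le_lt_trans L1 _; rewrite mulrC -ltr_pdivlMr // mulr_gt0.
  have K : `|h *: v - dl *m jacobian F x| <= e2 * `|dl|.
    apply: norm_le_coord; first by rewrite mulr_ge0 // ltW.
    move=> j; have := D1 dl; rewrite subr0 => /(_ dl1 j).
    rewrite [x + dl]addrC subrK (GP _ N1).2 h2.
    rewrite coordD [y 0 j + _]addrC addrK coordB.
    congr (`|_ - _| <= _); rewrite [RHS]mxE; apply: eq_bigr => k _.
    by rewrite [jacobian _ _ _ _]mxE.
  have -> : G (y + h *: v) 0 i - G y 0 i - h * (v *m B) 0 i = - ((h *: v - dl *m jacobian F x) *m B) 0 i.
    rewrite mulmxBl -mulmxA mulmxV // mulmx1 -scalemxAl [in RHS]mxE [X in _ = - (X + _)]mxE.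
    by rewrite /dl !mxE; ring.
  rewrite normrN; apply: le_trans (coord_le_norm _ _) _; apply: le_trans (HB _) _.
  have : CB * `|h *: v - dl *m jacobian F x| <= CB * (e2 * (2 * C * (`|h| * v1))).
    rewrite ler_pM2l //; apply: le_trans K _; rewrite ler_pM2l //.
    by apply: le_trans L1 _; rewrite ler_pM2l // mulr_gt0.
  move/le_trans; apply; rewrite le_eqVlt; apply/orP; left; apply/eqP.
  rewrite /e2; field; by rewrite !gt_eqF.
pose D0 := [set x | `|x - a| < d].
have oD0 : open D0 by apply/nr_open => x; exact: nr_ball.
(* The partials of [G] are entries of [invmx (jacobian F)] composed with [G], so each order of
   differentiability of [G] yields the next. *)
have GCk k i : Ck k N0 (fun y => G y 0 i).
  have cG y j : N0 y -> {for y, continuous (fun y => G y 0 j)}.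
    move=> Ny; apply/ctsP => e1 e10; have [d2 d20 D2] := GLn y Ny.
    exists (Num.min d2 (e1 / (2 * C))).
      by rewrite lt_min d20 divr_gt0 // mulr_gt0.
    move=> y'; rewrite lt_min => /andP[/D2 [_ L] L2].
    rewrite (_ : _ - _ = (G y' - G y) 0 j); last by rewrite !mxE.
    apply: le_lt_trans (coord_le_norm _ _) _; apply: le_lt_trans L _.
    by rewrite mulrC -ltr_pdivlMr // mulr_gt0.
  elim: k i => [|k IH] i; first by split => // y Ny; exact: cG.
  apply: CkS => [y Ny|l y Ny|l]; first exact: cG.
    by have [] := GD y (delta_mx 0 l) i Ny.
  apply: (@Ck_eq _ _ _ _ ((fun x => invmx (jacobian F x) l i) \o G) _ oN0).
    move=> y Ny /=; rewrite partialE; have [_ ->] := GD y (delta_mx 0 l) i Ny.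
    by rewrite -rowE mxE.
  apply: (@Ck_comp _ _ _ _ N0 D0) => //.
    by move=> y /GP [h _]; exact: le_lt_trans rd.
  apply: cinf_Ck => x /Hd [x1 x2 _]; apply: cinf_invmx => // i' j'.
  by apply: cinf_ext (cinf_partial i' (x1 j')) => z; rewrite mxE.
have N0a : N0 (F a) by rewrite /N0 /= subrr normr0.
exists G; split.
- by move=> i; exists N0; split.
- by exists rho => // y /GP [].
- have h1 := cinfv_cts Fa rho0.
  have h2 : nr a (fun x => `|x - a| < r) by exists r.
  apply: nrW (nrI h1 h2) => x [x1 x2].
  have [g1 g2] := GP _ x1.
  have := inj x (G (F x)) (lt_trans x2 rd) (le_lt_trans g1 rd).
  by rewrite g2 subrr normr0 mulr0 normr_le0 subr_eq0 => /eqP.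
Qed.

End InverseFunction.

(** * Derivatives of real functions and Gronwall's inequality *)

Section RealDerivatives.
Context {R : realType}.
Local Notation E n := 'rV[R]_n.
Implicit Types (f g : R -> R) (t : R).

Lemma dD f g t a b : is_derive t 1 f a -> is_derive t 1 g b ->
  is_derive t 1 (fun s => f s + g s) (a + b).
Proof. by move=> F G; exact: is_deriveD. Qed.

Lemma dN f t a : is_derive t 1 f a -> is_derive t 1 (fun s => - f s) (- a).
Proof. by move=> F; exact: is_deriveN. Qed.

Lemma dM f g t a b : is_derive t 1 f a -> is_derive t 1 g b ->
  is_derive t 1 (fun s => f s * g s) (f t * b + g t * a).
Proof. by move=> F G; exact: is_deriveM. Qed.

Lemma dC (c t : R) : is_derive t 1 (fun=> c) (0 : R).
Proof. exact: is_derive_cst. Qed.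

Lemma dsum n (F : 'I_n -> R -> R) (D : 'I_n -> R) t :
  (forall i, is_derive t 1 (F i) (D i)) ->
  is_derive t 1 (fun s => \sum_i F i s) (\sum_i D i).
Proof.
move=> H; have -> : (fun s => \sum_i F i s) = \sum_i F i.
  by apply/funext => s; rewrite fct_sumE.
exact: is_derive_sum.
Qed.

Lemma dcomp f g t a b : is_derive (g t) 1 f a -> is_derive t 1 g b ->
  is_derive t 1 (fun s => f (g s)) (a * b).
Proof. by move=> F G; exact: is_derive1_comp. Qed.

Lemma dlin (c t : R) : is_derive t 1 (fun s => c * s) c.
Proof.
by apply: is_derive_eps => e e0; exists 1 => // h _;
  rewrite [h *: 1]mulr1 mulrDr [c * t + _]addrC addrK mulrC subrr normr0 mulr_ge0 // ltW.
Qed.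

Lemma d_eq f t a b : is_derive t 1 f a -> a = b -> is_derive t 1 f b.
Proof. by move=> F <-. Qed.

Lemma dvcomp m (f : E m -> R) (g : R -> E m) t (d : E m) : cinf f (g t) ->
  (forall j, is_derive t 1 (fun s => g s 0 j) (d 0 j)) ->
  is_derive t 1 (fun s => f (g s)) (lform (fun i => partial i f (g t)) d).
Proof.
move=> F G; have := cinf_chain F (fun j => @ex_derive _ _ _ _ _ _ _ (G j)).
by move/d_eq; apply; apply: eq_bigr => j _; rewrite (@derive_val _ _ _ _ _ _ _ (G j)).
Qed.

Lemma d_cts f t a : is_derive t 1 f a -> {for t, continuous f}.
Proof. by move=> [/derivable1_diffP/differentiable_continuous]. Qed.

Lemma dmvt f df (a b : R) : a <= b -> (forall t, a <= t <= b -> is_derive t 1 f (df t)) ->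
  exists2 c, a <= c <= b & f b - f a = df c * (b - a).
Proof.
move=> ab H.
have D (t : R) : t \in `[a, b] -> is_derive t 1 f (df t) by rewrite in_itv /= => /H.
have D' (t : R) : t \in `]a, b[ -> is_derive t 1 f (df t) by move=> /subset_itv_oo_cc; exact: D.
have C : {within `[a, b], continuous f}.
  by apply: derivable_within_continuous => t /D [].
by have [c] := MVT_segment ab D' C; rewrite in_itv /=; exists c.
Qed.

Lemma dmvt_abs f df (a : R) : (forall t, `|t| < a -> is_derive t 1 f (df t)) ->
  forall u v, `|u| < a -> `|v| < a -> exists c, [/\ `|c| < a, `|c - u| <= `|v - u| &
    f v - f u = df c * (v - u)].
Proof.
move=> H.
have K u v : `|u| < a -> `|v| < a -> u <= v -> exists c, [/\ `|c| < a, u <= c <= v &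
    f v - f u = df c * (v - u)].
  rewrite !ltr_norml => ua va uv.
  have B t : u <= t <= v -> `|t| < a by rewrite ltr_norml; lra.
  have [|c cuv E] := @dmvt f df _ _ uv; first by move=> t /B /H.
  by exists c; split => //; exact: B.
move=> u v ua va; have [uv|vu] := leP u v.
  have [c [h1 h2 h3]] := K u v ua va uv; exists c; split => //.
  by rewrite !ger0_norm; lra.
have [c [h1 h2 h3]] := K v u va ua (ltW vu); exists c; split => //.
  by rewrite !ler0_norm; lra.
by rewrite -opprB h3; ring.
Qed.

(** For positive times [q s * expR (- K * s)] does not increase; negative times follow by reversing
    time. *)
Lemma gronwall1 (K a : R) (p dp : R -> R) : 0 <= K ->
  (forall t, `|t| < a -> is_derive t 1 p (dp t)) ->
  (forall t, `|t| < a -> `|dp t| <= K * p t) ->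
  forall t, `|t| < a -> p t <= p 0 * expR (K * `|t|).
Proof.
move=> K0.
have main (q dq : R -> R) : (forall t, `|t| < a -> is_derive t 1 q (dq t)) ->
  (forall t, `|t| < a -> `|dq t| <= K * q t) ->
  forall t, 0 <= t -> `|t| < a -> q t <= q 0 * expR (K * t).
  move=> D B t t0 ta.
  pose g s := q s * expR (- K * s).
  have Dg s : 0 <= s <= t -> is_derive s 1 g
      (q s * (expR (- K * s) * - K) + expR (- K * s) * dq s).
    move=> st; apply: dM; last first.
      by apply: (@dcomp expR (fun s => - K * s)); exact: dlin.
    apply: D; rewrite ger0_norm; last by lra.
    by move: ta; rewrite ger0_norm //; lra.
  have [c c0 E] := dmvt t0 Dg.
  have gt : g t <= g 0.
    rewrite -subr_le0 E subr0 mulr_le0_ge0 //.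
    have : `|c| < a by move: ta; rewrite !ger0_norm; lra.
    move/B; rewrite ler_norml => /andP[_ h].
    rewrite mulrCA -mulrDr; apply: mulr_ge0_le0; first exact: expR_ge0.
    by lra.
  move: gt; rewrite /g mulr0 expR0 mulr1 mulNr expRN.
  by rewrite ler_pdivrMr ?expR_gt0.
move=> D B t ta; have [t0|t0] := leP 0 t.
  by rewrite [X in expR (_ * X)]ger0_norm //; exact: (main p dp).
rewrite [X in expR (_ * X)]ler0_norm; last exact: ltW.
have := main (fun s => p (- s)) (fun s => dp (- s) * (-1)).
rewrite /= oppr0 => /(_ _ _ (- t)); rewrite opprK; apply.
- move=> s sa; apply: (@dcomp p); by apply: D; rewrite normrN.
- by move=> s sa; rewrite mulrN1 normrN; apply: B; rewrite normrN.
- by rewrite oppr_ge0 ltW.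
- by rewrite normrN.
Qed.

(** The max norm of a curve need not be derivable, so the estimate is made for the sum of squares.
    Adding [e * e] to it absorbs the inhomogeneous term through [2 x e <= x ^ 2 + e ^ 2], and
    [a <= 1] bounds the exponential by a constant. *)
Lemma gronwall m (L : R) : 0 <= L -> exists2 C, 0 < C &
  forall (a : R) (dl ddl : R -> E m) (e : R), a <= 1 -> 0 <= e ->
  (forall t, `|t| < a -> forall j, is_derive t 1 (fun s => dl s 0 j) (ddl t 0 j)) ->
  (forall t, `|t| < a -> `|ddl t| <= L * `|dl t| + e) ->
  forall t, `|t| < a -> `|dl t| <= C * (`|dl 0| + e).
Proof.
move=> L0; pose K := 2 * m%:R * L + m%:R + 1.
have m0 : 0 <= m%:R :> R by [].
have K0 : 0 < K by rewrite /K ltr_wpDl // addr_ge0 // !mulr_ge0.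
pose C2 := (m%:R + 1) * expR K.
have C20 : 0 < C2 by rewrite mulr_gt0 ?expR_gt0 // ltr_wpDl.
exists (C2 + 1); first by rewrite ltr_wpDr.
move=> a dl ddl e a1 e0 D B.
pose p t := \sum_j (dl t 0 j * dl t 0 j) + e * e.
pose dp t := \sum_j (dl t 0 j * ddl t 0 j + dl t 0 j * ddl t 0 j) + 0.
have sq t : `|dl t| * `|dl t| <= \sum_j (dl t 0 j * dl t 0 j).
  have [->|n0] := eqVneq `|dl t| 0.
    by rewrite mul0r sumr_ge0 // => i _; rewrite -expr2 sqr_ge0.
  have [[i j] /= ij] := mx_norm_neq0 n0.
  rewrite [`|dl t|]ij -normrM ord1 ger0_norm -?expr2 ?sqr_ge0 //.
  by rewrite (bigD1 j) //= -expr2 lerDl sumr_ge0 // => k _; rewrite -expr2 sqr_ge0.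
have Dp t : `|t| < a -> is_derive t 1 p (dp t).
  move=> ta; apply: dD.
  by apply: dsum => j; apply: dM; exact: D.
have Bp t : `|t| < a -> `|dp t| <= K * p t.
  move=> ta; rewrite /dp addr0; apply: le_trans (ler_norm_sum _ _ _) _.
  set x := `|dl t|; have x0 : 0 <= x by exact: normr_ge0.
  have T j : `|dl t 0 j * ddl t 0 j + dl t 0 j * ddl t 0 j| <= 2 * (x * (L * x + e)).
    apply: le_trans (ler_normD _ _) _; rewrite normrM.
    have : `|dl t 0 j| * `|ddl t 0 j| <= x * (L * x + e).
      apply: ler_pM => //; first exact: coord_le_norm.
      by apply: le_trans (coord_le_norm _ _) _; exact: B.
    by lra.
  apply: le_trans (ler_sum _ (fun j _ => T j)) _; rewrite sumr_const card_ord -mulr_natl.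
  have h1 := sq t; rewrite -/x in h1.
  set S := \sum_j _ in h1 *.
  have h2 : 2 * (x * e) <= x * x + e * e by have := sqr_ge0 (x - e); rewrite expr2; lra.
  have h3 : m%:R * L * (x * x) <= m%:R * L * S by rewrite ler_wpM2l // mulr_ge0.
  have h4 : m%:R * (2 * (x * e)) <= m%:R * (S + e * e) by rewrite ler_wpM2l //; lra.
  have h5 : 0 <= m%:R * L * (e * e) by rewrite !mulr_ge0.
  have h6 : 0 <= S by apply: le_trans h1; rewrite mulr_ge0.
  have h7 : 0 <= e * e by rewrite mulr_ge0.
  rewrite /p -/S /K; lra.
move=> t ta; have := gronwall1 (ltW K0) Dp Bp ta.
have S0 : p 0 <= m%:R * (`|dl 0| * `|dl 0|) + e * e.
  rewrite /p lerD2r; apply: le_trans (ler_sum _ (fun j _ => _ : _ <= `|dl 0| * `|dl 0|)) _.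
    move=> j _; apply: le_trans (ler_norm _) _; rewrite normrM.
    by apply: ler_pM => //; exact: coord_le_norm.
  by rewrite sumr_const card_ord mulr_natl.
have eK : expR (K * `|t|) <= expR K.
  by rewrite ler_expR ler_piMr ?(ltW K0) // (le_trans (ltW ta)).
set y := `|dl 0| in S0 *; set x := `|dl t|; have x0 : 0 <= x by exact: normr_ge0.
have y0 : 0 <= y by exact: normr_ge0.
move=> h; have h1 : x * x <= p t by apply: le_trans (sq t) _; rewrite lerDl mulr_ge0.
have p0 : 0 <= p 0.
  by rewrite addr_ge0 ?mulr_ge0 // sumr_ge0 // => i _; rewrite -expr2 sqr_ge0.
have h2 : x * x <= C2 * ((y + e) * (y + e)).
  apply: le_trans h1 _; apply: le_trans h _.
  apply: (@le_trans _ _ (p 0 * expR K)); first by rewrite ler_wpM2l.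
  rewrite /C2 mulrAC ler_wpM2r ?expR_ge0 //; apply: le_trans S0 _.
  have : 0 <= m%:R * (y * e) by rewrite !mulr_ge0.
  have : 0 <= m%:R * (e * e) by rewrite !mulr_ge0.
  have : 0 <= y * e by rewrite mulr_ge0.
  have : 0 <= y * y by rewrite mulr_ge0.
  by lra.
rewrite -(@ler_pXn2r _ 2) // ?nnegrE ?mulr_ge0 ?addr_ge0 ?(ltW C20) //.
rewrite exprMn !expr2; apply: le_trans h2 _; rewrite ler_wpM2r //.
  by rewrite mulr_ge0 // addr_ge0.
have : 0 <= C2 * C2 by rewrite mulr_ge0 ?(ltW C20).
by lra.
Qed.

End RealDerivatives.

Section FlowFamilies.
Context {R : realType}.
Local Notation E n := 'rV[R]_n.

Lemma fin_bound (I : finType) (Q : I -> R -> Prop) :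
  (forall i, exists2 M, 0 < M & Q i M) ->
  (forall i M M', M <= M' -> Q i M -> Q i M') ->
  exists2 M, 0 < M & forall i, Q i M.
Proof.
move=> H mono.
have /choice [M HM] : forall i, exists M, 0 < M /\ Q i M by move=> i; have [M] := H i; exists M.
exists (1 + \sum_i M i); first by rewrite ltr_wpDr // sumr_ge0 // => i _; exact: ltW (HM i).1.
move=> i; apply: mono (HM i).2; rewrite (bigD1 i) //= addrCA lerDl.
by rewrite addr_ge0 // sumr_ge0 // => j _; exact: ltW (HM j).1.
Qed.

Definition convex_set n (K : set (E n)) :=
  forall y y' t, K y -> K y' -> 0 <= t <= 1 -> K (y + t *: (y' - y)).

(** Convexity allows mean value estimates between any two points of [K], with constants that
    compactness makes uniform. *)
Definition compact_convex n (K : set (E n)) :=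
  [/\ forall x, ~ K x -> nr x (fun y => ~ K y), exists M, forall y, K y -> `|y| <= M & convex_set K].

Lemma compact_convex_compact n (K : set (E n)) : compact_convex K -> compact K.
Proof.
move=> [cK [M bK] _]; apply: bounded_closed_compact.
  exists M; split; first by rewrite num_real.
  by move=> b Mb x /bK xM /=; apply: le_trans (ltW Mb).
by rewrite -[K]setCK; apply: open_closedC; apply/nr_open => x /cK.
Qed.

Lemma cinf_bounded n (K : set (E n)) f : compact K -> (forall y, K y -> cinf f y) ->
  exists2 M, 0 < M & forall y, K y -> `|f y| <= M.
Proof.
move=> cK F; have [[x0 Kx0]|K0] := pselect (K !=set0); last first.
  by exists 1 => // y Ky; exfalso; apply: K0; exists y.
have [||x Kx H] := @EVT_max_rV R n (fun y => `|f y|) K _ cK.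
- by exists x0.
- apply: within_cts => x Kx e e0; apply: nrW (cinf_cts_nr (F x Kx) e0) => y h _.
  exact: le_lt_trans (ler_dist_dist _ _) h.
exists (`|f x| + 1); first by rewrite ltr_wpDl.
by move=> y Ky; apply: (@le_trans _ _ `|f x|); [apply: H; rewrite inE|rewrite lerDl].
Qed.

Lemma lip_compact n (K : set (E n)) f : compact_convex K -> (forall y, K y -> cinf f y) ->
  exists2 L, 0 < L & forall y y', K y -> K y' -> `|f y' - f y| <= L * `|y' - y|.
Proof.
move=> cK F; have [_ _ vK] := cK.
have [i|i M M' MM' H y Ky|M M0 HM] := @fin_bound 'I_n (fun i M => forall y, K y -> `|partial i f y| <= M).
- by apply: cinf_bounded (compact_convex_compact cK) _ => y /F; exact: cinf_partial.
- exact: le_trans (H y Ky) MM'.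
exists (n%:R * M + 1); first by rewrite ltr_wpDl // mulr_ge0 // ltW.
move=> y y' Ky Ky'.
have [|c c01] := @mean01 _ _ f y (y' - y).
  by move=> t /(vK _ _ _ Ky Ky') /F h; exact: cinf_derivable.
rewrite [y + _]addrC subrK => ->; have Kc := vK _ _ _ Ky Ky' c01.
have [_ ->] := cinf_dir (y' - y) (F _ Kc).
apply: le_trans (lform_norm _ _) _; rewrite ler_wpM2r //.
apply: le_trans (ler_sum _ (fun i _ => HM i _ Kc)) _.
by rewrite sumr_const card_ord mulr_natl lerDl.
Qed.

Lemma lipv_compact n m (K : set (E n)) (f : E n -> E m) : compact_convex K ->
  (forall y, K y -> cinfv f y) ->
  exists2 L, 0 < L & forall y y', K y -> K y' -> `|f y' - f y| <= L * `|y' - y|.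
Proof.
move=> cK F.
have [j|j M M' MM' H y y' Ky Ky'|M M0 HM] := @fin_bound 'I_m
   (fun j L => forall y y', K y -> K y' -> `|f y' 0 j - f y 0 j| <= L * `|y' - y|).
- by apply: (lip_compact cK) => y /F.
- by apply: le_trans (H y y' Ky Ky') _; rewrite ler_wpM2r.
exists M => // y y' Ky Ky'; apply: norm_le_coord; first by rewrite mulr_ge0 // ltW.
by move=> j; rewrite coordB; exact: HM.
Qed.

Lemma cinf_jac n m (f : E n -> E m) x i j : cinfv f x -> cinf (fun y => jacobian f y i j) x.
Proof. by move=> F; apply: cinf_ext (cinf_partial i (F j)) => y; rewrite mxE. Qed.

Lemma jac_bound n m (K : set (E n)) (f : E n -> E m) : compact_convex K ->
  (forall y, K y -> cinfv f y) ->
  exists2 M, 0 < M & forall y (h : E n), K y -> `|h *m jacobian f y| <= M * `|h|.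
Proof.
move=> cK F.
have [ij|ij M M' MM' H y Ky|M M0 HM] := @fin_bound ('I_n * 'I_m)%type
   (fun ij M => forall y, K y -> `|jacobian f y ij.1 ij.2| <= M).
- by apply: (cinf_bounded (compact_convex_compact cK)) => y /F; exact: cinf_jac.
- exact: le_trans (H y Ky) MM'.
exists (n%:R * M + 1); first by rewrite ltr_wpDl // mulr_ge0 // ltW.
move=> y h Ky; apply: norm_le_coord; first by rewrite mulr_ge0 // addr_ge0 // mulr_ge0 // ltW.
move=> j; rewrite mxE; apply: le_trans (lform_norm (fun i => jacobian f y i j) h) _.
rewrite ler_wpM2r //; apply: le_trans (ler_sum _ (fun i _ => HM (i, j) _ Ky)) _.
by rewrite sumr_const card_ord mulr_natl lerDl.
Qed.

Lemma taylor1 n m (K : set (E n)) (f : E n -> E m) : compact_convex K ->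
  (forall y, K y -> cinfv f y) ->
  exists2 L, 0 < L & forall y y', K y -> K y' ->
     `|f y' - f y - (y' - y) *m jacobian f y| <= L * (`|y' - y| * `|y' - y|).
Proof.
move=> cK F; have [_ _ vK] := cK.
have [ij|ij M M' MM' H y y' Ky Ky'|M M0 HM] := @fin_bound ('I_n * 'I_m)%type
   (fun ij L => forall y y', K y -> K y' ->
      `|jacobian f y' ij.1 ij.2 - jacobian f y ij.1 ij.2| <= L * `|y' - y|).
- by apply: (lip_compact cK) => y /F; exact: cinf_jac.
- by apply: le_trans (H y y' Ky Ky') _; rewrite ler_wpM2r.
exists (n%:R * M + 1); first by rewrite ltr_wpDl // mulr_ge0 // ltW.
move=> y y' Ky Ky'; apply: norm_le_coord.
  by rewrite mulr_ge0 ?mulr_ge0 // addr_ge0 // mulr_ge0 // ltW.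
move=> j; rewrite !coordB.
have [|c c01] := @mean01 _ _ (fun z => f z 0 j) y (y' - y).
  by move=> t /(vK _ _ _ Ky Ky') /F h; exact: (cinf_derivable (h j)).
rewrite [y + _]addrC subrK => ->; have Kc := vK _ _ _ Ky Ky' c01.
have [_ ->] := cinf_dir (y' - y) (F _ Kc j).
have -> : ((y' - y) *m jacobian f y) 0 j = lform (fun i => jacobian f y i j) (y' - y) by rewrite mxE.
have -> : lform (fun i => partial i (fun z => f z 0 j) (y + c *: (y' - y))) (y' - y) -
    lform (fun i => jacobian f y i j) (y' - y) =
    lform (fun i => jacobian f (y + c *: (y' - y)) i j - jacobian f y i j) (y' - y).
  by rewrite /lform -sumrB; apply: eq_bigr => i _; rewrite !mxE -mulrBr.
apply: le_trans (lform_norm _ _) _; rewrite mulrA ler_wpM2r //.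
have B i : `|jacobian f (y + c *: (y' - y)) i j - jacobian f y i j| <= M * `|y' - y|.
  apply: le_trans (HM (i, j) _ _ Ky Kc) _; rewrite ler_pM2l // addrAC subrr add0r normrZ.
  by rewrite ler_piMl // ger0_norm; lra.
apply: le_trans (ler_sum _ (fun i _ => B i)) _.
by rewrite -mulr_suml sumr_const card_ord mulr_natl ler_wpM2r // lerDl.
Qed.

(** The limit at [0] is the supremum of the lower bounds [V s - C s], [s > 0], which all lie below
    the upper bounds [V s' + C s']. A negative [s] is first compared with [|s|], whence the factor
    3. *)
Lemma sup_limit (V : R -> R) (C s0 : R) : 0 < s0 -> 0 <= C ->
  (forall s s', 0 < `|s| < s0 -> 0 < `|s'| < s0 -> `|V s - V s'| <= C * (`|s| + `|s'|)) ->
  exists D, forall s, 0 < `|s| < s0 -> `|V s - D| <= 3 * C * `|s|.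
Proof.
move=> s00 C0 H.
pose A := [set V s - C * s | s in [set s | 0 < s < s0]].
have ub s' : 0 < s' < s0 -> ubound A (V s' + C * s').
  move=> /andP[a b] _ [s /= /andP[c d] <-].
  have := H s s'; rewrite (gtr0_norm a) (gtr0_norm c) c d a b => /(_ isT isT).
  by move/(le_trans (ler_norm _)); lra.
have A0 : A !=set0.
  by exists (V (s0 / 2) - C * (s0 / 2)), (s0 / 2) => //=; lra.
have hs : has_sup A.
  by split => //; exists (V (s0 / 2) + C * (s0 / 2)); apply: ub; lra.
have pos s : 0 < s < s0 -> `|V s - sup A| <= C * s.
  move=> hs'; have h1 : sup A <= V s + C * s by apply: ge_sup => //; exact: ub.
  have h2 : V s - C * s <= sup A by apply: sup_upper_bound => //; exists s.
  by rewrite ler_norml; lra.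
exists (sup A) => s hs'; have := H s `|s|; rewrite normr_id => /(_ hs' hs') h1.
have h2 := pos _ hs'; have := ler_normD (V s - V `|s|) (V `|s| - sup A).
by rewrite addrA subrK; have := normr_ge0 s; lra.
Qed.

(** Limit and derivative are exchanged by bounding the increments of [F - f s]: the mean value
    theorem for [f s' - f s] shows that they are of order [s] times the increment of time, up to an
    error that vanishes with [s']. *)
Lemma unif_derive (f g : R -> R -> R) (F G : R -> R) (a C s0 : R) : 0 < s0 -> 0 <= C ->
  (forall s t : R, 0 < s < s0 -> `|t| < a -> is_derive t 1 (f s) (g s t)) ->
  (forall s t : R, 0 < s < s0 -> `|t| < a -> `|f s t - F t| <= C * s) ->
  (forall s t : R, 0 < s < s0 -> `|t| < a -> `|g s t - G t| <= C * s) ->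
  forall t : R, `|t| < a -> is_derive t 1 F (G t).
Proof.
move=> s00 C0 D hf hg t ta.
have step s u v : 0 < s < s0 -> `|u| < a -> `|v| < a ->
    `|(F v - f s v) - (F u - f s u)| <= 2 * C * s * `|v - u|.
  move=> ss ua va.
  apply/ler_addgt0Pr => e e0.
  pose s' := Num.min s (e / (2 * C + 1)).
  have s'0 : 0 < s' by rewrite lt_min divr_gt0 //; lra.
  have s's : s' <= s by rewrite ge_min lexx.
  have ss' : 0 < s' < s0 by lra.
  have s'e : 2 * C * s' <= e.
    have : s' * (2 * C + 1) <= e by rewrite -ler_pdivlMr ?ge_min ?lexx ?orbT //; lra.
    by lra.
  have Dd (w : R) : `|w| < a -> is_derive w 1 (fun w => f s' w - f s w) (g s' w - g s w).
    by move=> wa; apply: dD; [exact: D|apply: dN; exact: D].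
  have [c [ca _ E]] := dmvt_abs Dd ua va.
  have h1 := hf _ _ ss' ua; have h2 := hf _ _ ss' va.
  have h3 : `|g s' c - g s c| <= C * s' + C * s.
    have := ler_normB (g s' c - G c) (g s c - G c).
    have := hg _ _ ss ca; have := hg _ _ ss' ca.
    by rewrite opprB addrA subrK; lra.
  have h4 : `|(f s' v - f s v) - (f s' u - f s u)| <= 2 * C * s * `|v - u|.
    rewrite E normrM ler_wpM2r //; apply: le_trans h3 _.
    have : C * s' <= C * s by rewrite ler_wpM2l.
    by lra.
  move: h1 h2 h4; rewrite !ler_norml => /andP[? ?] /andP[? ?] /andP[? ?].
  by apply/andP; split; lra.
apply: is_derive_eps => e e0.
pose s := Num.min (s0 / 2) (e / (6 * C + 1)).
have s_0 : 0 < s by rewrite lt_min !divr_gt0 //; lra.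
have ss : 0 < s < s0 by rewrite s_0 (@le_lt_trans _ _ (s0 / 2)) ?ge_min ?lexx //; lra.
have se : 6 * C * s <= e.
  have : s * (6 * C + 1) <= e by rewrite -ler_pdivlMr ?ge_min ?lexx ?orbT //; lra.
  by lra.
have [Dd Dv] := D s t ss ta.
have dd : differentiable (f s) t by apply/derivable1_diffP.
have /eqaddoP/(_ (e / 2)) := diff_locally dd.
rewrite divr_gt0 // => /(_ isT) /nbhs_ballP [d /= d0 Hd].
exists (Num.min d (a - `|t|)); first by rewrite lt_min d0 subr_gt0.
move=> h; rewrite lt_min => /andP[hd ha]; rewrite [h *: 1]mulr1.
have tha : `|t + h| < a by apply: le_lt_trans (ler_normD _ _) _; rewrite -ltrBrDl.
have h1 := step s t (t + h) ss ta tha.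
have h2 := hg s t ss ta.
have h3 : `|f s (t + h) - f s t - h * g s t| <= e / 2 * `|h|.
  have := Hd h; rewrite -ball_normE /= sub0r normrN => /(_ hd).
  rewrite !fctE /= [h + t]addrC; congr (`|_| <= _).
  rewrite opprD addrA; congr (_ - _); rewrite -Dv deriveE //.
  by rewrite -{1}[h]mulr1 -[h * 1]/(h *: 1) linearZ.
move: h1; rewrite [t + h]addrC addrK [h + t]addrC => h1.
have h4 : `|h * g s t - h * G t| <= C * s * `|h| by rewrite -mulrBr normrM mulrC ler_wpM2r.
have h5 : 6 * C * s * `|h| <= e * `|h| by rewrite ler_wpM2r.
move: h1 h3 h4; rewrite !ler_norml => /andP[? ?] /andP[? ?] /andP[? ?].
by apply/andP; split; lra.
Qed.

End FlowFamilies.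

(** * Smooth dependence on initial values *)

Section SmoothDependence.
Context {R : realType}.
Local Notation E n := 'rV[R]_n.

Lemma lsubmx_norm n1 n2 (z : E (n1 + n2)) : `|lsubmx z| <= `|z|.
Proof. by apply: norm_le_coord => // i; rewrite mxE; exact: coord_le_norm. Qed.

Lemma rsubmx_norm n1 n2 (z : E (n1 + n2)) : `|rsubmx z| <= `|z|.
Proof. by apply: norm_le_coord => // i; rewrite mxE; exact: coord_le_norm. Qed.

Lemma row_mx_norm n1 n2 (x : E n1) (y : E n2) b : `|x| <= b -> `|y| <= b -> `|row_mx x y| <= b.
Proof.
move=> xb yb; apply: norm_le_coord; first exact: le_trans xb.
move=> i; rewrite mxE; case: splitP => j _.
  exact: le_trans (coord_le_norm _ _) xb.
exact: le_trans (coord_le_norm _ _) yb.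
Qed.

Lemma cinfv_lsubmx n m1 m2 (f : E n -> E (m1 + m2)) x : cinfv f x -> cinfv (fun y => lsubmx (f y)) x.
Proof. by move=> F j; apply: cinf_ext (F (lshift m2 j)) => y; rewrite mxE. Qed.

Lemma cinfv_rsubmx n m1 m2 (f : E n -> E (m1 + m2)) x : cinfv f x -> cinfv (fun y => rsubmx (f y)) x.
Proof. by move=> F j; apply: cinf_ext (F (rshift m1 j)) => y; rewrite mxE. Qed.

Lemma cinfv_row_mx n m1 m2 (f : E n -> E m1) (g : E n -> E m2) x : cinfv f x -> cinfv g x ->
  cinfv (fun y => row_mx (f y) (g y)) x.
Proof.
move=> F G j; rewrite -(splitK j); case: (fintype.split j) => i /=.
  by apply: cinf_ext (F i) => y; rewrite row_mxEl.
by apply: cinf_ext (G i) => y; rewrite row_mxEr.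
Qed.

(** A local flow in coordinates. Trajectories stay in [K] so that uniform bounds for [X] on [K]
    apply to them; [a <= 1] is what [gronwall] asks for. *)
Definition solution_family m (K : set (E m)) (X : E m -> E m) (B : set (E m)) (a : R)
    (phi : R -> E m -> E m) :=
  [/\ 0 < a <= 1, open B, forall x, B x -> phi 0 x = x,
      forall x (t : R), B x -> `|t| < a -> K (phi t x) &
      forall x (t : R) j, B x -> `|t| < a -> is_derive t 1 (fun s => phi s x 0 j) (X (phi t x) 0 j)].

Definition dphi m (phi : R -> E m -> E m) (t : R) (x w : E m) : E m :=
  \row_j 'D_w (fun y => phi t y 0 j) x.

Section Family.
Variables (m : nat) (K : set (E m)) (X : E m -> E m) (B : set (E m)) (a : R).
Variable (phi : R -> E m -> E m).
Hypotheses (cK : compact_convex K) (sX : forall y, K y -> cinfv X y).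
Hypothesis (F : solution_family K X B a phi).

Lemma family_lip : exists2 C, 0 < C & forall x x' t, B x -> B x' -> `|t| < a ->
  `|phi t x' - phi t x| <= C * `|x' - x|.
Proof.
have [/andP[a0 a1] oB phi0 phiK phiD] := F.
have [L L0 HL] := lipv_compact cK sX.
have [C C0 HC] := gronwall m (ltW L0).
exists C => // x x' t Bx Bx' ta.
have := HC a (fun t => phi t x' - phi t x) (fun t => X (phi t x') - X (phi t x)) 0 a1 (lexx _).
rewrite !phi0 // addr0; apply => // s sa.
  move=> j; rewrite coordB.
  have -> : (fun s => (phi s x' - phi s x) 0 j) = (fun s => phi s x' 0 j - phi s x 0 j).
    by apply/funext => u; rewrite coordB.
  by apply: dD; [exact: phiD|apply: dN; exact: phiD].
by rewrite addr0; apply: HL; exact: phiK.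
Qed.

(** The difference quotients [V s] in the direction [w] solve the linearized equation up to an error
    of order [s], by Taylor's formula. Gronwall's estimate makes them Cauchy as [s] tends to [0],
    uniformly in time, and the limit [D] solves the linearized equation exactly, by
    [unif_derive]. *)
Lemma family_deriv x w : B x -> exists (D : R -> E m) C s0, [/\ 0 < s0, 0 <= C &
  forall t, `|t| < a ->
   (forall s, 0 < `|s| < s0 -> B (x + s *: w) /\
      `|s^-1 *: (phi t (x + s *: w) - phi t x) - D t| <= C * `|s|) /\
   (forall j, is_derive t 1 (fun s => D s 0 j) ((D t *m jacobian X (phi t x)) 0 j))].
Proof.
move=> Bx; have [/andP[a0 a1] oB phi0 phiK phiD] := F.
have [C C0 HC] := family_lip.
have [L2 L20 HL2] := taylor1 cK sX.
have [MJ MJ0 HMJ] := jac_bound cK sX.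
have [G G0 HG] := gronwall m (ltW MJ0).
have [d d0 Hd] := (nr_open B).1 oB x Bx.
pose w1 := `|w| + 1; have w10 : 0 < w1 by rewrite ltr_wpDl.
pose s0 := d / w1; have s00 : 0 < s0 by rewrite divr_gt0.
have BB s : `|s| < s0 -> B (x + s *: w).
  move=> ss; apply: Hd; rewrite addrC addKr normrZ.
  by apply: le_lt_trans (_ : `|s| * w1 < d); [rewrite ler_wpM2l // lerDl|rewrite -ltr_pdivlMr].
pose V s t := s^-1 *: (phi t (x + s *: w) - phi t x).
pose dV s t := s^-1 *: (X (phi t (x + s *: w)) - X (phi t x)).
have VD (s t : R) j : `|s| < s0 -> `|t| < a -> is_derive t 1 (fun t => V s t 0 j) (dV s t 0 j).
  move=> ss ta; rewrite /dV coordZ coordB.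
  have -> : (fun t => V s t 0 j) = (fun t => s^-1 * (phi t (x + s *: w) 0 j - phi t x 0 j)).
    by apply/funext => u; rewrite /V coordZ coordB.
  apply: d_eq (dM (dC _ _) (dD (phiD _ _ j (BB s ss) ta) (dN (phiD _ _ j Bx ta)))) _.
  by rewrite mulr0 addr0.
pose c1 := L2 * (C * w1) * (C * w1).
have c10 : 0 < c1 by rewrite !mulr_gt0.
have dl (s t : R) : 0 < `|s| < s0 -> `|t| < a -> `|phi t (x + s *: w) - phi t x| <= C * w1 * `|s|.
  move=> /andP[sp ss] ta; apply: le_trans (HC _ _ _ Bx (BB s ss) ta) _.
  by rewrite addrC addKr normrZ mulrAC -mulrA ler_pM2l // ler_wpM2l // lerDl.
have VT (s t : R) : 0 < `|s| < s0 -> `|t| < a -> `|dV s t - V s t *m jacobian X (phi t x)| <= c1 * `|s|.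
  move=> hs ta; have /andP[sp ss] := hs.
  rewrite /dV /V -scalemxAl -scalerBr normrZ normfV ler_pdivrMl //.
  apply: le_trans (HL2 _ _ (phiK _ _ Bx ta) (phiK _ _ (BB s ss) ta)) _.
  have h := dl s t hs ta.
  apply: (@le_trans _ _ (L2 * ((C * w1 * `|s|) * (C * w1 * `|s|)))).
    by rewrite ler_pM2l //; apply: ler_pM.
  by rewrite /c1 le_eqVlt; apply/orP; left; apply/eqP; ring.
have V0 (s : R) : 0 < `|s| < s0 -> V s 0 = w.
  move=> /andP[sp ss]; rewrite /V !phi0 //; last exact: BB.
  by rewrite addrC addKr scalerA mulVf ?scale1r // -normr_gt0.
pose c2 := G * c1; have c20 : 0 <= c2 by rewrite ltW // mulr_gt0.
have Cau (s s' t : R) : 0 < `|s| < s0 -> 0 < `|s'| < s0 -> `|t| < a ->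
    `|V s t - V s' t| <= c2 * (`|s| + `|s'|).
  move=> hs hs' ta; have /andP[_ ss] := hs; have /andP[_ ss'] := hs'.
  have := HG a (fun t => V s t - V s' t) (fun t => dV s t - dV s' t) (c1 * (`|s| + `|s'|)) a1.
  rewrite !V0 // subrr normr0 add0r mulrA; apply => //.
  - by rewrite mulr_ge0 ?addr_ge0 // ltW.
  - move=> u ua j; rewrite coordB.
    have -> : (fun u => (V s u - V s' u) 0 j) = (fun u => V s u 0 j - V s' u 0 j).
      by apply/funext => z; rewrite coordB.
    by apply: dD; [exact: VD|apply: dN; exact: VD].
  - move=> u ua; have h1 := VT s u hs ua; have h2 := VT s' u hs' ua.
    have h3 := HMJ _ (V s u - V s' u) (phiK _ _ Bx ua).
    set J := jacobian _ _ in h1 h2 h3.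
    have -> : dV s u - dV s' u = (V s u - V s' u) *m J +
        ((dV s u - V s u *m J) - (dV s' u - V s' u *m J)).
      by rewrite mulmxBl; apply/rowP => i; rewrite !mxE; ring.
    apply: le_trans (ler_normD _ _) _; apply: lerD => //.
    by apply: le_trans (ler_normB _ _) _; rewrite mulrDr; exact: lerD.
have /choice [D0 HD0] : forall jt : 'I_m * R, exists D, `|jt.2| < a ->
    forall s, 0 < `|s| < s0 -> `|V s jt.2 0 jt.1 - D| <= 3 * c2 * `|s|.
  move=> [j t] /=; have [ta|] := ltP `|t| a; last by exists 0.
  have [|D HD] := @sup_limit _ (fun s => V s t 0 j) c2 s0 s00 c20; last by exists D.
  move=> s s' hs hs'; rewrite -coordB.
  by apply: le_trans (coord_le_norm _ _) _; exact: Cau.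
pose D t := \row_j D0 (j, t) : E m.
have HD (s t : R) : 0 < `|s| < s0 -> `|t| < a -> `|V s t - D t| <= 3 * c2 * `|s|.
  move=> hs ta; apply: norm_le_coord; first by rewrite mulr_ge0 // mulr_ge0.
  by move=> j; rewrite coordB [D t 0 j]mxE; exact: (HD0 (j, t)).
exists D, (3 * c2), s0; split => //; first by rewrite mulr_ge0.
move=> t ta; split.
  by move=> s hs; split; [apply: BB; lra|exact: HD].
move=> j.
apply: (@unif_derive _ (fun s t => V s t 0 j) (fun s t => dV s t 0 j) (fun t => D t 0 j)
  (fun t => (D t *m jacobian X (phi t x)) 0 j) a (MJ * (3 * c2) + c1 + 3 * c2) s0) => //.
- by rewrite !addr_ge0 ?mulr_ge0 // ltW.
- by move=> s u /andP[sp ss] ua; apply: VD => //; rewrite gtr0_norm.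
- move=> s u /andP[sp ss] ua; rewrite -coordB; apply: le_trans (coord_le_norm _ _) _.
  have := HD s u; rewrite gtr0_norm // sp ss => /(_ isT ua) /le_trans; apply.
  by rewrite ler_pM2r // lerDr addr_ge0 ?mulr_ge0 // ltW.
- move=> s u /andP[sp ss] ua; rewrite -coordB; apply: le_trans (coord_le_norm _ _) _.
  have := HD s u; have := VT s u; rewrite gtr0_norm // sp ss => /(_ isT ua) h1 /(_ isT ua) h2.
  have h3 := HMJ _ (V s u - D u) (phiK _ _ Bx ua).
  set J := jacobian _ _ in h1 h3 *.
  have -> : dV s u - D u *m J = (dV s u - V s u *m J) + (V s u - D u) *m J.
    by rewrite mulmxBl addrA subrK.
  apply: le_trans (ler_normD _ _) _.
  have : MJ * `|V s u - D u| <= MJ * (3 * c2 * s) by rewrite ler_pM2l.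
  have : 0 <= 3 * c2 * s by rewrite !mulr_ge0 // ltW.
  by lra.
Qed.

Lemma family_dphi x w t : B x -> `|t| < a ->
  (forall j, derivable (fun y => phi t y 0 j) x w) /\
  (forall j, is_derive t 1 (fun s => dphi phi s x w 0 j)
     ((dphi phi t x w *m jacobian X (phi t x)) 0 j)).
Proof.
move=> Bx ta; have [D [C [s0 [s00 C0 H]]]] := family_deriv w Bx.
have E (u : R) j : `|u| < a -> is_derive x w (fun y => phi u y 0 j) (D u 0 j).
  move=> ua; have [h1 _] := H u ua.
  apply: is_derive_eps => e e0; exists (Num.min s0 (e / (C + 1))).
    by rewrite lt_min s00 divr_gt0 // ltr_wpDl.
  move=> s; rewrite lt_min => /andP[ss se].
  have [->|sn] := eqVneq s 0; first by rewrite scale0r addr0 subrr mul0r subrr normr0 mulr0.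
  have sp : 0 < `|s| by rewrite normr_gt0.
  have [|_] := h1 s; first by rewrite sp.
  move=> h2; have := le_trans (coord_le_norm _ j) h2; rewrite coordB coordZ coordB => h3.
  have -> : phi u (x + s *: w) 0 j - phi u x 0 j - s * D u 0 j =
    s * (s^-1 * (phi u (x + s *: w) 0 j - phi u x 0 j) - D u 0 j).
    by rewrite mulrBr mulrA mulfV // mul1r.
  rewrite normrM mulrC ler_wpM2r //; apply: le_trans h3 _.
  move: se; rewrite ltr_pdivlMr ?ltr_wpDl // => se.
  by rewrite mulrC; lra.
have DE (u : R) : `|u| < a -> dphi phi u x w = D u.
  by move=> ua; apply/rowP => j; rewrite mxE; have [_ ->] := E u j ua.
split=> [j|j]; first by have [] := E t j ta.
have [_ /(_ j) h] := H t ta; rewrite (DE t ta).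
have [h1 h2] := h.
have nE : \forall s \near t, dphi phi s x w 0 j = D s 0 j.
  exists (a - `|t|); first by rewrite /= subr_gt0.
  move=> s; rewrite /ball_ /= => st; rewrite DE //.
  rewrite -[s](subrK t); apply: le_lt_trans (ler_normD _ _) _.
  by rewrite -ltrBrDr distrC.
by apply: near_eq_is_derive h; apply: filterS nE => s ->.
Qed.

Lemma dphi_bound : exists2 C, 0 < C & forall x w t, B x -> `|t| < a -> `|dphi phi t x w| <= C * `|w|.
Proof.
have [C C0 HC] := family_lip; exists C => // x w t Bx ta.
have [/andP[a0 a1] oB phi0 phiK phiD] := F.
apply: norm_le_coord; first by rewrite mulr_ge0 // ltW.
move=> j; rewrite mxE; have [/(_ j) dj _] := family_dphi w Bx ta.
have [d d0 Hd] := (nr_open B).1 oB x Bx.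
apply: (@closed_cvg _ _ (0 : R)^' _ (fun h => h^-1 *: (phi t (h *: w + x) 0 j - phi t x 0 j))
  [set z | `|z| <= C * `|w|]).
- rewrite (_ : mkset _ = (fun z : R => `|z|) @^-1` [set z | z <= C * `|w|]) //.
  apply: closed_comp; last exact: closed_le.
  by move=> z _; exact: norm_continuous.
- near=> h.
  have h0 : h != 0 by near: h; exact: nbhs_dnbhs_neq.
  have hB : B (x + h *: w).
    apply: Hd; rewrite addrC addKr normrZ.
    apply: le_lt_trans (_ : `|h| * (`|w| + 1) < d); first by rewrite ler_wpM2l // lerDl.
    rewrite -ltr_pdivlMr ?ltr_wpDl //; near: h; apply: dnbhs0_lt.
    by rewrite divr_gt0 // ltr_wpDl.
  rewrite /= normrM normfV ler_pdivrMl ?normr_gt0 //.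
  rewrite [h *: w + x]addrC -coordB; apply: le_trans (coord_le_norm _ _) _.
  apply: le_trans (HC _ _ _ Bx hB ta) _; rewrite addrC addKr normrZ.
  by rewrite mulrCA.
- exact: dj.
Unshelve. all: by end_near. Qed.

Lemma dphi0 x w : B x -> dphi phi 0 x w = w.
Proof.
move=> Bx; have [/andP[a0 a1] oB phi0 phiK phiD] := F.
apply/rowP => j; rewrite mxE.
rewrite (@nr_derive _ _ _ (fun y => y 0 j)).
  have [_ ->] := cinf_dir w (cinf_coord x j).
  rewrite /lform (bigD1 j) //= big1 ?addr0 => [|i ij].
    rewrite partialE; have := jacobian_id x => /matrixP /(_ j j).
    by rewrite !mxE partialE eqxx => ->; rewrite mulr1.
  have := jacobian_id x => /matrixP /(_ i j); rewrite !mxE => ->.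
  by rewrite (negbTE ij) mulr0.
by apply: nrW ((nr_open B).1 oB x Bx) => y /phi0 ->.
Qed.

End Family.

Definition time_domain m (B : set (E m)) (a : R) : set (E (m + 1)) :=
  [set z | B (lsubmx z) /\ `|rsubmx z 0 0| < a].

Definition joint m (phi : R -> E m -> E m) (z : E (m + 1)) : E m :=
  phi (rsubmx z 0 0) (lsubmx z).

Lemma is_derive_transport (V W : normedModType R) (f : V -> R) (g : W -> R) z v x w l :
  (forall h : R, f (z + h *: v) = g (x + h *: w)) -> is_derive x w g l -> is_derive z v f l.
Proof.
move=> H [h1 h2].
have E : (fun s : R => f (z + s *: v)) = (fun s : R => g (x + s *: w)) by apply/funext.
split.
  by have := line_derivable f z v 0; rewrite scale0r addr0 => <-; rewrite E line_derivable scale0r addr0.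
by have := line_derive f z v 0; rewrite scale0r addr0 => <-; rewrite E line_derive scale0r addr0.
Qed.

Lemma open_time_domain m (B : set (E m)) a : open B -> open (time_domain B a).
Proof.
move=> /nr_open oB; apply/nr_open => z [Bz za].
have [d d0 H] := oB _ Bz; exists (Num.min d (a - `|rsubmx z 0 0|)).
  by rewrite lt_min d0 subr_gt0.
move=> y; rewrite lt_min => /andP[yd ya]; split.
  by apply: H; rewrite -linearB; apply: le_lt_trans (lsubmx_norm _) yd.
rewrite -[rsubmx y 0 0](subrK (rsubmx z 0 0)); apply: le_lt_trans (ler_normD _ _) _.
rewrite -ltrBrDr; apply: le_lt_trans ya.
rewrite -coordB -linearB; apply: le_trans (coord_le_norm _ _) _; exact: rsubmx_norm.
Qed.

(* Together with [phi], its derivative [dphi] in the direction [w] solves the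
   equation of the field [(y, w) |-> (X y, w DX(y))]; hence an induction on the
   order of differentiability, over all fields. *)
Lemma joint_Ck k m (K : set (E m)) X B a phi : compact_convex K ->
  (forall y, K y -> cinfv X y) -> solution_family K X B a phi ->
  forall j, Ck k (time_domain B a) (fun z => joint phi z 0 j).
Proof.
elim: k m K X B a phi => [|k IH] m K X B a phi cK sX F j;
  have [/andP[a0 a1] oB phi0 phiK phiD] := F; have oD := @open_time_domain _ _ a oB.
  split => // z [Bz za]; apply/ctsP => e e0.
  have [C C0 HC] := family_lip cK sX F.
  have /d_cts/cvgrPdist_lt := phiD _ _ j Bz za.
  move=> /(_ (e / 2)); rewrite divr_gt0 // => /(_ isT) /nbhs_ballP [d /= d0 Hd].
  have [d1 d10 Hd1] := (nr_open _).1 oD z (conj Bz za).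
  exists (Num.min d1 (Num.min d (e / 2 / C))).
    by rewrite !lt_min d10 d0 !divr_gt0.
  move=> y; rewrite !lt_min => /and3P[y1 y2 y3].
  have [By ya] := Hd1 y y1.
  set x := lsubmx z in Bz *; set t := rsubmx z 0 0 in za Hd *.
  have h1 : `|phi (rsubmx y 0 0) (lsubmx y) 0 j - phi (rsubmx y 0 0) x 0 j| < e / 2.
    rewrite -coordB; apply: le_lt_trans (coord_le_norm _ _) _.
    apply: le_lt_trans (HC _ _ _ Bz By ya) _; rewrite mulrC -ltr_pdivlMr //.
    by apply: le_lt_trans y3; rewrite -linearB; exact: lsubmx_norm.
  have h2 : `|phi (rsubmx y 0 0) x 0 j - phi t x 0 j| < e / 2.
    rewrite distrC; apply: Hd; rewrite -ball_normE /= distrC.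
    apply: le_lt_trans y2; rewrite -coordB -linearB.
    by apply: le_trans (coord_le_norm _ _) _; exact: rsubmx_norm.
  have := ler_normD (phi (rsubmx y 0 0) (lsubmx y) 0 j - phi (rsubmx y 0 0) x 0 j)
    (phi (rsubmx y 0 0) x 0 j - phi t x 0 j).
  by rewrite addrA subrK /joint -/x -/t; lra.
have Jk := IH _ _ _ _ _ _ cK sX F.
have [C C0 HC] := dphi_bound cK sX F.
have Dx i z : time_domain B a z -> is_derive z (delta_mx 0 (lshift 1 i)) (fun z => joint phi z 0 j)
    (dphi phi (rsubmx z 0 0) (lsubmx z) (delta_mx 0 i) 0 j).
  move=> [Bz za]; have [/(_ j) d1 _] := family_dphi cK sX F (delta_mx 0 i) Bz za.
  apply: (@is_derive_transport _ _ _ (fun y => phi (rsubmx z 0 0) y 0 j) _ _ (lsubmx z) (delta_mx 0 i)).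
    move=> h; rewrite /joint; congr (phi _ _ 0 j).
      by rewrite !mxE /= eq_rlshift mulr0 addr0.
    by apply/rowP => l; rewrite !mxE /= eq_lshift.
  by rewrite [dphi _ _ _ _ 0 j]mxE; exact: derivableP.
have Dt i z : time_domain B a z -> is_derive z (delta_mx 0 (rshift m i)) (fun z => joint phi z 0 j)
    (X (joint phi z) 0 j).
  move=> [Bz za].
  apply: (@is_derive_transport _ _ _ (fun s => phi s (lsubmx z) 0 j) _ _ (rsubmx z 0 0) 1); last exact: phiD.
  move=> h; rewrite /joint; congr (phi _ _ 0 j).
    by rewrite !mxE /= eq_rshift ord1 eqxx [h *: 1]mulr1 mulr1.
  by apply/rowP => l; rewrite !mxE /= eq_lrshift mulr0 addr0.
(* The bounds match: directions with [|w| < 2] include the basis vectors, and [dphi_bound] keeps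
   their images within [2 * C], so that the extended family again stays in a compact convex set. *)
pose K' := [set p : E (m + m) | K (lsubmx p) /\ `|rsubmx p| <= 2 * C].
pose B' := [set p : E (m + m) | B (lsubmx p) /\ `|rsubmx p| < 2].
pose X' (p : E (m + m)) := row_mx (X (lsubmx p)) (rsubmx p *m jacobian X (lsubmx p)).
pose phi' t (p : E (m + m)) := row_mx (phi t (lsubmx p)) (dphi phi t (lsubmx p) (rsubmx p)).
have cK' : compact_convex K'.
  have [c1 [M c2] c3] := cK; split.
  - move=> p Kp; have [Kl|Kl] := pselect (K (lsubmx p)); last first.
      have [d d0 H] := c1 _ Kl; exists d => // q qp [Kq _]; apply: (H (lsubmx q)) => //.
      by rewrite -linearB; apply: le_lt_trans (lsubmx_norm _) qp.
    have pr : 2 * C < `|rsubmx p| by rewrite ltNge; apply/negP => h; apply: Kp.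
    exists (`|rsubmx p| - 2 * C); first by rewrite subr_gt0.
    move=> q qp [_ rq]; have := ler_normD (rsubmx q) (rsubmx p - rsubmx q).
    rewrite addrC subrK distrC -linearB => h.
    by have := rsubmx_norm (q - p); lra.
  - exists (M `|` 2 * C)%O => p [Kp rp].
    rewrite -[p]hsubmxK; apply: row_mx_norm.
      by apply: le_trans (c2 _ Kp) _; rewrite leUl.
    by apply: le_trans rp _; rewrite leUr.
  - move=> p q t [Kp rp] [Kq rq] t01; split.
      by rewrite linearD linearZ linearB; exact: c3.
    rewrite linearD linearZ linearB /=.
    have -> : rsubmx p + t *: (rsubmx q - rsubmx p) = (1 - t) *: rsubmx p + t *: rsubmx q.
      by apply/rowP => l; rewrite !mxE; ring.
    apply: le_trans (ler_normD _ _) _; rewrite !normrZ.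
    move: t01 => /andP[t0 t1]; rewrite (ger0_norm t0) ger0_norm ?subr_ge0 //.
    have : (1 - t) * `|rsubmx p| <= (1 - t) * (2 * C) by rewrite ler_wpM2l ?subr_ge0.
    have : t * `|rsubmx q| <= t * (2 * C) by rewrite ler_wpM2l.
    by lra.
have sX' p : K' p -> cinfv X' p.
  move=> [Kp _]; apply: cinfv_row_mx.
    by apply: (@cinfv_comp _ _ _ _ X); [exact: sX|exact: (cinfv_lsubmx (cinfv_id p))].
  move=> l; apply: (@cinf_ext _ _ (fun y => \sum_i rsubmx y 0 i * jacobian X (lsubmx y) i l)).
    by move=> y; rewrite mxE.
  apply: cinf_big => i _; apply: cinfM; first exact: (cinfv_rsubmx (cinfv_id p)).
  apply: (@cinf_comp _ _ _ (fun y => jacobian X y i l)); last exact: (cinfv_lsubmx (cinfv_id p)).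
  by apply: cinf_jac; exact: sX.
have F' : solution_family K' X' B' a phi'.
  split; first by rewrite a0.
  - apply/nr_open => p [Bp rp].
    have [d d0 H] := (nr_open _).1 oB _ Bp; exists (Num.min d (2 - `|rsubmx p|)).
      by rewrite lt_min d0 subr_gt0.
    move=> q; rewrite lt_min => /andP[q1 q2]; split.
      by apply: H; rewrite -linearB; apply: le_lt_trans (lsubmx_norm _) q1.
    rewrite -[rsubmx q](subrK (rsubmx p)); apply: le_lt_trans (ler_normD _ _) _.
    by rewrite -ltrBrDr -linearB; apply: le_lt_trans (rsubmx_norm _) q2.
  - move=> p [Bp rp]; rewrite /phi' phi0 // (dphi0 F) // hsubmxK //.
  - move=> p t [Bp rp] ta; split; rewrite /phi' ?row_mxKl ?row_mxKr; first exact: phiK.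
    apply: le_trans (HC _ _ _ Bp ta) _; rewrite mulrC ler_pM2r //; exact: ltW.
  - move=> p t l [Bp rp] ta; rewrite /X' /phi'; rewrite row_mxKl row_mxKr.
    rewrite -(splitK l); case: (fintype.split l) => i /=.
      rewrite row_mxEl; have -> : (fun s => row_mx (phi s (lsubmx p)) (dphi phi s (lsubmx p) (rsubmx p)) 0
        (lshift m i)) = (fun s => phi s (lsubmx p) 0 i) by apply/funext => s; rewrite row_mxEl.
      exact: phiD.
    rewrite row_mxEr; have -> : (fun s => row_mx (phi s (lsubmx p)) (dphi phi s (lsubmx p) (rsubmx p)) 0
        (rshift m i)) = (fun s => dphi phi s (lsubmx p) (rsubmx p) 0 i) by apply/funext => s; rewrite row_mxEr.
    by have [_] := family_dphi cK sX F (rsubmx p) Bp ta; exact.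
have Jk' := IH _ _ _ _ _ _ cK' sX' F'.
apply: CkS.
- by move=> z Dz; exact: Ck_cts (Jk j) Dz.
- move=> i z Dz; rewrite -(splitK i); case: (fintype.split i) => l /=.
    by have [] := Dx l z Dz.
  by have [] := Dt l z Dz.
- move=> i; rewrite -(splitK i); case: (fintype.split i) => l /=.
    pose ins (z : E (m + 1)) : E (m + m + 1) := row_mx (row_mx (lsubmx z) (delta_mx 0 l)) (rsubmx z).
    apply: (@Ck_eq _ _ _ _ ((fun z => joint phi' z 0 (rshift m j)) \o ins) _ oD).
      move=> z Dz; rewrite /= partialE; have [_ ->] := Dx l z Dz.
      by rewrite /joint /ins /phi' !row_mxKl !row_mxKr row_mxEr.
    apply: (@Ck_comp _ _ _ _ _ (time_domain B' a)) => //.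
    + by apply: open_time_domain; have [] := F'.
    + move=> z [Bz za]; rewrite /time_domain /ins /= row_mxKl row_mxKr.
      split => //; split; rewrite ?row_mxKl ?row_mxKr //.
      by apply: le_lt_trans (norm_delta _) _; rewrite ltr1n.
    + move=> p; apply: cinf_Ck => z _.
      apply: (@cinfv_row_mx _ _ _ (fun z : E (m + 1) => row_mx (lsubmx z) (delta_mx 0 l)) (fun z => rsubmx z)).
        by apply: cinfv_row_mx; [exact: (cinfv_lsubmx (cinfv_id z))|exact: cinfv_cst].
      exact: (cinfv_rsubmx (cinfv_id z)).
  apply: (@Ck_eq _ _ _ _ ((fun y => X y 0 j) \o joint phi) _ oD).
    by move=> z Dz; rewrite /= partialE; have [_ ->] := Dt l z Dz.
  have sub : (forall z, time_domain B a z -> [set y | cinfv X y] (joint phi z)).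
    by move=> z [Bz za]; apply: sX; exact: phiK.
  apply: (Ck_comp oD _ sub) => //.
    by apply/nr_open => y; exact: cinfv_nr.
  by apply: cinf_Ck => y; exact.
Qed.

End SmoothDependence.

(** * Plots and integral curves *)

Section RealInduction.
Context {R : realType}.

(** Connectedness of an interval as an induction principle; the argument takes place at the supremum
    of the times up to which [P] holds. The opening step may use [P] on [[0, t]], the closing step
    on [[0, t)]. *)
Lemma real_induction (P : R -> Prop) (a : R) : P 0 ->
  (forall t, 0 <= t < a -> (forall s, 0 <= s <= t -> P s) ->
     exists2 e, 0 < e & forall s, t <= s < t + e -> P s) ->
  (forall t, 0 < t < a -> (forall s, 0 <= s < t -> P s) -> P t) ->
  forall t, 0 <= t < a -> P t.
Proof.
move=> P0 Hop Hcl t /andP[t0 ta].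
pose A := [set u : R | 0 <= u <= t /\ forall s, 0 <= s <= u -> P s].
have A0 : A 0.
  split; first by rewrite lexx.
  by move=> s /andP[s0 s1]; have -> : s = 0 by apply/le_anti; rewrite s0 s1.
have hs : has_sup A.
  by split; [exists 0|exists t => u [/andP[_ ut] _]].
set m := sup A.
have m0 : 0 <= m by exact: sup_upper_bound.
have mt : m <= t by apply: ge_sup; [exists 0|move=> u [/andP[_ ut] _]].
have below s : 0 <= s < m -> P s.
  move=> /andP[s0 sm]; have [u [_ Hu] su] := sup_gt hs.1 sm.
  by apply: Hu; rewrite s0 ltW.
have Pm : P m.
  have [m00|m_gt] := eqVneq m 0; first by rewrite m00.
  by apply: Hcl => //; rewrite lt_neqAle eq_sym m_gt m0 (le_lt_trans mt).
have upto s : 0 <= s <= m -> P s.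
  move=> /andP[s0]; rewrite le_eqVlt => /orP[/eqP -> //|sm].
  by apply: below; rewrite s0.
have [mm|mlt] := eqVneq m t; first by rewrite -mm.
have mltt : m < t by rewrite lt_neqAle mlt.
have [|e e0 He] := Hop m _ upto; first by rewrite m0 (lt_trans mltt).
pose m' := Num.min t (m + e / 2).
have mm' : m < m' by rewrite lt_min mltt; lra.
have : A m'.
  split; first by rewrite (le_trans m0 (ltW mm')) /= ge_min lexx.
  move=> s /andP[s0 sm']; have [sm|ms] := leP s m; first by apply: upto; rewrite s0.
  apply: He; rewrite (ltW ms) /=; apply: (le_lt_trans sm').
  by rewrite gt_min; apply/orP; right; lra.
by move=> /(sup_upper_bound hs); rewrite -/m leNgt mm'.
Qed.

End RealInduction.

Section Plots.
Context {R : realType} {n : nat} {M : smooth_manifold R n}.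
Local Notation E n := 'rV[R]_n.
Implicit Types (c d : chart R n M) (x : M).

Lemma atlas_chart c : atlas M c -> chart_of setT c.
Proof. by have [H _ _ _] := matlas M; exact: H. Qed.

Lemma atlas_at x : exists2 c, atlas M c & cdom c x.
Proof. by have [_ H _ _] := matlas M; exact: H. Qed.

Lemma cdom_nbhs c x : atlas M c -> cdom c x -> nbhs x (cdom c).
Proof. by move=> /atlas_chart [oc _ _ _ _] cx; exact: open_nbhs_nbhs. Qed.

Lemma cinvK c x : atlas M c -> cdom c x -> cinv c (cmap c x) = x.
Proof. by move=> /atlas_chart [_ _ H _ _]; exact: H. Qed.

Lemma cimg_cdom c y : atlas M c -> cimg c y -> cdom c (cinv c y).
Proof. by move=> Ac [x cx <-]; rewrite cinvK. Qed.

Lemma cmapK c y : atlas M c -> cimg c y -> cmap c (cinv c y) = y.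
Proof. by move=> Ac [x cx <-]; rewrite cinvK. Qed.

Lemma cimg_cmap c x : cdom c x -> cimg c (cmap c x).
Proof. by exists x. Qed.

Lemma cimg_nr c y : atlas M c -> cimg c y -> nr y (cimg c).
Proof.
move=> /atlas_chart [_ [W oW cE] _ _ _]; rewrite cE => -[Oy _].
by apply: nrW ((nr_open W).1 oW y Oy) => z Oz; split.
Qed.

Lemma cinv_nr c y U : atlas M c -> cimg c y -> nbhs (cinv c y) U -> nr y (fun z => U (cinv c z)).
Proof.
move=> Ac cy Uy; have [_ _ _ _ /subspace_continuousP/(_ y cy)] := atlas_chart Ac.
move=> /(_ U Uy) /nrP H.
by apply: nrW (nrI H (cimg_nr Ac cy)) => z [h /h].
Qed.

Lemma cmap_nbhs c x (P : E n -> Prop) : atlas M c -> cdom c x -> nr (cmap c x) P ->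
  nbhs x (fun z => P (cmap c z)).
Proof.
move=> Ac cx /nrP NP; have [_ _ _ /subspace_continuousP/(_ x cx) H _] := atlas_chart Ac.
have := H _ NP; rewrite /nbhs /= /within /= => H1.
by apply: filterS2 H1 (cdom_nbhs Ac cx) => z; exact.
Qed.

Lemma smooth_on_cinfv q m (O : set (E q)) (f : E q -> E m) y : smooth_on O f -> nr y O -> cinfv f y.
Proof.
move=> [g [[V [oV WV Vg]] fg]] Oy.
apply: (@cinfv_eq _ _ _ g); first by apply: nrW Oy => z /fg ->.
by move=> j; exists V; split => //; exact: WV (nr_self Oy).
Qed.

Lemma transition_cinfv c d x : atlas M c -> atlas M d -> cdom c x -> cdom d x ->
  cinfv (cmap d \o cinv c) (cmap c x).
Proof.
move=> Ac Ad cx dx; have [_ _ /(_ c d Ac Ad) [H _] _] := matlas M.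
apply: smooth_on_cinfv H _.
have ci := cimg_cmap cx.
have : nbhs (cinv c (cmap c x)) (cdom d) by rewrite cinvK //; exact: cdom_nbhs.
move=> /(cinv_nr Ac ci) h; apply: nrW (nrI h (cimg_nr Ac ci)) => y [dy cy].
by exists (cinv c y); [split => //; exact: cimg_cdom|exact: cmapK].
Qed.

(* Smooth plots of [M]; maps defined on [M] are tested by composition with plots. *)
Definition sm q (f : E q -> M) (w : E q) := exists c, [/\ atlas M c, cdom c (f w),
  nr w (fun w' => cdom c (f w')) & cinfv (cmap c \o f) w].

Lemma sm_chart q (f : E q -> M) w d : sm f w -> atlas M d -> cdom d (f w) ->
  nr w (fun w' => cdom d (f w')) /\ cinfv (cmap d \o f) w.
Proof.
move=> [c [Ac cf nf sf]] Ad df.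
have T := transition_cinfv Ac Ad cf df.
split.
  have h : nr (cmap c (f w)) (fun y => cdom d (cinv c y)).
    apply: cinv_nr => //; first exact: cimg_cmap.
    by rewrite cinvK //; exact: cdom_nbhs.
  have := cinfv_nr_pre sf h.
  by move=> h'; apply: nrW (nrI h' nf) => y [/= + cy]; rewrite cinvK.
apply: (@cinfv_eq _ _ _ ((cmap d \o cinv c) \o (cmap c \o f))).
  by apply: nrW nf => y cy /=; rewrite cinvK.
exact: cinfv_comp.
Qed.

Lemma sm_cts q (f : E q -> M) w U : sm f w -> nbhs (f w) U -> nr w (fun w' => U (f w')).
Proof.
move=> [c [Ac cf nf sf]] Uf.
have h : nr (cmap c (f w)) (fun y => U (cinv c y)).
  by apply: cinv_nr => //; [exact: cimg_cmap|rewrite cinvK].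
have := cinfv_nr_pre sf h.
by move=> h'; apply: nrW (nrI h' nf) => y [/= + cy]; rewrite cinvK.
Qed.

Lemma sm_eq q (f g : E q -> M) w : nr w (fun w' => f w' = g w') -> sm f w -> sm g w.
Proof.
move=> fg [c [Ac cf nf sf]]; exists c; split => //.
- by rewrite -(nr_self fg).
- by apply: nrW (nrI fg nf) => y [<-].
- by apply: cinfv_eq sf; apply: nrW fg => y /= ->.
Qed.

Lemma sm_comp q p (f : E q -> M) (g : E p -> E q) w : sm f (g w) -> cinfv g w -> sm (f \o g) w.
Proof.
move=> [c [Ac cf nf sf]] sg; exists c; split => //.
  exact: cinfv_nr_pre sg nf.
exact: (cinfv_comp sf sg).
Qed.

Lemma sm_cst q x (w : E q) : sm (fun=> x) w.
Proof.
have [c Ac cx] := atlas_at x; exists c; split => //; first by exists 1.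
exact: cinfv_cst.
Qed.

Lemma sm_cinv q (g : E q -> E n) w c : atlas M c -> cimg c (g w) -> cinfv g w -> sm (cinv c \o g) w.
Proof.
move=> Ac cg sg; have h := cinfv_nr_pre sg (cimg_nr Ac cg).
exists c; split => //; first exact: cimg_cdom.
  by apply: nrW h => y; exact: cimg_cdom.
by apply: cinfv_eq sg; apply: nrW h => y cy /=; rewrite cmapK.
Qed.

Lemma sm_nr q (f : E q -> M) w : sm f w -> nr w (sm f).
Proof.
move=> [c [Ac cf nf sf]].
apply: nrW (nrI (nr_nr nf) (cinfv_nr sf)) => y [h1 h2].
by exists c; split => //; exact: nr_self h1.
Qed.

Definition smf (g : M -> R) (x : M) := forall q (f : E q -> M) w, f w = x -> sm f w -> cinf (g \o f) w.

Lemma smf_chart (g : M -> R) c x : atlas M c -> cdom c x -> cinf (g \o cinv c) (cmap c x) -> smf g x.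
Proof.
move=> Ac cx G q f w fw sf; rewrite -fw in cx G.
have [nf cf] := sm_chart sf Ac cx.
apply: (@cinf_eq _ _ ((g \o cinv c) \o (cmap c \o f))).
  by apply: nrW nf => y cy /=; rewrite cinvK.
exact: cinf_comp.
Qed.

Lemma smooth_function_cinf h c x : smooth_function h -> atlas M c -> cdom c x ->
  cinf (h \o cinv c) (cmap c x).
Proof.
move=> H Ac cx; have := H c Ac => /smooth_on_cinfv /(_ (cimg_nr Ac (cimg_cmap cx)) 0).
by apply: cinf_ext => y; rewrite mxE.
Qed.

Lemma smooth_function_smf h x : smooth_function h -> smf h x.
Proof.
move=> H; have [c Ac cx] := atlas_at x.
exact: smf_chart (smooth_function_cinf H Ac cx).
Qed.

Lemma smooth_function_nbhs h x (P : R -> Prop) : smooth_function h -> 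
  (\forall y \near h x, P y) -> nbhs x (fun z => P (h z)).
Proof.
move=> H NP; have [c Ac cx] := atlas_at x.
have Hc := cinf_cts (smooth_function_cinf H Ac cx).
have : nr (cmap c x) (fun y => P (h (cinv c y))).
  by apply/nrP; apply: Hc; rewrite /= cinvK.
move=> /(cmap_nbhs Ac cx) h1.
by apply: filterS2 h1 (cdom_nbhs Ac cx) => z + cz; rewrite cinvK.
Qed.

End Plots.

Section Balls.
Context {R : realType}.
Local Notation E n := 'rV[R]_n.

Definition cball n (y0 : E n) (r : R) : set (E n) := [set y | `|y - y0| <= r].

Lemma cball_compact_convex n (y0 : E n) r : compact_convex (cball y0 r).
Proof.
split.
- move=> x /negP; rewrite -ltNge => rx; exists (`|x - y0| - r); first by rewrite subr_gt0.
  move=> y yx; apply/negP; rewrite -ltNge.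
  have := ler_distD y x y0; rewrite distrC in yx; lra.
- exists (`|y0| + r) => y yr; rewrite -[y](subrK y0) addrC.
  by apply: le_trans (ler_normD _ _) _; rewrite lerD2l.
- move=> y y' t yr y'r /andP[t0 t1]; rewrite /cball /=.
  have -> : y + t *: (y' - y) - y0 = (1 - t) *: (y - y0) + t *: (y' - y0).
    by apply/rowP => i; rewrite !mxE; ring.
  apply: le_trans (ler_normD _ _) _; rewrite !normrZ.
  rewrite (ger0_norm t0) ger0_norm ?subr_ge0 //.
  have : (1 - t) * `|y - y0| <= (1 - t) * r by rewrite ler_wpM2l ?subr_ge0.
  have : t * `|y' - y0| <= t * r by rewrite ler_wpM2l.
  by lra.
Qed.

Lemma cinfv_bounded n m (K : set (E n)) (f : E n -> E m) : compact K ->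
  (forall y, K y -> cinfv f y) -> exists2 B, 0 < B & forall y, K y -> `|f y| <= B.
Proof.
move=> cK F.
have [j|j B B' BB' H y Ky|B B0 HB] := @fin_bound R 'I_m (fun j B => forall y, K y -> `|f y 0 j| <= B).
- by apply: (cinf_bounded cK) => y /F.
- exact: le_trans (H y Ky) BB'.
by exists B => // y Ky; apply: norm_le_coord => [|j]; [exact: ltW|exact: HB].
Qed.

End Balls.

(** * Integral curves and their uniqueness *)

Section IntegralCurves.
Context {R : realType} {n : nat} {M : smooth_manifold R n}.
Local Notation E n := 'rV[R]_n.
Implicit Types (c : chart R n M) (x : M) (V : chart R n M -> M -> E n).

Definition icurve V (p : R -> M) := continuous p /\
  forall (t : R) c, atlas M c -> cdom c (p t) -> forall j,
    is_derive t 1 (fun s : R => cmap c (p s) 0 j : R) (V c (p t) 0 j).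

Lemma icurve_shift V p (u : R) : icurve V p -> icurve V (fun s => p (u + s)).
Proof.
move=> [pc pd]; split.
  move=> s; apply: (@continuous_comp _ _ _ (fun s => u + s) p) => //.
    exact: d_cts (dD (dC u s) (is_derive_id s 1)).
  exact: pc.
move=> t c Ac cp j; have := @dcomp _ (fun s => cmap c (p s) 0 j) (fun s => u + s) t _ 1 (pd _ _ Ac cp j).
rewrite mulr1; apply; rewrite -[X in is_derive _ _ _ X](add0r (1 : R)).
by apply: dD.
Qed.

Lemma icurve_rev V p : icurve V p -> icurve (fun c x => - V c x) (fun s => p (- s)).
Proof.
move=> [pc pd]; split.
  move=> s; apply: (@continuous_comp _ _ _ (fun s : R => - s) p) => //.
    exact: d_cts (dN (is_derive_id s 1)).
  exact: pc.
move=> t c Ac cp j; have := @dcomp _ (fun s => cmap c (p s) 0 j) (fun s => - s) t _ (-1) (pd _ _ Ac cp j).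
by rewrite mulrN1 mxE; apply; exact: dN (is_derive_id _ _).
Qed.

Lemma icurve_near V p t U : icurve V p -> nbhs (p t) U ->
  exists2 e, 0 < e & forall s : R, `|s - t| < e -> U (p s).
Proof.
move=> [pc _] /(pc t) /nbhs_ballP [e /= e0 H]; exists e => // s st.
by apply: H; rewrite -ball_normE /= distrC.
Qed.

Lemma chart_ball_nbhs c y0 r x : atlas M c -> cdom c x -> `|cmap c x - y0| < r ->
  nbhs x (fun z => cdom c z /\ `|cmap c z - y0| < r).
Proof.
move=> Ac cx xr; apply: filterI; first exact: cdom_nbhs.
exact: cmap_nbhs (nr_ball xr).
Qed.

Lemma closed_cinv_cball c y0 r : atlas M c -> cball y0 r `<=` cimg c -> closed (cinv c @` cball y0 r).
Proof.
move=> Ac sub; apply: compact_closed; first exact: mhausdorff.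
apply: continuous_compact; last exact: compact_convex_compact (cball_compact_convex _ _).
have [_ _ _ _ H] := atlas_chart Ac.
exact: continuous_subspaceW H.
Qed.

(** With speed at most [B] the coordinates travel at most [B * a]. The curve could still leave the
    chart domain while its coordinates stay bounded; this is excluded because a closed cube of the
    chart is compact, hence closed in the Hausdorff space M. *)
Lemma icurve_stay V p c y0 r B a : icurve V p -> atlas M c -> cball y0 r `<=` cimg c -> 0 <= B ->
  (forall x, cdom c x -> `|cmap c x - y0| <= r -> `|V c x| <= B) ->
  cdom c (p 0) -> `|cmap c (p 0) - y0| + B * a < r ->
  forall t, 0 <= t < a -> cdom c (p t) /\ `|cmap c (p t) - y0| < r.
Proof.
move=> ip Ac sub B0 bV cp0 p0r; have [pc pd] := ip.
move=> t0 t0a; have a0 : 0 < a by case/andP: t0a; lra.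
have Ba : 0 <= B * a by rewrite mulr_ge0 // ltW.
move: t0 t0a; apply: real_induction; first by split => //; lra.
- move=> t /andP[t0 ta] H; have [|h1 h2] := H t; first by rewrite t0 lexx.
  have [e e0 He] := icurve_near ip (chart_ball_nbhs Ac h1 h2).
  by exists e => // s st; apply: He; rewrite ger0_norm; lra.
move=> t /andP[t0 ta] H.
pose r' := `|cmap c (p 0) - y0| + B * t.
have r'r : r' < r.
  have : B * t <= B * a by rewrite ler_wpM2l // ltW.
  by rewrite /r'; lra.
have Hs s : 0 <= s < t -> `|cmap c (p s) - y0| <= r'.
  move=> /andP[s0 st].
  have K : `|cmap c (p s) - cmap c (p 0)| <= B * t.
    apply: norm_le_coord; first by rewrite mulr_ge0 // ltW.
    move=> j; rewrite coordB.
    have [|u u0 ->] := @dmvt _ (fun s => cmap c (p s) 0 j) (fun s => V c (p s) 0 j) 0 s s0.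
      move=> u u0; apply: pd => //; have [] // := H u; lra.
    rewrite subr0 normrM (ger0_norm s0); apply: ler_pM => //; last exact: ltW.
    apply: le_trans (coord_le_norm _ _) _.
    by have [|h1 h2] := H u; [lra|apply: bV => //; exact: ltW].
  by have := ler_distD (cmap c (p 0)) (cmap c (p s)) y0; rewrite /r'; lra.
have sub' : cball y0 r' `<=` cimg c.
  by move=> y yr; apply: sub; exact: le_trans yr (ltW r'r).
have : (cinv c @` cball y0 r') (p t).
  apply: contrapT => np.
  have : nbhs (p t) (~` (cinv c @` cball y0 r')).
    by apply: open_nbhs_nbhs; split => //; apply: closed_openC; exact: closed_cinv_cball.
  move=> /(icurve_near ip) [e e0 He].
  pose s := Num.max 0 (t - e / 2).
  have s0 : 0 <= s < t by rewrite le_max lexx /= gt_max t0; lra.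
  have es : t - e / 2 <= s by rewrite le_max lexx orbT.
  apply: (He s); first by rewrite ltr0_norm; lra.
  exists (cmap c (p s)); first exact: Hs.
  by rewrite cinvK //; have [] := H s s0.
move=> [y yr <-]; split; first by apply: cimg_cdom => //; exact: sub'.
by rewrite cmapK //; [exact: le_lt_trans yr _|exact: sub'].
Qed.

Definition smooth_field V := forall c y, atlas M c -> cimg c y -> cinfv (fun y => V c (cinv c y)) y.

Lemma chart_cball c x : atlas M c -> cdom c x -> exists2 r, 0 < r & cball (cmap c x) r `<=` cimg c.
Proof.
move=> Ac cx; have [d d0 H] := cimg_nr Ac (cimg_cmap cx).
exists (d / 2); first by rewrite divr_gt0.
by move=> y yd; apply: H; apply: le_lt_trans yd _; lra.
Qed.

Lemma hausdorff_ext (p1 p2 : R -> M) t : 0 < t -> continuous p1 -> continuous p2 ->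
  (forall s, 0 <= s < t -> p1 s = p2 s) -> p1 t = p2 t.
Proof.
move=> t0 c1 c2 H; apply: (@mhausdorff _ _ _ M) => A B /c1 /nbhs_ballP [e /= e0 HA] /c2 /nbhs_ballP [d /= d0 HB].
pose e1 := Num.min e d; have e10 : 0 < e1 by rewrite lt_min e0.
pose s := Num.max 0 (t - e1 / 2).
have s0 : 0 <= s < t by rewrite le_max lexx /= gt_max t0; lra.
have es : t - e1 / 2 <= s by rewrite le_max lexx orbT.
have st : `|t - s| < e1 by rewrite gtr0_norm; lra.
move: st; rewrite lt_min => /andP[se sd].
exists (p1 s); split; first by apply: HA; rewrite -ball_normE.
by rewrite H //; apply: HB; rewrite -ball_normE.
Qed.

(** Real induction: in a chart, Gronwall's estimate extends an equality beyond [t], and an equality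
    before [t] passes to [t] because M is Hausdorff. *)
Lemma icurve_uniq_ge V p1 p2 : smooth_field V -> icurve V p1 -> icurve V p2 -> p1 0 = p2 0 ->
  forall t, 0 <= t -> p1 t = p2 t.
Proof.
move=> sV i1 i2 p0 T T0; have : 0 <= T < T + 1 by lra.
move: T {T0} (T + 1); move=> T a; move: T; apply: real_induction => //; last first.
  by move=> t /andP[t0 ta] H; apply: hausdorff_ext t0 i1.1 i2.1 H.
move=> t /andP[t0 ta] H; have pt : p1 t = p2 t by apply: H; rewrite t0 lexx.
have [c Ac cx] := atlas_at (p1 t).
have [r r0 Kr] := chart_cball Ac cx.
set y0 := cmap c (p1 t) in Kr; have Kcc := cball_compact_convex y0 r.
have NB : nbhs (p1 t) (fun z => cdom c z /\ `|cmap c z - y0| < r).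
  by apply: chart_ball_nbhs => //; rewrite subrr normr0.
have [e1 e10 H1] := icurve_near i1 NB.
have NB2 : nbhs (p2 t) (fun z => cdom c z /\ `|cmap c z - y0| < r) by rewrite -pt.
have [e2 e20 H2] := icurve_near i2 NB2.
have [|L L0 HL] := lipv_compact (f := fun y => V c (cinv c y)) Kcc.
  by move=> y /Kr; exact: sV.
have [C C0 HC] := gronwall n (ltW L0).
pose e := Num.min 1 (Num.min e1 e2).
have e0 : 0 < e by rewrite !lt_min ltr01 e10 e20.
exists e => // s /andP[ts se].
have e1' : e <= 1 by rewrite ge_min lexx.
have ee u : `|u| < e -> `|t + u - t| < e1 /\ `|t + u - t| < e2.
  by rewrite addrAC subrr add0r !lt_min => /and3P[_ -> ->].
have [j1 d1] := icurve_shift t i1; have [j2 d2] := icurve_shift t i2.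
have := HC e (fun u => cmap c (p1 (t + u)) - cmap c (p2 (t + u)))
  (fun u => V c (p1 (t + u)) - V c (p2 (t + u))) 0 e1' (lexx _).
rewrite !addr0 -pt subrr normr0 mulr0 => /(_ _ _ (s - t)) Q.
have := Q _ _ _; rewrite addrCA subrr addr0 normr_le0 subr_eq0 => {}Q.
have st1 : `|s - t| < e by rewrite ger0_norm; lra.
have [] := ee (s - t) st1; rewrite addrCA subrr addr0 => se1 se2.
rewrite -(cinvK Ac (H1 _ se1).1) -(cinvK Ac (H2 _ se2).1); congr (cinv c _).
apply/eqP; apply: Q => //.
- move=> u /ee [u1 u2] j; rewrite coordB.
  have -> : (fun s => (cmap c (p1 (t + s)) - cmap c (p2 (t + s))) 0 j) =
    (fun s => cmap c (p1 (t + s)) 0 j - cmap c (p2 (t + s)) 0 j) by apply/funext => z; rewrite coordB.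
  apply: dD; first by apply: d1 => //; have [] := H1 _ u1.
  by apply: dN; apply: d2 => //; have [] := H2 _ u2.
- move=> u /ee [u1 u2]; rewrite addr0; have [a1 b1] := H1 _ u1; have [a2 b2] := H2 _ u2.
  by have := HL _ _ (ltW b2) (ltW b1); rewrite !cinvK.
Qed.

Lemma icurve_uniq V p1 p2 : smooth_field V -> icurve V p1 -> icurve V p2 -> p1 0 = p2 0 -> p1 =1 p2.
Proof.
move=> sV i1 i2 p0 t; have [t0|t0] := leP 0 t; first exact: (icurve_uniq_ge sV).
rewrite -[t]opprK.
apply: (@icurve_uniq_ge (fun c x => - V c x) (fun s => p1 (- s)) (fun s => p2 (- s))).
- by move=> c y Ac cy; apply: cinfvN; exact: sV.
- exact: icurve_rev.
- exact: icurve_rev.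
- by rewrite oppr0.
- by rewrite oppr_ge0 ltW.
Qed.

End IntegralCurves.

(** * Smoothness of the flow *)

Section Flow.
Context {R : realType} {n : nat} {M : smooth_manifold R n}.
Local Notation E n := 'rV[R]_n.
Variables (X : vector_field M) (Phi : R -> M -> M).
Hypothesis hPhi : is_flow X Phi.
Implicit Types (c : chart R n M) (x : M).

Lemma field_smooth : smooth_field X.
Proof.
move=> c y Ac cy; have := vf_smooth X Ac => /smooth_on_cinfv /(_ (cimg_nr Ac cy)).
by apply: cinfv_eq; exists 1.
Qed.

Lemma flow_icurve x : icurve X (fun t => Phi t x).
Proof. by have [_ h1 h2] := hPhi x; split. Qed.

Lemma flow0 x : Phi 0 x = x.
Proof. by have [] := hPhi x. Qed.

Lemma flow_cts x : continuous (fun t => Phi t x).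
Proof. by have [] := hPhi x. Qed.

Lemma flowD s t x : Phi (s + t) x = Phi t (Phi s x).
Proof.
apply: (icurve_uniq field_smooth (icurve_shift s (flow_icurve x)) (flow_icurve (Phi s x))).
by rewrite addr0 flow0.
Qed.

Lemma flowK t x : Phi (- t) (Phi t x) = x.
Proof. by rewrite -flowD subrr flow0. Qed.

(** Starting within [r / 2] of the centre with speed at most [B], a trajectory stays in the cube for
    the time [r / 2 / B], and [joint_Ck] applies there. The conclusion speaks of plots, so that it
    composes without reference to the chart. *)
Lemma flow_local x0 : exists U (a : R), [/\ nbhs x0 U, 0 < a &
  forall q (f : E q -> M) (tau : E q -> R) w, U (f w) -> sm f w -> cinf tau w -> `|tau w| < a ->
    sm (fun w => Phi (tau w) (f w)) w].
Proof.
have [c Ac cx] := atlas_at x0; have [r r0 Kr] := chart_cball Ac cx.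
set y0 := cmap c x0 in Kr; have Kcc := cball_compact_convex y0 r.
pose X' y := X c (cinv c y).
have sX' y : cball y0 r y -> cinfv X' y by move=> /Kr; exact: field_smooth.
have [B B0 HB] := cinfv_bounded (compact_convex_compact Kcc) sX'.
pose a := Num.min 1 (r / 2 / B).
have a0 : 0 < a by rewrite lt_min ltr01 !divr_gt0.
have a1 : a <= 1 by rewrite ge_min lexx.
have Ba : B * a <= r / 2 by rewrite mulrC -ler_pdivlMr // ge_min lexx orbT.
pose U := [set x | cdom c x /\ `|cmap c x - y0| < r / 2].
pose phi t y := cmap c (Phi t (cinv c y)).
pose D0 := [set y : E n | `|y - y0| < r / 2].
have stay x t : U x -> `|t| < a -> cdom c (Phi t x) /\ `|cmap c (Phi t x) - y0| < r.
  move=> [cx' xr] ta.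
  have HB' z : cdom c z -> `|cmap c z - y0| <= r -> `|X c z| <= B.
    by move=> cz zr; have := HB _ zr; rewrite /X' cinvK.
  have lt : `|cmap c x - y0| + B * a < r by lra.
  have [t0|t0] := leP 0 t.
    apply: (icurve_stay (flow_icurve x) Ac Kr (ltW B0) HB' _ (a := a)); rewrite ?flow0 //.
    by rewrite t0 /=; move: ta; rewrite ger0_norm.
  have := icurve_stay (icurve_rev (flow_icurve x)) Ac Kr (ltW B0) _ _ (a := a).
  rewrite oppr0 flow0 => H; have := H _ cx' lt (- t); rewrite opprK; apply.
    by move=> z cz zr; rewrite normrN; exact: HB'.
  by rewrite oppr_ge0 ltW //=; move: ta; rewrite ltr0_norm.
have DU y : D0 y -> U (cinv c y) /\ cimg c y.
  move=> yr; have cy : cimg c y by apply: Kr; rewrite /cball /=; move: yr; rewrite /D0 /=; lra.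
  by split => //; split; [exact: cimg_cdom|rewrite cmapK].
have oD0 : open D0 by apply/nr_open => y yr; exact: nr_ball.
have F : solution_family (cball y0 r) X' D0 a phi.
  split => //.
  - by rewrite a0 a1.
  - by move=> y /DU [_ cy]; rewrite /phi flow0 cmapK.
  - by move=> y t /DU [Uy cy] ta; have [_ /ltW] := stay _ _ Uy ta.
  - move=> y t j /DU [Uy cy] ta; have [h1 h2] := stay _ _ Uy ta.
    rewrite /X' /phi cinvK //.
    by have [_] := flow_icurve (cinv c y); apply.
have J j z : time_domain D0 a z -> cinf (fun z => joint phi z 0 j) z.
  move=> Dz; exists (time_domain D0 a); split => //; first exact: open_time_domain.
  by move=> k; exact: (joint_Ck k Kcc sX' F).
exists U, a; split => //.
  by apply: chart_ball_nbhs => //; rewrite subrr normr0 divr_gt0.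
move=> q f tau w Uf sf st ta.
have [nf cf] := sm_chart sf Ac Uf.1.
pose g w := row_mx (cmap c (f w)) (const_mx (tau w)) : E (n + 1).
have sg : cinfv g w.
  apply: cinfv_row_mx => // j; apply: cinf_ext st => y; by rewrite mxE.
have gD : time_domain D0 a (g w) by rewrite /time_domain /g /= row_mxKl row_mxKr mxE; split => //; exact: Uf.2.
have Jg : cinfv (joint phi) (g w) by move=> j; exact: J.
have nU : nr w (fun w => U (f w)).
  by apply: sm_cts => //; apply: chart_ball_nbhs => //; [exact: Uf.1|exact: Uf.2].
have nt : nr w (fun w => `|tau w| < a).
  have := cinf_lt st (_ : tau w < a); have := cinf_gt st (_ : - a < tau w).
  move: ta; rewrite ltr_norml => /andP[-> ->] /(_ isT) h1 /(_ isT) h2.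
  by apply: nrW (nrI h1 h2) => y [h3 h4]; rewrite ltr_norml h3.
have joE w' : U (f w') -> joint phi (g w') = cmap c (Phi (tau w') (f w')).
  by move=> [cf' _]; rewrite /joint /g row_mxKl row_mxKr mxE /phi cinvK.
exists c; split => //.
- by have [] := stay _ _ Uf ta.
- by apply: nrW (nrI nU nt) => y [Uy ty]; have [] := stay _ _ Uy ty.
- apply: (@cinfv_eq _ _ _ (joint phi \o g)); last exact: cinfv_comp.
  by apply: nrW nU => y Uy /=; rewrite joE.
Qed.

(** Real induction on the length of time, for all plots through a fixed point at once: the flow for
    a constant earlier time preserves plots by the induction hypothesis, and [flow_local] covers the
    short time that remains. The sign [sg] treats both directions of time. *)
Lemma flow_sm q (f : E q -> M) (tau : E q -> R) w : sm f w -> cinf tau w ->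
  sm (fun w => Phi (tau w) (f w)) w.
Proof.
move=> sf st.
have main (sg : R) x0 : (sg = 1 \/ sg = -1) -> forall T, 0 <= T -> forall q (f : E q -> M) (tau : E q -> R) w,
    f w = x0 -> tau w = sg * T -> sm f w -> cinf tau w -> sm (fun w => Phi (tau w) (f w)) w.
  move=> hsg T T0; have : 0 <= T < T + 1 by lra.
  have nsg (u : R) : `|sg * u| = `|u| by case: hsg => ->; rewrite ?mul1r ?mulN1r ?normrN.
  have split_flow q' (f' : E q' -> M) tau' w' u : sm f' w' -> cinf tau' w' ->
     sm (fun w => Phi (tau' w - u) (Phi u (f' w))) w' -> sm (fun w => Phi (tau' w) (f' w)) w'.
    by move=> _ _; apply: sm_eq; exists 1 => // y _; rewrite -flowD addrCA subrr addr0.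
  move: T {T0} (T + 1) => T a; move: T; apply: real_induction.
  - move=> q' f' tau' w' fw; rewrite mulr0 => tw sf' st'.
    have [U [b [/nbhs_singleton Ux b0 H]]] := flow_local x0.
    by apply: H; rewrite ?fw ?tw ?normr0.
  - move=> t /andP[t0 ta] H.
    have [U [b [/nbhs_singleton Ux b0 Hb]]] := flow_local (Phi (sg * t) x0).
    exists b => // s /andP[ts sb] q' f' tau' w' fw tw sf' st'.
    apply: (split_flow _ _ _ _ (sg * t)) => //; apply: Hb.
    + by rewrite fw.
    + by apply: (H t) => //; [rewrite t0 lexx|exact: cinfC].
    + by apply: cinfB => //; exact: cinfC.
    + by rewrite tw -mulrBr nsg ger0_norm; lra.
  - move=> t /andP[t0 ta] H.
    have [U [b [Ux b0 Hb]]] := flow_local (Phi (sg * t) x0).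
    have [e e0 He] := icurve_near (flow_icurve x0) Ux.
    pose e1 := Num.min e b; have e10 : 0 < e1 by rewrite lt_min e0.
    pose s := Num.max 0 (t - e1 / 2).
    have s0 : 0 <= s < t by rewrite le_max lexx /= gt_max t0; lra.
    have es : t - e1 / 2 <= s by rewrite le_max lexx orbT.
    have st1 : `|t - s| < e1 by rewrite gtr0_norm; lra.
    move: (st1); rewrite lt_min => /andP[se sb].
    move=> q' f' tau' w' fw tw sf' st'.
    apply: (split_flow _ _ _ _ (sg * s)) => //; apply: Hb.
    + by rewrite fw; apply: He; rewrite -mulrBr nsg distrC.
    + by apply: (H s) => //; exact: cinfC.
    + by apply: cinfB => //; exact: cinfC.
    + by rewrite tw -mulrBr nsg.
have [t0|t0] := leP 0 (tau w).
  by apply: (main 1 (f w) _ (tau w)) => //; [left|rewrite mul1r].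
by apply: (main (-1) (f w) _ (- tau w)) => //; [right|rewrite oppr_ge0 ltW|rewrite mulN1r opprK].
Qed.

End Flow.

(** * Gradient-like flows *)

Section LinearAlgebra.
Context {R : realType}.
Local Notation E n := 'rV[R]_n.

Lemma unitmx_inj m (J : 'M[R]_m) : (forall u : E m, u *m J = 0 -> u = 0) -> J \in unitmx.
Proof.
move=> H; rewrite -row_free_unit -kermx_eq0; apply/eqP/row_matrixP => i.
by rewrite row0; apply: H; rewrite -row_mul mulmx_ker row0.
Qed.

Lemma mulmx_jacobian n m (f : E n -> E m) x u : cinfv f x ->
  u *m jacobian f x = \row_j 'D_u (fun y => f y 0 j) x.
Proof. by move=> F; apply/rowP => j; rewrite [RHS]mxE (dir_jacobian u F). Qed.

End LinearAlgebra.

Section MorseFlow.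
Context {R : realType} {n : nat}.
Local Notation E n := 'rV[R]_n.
Variables (M : smooth_manifold R n) (h : M -> R) (X : vector_field M) (Phi : R -> M -> M).
Hypotheses (hPhi : is_flow X Phi) (hMS : morse_smale h X Phi).
Implicit Types (c : chart R n M) (x v : M).

Lemma h_smooth : smooth_function h.
Proof. by have [[]] := hMS. Qed.

Lemma h_near x (P : R -> Prop) : (\forall y \near h x, P y) -> nbhs x (fun z => P (h z)).
Proof. exact/smooth_function_nbhs/h_smooth. Qed.

Lemma h_cts : continuous h.
Proof. by move=> x U; exact: (h_near (P := U)). Qed.

Lemma h_gt x a : a < h x -> nbhs x (fun z => a < h z).
Proof. by move=> ah; apply: (h_near (P := fun y => a < y)); exists (h x - a); rewrite /= ?subr_gt0 // => y; rewrite /ball_ /= ltr_norml; lra. Qed.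

Lemma h_lt x a : h x < a -> nbhs x (fun z => h z < a).
Proof. by move=> ah; apply: (h_near (P := fun y => y < a)); exists (a - h x); rewrite /= ?subr_gt0 // => y; rewrite /ball_ /= ltr_norml; lra. Qed.

Lemma h_flow_derive x (t : R) c : atlas M c -> cdom c (Phi t x) ->
  is_derive t 1 (fun s => h (Phi s x)) (lie_derivative h X c (Phi t x)).
Proof.
move=> Ac cx; have [_ /(_ t c Ac cx) D] := flow_icurve hPhi x.
have := dvcomp (smooth_function_cinf h_smooth Ac cx) D.
have [e e0 He] := icurve_near (flow_icurve hPhi x) (cdom_nbhs Ac cx).
apply: near_eq_is_derive; exists e => // s; rewrite /ball_ /= distrC => /He cs.
by rewrite cinvK.
Qed.

Lemma gl_chart v : crit h v -> exists c (r : R),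
     [/\ atlas M c /\ cdom c v, 0 < r,
         cimg c = [set y : 'rV[R]_n | \sum_(j < n) y 0 j ^+ 2 < r ^+ 2],
         forall y, cimg c y -> h (cinv c y) =
           h v - 2^-1 * (\sum_(j < n | (j < morse_index h v)%N) y 0 j ^+ 2)
               + 2^-1 * (\sum_(j < n | (morse_index h v <= j)%N) y 0 j ^+ 2) &
         forall y, cimg c y -> forall j : 'I_n,
           X c (cinv c y) 0 j =
             if (j < morse_index h v)%N then y 0 j else - y 0 j].
Proof. by have [_ _ [_ H] _] := hMS; exact: H. Qed.

Lemma lie_neg x c : ~ crit h x -> atlas M c -> cdom c x -> lie_derivative h X c x < 0.
Proof. by have [_ _ [H _] _] := hMS; exact: H. Qed.

Lemma critP x c : crit h x -> atlas M c -> cdom c x -> forall i, partial i (h \o cinv c) (cmap c x) = 0.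
Proof. exact. Qed.

Lemma field_chart0 c d x : atlas M c -> atlas M d -> cdom c x -> cdom d x -> X c x = 0 -> X d x = 0.
Proof. by move=> Ac Ad cx dx X0; rewrite (vf_change X Ac Ad cx dx) X0 mul0mx. Qed.

Lemma quad_partial (i : nat) (k : 'I_n) (b : R) (y : E n) :
  partial k (fun y : E n => b - 2^-1 * (\sum_(j < n | (j < i)%N) y 0 j ^+ 2)
     + 2^-1 * (\sum_(j < n | (i <= j)%N) y 0 j ^+ 2)) y = if (k < i)%N then - y 0 k else y 0 k.
Proof.
rewrite partialE.
have S (P : pred 'I_n) (t : R) : \sum_(j < n | P j) (y + t *: delta_mx 0 k) 0 j ^+ 2 =
    \sum_(j < n | P j) y 0 j ^+ 2 + (if P k then 2 * t * y 0 k + t ^+ 2 else 0).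
  have C j : (y + t *: delta_mx 0 k) 0 j ^+ 2 = y 0 j ^+ 2 + (if j == k then 2 * t * y 0 k + t ^+ 2 else 0).
    rewrite !mxE eqxx /=; case: eqVneq => [->|_]; last by rewrite mulr0 !addr0.
    by rewrite mulr1 !expr2; ring.
  rewrite (eq_bigr _ (fun j _ => C j)) big_split /=; congr (_ + _).
  rewrite -big_mkcondr /=; case: ifP => Pk.
    by rewrite (big_pred1 k) // => j /=; case: eqVneq => [->|]; rewrite ?Pk ?andbF.
  by rewrite big1 // => j /andP[Pj /eqP jk]; rewrite -jk Pj in Pk.
have [_ ->] // : is_derive y (delta_mx 0 k : E n) (fun y : E n => b - 2^-1 * (\sum_(j < n | (j < i)%N) y 0 j ^+ 2)
     + 2^-1 * (\sum_(j < n | (i <= j)%N) y 0 j ^+ 2)) (if (k < i)%N then - y 0 k else y 0 k).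
apply: is_derive_eps => e e0; exists (2 * e); first by rewrite mulr_gt0.
move=> t te; rewrite !S; have tt : `|t ^+ 2| <= 2 * e * `|t|.
  by rewrite expr2 normrM ler_wpM2r // ltW.
case: ltnP => ki.
  rewrite (_ : _ - _ = - (2^-1 * t ^+ 2)); last by lra.
  by rewrite normrN normrM ger0_norm //; lra.
rewrite (_ : _ - _ = 2^-1 * t ^+ 2); last by lra.
by rewrite normrM ger0_norm //; lra.
Qed.

(** In normal form the partials of [h] vanish simultaneously at the origin only. In particular the
    chart is centred at its critical point, which [gradient_like] does not state. *)
Lemma gl_crit v c x : atlas M c -> cdom c x -> crit h x ->
  (forall y, cimg c y -> h (cinv c y) =
           h v - 2^-1 * (\sum_(j < n | (j < morse_index h v)%N) y 0 j ^+ 2)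
               + 2^-1 * (\sum_(j < n | (morse_index h v <= j)%N) y 0 j ^+ 2)) -> cmap c x = 0.
Proof.
move=> Ac cx hx Hh; apply/rowP => k; rewrite [RHS]mxE.
have := critP hx Ac cx k.
rewrite (@nr_partial _ _ _ _ _ k (nrW Hh (cimg_nr Ac (cimg_cmap cx)))) quad_partial.
by case: ifP => // _ /eqP; rewrite oppr_eq0 => /eqP.
Qed.

(** [X] vanishes at [v] by the normal form, so the constant curve is the integral curve through
    [v]. *)
Lemma flow_crit v t : crit h v -> Phi t v = v.
Proof.
move=> hv; have [c [r [[Ac cv] r0 cE Hh HX]]] := gl_chart hv.
have v0 := gl_crit Ac cv hv Hh.
have Xv : X c v = 0.
  apply/rowP => j; have := HX _ (cimg_cmap cv) j; rewrite cinvK // v0 !mxE oppr0.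
  by case: ifP.
apply: (icurve_uniq (field_smooth X) (flow_icurve hPhi v) (p2 := fun=> v)); last exact: flow0.
split; first exact: cst_continuous.
by move=> s d Ad dv j; rewrite (field_chart0 Ac Ad cv dv Xv) mxE; exact: dC.
Qed.

Lemma flow_ncrit x t : ~ crit h x -> ~ crit h (Phi t x).
Proof. by move=> nx cx; apply: nx; rewrite -(flowK hPhi t x) flow_crit. Qed.

Lemma h_flow_decr x s t : ~ crit h x -> s < t -> h (Phi t x) < h (Phi s x).
Proof.
move=> nx st.
have D (u : R) : exists d, is_derive u 1 (fun s => h (Phi s x)) d /\ d < 0.
  have [c Ac cx] := atlas_at (Phi u x); exists (lie_derivative h X c (Phi u x)).
  by split; [exact: h_flow_derive|apply: lie_neg => //; exact: flow_ncrit].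
have /choice [d Hd] := D.
have [|c _ E] := @dmvt _ (fun s => h (Phi s x)) d s t (ltW st); first by move=> u _; have [] := Hd u.
by rewrite -subr_lt0 E nmulr_rlt0 ?subr_gt0 //; have [] := Hd c.
Qed.

Lemma h_flow_le x s t : s <= t -> h (Phi t x) <= h (Phi s x).
Proof.
rewrite le_eqVlt => /orP[/eqP -> //|st].
have [cx|nx] := pselect (crit h x); first by rewrite !flow_crit.
by apply/ltW/h_flow_decr.
Qed.

Lemma h_flow_inj x s t : ~ crit h x -> h (Phi s x) = h (Phi t x) -> s = t.
Proof.
move=> nx st; have [lt|lt|//] := ltgtP s t.
  by have := h_flow_decr nx lt; rewrite st ltxx.
by have := h_flow_decr nx lt; rewrite st ltxx.
Qed.

Lemma h_flow_cts x : continuous (fun t => h (Phi t x)).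
Proof. by move=> t; apply: continuous_comp; [exact: (flow_cts hPhi)|exact: h_cts]. Qed.

Lemma Wminus_lim v x e : Wminus Phi v x -> 0 < e -> exists T : R, forall t, t <= T -> `|h (Phi t x) - h v| < e.
Proof.
move=> Wx e0.
have : nbhs v (fun z => `|h z - h v| < e).
  by apply: (h_near (P := fun y => `|y - h v| < e)); exists e => // y; rewrite /ball_ /= distrC.
move=> /Wx [T [_ HT]]; exists (T - 1) => t tT; apply: HT; lra.
Qed.

Lemma Wplus_lim v x e : Wplus Phi v x -> 0 < e -> exists T : R, forall t, T <= t -> `|h (Phi t x) - h v| < e.
Proof.
move=> Wx e0.
have : nbhs v (fun z => `|h z - h v| < e).
  by apply: (h_near (P := fun y => `|y - h v| < e)); exists e => // y; rewrite /ball_ /= distrC.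
move=> /Wx [T [_ HT]]; exists (T + 1) => t tT; apply: HT; lra.
Qed.

Lemma Wminus_flow v x t : Wminus Phi v x -> Wminus Phi v (Phi t x).
Proof.
move=> Wx U /Wx [T [_ HT]]; exists (T - t); split; first exact: num_real.
by move=> s sT /=; rewrite -(flowD hPhi) addrC; apply: HT; lra.
Qed.

Lemma Wplus_flow v x t : Wplus Phi v x -> Wplus Phi v (Phi t x).
Proof.
move=> Wx U /Wx [T [_ HT]]; exists (T - t); split; first exact: num_real.
by move=> s sT /=; rewrite -(flowD hPhi) addrC; apply: HT; lra.
Qed.

Lemma Wminus_uniq v w x : Wminus Phi v x -> Wminus Phi w x -> v = w.
Proof.
move=> Wv Ww; apply: (@mhausdorff _ _ _ M) => A B /Wv [T [_ HT]] /Ww [S [_ HS]].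
pose m := Num.min T S; have mT : m <= T by rewrite ge_min lexx.
have mS : m <= S by rewrite ge_min lexx orbT.
by exists (Phi (m - 1) x); split; [apply: HT|apply: HS]; lra.
Qed.

Lemma Wplus_uniq v w x : Wplus Phi v x -> Wplus Phi w x -> v = w.
Proof.
move=> Wv Ww; apply: (@mhausdorff _ _ _ M) => A B /Wv [T [_ HT]] /Ww [S [_ HS]].
pose m := Num.max T S; have mT : T <= m by rewrite le_max lexx.
have mS : S <= m by rewrite le_max lexx orbT.
by exists (Phi (m + 1) x); split; [apply: HT|apply: HS]; lra.
Qed.

Lemma Wminus_self v : crit h v -> Wminus Phi v v.
Proof. by move=> hv U Uv; exists 0; split => // t _; rewrite /= flow_crit //; exact: nbhs_singleton. Qed.

Lemma Wplus_self v : crit h v -> Wplus Phi v v.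
Proof. by move=> hv U Uv; exists 0; split => // t _; rewrite /= flow_crit //; exact: nbhs_singleton. Qed.

Lemma Wminus_crit v x : Wminus Phi v x -> crit h x -> v = x.
Proof. by move=> Wx /Wminus_self; exact: Wminus_uniq. Qed.

Lemma Wplus_crit v x : Wplus Phi v x -> crit h x -> v = x.
Proof. by move=> Wx /Wplus_self; exact: Wplus_uniq. Qed.

Lemma Wminus_le v x t : Wminus Phi v x -> h (Phi t x) <= h v.
Proof.
move=> Wx; rewrite leNgt; apply/negP => lt.
have [|T HT] := Wminus_lim Wx (_ : 0 < h (Phi t x) - h v); first by rewrite subr_gt0.
pose s := Num.min T t; have st : s <= t by rewrite ge_min lexx orbT.
have sT : s <= T by rewrite ge_min lexx.
have := HT s sT; have := h_flow_le x st; rewrite ltr_norml => h1 /andP[_ h2]; lra.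
Qed.

Lemma Wplus_ge v x t : Wplus Phi v x -> h v <= h (Phi t x).
Proof.
move=> Wx; rewrite leNgt; apply/negP => lt.
have [|T HT] := Wplus_lim Wx (_ : 0 < h v - h (Phi t x)); first by rewrite subr_gt0.
pose s := Num.max T t; have st : t <= s by rewrite le_max lexx orbT.
have sT : T <= s by rewrite le_max lexx.
have := HT s sT; have := h_flow_le x st; rewrite ltr_norml => h1 /andP[h2 _]; lra.
Qed.

Lemma Wminus_h v x : Wminus Phi v x -> h x <= h v.
Proof. by move=> /(Wminus_le 0); rewrite (flow0 hPhi). Qed.

Lemma Wminus_lt v x t : Wminus Phi v x -> ~ crit h x -> h (Phi t x) < h v.
Proof.
move=> Wx nx; have : t - 1 < t by lra.
by move=> /(h_flow_decr nx) /lt_le_trans; apply; exact: Wminus_le.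
Qed.

Lemma Wplus_gt v x t : Wplus Phi v x -> ~ crit h x -> h v < h (Phi t x).
Proof.
move=> Wx nx; have : t < t + 1 by lra.
by move=> /(h_flow_decr nx); apply: le_lt_trans; exact: Wplus_ge.
Qed.

Lemma flow_ivt x s t a : s <= t -> h (Phi t x) <= a <= h (Phi s x) ->
  exists2 u, s <= u <= t & h (Phi u x) = a.
Proof.
move=> st /andP[h1 h2].
have [||u] := @IVT _ (fun t => h (Phi t x)) s t a st.
- by apply: continuous_subspaceT; exact: h_flow_cts.
- by rewrite ge_min h1 orbT le_max h2.
by rewrite in_itv /=; exists u.
Qed.

Lemma Wminus_level v x a : Wminus Phi v x -> h x <= a < h v -> exists2 t, t <= 0 & h (Phi t x) = a.
Proof.
move=> Wx /andP[xa av]; have [|T HT] := Wminus_lim Wx (_ : 0 < h v - a); first by rewrite subr_gt0.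
pose s := Num.min T 0; have s0 : s <= 0 by rewrite ge_min lexx orbT.
have sT : s <= T by rewrite ge_min lexx.
have := HT s sT; rewrite ltr_norml => /andP[h1 _].
have [|u /andP[_ u0] E] := flow_ivt (x := x) (a := a) s0; last by exists u.
by rewrite (flow0 hPhi) // xa /=; apply/ltW; lra.
Qed.

Lemma Wplus_level v x a : Wplus Phi v x -> h v < a <= h x -> exists2 t, 0 <= t & h (Phi t x) = a.
Proof.
move=> Wx /andP[va ax]; have [|T HT] := Wplus_lim Wx (_ : 0 < a - h v); first by rewrite subr_gt0.
pose s := Num.max T 0; have s0 : 0 <= s by rewrite le_max lexx orbT.
have sT : T <= s by rewrite le_max lexx.
have := HT s sT; rewrite ltr_norml => /andP[_ h1].
have [|u /andP[u0 _] E] := flow_ivt (x := x) (a := a) s0; last by exists u.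
by rewrite (flow0 hPhi) // ax andbT; apply/ltW; lra.
Qed.

Definition reaches (a : R) (x : M) : Prop := exists t, h (Phi t x) = a.

(** Unique off the critical points; at a critical point any such time gives the same point
    ([level_point_eq]). The value [0] is a default when the level is not reached. *)
Definition level_time (a : R) (x : M) : R := xget 0 [set t | h (Phi t x) = a].

Definition level_point (a : R) (x : M) : M := Phi (level_time a x) x.

Lemma level_pointP a x : reaches a x -> h (level_point a x) = a.
Proof. by move=> [t ta]; rewrite /level_point /level_time; case: xgetP => [s _ //|/(_ t)]. Qed.

Lemma level_point_eq a x t : h (Phi t x) = a -> level_point a x = Phi t x.
Proof.
move=> ta; have [cx|nx] := pselect (crit h x); first by rewrite /level_point !flow_crit.
have /level_pointP : reaches a x by exists t.
by rewrite -[in RHS]ta /level_point => /(h_flow_inj nx) ->.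
Qed.

Lemma reaches_flow a x t : reaches a x -> reaches a (Phi t x).
Proof. by move=> [s sa]; exists (s - t); rewrite -(flowD hPhi) addrC subrK. Qed.

Lemma level_point_flow a x t : reaches a x -> level_point a (Phi t x) = level_point a x.
Proof.
move=> [s sa]; rewrite (level_point_eq sa) (@level_point_eq a (Phi t x) (s - t)).
  by rewrite -(flowD hPhi) addrC subrK.
by rewrite -(flowD hPhi) addrC subrK.
Qed.

Lemma level_point_self x : level_point (h x) x = x.
Proof. by rewrite (@level_point_eq _ _ 0) (flow0 hPhi). Qed.

(* The crossing time is obtained from the inverse function theorem applied to
   [(w, t) |-> (w, h (Phi t (f w)))]. *)
Lemma level_point_sm q (f : E q -> M) (w : E q) a : sm f w -> ~ crit h (f w) -> reaches a (f w) ->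
  nr w (fun w' => reaches a (f w')) /\ sm (fun w' => level_point a (f w')) w.
Proof.
move=> sf nf [t0 ta].
pose G (z : E (q + 1)) := h (Phi (rsubmx z 0 0) (f (lsubmx z))).
pose F (z : E (q + 1)) : E (q + 1) := row_mx (lsubmx z) (const_mx (G z)).
pose z0 : E (q + 1) := row_mx w (const_mx t0).
have z0l : lsubmx z0 = w by rewrite row_mxKl.
have z0r : rsubmx z0 0 0 = t0 by rewrite row_mxKr mxE.
have smG : cinf G z0.
  have S : sm (fun z : E (q + 1) => Phi (rsubmx z 0 0) (f (lsubmx z))) z0.
    apply: flow_sm => //; last exact: (cinfv_rsubmx (cinfv_id z0)).
    by apply: (@sm_comp _ _ _ _ _ f); [rewrite z0l|exact: (cinfv_lsubmx (cinfv_id z0))].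
  exact: (smooth_function_smf h_smooth erefl S).
have smF : cinfv F z0.
  apply: cinfv_row_mx; first exact: (cinfv_lsubmx (cinfv_id z0)).
  by move=> j; apply: cinf_ext smG => z; rewrite mxE.
(* For a vector in the kernel the space components vanish, and then the time component times X(h)
   vanishes, where X(h) is negative off the critical points. *)
have JF : jacobian F z0 \in unitmx.
  apply: unitmx_inj => u; rewrite (mulmx_jacobian u smF) => /rowP Hu.
  have ul : lsubmx u = 0.
    apply/rowP => j; have := Hu (lshift 1 j); rewrite !mxE.
    have -> : (fun y => F y 0 (lshift 1 j)) = (fun y : E (q + 1) => y 0 (lshift 1 j)).
      by apply/funext => y; rewrite row_mxEl mxE.
    have [_ ->] := cinf_dir u (cinf_coord z0 (lshift 1 j)).
    have J1 := @jacobian_id R _ z0.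
    rewrite /lform (eq_bigr (fun i => u 0 i * (1%:M : 'M[R]_(q + 1)) i (lshift 1 j))).
      by move=> H; rewrite -[in LHS](mulmx1 u) mxE.
    by move=> i _; rewrite -J1 mxE.
  have ur : rsubmx u 0 0 = 0.
    have := Hu (rshift q 0); rewrite !mxE.
    have -> : (fun y => F y 0 (rshift q 0)) = G by apply/funext => y; rewrite row_mxEr mxE.
    have [c Ac cx] := atlas_at (Phi t0 (f w)).
    have D := h_flow_derive Ac cx.
    have : is_derive z0 u G (rsubmx u 0 0 * lie_derivative h X c (Phi t0 (f w))).
      apply: (@is_derive_transport _ _ _ _ (fun s => h (Phi s (f w))) _ _ t0 (rsubmx u 0 0)).
        move=> s; rewrite /G !linearD !linearZ /= ul scaler0 addr0 z0l.
        by rewrite mxE z0r mxE.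
      have E1 : (fun s => h (Phi (t0 + s * rsubmx u 0 0) (f w))) = (fun s => h (Phi (t0 + s *: rsubmx u 0 0) (f w))) by [].
      have Dl : is_derive (0 : R) 1 (fun s => t0 + rsubmx u 0 0 * s) (rsubmx u 0 0).
        by apply: d_eq (dD (dC t0 0) (dlin (rsubmx u 0 0) 0)) _; rewrite add0r.
      have D0 : is_derive (t0 + rsubmx u 0 0 * 0) 1 (fun s => h (Phi s (f w))) (lie_derivative h X c (Phi t0 (f w))).
        by rewrite mulr0 addr0.
      have [c1 c2] := @dcomp _ _ (fun s => t0 + rsubmx u 0 0 * s) 0 _ _ D0 Dl.
      have E2 : (fun s => h (Phi (t0 + rsubmx u 0 0 * s) (f w))) = (fun s : R => h (Phi (t0 + s *: rsubmx u 0 0) (f w))).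
        by apply/funext => s; rewrite mulrC.
      rewrite E2 in c1 c2.
      have L1 := line_derivable (fun s => h (Phi s (f w))) t0 (rsubmx u 0 0) 0.
      have L2 := line_derive (fun s => h (Phi s (f w))) t0 (rsubmx u 0 0) 0.
      rewrite scale0r addr0 in L1 L2.
      by split; [rewrite -L1|rewrite -L2 c2 mulrC].
    move=> [_ ->] /eqP; rewrite mulf_eq0 => /orP[/eqP H|/eqP H]; first by move: H; rewrite mxE.
    by have := lie_neg (flow_ncrit (t := t0) nf) Ac cx; rewrite H ltxx.
  rewrite -[u]hsubmxK ul; apply/rowP => j; rewrite !mxE; case: splitP => k _; rewrite ?mxE //.
  by move: ur; rewrite mxE ord1.
have [I [smI FI IF]] := inverse_function smF JF.
have Fz0 : F z0 = row_mx w (const_mx a) by rewrite /F z0l /G z0l z0r ta.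
pose g w' := I (row_mx w' (const_mx a)).
have sg : cinfv g w.
  apply: (@cinfv_comp _ _ _ _ I (fun w' => row_mx w' (const_mx a))); first by rewrite -Fz0.
  by apply: cinfv_row_mx; [exact: cinfv_id|exact: cinfv_cst].
have gE : nr w (fun w' => lsubmx (g w') = w' /\ h (Phi (rsubmx (g w') 0 0) (f w')) = a).
  have : nr w (fun w' => F (g w') = row_mx w' (const_mx a)).
    apply: (@cinfv_nr_pre _ _ _ (fun w' : E q => row_mx w' (const_mx a) : E (q + 1)) w (fun y => F (I y) = y)).
      by apply: cinfv_row_mx; [exact: cinfv_id|exact: cinfv_cst].
    by rewrite -Fz0.
  apply: nrW => y /eq_row_mx [e1 e2]; split => //.
  have := congr1 (fun A : 'rV[R]_1 => A 0 0) e2; by rewrite [LHS]mxE [RHS]mxE /G e1.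
split; first by apply: nrW gE => y [_ e]; exists (rsubmx (g y) 0 0).
apply: (@sm_eq _ _ _ _ (fun w' => Phi (rsubmx (g w') 0 0) (f w'))).
  by apply: nrW gE => y [_ e]; rewrite (level_point_eq e).
by apply: flow_sm => //; exact: (cinfv_rsubmx sg).
Qed.

End MorseFlow.

(** * The hyperbolic model near a critical point *)

Section LocalModel.
Context {R : realType} {n : nat}.
Local Notation E n := 'rV[R]_n.

Definition nsq (P : pred 'I_n) (y : E n) : R := \sum_(j < n | P j) y 0 j ^+ 2.

Lemma nsq_ge0 P y : 0 <= nsq P y.
Proof. by apply: sumr_ge0 => j _; exact: sqr_ge0. Qed.

Lemma nsq0 P y : nsq P y = 0 -> forall j, P j -> y 0 j = 0.
Proof.
move=> /eqP; rewrite psumr_eq0 => [/allP H j Pj|j _]; last exact: sqr_ge0.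
by have := H j; rewrite mem_index_enum => /(_ isT) /implyP /(_ Pj); rewrite sqrf_eq0 => /eqP.
Qed.

(** The flow of the field in normal form: the first [i] coordinates are unstable, the others
    stable. *)
Definition hyp_flow (i : nat) (s : R) (y : E n) : E n :=
  \row_j ((if (j < i)%N then expR s else expR (- s)) * y 0 j).

Lemma hyp_flow0 i y : hyp_flow i 0 y = y.
Proof. by apply/rowP => j; rewrite mxE oppr0 expR0 if_same mul1r. Qed.

Lemma hyp_flowD i s t y : hyp_flow i s (hyp_flow i t y) = hyp_flow i (s + t) y.
Proof. by apply/rowP => j; rewrite !mxE; case: ifP => _; rewrite mulrA -expRD -?opprD. Qed.

Definition neg_part (i : nat) : pred 'I_n := fun j => (j < i)%N.
Definition pos_part (i : nat) : pred 'I_n := fun j => (i <= j)%N.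

Lemma nsq_hyp_neg i s y : nsq (neg_part i) (hyp_flow i s y) = expR s ^+ 2 * nsq (neg_part i) y.
Proof.
rewrite /nsq mulr_sumr; apply: eq_bigr => j; rewrite /neg_part => ji.
by rewrite mxE ji exprMn.
Qed.

Lemma nsq_hyp_pos i s y : nsq (pos_part i) (hyp_flow i s y) = expR (- s) ^+ 2 * nsq (pos_part i) y.
Proof.
rewrite /nsq mulr_sumr; apply: eq_bigr => j; rewrite /pos_part => ij.
by rewrite mxE ltnNge ij exprMn.
Qed.

Lemma nsq_split i (y : E n) : \sum_(j < n) y 0 j ^+ 2 = nsq (neg_part i) y + nsq (pos_part i) y.
Proof.
rewrite (bigID (neg_part i)) /=; congr (_ + _); apply: eq_bigl => j.
by rewrite /neg_part /pos_part -leqNgt.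
Qed.

Lemma hyp_flow_near i t y P : nr (hyp_flow i t y) P ->
  exists2 e, 0 < e & forall s : R, `|s - t| < e -> P (hyp_flow i s y).
Proof.
move=> [d d0 H].
have : \forall s \near t, forall j : 'I_n, `|hyp_flow i s y 0 j - hyp_flow i t y 0 j| < d.
  apply: (@filter_forall _ _ (fun j s => `|hyp_flow i s y 0 j - hyp_flow i t y 0 j| < d) (nbhs t)) => j.
  have C : {for t, continuous (fun s => hyp_flow i s y 0 j)}.
    have -> : (fun s => hyp_flow i s y 0 j) = (fun s => (if (j < i)%N then expR s else expR (- s)) * y 0 j).
      by apply/funext => s; rewrite mxE.
    case: (j < i)%N.
      exact: d_cts (dM (is_derive_expR t) (dC (y 0 j) t)).
    exact: d_cts (dM (@dcomp _ expR (fun s => - s) t _ _ (is_derive_expR _) (dN (is_derive_id t 1))) (dC (y 0 j) t)).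
  by move/cvgrPdist_lt: C => /(_ d d0); apply: filterS => s; rewrite distrC.
move=> /nbhs_ballP [e /= e0 He]; exists e => // s st; apply: H; apply: norm_lt_coord => // j.
by rewrite coordB; apply: He; rewrite -ball_normE /= distrC.
Qed.

End LocalModel.

Section GLChart.
Context {R : realType} {n : nat}.
Local Notation E n := 'rV[R]_n.
Variables (M : smooth_manifold R n) (h : M -> R) (X : vector_field M) (Phi : R -> M -> M).
Hypotheses (hPhi : is_flow X Phi) (hMS : morse_smale h X Phi).
Variables (v : M) (hv : crit h v) (c : chart R n M) (r : R).
Let i := morse_index h v.
Notation m2 := (nsq (neg_part i)).
Notation p2 := (nsq (pos_part i)).
Hypotheses (Ac : atlas M c) (cv : cdom c v) (r0 : 0 < r).
Hypothesis (cE : cimg c = [set y : 'rV[R]_n | \sum_(j < n) y 0 j ^+ 2 < r ^+ 2]).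
Hypothesis (Hh : forall y, cimg c y -> h (cinv c y) =
  h v - 2^-1 * (\sum_(j < n | (j < morse_index h v)%N) y 0 j ^+ 2)
      + 2^-1 * (\sum_(j < n | (morse_index h v <= j)%N) y 0 j ^+ 2)).
Hypothesis (HX : forall y, cimg c y -> forall j : 'I_n,
  X c (cinv c y) 0 j = if (j < morse_index h v)%N then y 0 j else - y 0 j).

Lemma gl_cimg y : cimg c y <-> m2 y + p2 y < r ^+ 2.
Proof. by rewrite cE /= (nsq_split i). Qed.

Lemma gl_h y : cimg c y -> h (cinv c y) = h v - 2^-1 * m2 y + 2^-1 * p2 y.
Proof. exact: Hh. Qed.

Lemma gl_center : cmap c v = 0.
Proof. exact: gl_crit Ac cv hv Hh. Qed.

Lemma gl_flow_cmap x T : 0 <= T -> (forall s, 0 <= s <= T -> cdom c (Phi s x)) ->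
  cmap c (Phi T x) = hyp_flow i T (cmap c x).
Proof.
move=> T0 H; apply/rowP => j; rewrite mxE.
have [_ D] := flow_icurve hPhi x.
have V s : cdom c (Phi s x) -> X c (Phi s x) 0 j = if (j < i)%N then cmap c (Phi s x) 0 j else - cmap c (Phi s x) 0 j.
  by move=> cs; have := HX (cimg_cmap cs) j; rewrite cinvK.
pose sg := if (j < i)%N then 1 else -1 : R.
have VE s : cdom c (Phi s x) -> X c (Phi s x) 0 j = sg * cmap c (Phi s x) 0 j.
  by move=> /V ->; rewrite /sg; case: ifP; rewrite ?mul1r ?mulN1r.
have Dg s : 0 <= s <= T -> is_derive s 1 (fun s => cmap c (Phi s x) 0 j * expR (- sg * s)) 0.
  move=> /H cs; have D1 := D s c Ac cs j.
  have D2 : is_derive s 1 (fun s => expR (- sg * s)) (expR (- sg * s) * - sg).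
    by apply: (@dcomp _ expR (fun s => - sg * s)); exact: dlin.
  apply: d_eq (dM D1 D2) _; rewrite (VE s cs); ring.
have [u _] := dmvt (df := fun=> 0) T0 Dg.
rewrite mul0r mulr0 expR0 mulr1 (flow0 hPhi) // => /subr0_eq /(congr1 (fun z => z * expR (sg * T))).
rewrite -mulrA -expRD mulNr addNr expR0 mulr1 => ->; rewrite mulrC /sg.
by case: ifP => _; rewrite ?mul1r ?mulN1r.
Qed.

(** As long as the linear flow stays in the chart it is the actual one; the closing step compares
    the two limits in the Hausdorff space M. *)
Lemma gl_flow y T : cimg c y -> (forall s, 0 <= s <= T -> cimg c (hyp_flow i s y)) ->
  forall s, 0 <= s <= T -> Phi s (cinv c y) = cinv c (hyp_flow i s y).
Proof.
move=> cy H s0 /andP[s00 s0T].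
suff : s0 <= T -> Phi s0 (cinv c y) = cinv c (hyp_flow i s0 y) by apply.
have : 0 <= s0 < T + 1 by lra.
move: s0 {s00 s0T}; apply: real_induction; first by rewrite (flow0 hPhi) // hyp_flow0.
- move=> t /andP[t0 ta] Hs; have [tT|Tt] := ltP t T; last first.
    exists 1 => // s /andP[ts _] sT; have -> : s = t by lra.
    by apply: Hs; lra.
  have Q u : 0 <= u <= t -> cdom c (Phi u (cinv c y)).
    by move=> ut; rewrite Hs //; [apply: cimg_cdom => //; apply: H; lra|lra].
  have [|e e0 He] := icurve_near (t := t) (flow_icurve hPhi (cinv c y)) (cdom_nbhs Ac _ : nbhs _ (cdom c)).
    by apply: Q; lra.
  exists e => // s /andP[ts se] sT.
  have Q' u : 0 <= u <= s -> cdom c (Phi u (cinv c y)).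
    move=> us; have [ut|tu] := leP u t; first by apply: Q; lra.
    by apply: He; rewrite gtr0_norm; lra.
  have cs : cdom c (Phi s (cinv c y)) by apply: Q'; lra.
  rewrite -[LHS](cinvK Ac cs) gl_flow_cmap; [by rewrite cmapK|lra|exact: Q'].
- move=> t /andP[t0 ta] Hs tT; apply: (@mhausdorff _ _ _ M) => A B HA HB.
  have [e1 e10 He1] := icurve_near (flow_icurve hPhi (cinv c y)) HA.
  have ct : cimg c (hyp_flow i t y) by apply: H; lra.
  have [e2 e20 He2] := hyp_flow_near (cinv_nr Ac ct HB).
  pose e := Num.min e1 e2; have e0 : 0 < e by rewrite lt_min e10.
  pose s := Num.max 0 (t - e / 2).
  have s0 : 0 <= s < t by rewrite le_max lexx /= gt_max t0; lra.
  have es : t - e / 2 <= s by rewrite le_max lexx orbT.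
  have st : `|s - t| < e by rewrite ltr0_norm; lra.
  move: st; rewrite lt_min => /andP[se1 se2].
  exists (Phi s (cinv c y)); split; first exact: He1.
  by rewrite Hs //; [exact: He2|lra].
Qed.

Lemma gl_flow_back y T : cimg c y -> (forall s, 0 <= s <= T -> cimg c (hyp_flow i (- s) y)) ->
  forall s, 0 <= s <= T -> Phi (- s) (cinv c y) = cinv c (hyp_flow i (- s) y).
Proof.
move=> cy H s sT; set z := hyp_flow i (- s) y.
have : Phi s (cinv c z) = cinv c (hyp_flow i s z).
  apply: (@gl_flow z s) => //; first exact: H.
    by move=> u us; rewrite hyp_flowD -[u - s]opprK opprB; apply: H; lra.
  by lra.
by rewrite hyp_flowD subrr hyp_flow0 => <-; rewrite (flowK hPhi).
Qed.

Lemma expR_sq_le1 (s : R) : 0 <= s -> expR (- s) ^+ 2 <= 1.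
Proof.
move=> s0; rewrite expr_le1 ?expR_ge0 // -[leRHS]expR0 ler_expR; lra.
Qed.

Lemma expR_small (b d : R) : 0 <= b -> 0 < d -> exists2 T, 0 <= T & forall s, T <= s -> expR (- s) * b < d.
Proof.
move=> b0 d0; exists (b / d); first by rewrite divr_ge0 // ltW.
move=> s sT; rewrite expRN mulrC ltr_pdivrMr ?expR_gt0 //.
have h1 : b <= d * s by rewrite mulrC -ler_pdivrMr.
have h2 := expR_ge1Dx s; have : d * (1 + s) <= d * expR s by rewrite ler_wpM2l // ltW.
by lra.
Qed.

Lemma gl_unstable y : cimg c y -> p2 y = 0 -> Wminus Phi v (cinv c y).
Proof.
move=> cy py U Uv.
have cs s : 0 <= s -> cimg c (hyp_flow i (- s) y).
  move=> s0; apply/gl_cimg; rewrite nsq_hyp_neg nsq_hyp_pos py mulr0 addr0.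
  apply: le_lt_trans ((gl_cimg y).1 cy); rewrite py addr0.
  by rewrite ler_piMl ?nsq_ge0 // expR_sq_le1.
have [d d0 Hd] : nr 0 (fun z => U (cinv c z)).
  by rewrite -gl_center; apply: cinv_nr => //; [exact: cimg_cmap|rewrite cinvK].
have [T T0 HT] := expR_small (normr_ge0 y) d0.
exists (- T); split; first exact: num_real.
move=> t tT; rewrite /= -[t]opprK.
rewrite (@gl_flow_back y (- t)) //; [|by move=> s /andP[s0 _]; exact: cs|by lra].
apply: Hd; rewrite subr0; apply: (@le_lt_trans _ _ (expR (- - t) * `|y|)); last by apply: HT; lra.
apply: norm_le_coord; first by rewrite mulr_ge0 ?expR_ge0.
move=> j; rewrite mxE; case: ifP => ji.
  by rewrite normrM ger0_norm ?expR_ge0 // ler_wpM2l ?expR_ge0 ?coord_le_norm.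
rewrite (nsq0 py); last by rewrite /pos_part leqNgt ji.
by rewrite mulr0 normr0 mulr_ge0 ?expR_ge0.
Qed.

Lemma gl_stable y : cimg c y -> m2 y = 0 -> Wplus Phi v (cinv c y).
Proof.
move=> cy py U Uv.
have cs s : 0 <= s -> cimg c (hyp_flow i s y).
  move=> s0; apply/gl_cimg; rewrite nsq_hyp_neg nsq_hyp_pos py mulr0 add0r.
  apply: le_lt_trans ((gl_cimg y).1 cy); rewrite py add0r.
  by rewrite ler_piMl ?nsq_ge0 // expR_sq_le1.
have [d d0 Hd] : nr 0 (fun z => U (cinv c z)).
  by rewrite -gl_center; apply: cinv_nr => //; [exact: cimg_cmap|rewrite cinvK].
have [T T0 HT] := expR_small (normr_ge0 y) d0.
exists T; split; first exact: num_real.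
move=> t tT /=.
rewrite (@gl_flow y t) //; [|by move=> s /andP[s0 _]; exact: cs|by lra].
apply: Hd; rewrite subr0; apply: (@le_lt_trans _ _ (expR (- t) * `|y|)); last by apply: HT; lra.
apply: norm_le_coord; first by rewrite mulr_ge0 ?expR_ge0.
move=> j; rewrite mxE; case: ifP => ji; last first.
  by rewrite normrM ger0_norm ?expR_ge0 // ler_wpM2l ?expR_ge0 ?coord_le_norm.
by rewrite (nsq0 py) // mulr0 normr0 mulr_ge0 ?expR_ge0.
Qed.

(** [T] solves [expR T ^ 2 = q] with [q = r ^ 2 / (2 b)]. As [q > 2], the square norm of the
    contracting part has shrunk by more than one half when that of the expanding part reaches
    [r ^ 2 / 2]. *)
Lemma exit_time (b : R) : 0 < b < r ^+ 2 / 4 -> exists T, [/\ 0 <= T, expR T ^+ 2 * b = r ^+ 2 / 2 &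
  expR (- T) ^+ 2 < 2^-1].
Proof.
move=> /andP[b0 br]; have r20 : 0 < r ^+ 2 by rewrite exprn_gt0.
pose q := r ^+ 2 / 2 / b; have q0 : 0 < q by rewrite !divr_gt0.
have q2 : 2 < q by rewrite ltr_pdivlMr //; lra.
have E : expR (ln q / 2) ^+ 2 = q by rewrite expr2 -expRD -splitr lnK.
exists (ln q / 2); split.
- by rewrite divr_ge0 // ln_ge0 //; lra.
- by rewrite E divfK // gt_eqF.
- by rewrite expRN exprVn E ltf_pV2 ?posrE.
Qed.

(** Up to [T] the unstable square norm does not exceed [r ^ 2 / 2] and the stable one stays below
    [r ^ 2 / 4], so the point remains in the chart. At [T] they contribute [- r ^ 2 / 4] and at most
    [r ^ 2 / 16] to [h], which is the origin of [3 / 16]. *)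
Lemma gl_exit x : cdom c x -> 0 < m2 (cmap c x) < r ^+ 2 / 4 -> p2 (cmap c x) < r ^+ 2 / 4 ->
  exists T, [/\ 0 <= T, forall s, 0 <= s <= T -> Phi s x = cinv c (hyp_flow i s (cmap c x)) /\
     cimg c (hyp_flow i s (cmap c x)) & h (Phi T x) <= h v - 3 / 16 * r ^+ 2].
Proof.
move=> cx mx px; set y := cmap c x in mx px *; have [T [T0 E E']] := exit_time mx.
have cs s : 0 <= s <= T -> cimg c (hyp_flow i s y).
  move=> /andP[s0 sT]; apply/gl_cimg; rewrite nsq_hyp_neg nsq_hyp_pos.
  have h1 : expR s ^+ 2 * m2 y <= r ^+ 2 / 2.
    by rewrite -E ler_wpM2r ?nsq_ge0 // lerXn2r ?nnegrE ?expR_ge0 // ler_expR.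
  have h2 : expR (- s) ^+ 2 * p2 y <= p2 y by rewrite ler_piMl ?nsq_ge0 // expR_sq_le1.
  by lra.
have Hf s : 0 <= s <= T -> Phi s x = cinv c (hyp_flow i s y).
  by move=> sT; rewrite -{1}(cinvK Ac cx); apply: (@gl_flow y T) => //; exact: cimg_cmap.
have TT : 0 <= T <= T by rewrite T0 lexx.
exists T; split => //; first by move=> s sT; split; [exact: Hf|exact: cs].
rewrite Hf // gl_h; last exact: cs.
rewrite nsq_hyp_neg nsq_hyp_pos E.
have : expR (- T) ^+ 2 * p2 y <= 2^-1 * p2 y by rewrite ler_wpM2r ?nsq_ge0 // ltW.
by lra.
Qed.

Lemma gl_exit_back x : cdom c x -> 0 < p2 (cmap c x) < r ^+ 2 / 4 -> m2 (cmap c x) < r ^+ 2 / 4 ->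
  exists T, h v < h (Phi (- T) x).
Proof.
move=> cx px mx; set y := cmap c x in mx px *; have [T [T0 E E']] := exit_time px.
have cs s : 0 <= s <= T -> cimg c (hyp_flow i (- s) y).
  move=> /andP[s0 sT]; apply/gl_cimg; rewrite nsq_hyp_neg nsq_hyp_pos opprK.
  have h1 : expR s ^+ 2 * p2 y <= r ^+ 2 / 2.
    by rewrite -E ler_wpM2r ?nsq_ge0 // lerXn2r ?nnegrE ?expR_ge0 // ler_expR.
  have h2 : expR (- s) ^+ 2 * m2 y <= m2 y by rewrite ler_piMl ?nsq_ge0 // expR_sq_le1.
  by lra.
have TT : 0 <= T <= T by rewrite T0 lexx.
exists T; rewrite -{1}(cinvK Ac cx) (gl_flow_back (cimg_cmap cx) cs TT) gl_h; last exact: cs.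
rewrite nsq_hyp_neg nsq_hyp_pos opprK E.
have : expR (- T) ^+ 2 * m2 y <= 2^-1 * m2 y by rewrite ler_wpM2r ?nsq_ge0 // ltW.
have : 0 < r ^+ 2 by rewrite exprn_gt0.
by lra.
Qed.

(** A nonzero stable part would take the point above the level of [v] in backward time, which is
    impossible on [Wminus Phi v]. Hence no other sheet of the unstable manifold returns close to
    [v]. *)
Lemma gl_Wminus x : cdom c x -> Wminus Phi v x -> p2 (cmap c x) < r ^+ 2 / 4 ->
  m2 (cmap c x) < r ^+ 2 / 4 -> p2 (cmap c x) = 0.
Proof.
move=> cx Wx px mx; apply/eqP; rewrite eq_le nsq_ge0 andbT leNgt; apply/negP => p0.
have [|T] := gl_exit_back cx _ mx; first by rewrite p0.
by rewrite ltNge (Wminus_le hPhi hMS).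
Qed.

Lemma gl_Wplus x : cdom c x -> Wplus Phi v x -> p2 (cmap c x) < r ^+ 2 / 4 ->
  m2 (cmap c x) < r ^+ 2 / 4 -> m2 (cmap c x) = 0.
Proof.
move=> cx Wx px mx; apply/eqP; rewrite eq_le nsq_ge0 andbT leNgt; apply/negP => m0.
have [|T [_ _ H]] := gl_exit cx _ px; first by rewrite m0.
have := Wplus_ge hPhi hMS T Wx; have : 0 < r ^+ 2 by rewrite exprn_gt0.
by lra.
Qed.

End GLChart.

(** * Broken trajectories *)

Section BrokenPaths.
Context {R : realType} {n : nat}.
Local Notation E n := 'rV[R]_n.
Variables (M : smooth_manifold R n) (h : M -> R) (X : vector_field M) (Phi : R -> M -> M).
Hypotheses (hPhi : is_flow X Phi) (hMS : morse_smale h X Phi).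
Local Notation broken := (broken M).
Implicit Types (s : broken).
Let f0 := flow0 hPhi.

Lemma crit_lt_trans (u v w : M) : crit_lt h u v -> crit_lt h v w -> crit_lt h u w.
Proof. by move=> [a b] [c d]; split; [exact: ltn_trans c|exact: lt_trans d]. Qed.

Lemma flow_lineP (x y : M) : flow_line Phi x y <-> exists t, y = Phi t x.
Proof. by split=> [[t _ <-]|[t ->]]; exists t. Qed.

Lemma flow_line_flow (x : M) t : flow_line Phi (Phi t x) = flow_line Phi x.
Proof.
apply/seteqP; split=> y /flow_lineP [u ->]; apply/flow_lineP.
  by exists (t + u); rewrite (flowD hPhi).
by exists (u - t); rewrite -(flowD hPhi) addrC subrK.
Qed.

Lemma flow_line_self (x : M) : flow_line Phi x x.
Proof. by apply/flow_lineP; exists 0; rewrite f0. Qed.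

(** [is_broken] peels off the first trajectory, whereas paths are extended and truncated at their
    lower end. *)
Lemma is_broken_rcons (v w : M) s o (u : M) : is_broken h Phi v (rcons s (o, u)) w <->
  exists w', [/\ is_broken h Phi v s w', crit h u, crit_lt h u w', traj Phi w' u o & u = w].
Proof.
elim: s v => [|[l' u'] s IH] v /=.
  by split=> [[? ? ? ?]|[w' [-> ? ? ? ?]]]; [exists v|].
split=> [[h1 h2 h3 /IH [w' [a b c d e]]]|[w' [[h1 h2 h3 a] b c d e]]].
  by exists w'; split.
by split => //; apply/IH; exists w'.
Qed.

Lemma is_broken_le (v w : M) s : is_broken h Phi v s w -> crit_le h w v.
Proof.
elim: s v => [|[l u] s IH] v /=; first by move=> ->; right.
by move=> [_ uv _ /IH [wu|->]]; left => //; exact: crit_lt_trans uv.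
Qed.

Lemma crit_le_h (w v : M) : crit_le h w v -> h w <= h v.
Proof. by case=> [[_ /ltW]|->]. Qed.

Lemma is_broken_crit (v w : M) s : crit h v -> is_broken h Phi v s w -> crit h w.
Proof. by elim: s v => [|[l u] s IH] v hv /=; [move=> <-|move=> [hu _ _ /(IH u hu)]]. Qed.

Lemma broken_points_rcons (v : M) s o (u : M) :
  broken_points v (rcons s (o, u)) = broken_points v s `|` (o `|` [set u]).
Proof.
by elim: s v => [|[l' u'] s IH] v //=; rewrite IH -!setUA.
Qed.

Lemma traj_ncrit (w u x : M) : crit_lt h u w -> Wminus Phi w x -> Wplus Phi u x -> ~ crit h x.
Proof.
move=> [_ uw] Wx Px cx; move: uw.
by rewrite (Wminus_crit hPhi hMS Wx cx) (Wplus_crit hPhi hMS Px cx) ltxx.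
Qed.

Lemma traj_ltP (w u x : M) t : crit_lt h u w -> Wminus Phi w x -> Wplus Phi u x ->
  h u < h (Phi t x) < h w.
Proof.
move=> uw Wx Px; have nx := traj_ncrit uw Wx Px.
by rewrite (Wminus_lt hPhi hMS) // (Wplus_gt hPhi hMS).
Qed.

(** The pieces of a path occupy disjoint ranges of [h], separated by the values at the breaks, and
    [h] is strictly decreasing on each flow line; so a level determines the point. *)
Lemma broken_points_h (v w : M) s : is_broken h Phi v s w ->
  [/\ broken_points v s w, forall y, broken_points v s y -> h w <= h y <= h v &
   forall y y', broken_points v s y -> broken_points v s y' -> h y = h y' -> y = y'].
Proof.
elim/last_ind: s w => [|s [l u] IH] w.
  move=> /= <-; split => //; first by move=> y ->; rewrite lexx.
  by move=> y y' -> ->.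
move=> /is_broken_rcons [w' [/IH [h1 h2 h3] hu uw' [x [Wx Px] ->] uw]].
have T y : flow_line Phi x y -> h u < h y < h w'.
  by move=> /flow_lineP [t ->]; exact: traj_ltP.
have nx := traj_ncrit uw' Wx Px.
have uw'h : h u < h w' by case: uw'.
have w'v : h w' <= h v by have /andP[_] := h2 _ h1.
subst w; rewrite broken_points_rcons; split; first by right; right.
- move=> y [/h2 /andP[a b]|[/T /andP[a b]|->]]; first by rewrite (le_trans (ltW uw'h)).
    by rewrite (ltW a) (le_trans (ltW b)).
  by rewrite lexx (le_trans (ltW uw'h)).
- move=> y y' [a|[a|a]] [b|[b|b]] E.
  + exact: h3.
  + by have /andP[a1 _] := h2 _ a; have /andP[_ b1] := T _ b; exfalso; lra.
  + by have /andP[a1 _] := h2 _ a; rewrite b in E; exfalso; lra.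
  + by have /andP[a1 _] := h2 _ b; have /andP[_ b1] := T _ a; exfalso; lra.
  + move/flow_lineP: a E => [t ->]; move/flow_lineP: b => [t' ->].
    by move=> /(h_flow_inj hPhi hMS nx) ->.
  + by have /andP[a1 _] := T _ a; rewrite b in E; exfalso; lra.
  + by have /andP[a1 _] := h2 _ b; rewrite a in E; exfalso; lra.
  + by have /andP[a1 _] := T _ b; rewrite a in E; exfalso; lra.
  + by rewrite a b.
Qed.

Section FixedV.
Variables (v : M) (hv : crit h v).
Let Wh := What h Phi v.

Lemma prolonged_path_uniq p y y' : Wh p -> prolonged_path Phi v p y -> prolonged_path Phi v p y' ->
  h y = h y' -> y = y'.
Proof.
case: p => s x [w [/= hw _ Bw Wx]]; have [h1 h2 h3] := broken_points_h Bw.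
have T z : flow_line Phi x z -> h z <= h w by move=> /flow_lineP [t ->]; exact: Wminus_le Wx.
have Tw z : flow_line Phi x z -> h z = h w -> z = w.
  move=> /flow_lineP [t ->] E; have [cx|nx] := pselect (crit h x).
    by rewrite (flow_crit hPhi hMS) // (Wminus_crit hPhi hMS Wx cx).
  by have := Wminus_lt hPhi hMS t Wx nx; rewrite E ltxx.
move=> [a|a] [b|b] E.
- exact: h3.
- have /andP[a1 _] := h2 _ a; have b1 := T _ b.
  have Ew : h y' = h w by lra.
  by rewrite (Tw _ b Ew); apply: h3 => //; rewrite E.
- have /andP[a1 _] := h2 _ b; have b1 := T _ a.
  have Ew : h y = h w by lra.
  by rewrite (Tw _ a Ew); apply: h3 => //; rewrite -E.
- have [cx|nx] := pselect (crit h x).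
    by move/flow_lineP: a => [t ->]; move/flow_lineP: b => [t' ->]; rewrite !(flow_crit hPhi hMS).
  move/flow_lineP: a E => [t ->]; move/flow_lineP: b => [t' ->].
  by move=> /(h_flow_inj hPhi hMS nx) ->.
Qed.

Definition available (a : R) (p : broken * M) : Prop := exists y, prolonged_path Phi v p y /\ h y = a.

Definition regular (a : R) : Prop := ~ critval h a.

Lemma path_pointE p y : Wh p -> prolonged_path Phi v p y -> path_point h Phi v p (h y) = y.
Proof.
move=> Wp py; rewrite /path_point; case: xgetP => [z _ [pz hz]|/(_ y)]; last by case.
exact: prolonged_path_uniq Wp pz py hz.
Qed.

Lemma path_pointP p a : Wh p -> available a p ->
  prolonged_path Phi v p (path_point h Phi v p a) /\ h (path_point h Phi v p a) = a.
Proof. by move=> Wp [y [py <-]]; rewrite path_pointE. Qed.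

Lemma path_point_set p q a :
  (forall y, h y = a -> (prolonged_path Phi v p y <-> prolonged_path Phi v q y)) ->
  path_point h Phi v p a = path_point h Phi v q a /\ (available a p <-> available a q).
Proof.
move=> H; split.
  rewrite /path_point; congr (xget _ _); apply/seteqP; split=> y [/= py hy]; split => //; exact/(H y hy).
by split=> -[y [py hy]]; exists y; split => //; exact/(H y hy).
Qed.

Lemma prolonged_path_flow s (x : M) t : prolonged_path Phi v (s, Phi t x) = prolonged_path Phi v (s, x).
Proof. by rewrite /prolonged_path /= flow_line_flow. Qed.

Lemma path_point_flow s (x : M) t a : path_point h Phi v (s, Phi t x) a = path_point h Phi v (s, x) a.
Proof. by rewrite /path_point prolonged_path_flow. Qed.

Lemma available_flow s (x : M) t a : available a (s, Phi t x) <-> available a (s, x).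
Proof. by rewrite /available prolonged_path_flow. Qed.

Lemma reaches_available s (x : M) a : Wh (s, x) -> reaches h Phi a x ->
  available a (s, x) /\ path_point h Phi v (s, x) a = level_point h Phi a x.
Proof.
move=> Wp ra; have ha := level_pointP ra.
have pl : prolonged_path Phi v (s, x) (level_point h Phi a x).
  by right; apply/flow_lineP; exists (level_time h Phi a x).
split; first by exists (level_point h Phi a x).
by rewrite -{1}ha path_pointE.
Qed.

Lemma path_point_end s (x : M) : Wh (s, x) -> path_point h Phi v (s, x) (h x) = x.
Proof. by move=> Wp; apply: path_pointE => //; right; exact: flow_line_self. Qed.

Lemma break_h s o (u x : M) y : Wh (s, x) -> ~ crit h x -> Wplus Phi u x -> crit h u -> Wminus Phi u y ->
  o = flow_line Phi x -> forall a, h u < a ->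
  path_point h Phi v (rcons s (o, u), y) a = path_point h Phi v (s, x) a /\
  (available a (rcons s (o, u), y) <-> available a (s, x)).
Proof.
move=> Wp nx Px hu Wy -> a ua; apply: path_point_set => z hz.
rewrite /prolonged_path /= broken_points_rcons; split; last first.
  by move=> [a1|a1]; left; [left|right; left].
move=> [[a1|[a1|a1]]|a1]; [by left|by right| |].
  by move: ua; rewrite -hz a1 ltxx.
move/flow_lineP: a1 hz => [t ->] hz; have := Wminus_le hPhi hMS t Wy; rewrite hz => h1.
by move: ua; rewrite ltNge h1.
Qed.

Lemma What_nil (x : M) : Wminus Phi v x -> Wh ([::], x).
Proof. by move=> Wx; exists v; split => //; right. Qed.

Lemma What_flow s (x : M) t : Wh (s, x) -> Wh (s, Phi t x).
Proof. by move=> [w [h1 h2 h3 h4]]; exists w; split => //; exact: Wminus_flow. Qed.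

Lemma What_rcons s (x u y : M) : Wh (s, x) ->
  (forall w, crit h w -> Wminus Phi w x -> crit_lt h u w) ->
  crit h u -> Wplus Phi u x -> Wminus Phi u y -> Wh (rcons s (flow_line Phi x, u), y).
Proof.
move=> [w [/= hw wv Bw Wx]] lt hu Px Wy.
have B : is_broken h Phi v (rcons s (flow_line Phi x, u)) u.
  by apply/is_broken_rcons; exists w; split => //; [exact: lt|exists x].
by exists u; split => //; exact: is_broken_le B.
Qed.

Lemma What_inv s (y : M) : Wh (s, y) -> (s = [::] /\ Wminus Phi v y) \/
  exists s' x u, [/\ s = rcons s' (flow_line Phi x, u), Wh (s', x) /\ ~ crit h x, crit h u, Wplus Phi u x &
    Wminus Phi u y].
Proof.
case/lastP: s => [|s [l u]].
  by move=> [w [/= hw _ <- Wy]]; left.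
move=> [w [/= hw _ /is_broken_rcons [w' [h1 h2 h3 [x [Wx Px] ->] h5]] Wy]]; right.
exists s, x, u; split => //; last by rewrite h5.
split; last exact: traj_ncrit h3 Wx Px.
by exists w'; split => //; [exact: is_broken_crit h1|exact: is_broken_le h1].
Qed.

Lemma What_h_le s (x : M) : Wh (s, x) -> h x <= h v.
Proof.
move=> [w [/= _ /crit_le_h wv _ /(Wminus_h hPhi hMS) xw]]; exact: le_trans xw wv.
Qed.

(** Induction from the lower end: a level below the last break is met on the last flow line, one
    above it on the path before the break; the break itself is excluded by regularity. *)
Lemma regular_available s (x : M) a : Wh (s, x) -> regular a -> h x <= a < h v -> available a (s, x).
Proof.
elim/last_ind: s x => [|s ou IH] x Wp ra /andP[xa av].
  have [[_ Wx]|[s' [x' [u [/(congr1 size)]]]]] := What_inv Wp; last by rewrite size_rcons.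
  have [|t _ ta] := Wminus_level hPhi hMS (a := a) Wx; first by rewrite xa.
  by have [] // := @reaches_available _ _ a Wp; exists t.
have [[/(congr1 size)]|[s' [x' [u [E [Wp' nx'] hu Px Wx]]]]] := What_inv Wp; first by rewrite size_rcons.
have [au|ua|ua] := ltgtP a (h u); last by exfalso; apply: ra; exists u.
  have [|t _ ta] := Wminus_level hPhi hMS (a := a) Wx; first by rewrite xa.
  by have [] // := @reaches_available _ _ a Wp; exists t.
rewrite E; apply/(break_h Wp' nx' Px hu Wx erefl ua).2.
have ss' : s = s' by have := E => /rcons_inj [].
have [x'a|ax'] := leP (h x') a; first by rewrite -ss'; apply: IH; rewrite ?ss' // x'a.
have [|t _ ta] := Wplus_level hPhi hMS (a := a) Px; first by rewrite ua ltW.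
by have [] // := @reaches_available _ _ a Wp'; exists t.
Qed.

Lemma available_dec s (x : M) a : Wh (s, x) -> available a (s, x) -> regular a ->
  reaches h Phi a x \/ exists s' x' u, [/\ s = rcons s' (flow_line Phi x', u), Wh (s', x') /\ ~ crit h x',
    crit h u, Wplus Phi u x' & Wminus Phi u x] /\ h u < a.
Proof.
move=> Wp [y [py hy]] ra.
have [/flow_lineP [t yE]|nl] := pselect (flow_line Phi x y); first by left; exists t; rewrite -yE.
case: py => // bp; right.
have [[sE Wx]|[s' [x' [u [E [Wp' nx'] hu Px Wx]]]]] := What_inv Wp.
  by exfalso; apply: ra; move: bp; rewrite sE /= => yv; exists v => //; rewrite -hy yv.
exists s', x', u; split => //; rewrite ltNge; apply/negP => au.
move: bp; rewrite E /= broken_points_rcons => -[bp|[bp|bp]].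
- have [w [/= _ _ Bw Wx']] := Wp'; have [h1 h2 h3] := broken_points_h Bw.
  have /andP[wy _] := h2 _ bp.
  have uw : h u < h w.
    by apply: lt_le_trans (Wminus_h hPhi hMS Wx'); have := Wplus_gt hPhi hMS 0 Px nx'; rewrite f0.
  by clear -uw wy hy au; lra.
- by move/flow_lineP: bp hy => [t ->]; have := Wplus_gt hPhi hMS t Px nx'; lra.
- by apply: ra; exists u => //; rewrite -hy bp.
Qed.

(* The point [m] lies on the path [(s, x)], after the breaks recorded in [s'],
   and the flow line of [m] either contains [x] or ends at a further break [u]. *)
Definition continues s' (m : M) s (x : M) : Prop :=
  (s = s' /\ exists t, x = Phi t m) \/
  exists u s'', [/\ crit h u, Wplus Phi u m, s = s' ++ (flow_line Phi m, u) :: s'',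
    h x <= h u /\ (s'' = [::] -> Wminus Phi u x) &
    s'' <> [::] -> exists u2, [/\ crit h u2, h x <= h u2 & h u2 < h u]].

(** Breaks below the level [a] are removed one at a time from the lower end. By [break_h] nothing
    observed from [a] upwards changes, while [continues] retains the necessary information on the
    part cut off. *)
Lemma truncate s (x : M) a : Wh (s, x) -> available a (s, x) -> regular a ->
  exists s' m, [/\ Wh (s', m), h m = a, m = path_point h Phi v (s, x) a,
    forall b, a <= b -> path_point h Phi v (s', m) b = path_point h Phi v (s, x) b /\
       (available b (s', m) <-> available b (s, x)) &
    continues s' m s x].
Proof.
have TR s1 (x1 : M) : Wh (s1, x1) -> reaches h Phi a x1 ->
  exists s' m, [/\ Wh (s', m), h m = a, m = path_point h Phi v (s1, x1) a,
    forall b, a <= b -> path_point h Phi v (s', m) b = path_point h Phi v (s1, x1) b /\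
       (available b (s', m) <-> available b (s1, x1)) &
    continues s' m s1 x1].
  move=> Wp rx; have [_ pE] := reaches_available Wp rx.
  exists s1, (level_point h Phi a x1); split; [exact: What_flow|exact: level_pointP|by []| |].
    by move=> b _; split; [exact: path_point_flow|exact: available_flow].
  left; split => //; exists (- level_time h Phi a x1).
  by rewrite /level_point -(flowD hPhi) subrr f0.
elim/last_ind: s x => [|s ou IH] x Wp av ra; have [rx|[s' [x' [u [[E [Wp' nx'] hu Px Wx] ua]]]]] := available_dec Wp av ra.
- exact: TR.
- by move: E => /(congr1 size); rewrite size_rcons.
- exact: TR.
have ss' : s = s' by have := E => /rcons_inj [].
subst s'; have [|s2 [m [W2 hm mE agr ct]]] := IH _ Wp' _ ra.
  by apply/(break_h Wp' nx' Px hu Wx erefl ua).2; rewrite -E.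
exists s2, m; split => //.
- by rewrite mE E (break_h Wp' nx' Px hu Wx erefl ua).1.
- move=> b ab; have [e1 e2] := agr b ab.
  have [e3 e4] := break_h Wp' nx' Px hu Wx erefl (lt_le_trans ua ab).
  by rewrite E e3; split => //; apply: (iff_trans e2); apply: iff_sym.
have xu := Wminus_h hPhi hMS Wx.
have ux' : h u < h x' by have := Wplus_gt hPhi hMS 0 Px nx'; rewrite f0.
right; case: ct => [[ss2 [t xE]]|[u1 [s3 [c1 P1 E1 [x'u1 _] _]]]].
  exists u, [::]; split => //.
    have -> : m = Phi (- t) x' by rewrite xE -(flowD hPhi) subrr f0.
    exact: Wplus_flow.
  by rewrite E -ss2 cats1 xE flow_line_flow.
exists u1, (rcons s3 (flow_line Phi x', u)); split => //.
- by rewrite E E1 rcons_cat rcons_cons.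
- split; last by move/(congr1 size); rewrite size_rcons.
  lra.
- by move=> _; exists u; split => //; lra.
Qed.

(** A break between the levels [a] and [b] would contribute a critical value there; hence both
    points lie on one flow line, and each is obtained from the other by the flow. *)
Lemma path_connect p a b : Wh p -> available a p -> available b p -> regular a -> regular b ->
  a <= b -> (forall c, critval h c -> ~ a <= c <= b) ->
  [/\ reaches h Phi b (path_point h Phi v p a), reaches h Phi a (path_point h Phi v p b),
      level_point h Phi b (path_point h Phi v p a) = path_point h Phi v p b &
      level_point h Phi a (path_point h Phi v p b) = path_point h Phi v p a].
Proof.
case: p => s x Wp aa ab ra rb leab nc; have [s' [m [W' hm mE agr _]]] := truncate Wp aa ra.
have [e1 e2] := agr b leab; have [rm|] := available_dec W' (e2.2 ab) rb; last first.
  move=> [s1 [x1 [u [[_ _ hu _ Wm] ub]]]]; exfalso; apply: (nc (h u)); first by exists u.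
  by rewrite -hm (Wminus_h hPhi hMS Wm) ltW.
have [_ e3] := reaches_available W' rm; rewrite -e1 -mE e3.
have nm : ~ crit h m by move=> cm; apply: ra; exists m.
have ra' : reaches h Phi a m by exists 0; rewrite f0.
split => //.
  by rewrite /level_point; apply/(reaches_flow hPhi).
by rewrite [level_point h Phi b m]/level_point (level_point_flow hPhi hMS) // -[in LHS]hm (level_point_self hPhi hMS).
Qed.

End FixedV.
End BrokenPaths.

(** * Critical values of a proper Morse function *)

Section CriticalValues.
Context {R : realType} {n : nat}.
Local Notation E n := 'rV[R]_n.
Variables (M : smooth_manifold R n) (h : M -> R) (X : vector_field M) (Phi : R -> M -> M).
Hypotheses (hPhi : is_flow X Phi) (hMS : morse_smale h X Phi).
Let f0 := flow0 hPhi.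

Lemma slab_compact a b : compact [set x : M | a <= h x <= b].
Proof.
have [_ pr _ _] := hMS; have := pr _ (@segment_compact R a b).
by congr compact; apply/seteqP; split=> x /=; rewrite in_itv.
Qed.

(** Near a critical point the normal form admits no other one; near a noncritical point some partial
    derivative stays nonzero. *)
Lemma crit_nbhs y : nbhs y (fun w => crit h w -> h w = h y).
Proof.
have [cy|ny] := pselect (crit h y).
  have [c [r [[Ac cv] r0 cE Hh HX]]] := gl_chart hMS cy.
  apply: filterS (cdom_nbhs Ac cv) => w cw hw; congr h.
  by rewrite -(cinvK Ac cw) (gl_crit Ac cw hw Hh) -(gl_crit Ac cv cy Hh) cinvK.
have [c [Ac [cy [i pi]]]] : exists c, atlas M c /\ cdom c y /\ exists i, partial i (h \o cinv c) (cmap c y) != 0.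
  apply: contrapT => H; apply: ny => c Ac cy i; apply/eqP; apply: contrapT => /negP pi.
  by apply: H; exists c; split => //; split => //; exists i.
have N := cinf_neq0 (cinf_partial i (smooth_function_cinf (h_smooth hMS) Ac cy)) pi.
apply: filterS (filterI (cdom_nbhs Ac cy) (cmap_nbhs Ac cy N)) => w [cw /= pw] hw.
by move: pw; rewrite hw // eqxx.
Qed.

(** Otherwise critical points with values close to, but different from, [c] cluster at some [y] in a
    compact slab. By [crit_nbhs] such points have the value [h y] near [y], so [h y] differs from
    [c]; but points closer to [c] than [h y] cluster there as well. *)
Lemma critval_isolated c : exists2 e, 0 < e & forall b, critval h b -> `|b - c| < e -> b = c.
Proof.
apply: contrapT => H.
pose F := filter_from [set e : R | 0 < e] (fun e => [set w : M | crit h w /\ 0 < `|h w - c| < e]).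
have PF : ProperFilter F.
  apply: filter_from_proper; last first.
    move=> e /= e0; apply: contrapT => /set0P/negP/negPn/eqP w0; apply: H; exists e => // b [w cw <-] we.
    apply/eqP; rewrite -subr_eq0 -normr_eq0; apply: contrapT => /negP wn.
    have : [set w : M | crit h w /\ 0 < `|h w - c| < e] w by split => //; rewrite we lt_def wn normr_ge0.
    by rewrite w0.
  apply: filter_from_filter; first by exists 1 => /=.
  move=> e d /= e0 d0; exists (Num.min e d); first by rewrite /= lt_min e0.
  by move=> w /= [cw]; rewrite lt_min => /andP[w0 /andP[we wd]]; rewrite w0 we wd.
have FK : F [set x : M | c - 1 <= h x <= c + 1].
  by exists 1 => //= w /= [_ /andP[_]]; rewrite ltr_norml; lra.
have [y [_ cl]] := slab_compact PF FK.
have FA e : 0 < e -> F [set w : M | crit h w /\ 0 < `|h w - c| < e] by exists e.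
have [w [[cw /andP[w0 _]] hw]] := cl _ _ (FA 1 ltr01) (crit_nbhs y).
have y0 : 0 < `|h y - c| by rewrite -(hw cw).
have [w' [[cw' /andP[_ wy]] hw']] := cl _ _ (FA _ y0) (crit_nbhs y).
by move: wy; rewrite (hw' cw') ltxx.
Qed.

(** A flow line that stays above [a] remains in a compact slab and has a cluster point [y] as time
    tends to infinity. Then [h y] bounds [h] from below along it, yet near the noncritical point [y]
    the flow for time [1] leads below [h y]. *)
Lemma descend x a : a <= h x -> (forall c, critval h c -> ~ a <= c <= h x) -> reaches h Phi a x.
Proof.
move=> ax nc; have [[t0 t00 ht0]|H] := pselect (exists2 t, 0 <= t & h (Phi t x) <= a).
  have [|t _ ta] := @flow_ivt _ _ _ _ _ _ hPhi hMS x _ _ a t00; first by rewrite ht0 f0.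
  by exists t.
exfalso; have {}H t : 0 <= t -> a < h (Phi t x) by move=> t0; rewrite ltNge; apply/negP => ?; apply: H; exists t.
have FK : (Phi^~ x @ +oo) [set z : M | a <= h z <= h x].
  exists 0; split; first exact: num_real.
  move=> t /= t0; rewrite (ltW (H t (ltW t0))) /=.
  by have := h_flow_le hPhi hMS x (ltW t0); rewrite f0.
have [y [/= /andP[ay yx] cl]] := slab_compact _ FK.
have TL t (B : set M) : nbhs y B -> exists2 s, t <= s & B (Phi s x).
  move=> By; have FT : (Phi^~ x @ +oo) [set z | exists2 s, t <= s & z = Phi s x].
    by exists t; split; [exact: num_real|move=> s /= ts; exists s => //; exact: ltW].
  by have [z [[s ts ->] Bz]] := cl _ _ FT By; exists s.
have ny : ~ crit h y by move=> cy; apply: (nc (h y)); [exists y|rewrite ay].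
have hy t : h y <= h (Phi t x).
  rewrite leNgt; apply/negP => ty; have [s ts] := TL t _ (h_gt hMS ty).
  by rewrite ltNge (h_flow_le hPhi hMS).
have y1 : h (Phi 1 y) < h y by have := h_flow_decr hPhi hMS ny (@ltr01 R); rewrite f0.
have [c Ac cy] := atlas_at y.
have sc : sm (cinv c \o id) (cmap c y) by apply: sm_cinv => //; [exact: cimg_cmap|exact: cinfv_id].
have sP : sm (fun z => Phi 1 (cinv c z)) (cmap c y) by apply: (flow_sm hPhi sc); exact: cinfC.
have : nbhs y (fun z => h (Phi 1 z) < h y).
  have N := sm_cts sP (U := fun z => h z < h y); have {N} : nr (cmap c y) (fun z => h (Phi 1 (cinv c z)) < h y).
    by apply: N; rewrite cinvK //; exact: (h_lt hMS).
  move=> /(cmap_nbhs Ac cy) N; apply: filterS (filterI (cdom_nbhs Ac cy) N) => z [cz /=].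
  by rewrite cinvK.
move=> /(TL 0) [s _]; rewrite -(flowD hPhi) => sy.
by have := hy (s + 1); rewrite leNgt sy.
Qed.

Lemma slab_noncritical c (x : M) b : slab h c x -> critval h b -> b < c -> b < h x.
Proof.
move=> [cx _] cb bc; rewrite -lte_fin; apply: le_lt_trans cx.
by apply: ereal_sup_ubound; exists b.
Qed.

Lemma slab_noncritical_gt c (x : M) b : slab h c x -> critval h b -> c < b -> h x < b.
Proof.
move=> [_ cx] cb bc; rewrite -lte_fin; apply: lt_le_trans cx _.
by apply: ereal_inf_lbound; exists b.
Qed.

Lemma slab_near c (x : M) : slab h c x -> nbhs x (slab h c).
Proof.
move=> [cx xc]; apply: filterI.
  case: (crit_below h c) cx => [b|//|_]; last by apply: filterS filterT => z _; exact: ltNyr.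
  by rewrite lte_fin => /(h_gt hMS); apply: filterS => z; rewrite lte_fin.
case: (crit_above h c) xc => [b|_|//]; last by apply: filterS filterT => z _; exact: ltry.
by rewrite lte_fin => /(h_lt hMS); apply: filterS => z; rewrite lte_fin.
Qed.

(* The infimum of the critical values above [t] is attained since they are isolated. *)
Lemma next_critval t b0 : critval h b0 -> t <= b0 ->
  exists c, [/\ critval h c, t <= c <= b0 & forall b, critval h b -> t <= b -> c <= b].
Proof.
move=> cb tb; pose S := [set b | critval h b /\ t <= b].
have S0 : S !=set0 by exists b0.
have lbS : has_lbound S by exists t => b [].
have cl b : S b -> inf S <= b by move=> Sb; apply: ge_inf.
have [e e0 He] := critval_isolated (inf S).
have [b [Sb tb'] bi] := inf_adherent e0 (conj S0 lbS).
have bE : b = inf S.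
  by apply: He => //; rewrite ger0_norm ?subr_ge0 ?cl //; move: bi; lra.
exists b; split => //; first by rewrite tb' bE cl.
by move=> b' cb' tb''; rewrite bE; apply: cl.
Qed.

(** [c] is the least critical value not below [h x]. The isolation radius at [h x] makes both
    inequalities strict, including the case in which a neighbouring critical value does not
    exist. *)
Lemma slab_exists v x : crit h v -> h x <= h v -> exists c, [/\ critval h c, c <= h v & slab h c x].
Proof.
move=> hv xv; have [|c [cc /andP[xc cv] H]] := @next_critval (h x) (h v) _ xv; first by exists v.
exists c; split => //.
have [e e0 He] := critval_isolated (h x).
have far b : critval h b -> b != c -> (b < c -> b <= h x - e) /\ (c < b -> h x + e <= b).
  move=> cb bc; have [be|be] := ltP `|b - h x| e.
    have bE := He b cb be; have cb' : c <= b by apply: H => //; rewrite bE.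
    by move: bc; rewrite eq_le cb' bE xc.
  move: be; case: (ger0P (b - h x)) => h0.
    move=> be; have cb' : c <= b by apply: H => //; lra.
    by split; lra.
  by move=> be; split; lra.
split.
  apply: (@le_lt_trans _ _ (h x - e)%:E); last by rewrite lte_fin; lra.
  by apply: ge_ereal_sup => _ [b [cb bc] <-]; rewrite lee_fin; apply: (far b cb _).1 => //; rewrite lt_eqF.
apply: (@lt_le_trans _ _ (h x + e)%:E); first by rewrite lte_fin; lra.
by apply: le_ereal_inf_tmp => _ [b [cb bc] <-]; rewrite lee_fin; apply: (far b cb _).2 => //; rewrite gt_eqF.
Qed.

End CriticalValues.

(** * Charts around broken trajectories *)

Section NatCoordinates.
Context {R : realType}.
Local Notation E n := 'rV[R]_n.

(** Coordinates are indexed by natural numbers and extended by zero, so that blocks of coordinates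
    of vectors of different lengths can be compared without casts. *)
Definition cx q (d : E q) (i : nat) : R := if insub i is Some l then d 0 l else 0.

Lemma cxE q (d : E q) (l : 'I_q) : cx d l = d 0 l.
Proof. by rewrite /cx insubT //= => p; congr (d 0 _); apply: val_inj. Qed.

Lemma cx_lt q (d : E q) i (p : (i < q)%N) : cx d i = d 0 (Ordinal p).
Proof. by rewrite -cxE. Qed.

Lemma cx_row q (f : nat -> R) j : cx (\row_(i < q) f i) j = if (j < q)%N then f j else 0.
Proof. by case: ifP => p; [rewrite cx_lt mxE|rewrite /cx insubF]. Qed.

Lemma cx_out q (d : E q) i : (q <= i)%N -> cx d i = 0.
Proof. by move=> p; rewrite /cx insubF // ltnNge p. Qed.

Lemma cx_eq q (d d' : E q) : (forall i, (i < q)%N -> cx d i = cx d' i) -> d = d'.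
Proof. by move=> H; apply/rowP => l; have := H l (ltn_ord l); rewrite !cxE. Qed.

Lemma cinf_cx q p (f : E q -> E p) w i : cinfv f w -> cinf (fun w => cx (f w) i) w.
Proof.
move=> sf; have [ip|ip] := ltnP i p.
  by apply: cinf_ext (sf (Ordinal ip)) => y; rewrite cx_lt.
by apply: (@cinf_ext _ _ (fun=> 0)); [move=> y; rewrite cx_out|exact: cinfC].
Qed.

Definition emb q p (d : E q) : E p := \row_(j < p) cx d j.

Lemma cx_emb q p (d : E q) j : cx (emb p d) j = if (j < p)%N then cx d j else 0.
Proof. exact: cx_row. Qed.

Lemma cinfv_emb q p r (f : E q -> E p) w : cinfv f w -> cinfv (fun w => emb r (f w)) w.
Proof. by move=> sf l; apply: cinf_ext (cinf_cx l sf) => y; rewrite mxE. Qed.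

Lemma cx_le_norm q (d : E q) i : `|cx d i| <= `|d|.
Proof. by have [iq|iq] := ltnP i q; [rewrite cx_lt coord_le_norm|rewrite cx_out // normr0]. Qed.

Lemma cinf_nsq q p (P : pred 'I_p) (f : E q -> E p) w : cinfv f w -> cinf (fun w => nsq P (f w)) w.
Proof.
move=> sf; apply: (cinf_big _ (f := fun j w => f w 0 j ^+ 2)) => j _.
by apply: cinf_ext (cinfM (sf j) (sf j)) => y; rewrite expr2.
Qed.

End NatCoordinates.

Section Gcharts.
Context {R : realType} {n : nat}.
Local Notation E n := 'rV[R]_n.
Variables (M : smooth_manifold R n) (h : M -> R) (X : vector_field M) (Phi : R -> M -> M).
Hypotheses (hPhi : is_flow X Phi) (hMS : morse_smale h X Phi).
Local Notation broken := (broken M).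
Let f0 := flow0 hPhi.
Variables (v : M) (hv : crit h v).
Local Notation Wh := (What h Phi v).
Local Notation m := (morse_index h v).
Local Notation regular := (@regular R n M h).

Lemma morse_index_le u : (morse_index h u <= n)%N.
Proof. by apply/bigmax_leqP => -[k kn] _ /=; rewrite -ltnS. Qed.

(* [None] observes the end point of a path, [Some a] its point on the level [a]. *)
Definition obs (p : broken * M) (i : option R) : M :=
  if i is Some a then path_point h Phi v p a else p.2.

Definition avail (p : broken * M) (i : option R) : Prop :=
  if i is Some a then regular a /\ available h Phi v a p else True.

Definition idx (A : seq R) (i : option R) := if i is Some a then a \in A else true.

(* A chart at a broken trajectory, with [gP] the parametrization of \hat W^-_v by
   a neighbourhood [gV] of R^m intersected with the half spaces on which the
   first [size gcs] coordinates are nonnegative. Where the [i]-th of these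
   vanishes, the path breaks at the [i]-th point of [gcs]. The inverse of [gP] is
   the composition of [obs] with a map [gL] defined on all families of points of
   [M] that satisfy [gO], whether or not these are observed on a path; it only
   depends on the end point and the levels in [gA], and is smooth as such. *)
Record gchart := GChart { gcs : seq M; gV : E m -> Prop; gP : E m -> broken * M;
  gA : seq R; gO : (option R -> M) -> Prop; gL : (option R -> M) -> E m }.

Definition gD G d := gV G d /\ forall i, (i < size (gcs G))%N -> 0 <= cx d i.

(** By [gv_L2] any path whose observations satisfy [gO] belongs to the chart, so chart domains are
    conditions on observations. [gv_A2] puts the end point below the levels in [gA], which ensures
    that these are met ([avail_gA]). [gv_obs] provides plots that are smooth on full neighbourhoods
    although paths exist on [gD] only. *)
Record gvalid (G : gchart) : Prop := GValid {
  gv_size : (size (gcs G) <= m)%N;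
  gv_V : forall d, gV G d -> nr d (gV G);
  gv_What : forall d, gD G d -> Wh (gP G d);
  gv_lab : forall d, gD G d ->
    map snd (gP G d).1 = mask [seq cx d i == 0 | i <- iota 0 (size (gcs G))] (gcs G);
  gv_obs : forall d i, gD G d -> avail (gP G d) i -> exists g, sm g d /\
    nr d (fun d' => gD G d' -> avail (gP G d') i /\ obs (gP G d') i = g d');
  gv_L1 : forall d, gD G d -> gO G (obs (gP G d)) /\ gL G (obs (gP G d)) = d;
  gv_L2 : forall p, Wh p -> gO G (obs p) -> gD G (gL G (obs p)) /\ gP G (gL G (obs p)) = p;
  gv_A : forall a, a \in gA G -> regular a /\ a < h v;
  gv_A2 : forall y a, gO G y -> a \in gA G -> h (y None) < a;
  gv_ext : forall y y', (forall i, idx (gA G) i -> y i = y' i) -> gO G y -> gO G y' /\ gL G y = gL G y';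
  gv_smooth : forall q (f : option R -> E q -> M) w, (forall i, idx (gA G) i -> sm (f i) w) ->
    gO G (f^~ w) -> nr w (fun w' => gO G (f^~ w')) /\ cinfv (fun w' => gL G (f^~ w')) w }.

Lemma avail_gA G p a : gvalid G -> Wh p -> gO G (obs p) -> a \in gA G -> avail p (Some a).
Proof.
case: p => s x VG Wp Op aA; have [ra av] := gv_A VG aA; split => //.
by apply: (regular_available hPhi hMS hv Wp ra); rewrite av (ltW (gv_A2 VG Op aA)).
Qed.

Lemma regular_ncrit x a : regular a -> reaches h Phi a x -> ~ crit h x.
Proof. by move=> ra [t ta] cx; apply: ra; exists x => //; rewrite -ta (flow_crit hPhi hMS). Qed.

(** A level met on the flow line of the end point is observed through the end point alone, whatever
    the earlier part of the path. *)
Lemma obs_reach q (D : E q -> Prop) (P : E q -> broken * M) (g : E q -> M) d a : sm g d ->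
  nr d (fun d' => D d' -> Wh (P d') /\ (P d').2 = g d') -> regular a -> reaches h Phi a (g d) ->
  exists g', sm g' d /\ nr d (fun d' => D d' -> avail (P d') (Some a) /\ obs (P d') (Some a) = g' d').
Proof.
move=> sg H ra rg; have [N S] := level_point_sm hPhi hMS sg (regular_ncrit ra rg) rg.
exists (fun d => level_point h Phi a (g d)); split => //; apply: nrW (nrI H N) => y [h1 h2] /h1.
case: (P y) => s x /= [Wp xg]; rewrite -xg in h2 *.
by have [e1 e2] := reaches_available hPhi hMS Wp h2.
Qed.

Definition set_end (y : option R -> M) (x : M) (i : option R) := if i is Some _ then y i else x.

(** The unstable disc of [v] in normal form. [gO] only asks for closeness to [v]; for the end points
    of paths the vanishing of the stable part is then automatic. *)
Definition gl_disc (c : chart R n M) (r : R) : gchart := GChart [::]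
  (fun y => nsq predT (emb n y) < r ^+ 2 / 4) (fun y => ([::], cinv c (emb n y))) [::]
  (fun y => [/\ cdom c (y None), nsq (pos_part m) (cmap c (y None)) < r ^+ 2 / 4 &
      nsq (neg_part m) (cmap c (y None)) < r ^+ 2 / 4])
  (fun y => emb m (cmap c (y None))).

Lemma nsq_predT (y : E n) i : nsq predT y = nsq (neg_part i) y + nsq (pos_part i) y.
Proof. exact: nsq_split. Qed.

Lemma nsq_emb_pos (y : E m) : nsq (pos_part m) (emb n y) = 0.
Proof. by apply: big1 => j; rewrite /pos_part => mj; rewrite mxE cx_out // expr0n. Qed.

Lemma emb_proj (y : E n) : nsq (pos_part m) y = 0 -> emb n (emb m y) = y.
Proof.
move=> /nsq0 H; apply/rowP => j; rewrite mxE cx_emb; case: ltnP => jm; first by rewrite cxE.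
by rewrite H.
Qed.

Lemma proj_emb (y : E m) : emb m (emb n y) = y.
Proof.
apply/rowP => j; rewrite mxE cx_emb (leq_trans (ltn_ord j)) ?cxE //; exact: morse_index_le.
Qed.

Record gl_model (u : M) (c : chart R n M) (r : R) : Prop := GlModel {
  gl_atlas : atlas M c; gl_cdom : cdom c u; gl_r0 : 0 < r;
  gl_cE : cimg c = [set y : 'rV[R]_n | \sum_(j < n) y 0 j ^+ 2 < r ^+ 2];
  gl_Hh : forall y, cimg c y -> h (cinv c y) =
           h u - 2^-1 * (\sum_(j < n | (j < morse_index h u)%N) y 0 j ^+ 2)
               + 2^-1 * (\sum_(j < n | (morse_index h u <= j)%N) y 0 j ^+ 2);
  gl_HX : forall y, cimg c y -> forall j : 'I_n,
           X c (cinv c y) 0 j = if (j < morse_index h u)%N then y 0 j else - y 0 j }.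

Lemma gl_model_ex u : crit h u -> exists c r, gl_model u c r.
Proof. by move=> hu; have [c [r [[Ac cv] r0 cE Hh HX]]] := gl_chart hMS hu; exists c, r. Qed.

Lemma glm_unstable u c r y : crit h u -> gl_model u c r -> cimg c y ->
  nsq (pos_part (morse_index h u)) y = 0 -> Wminus Phi u (cinv c y).
Proof. by move=> hu [? ? ? cE ? ?] cy py; apply: (gl_unstable hPhi hu _ _ cE). Qed.

Lemma glm_stable u c r y : crit h u -> gl_model u c r -> cimg c y ->
  nsq (neg_part (morse_index h u)) y = 0 -> Wplus Phi u (cinv c y).
Proof. by move=> hu [? ? ? cE ? ?] cy py; apply: (gl_stable hPhi hu _ _ cE). Qed.

Section Base.
Variables (c : chart R n M) (r : R).
Hypothesis GL : gl_model v c r.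
Let Ac := gl_atlas GL.

Lemma gl_disc_cimg y : gV (gl_disc c r) y -> cimg c (emb n y).
Proof.
move=> /= Vy; rewrite (gl_cE GL) /=; apply: lt_le_trans Vy _.
by have := sqr_ge0 r; lra.
Qed.

Lemma is_broken_refl s w : is_broken h Phi w s w -> s = [::].
Proof.
case: s => [//|[l u] s] /= [_ [_ uw] _ /is_broken_le /crit_le_h wu].
by exfalso; lra.
Qed.

Lemma gl_disc_valid : gvalid (gl_disc c r).
Proof.
have Wd y : gV (gl_disc c r) y -> Wh ([::], cinv c (emb n y)).
  move=> Vy; apply: What_nil => //; apply: (glm_unstable hv GL _ (nsq_emb_pos _)).
  exact: gl_disc_cimg.
have Vn y : gV (gl_disc c r) y -> nr y (gV (gl_disc c r)).
  move=> /= Vy; have F : cinf (fun y : E m => nsq predT (emb n y)) y.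
    by apply: cinf_nsq; apply: cinfv_emb; exact: cinfv_id.
  exact: cinf_lt F Vy.
have Sd y : gV (gl_disc c r) y -> sm (fun y => cinv c (emb n y)) y.
  move=> Vy; apply: sm_cinv => //; first exact: gl_disc_cimg.
  by apply: cinfv_emb; exact: cinfv_id.
split => //.
- by move=> d [Vd _]; exact: Wd.
- move=> d i [Vd _] av; case: i av => [a [ra ava]|_]; last first.
    by exists (fun y => cinv c (emb n y)); split; [exact: Sd|apply: nrT].
  apply: (@obs_reach _ _ _ (fun y => cinv c (emb n y))) => //; first exact: Sd.
    by apply: nrT => d' [Vd' _]; split => //; exact: Wd.
  have [//|[s1 [x1 [u [[]]]]]] := available_dec hPhi hMS hv (Wd d Vd) ava ra.
  by move=> /(congr1 size); rewrite size_rcons.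
- move=> d [Vd _] /=; have cd := gl_disc_cimg Vd; rewrite cmapK // proj_emb nsq_emb_pos.
  split => //; split; [exact: cimg_cdom|by rewrite divr_gt0 // exprn_gt0 // (gl_r0 GL)|].
  by apply: le_lt_trans Vd; rewrite (nsq_predT _ m) nsq_emb_pos addr0.
(* In backward time the end point never rises above the level of [v], so near [v] it has no stable
   part and lies on the disc. Its backward limit is then [v], and the path is unbroken since [h]
   drops at each break. *)
- move=> [s x] [w [/= hw wv Bw Wx]] /= [cx px mx].
  have wx := crit_le_h wv.
  have p0 : nsq (pos_part m) (cmap c x) = 0.
    apply/eqP; rewrite eq_le nsq_ge0 andbT leNgt; apply/negP => p0.
    have [|T] := gl_exit_back hPhi Ac (gl_r0 GL) (gl_cE GL) (gl_Hh GL) (gl_HX GL) cx _ mx; first by rewrite p0.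
    by rewrite ltNge (le_trans (Wminus_le hPhi hMS _ Wx)).
  have Wv : Wminus Phi v x.
    rewrite -(cinvK Ac cx); apply: (glm_unstable hv GL) => //; exact: cimg_cmap.
  have s0 : s = [::] by apply: (@is_broken_refl _ v); rewrite {2}(Wminus_uniq Wv Wx).
  rewrite emb_proj // cinvK // s0; split => //; split => //=.
  by rewrite (nsq_predT _ m) emb_proj // p0 addr0.
- by move=> y y' /(_ None isT) /= <-.
- move=> q f w /(_ None isT) /= sf [cf pf mf].
  have [nf cf'] := sm_chart sf Ac cf; split; last exact: cinfv_emb cf'.
  apply: nrW (nrI nf (nrI (cinf_lt (cinf_nsq _ cf') pf) (cinf_lt (cinf_nsq _ cf') mf))).
  by move=> y [? [? ?]].
Qed.

End Base.

(** Transport along the flow: the new end point is moved back before the old chart reads it. *)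
Definition gflow (G : gchart) (t : R) : gchart := GChart (gcs G) (gV G)
  (fun d => ((gP G d).1, Phi t (gP G d).2)) (gA G)
  (fun y => gO G (set_end y (Phi (- t) (y None))) /\ forall a, a \in gA G -> h (y None) < a)
  (fun y => gL G (set_end y (Phi (- t) (y None)))).

Lemma obs_flow s x t : obs (s, Phi t x) = set_end (obs (s, x)) (Phi t x).
Proof. by apply/funext => -[a|] //=; rewrite (path_point_flow h hPhi). Qed.

Lemma avail_flow s x t i : avail (s, Phi t x) i <-> avail (s, x) i.
Proof. by case: i => [a|//]; split=> -[ra /(available_flow h hPhi)]. Qed.

Lemma set_end_obs p : set_end (obs p) p.2 = obs p.
Proof. by apply/funext => -[a|]. Qed.

Lemma set_endK y x x' : set_end (set_end y x) x' = set_end y x'.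
Proof. by apply/funext => -[a|]. Qed.

Lemma sm_flow q (f : E q -> M) w t : sm f w -> sm (fun w => Phi t (f w)) w.
Proof. by move=> sf; apply: (flow_sm hPhi sf); exact: cinfC. Qed.

Lemma sm_h_lt q (f : E q -> M) w a : sm f w -> h (f w) < a -> nr w (fun w' => h (f w') < a).
Proof. by move=> sf fa; apply: (sm_cts sf (U := fun z => h z < a)); exact: (h_lt hMS). Qed.

Lemma nr_all (T : eqType) (s : seq T) q (P : T -> E q -> Prop) w : (forall a, a \in s -> nr w (P a)) ->
  nr w (fun w' => forall a, a \in s -> P a w').
Proof.
elim: s => [|b s IH] H; first exact: nrT.
have h1 : nr w (P b) by apply: H; rewrite inE eqxx.
have h2 : nr w (fun w' => forall a, a \in s -> P a w') by apply: IH => a ia; apply: H; rewrite inE ia orbT.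
by apply: nrW (nrI h1 h2) => y [g1 g2] a; rewrite inE => /orP[/eqP ->|/g2].
Qed.

Lemma gflow_valid G t : 0 <= t -> gvalid G -> gvalid (gflow G t).
Proof.
move=> t0 VG; have inv x : Phi (- t) (Phi t x) = x by exact: flowK.
split; try by case: VG.
- by move=> d Dd /=; have := gv_What VG Dd; case: (gP G d) => s x; exact: (What_flow hPhi).
- move=> d i Dd av.
  have av' : avail (gP G d) i.
    by move: av => /=; case: (gP G d) => s x /= /avail_flow.
  have [g [sg ng]] := gv_obs VG Dd av'; case: i av av' ng => [a|] av av' ng.
    exists g; split => //; apply: nrW ng => d' H Dd'; have := H Dd'.
    by rewrite /=; case: (gP G d') => s x /= [[h1 h2] <-]; rewrite (path_point_flow h hPhi); split => //; split => //;
      exact/(available_flow h hPhi).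
  by exists (fun d => Phi t (g d)); split; [exact: sm_flow|apply: nrW ng => d' H /H /= [_ ->]].
- move=> d Dd; have [h1 h2] := gv_L1 VG Dd; have H3 a := gv_A2 (a := a) VG h1.
  rewrite /=; case E1: (gP G d) h1 h2 H3 => [s x] /= h1 h2 H3.
  rewrite obs_flow set_endK /= inv set_end_obs; split => //; split => // a aA.
  by apply: le_lt_trans (H3 a aA); have := h_flow_le hPhi hMS x t0; rewrite f0.
- move=> [s x] Wp /= [Op _]; have W' : Wh (s, Phi (- t) x) by exact: (What_flow hPhi).
  rewrite -obs_flow in Op *; have [h1 h2] := gv_L2 VG W' Op.
  by rewrite /gD /= h2 /= -(flowD hPhi) addNr f0.
- by move=> y a [_ H] /H.
- move=> y y' yy' [Oy Hy]; have y0 := yy' None isT.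
  have [i|h1 h2] := gv_ext VG (y' := set_end y' (Phi (- t) (y' None))) _ Oy.
    by case: i => [a|] ia; rewrite /= ?y0 // yy'.
  by split => //; split => //; rewrite -y0.
- move=> q f w sf [Of Hf]; pose f' i w := set_end (f^~ w) (Phi (- t) (f None w)) i.
  have sf' i : idx (gA G) i -> sm (f' i) w.
    by case: i => [a|] ia; [exact: sf|apply: sm_flow; exact: sf].
  have [h1 h2] := gv_smooth VG sf' Of; split => //.
  have h3 : nr w (fun w' => forall a, a \in gA G -> h (f None w') < a).
    by apply: nr_all => a aA; apply: sm_h_lt; [exact: sf|exact: Hf].
  by apply: nrW (nrI h1 h3) => y [].
Qed.

End Gcharts.

Section Completion.
Context {R : realType}.
Local Notation E n := 'rV[R]_n.

(** In the factorization [A = col_ebase A *m pid_mx p *m row_ebase A] the last factor is extended by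
    the identity to an invertible matrix of size [m]; this completes the columns of [A]. *)
Lemma unit_completion m p (A : 'M[R]_(m, p)) : (forall t : E p, exists x, x *m A = t) ->
  (p <= m)%N /\ exists2 C : 'M[R]_m, C \in unitmx & forall i (j : 'I_p) (j' : 'I_m), val j' = val j -> C i j' = A i j.
Proof.
move=> H; have fA : row_full A.
  by rewrite -sub1mx; apply/row_subP => i; have [x <-] := H (row i 1%:M); exact: submxMl.
have rA : \rank A = p by apply/eqP.
have pm : (p <= m)%N by rewrite -rA rank_leq_row.
split => //; pose P : 'M[R]_(m, p) := pid_mx p; pose Q : 'M[R]_(p, m) := pid_mx p.
pose K : 'M[R]_m := copid_mx p.
have QP : Q *m P = 1%:M by rewrite pid_mx_id // pid_mx_1.
have PQ : P *m Q = pid_mx p by rewrite pid_mx_id.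
have QK : Q *m K = 0 by rewrite mul_pid_mx_copid.
have KP : K *m P = 0 by rewrite mul_copid_mx_pid.
have KK : K *m K = K by rewrite copid_mx_id.
pose ext (V : 'M[R]_p) : 'M[R]_m := P *m V *m Q + K.
have extM V W : ext V *m ext W = ext (V *m W).
  rewrite /ext mulmxDl mulmxDr (mulmxDr K) KK.
  have -> : P *m V *m Q *m (P *m W *m Q) = P *m (V *m W) *m Q.
    by rewrite !mulmxA -(mulmxA (P *m V) Q P) QP mulmx1.
  by rewrite -!mulmxA QK !mulmxA KP !mul0mx !mulmx0 addr0 add0r.
have ext1 : ext 1%:M = 1%:M by rewrite /ext mulmx1 PQ /K /copid_mx addrC subrK.
pose C := col_ebase A *m ext (row_ebase A).
have CP : C *m P = A.
  rewrite /C /ext -mulmxA mulmxDl KP addr0 -!mulmxA QP mulmx1.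
  by rewrite -[RHS]mulmx_ebase rA mulmxA.
have uC : C \in unitmx.
  rewrite unitmx_mul col_ebase_unit /=.
  have /mulmx1_unit [] // : ext (row_ebase A) *m ext (invmx (row_ebase A)) = 1%:M.
  by rewrite extM mulmxV ?ext1 // row_ebase_unit.
exists C => //; move: C CP uC => C CP _ i l l' ll; have ll' : l' = l :> nat by [].
rewrite -CP mxE (bigD1 l') //= mxE ll' eqxx ltn_ord mulr1 big1 ?addr0 // => a al.
rewrite mxE; case: (eqVneq (a : nat) l) => [ae|_] /=; last by rewrite mulr0.
by case/negP: al; apply/eqP/val_inj; rewrite /= ae ll'.
Qed.

(** Turns the iterated derivatives in the definition of [tangent] into smoothness on R^1. *)
Lemma curve_cinf (f : R -> R) a : 0 < a -> (forall (t : R) k, `|t| < a -> derivable (derive1n k f) t 1) ->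
  forall w0 : E 1, `|w0 0 0| < a -> cinf (fun w : E 1 => f (w 0 0)) w0.
Proof.
move=> a0 H w0 w0a; exists [set w : E 1 | `|w 0 0| < a]; split.
- apply/nr_open => w wa; exists (a - `|w 0 0|); first by rewrite subr_gt0.
  move=> y yw /=; have := coord_le_norm (y - w) 0; rewrite coordB => h1.
  have := ler_normD (w 0 0) (y 0 0 - w 0 0); rewrite addrC subrK.
  by move: wa yw h1 => /=; lra.
- by [].
suff S k l : Ck k [set w : E 1 | `|w 0 0| < a] (fun w => derive1n l f (w 0 0)) by move=> k; exact: (S k 0%N).
have sh (g : R -> R) (w : E 1) : (fun t : R => g ((w + t *: delta_mx 0 0) 0 0)) = (fun t => g (w 0 0 + t)).
  by apply/funext => t; rewrite !mxE mulr1.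
have P (g : R -> R) : partial 0 (fun w : E 1 => g (w 0 0)) = (fun w => derive1 g (w 0 0)).
  apply/funext => w; rewrite /partial sh /derive1.
  have -> // : (fun t : R => t^-1 *: (g (w 0 0 + (t + 0)) - g (w 0 0 + 0))) = (fun t => t^-1 *: (g (t + w 0 0) - g (w 0 0))).
  by apply/funext => t; rewrite !addr0 [w 0 0 + t]addrC.
elim: k l => [|k IH] l.
  split => // w wa; apply: continuous_comp; first exact: coord_continuous.
  by apply: differentiable_continuous; apply/derivable1_diffP; exact: H.
split.
  move=> w wa; apply: continuous_comp; first exact: coord_continuous.
  by apply: differentiable_continuous; apply/derivable1_diffP; exact: H.
move=> i; rewrite (ord1 i); split.
  move=> w wa; rewrite sh; have := H _ l wa; rewrite /derivable /=.
  set f1 := (fun t : R => t^-1 *: _); set f2 := (fun t : R => t^-1 *: _).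
  have -> // : f1 = f2.
  by apply/funext => t; rewrite /f1 /f2 /= !addr0 [w 0 0 + _]addrC.
by rewrite P; exact: (IH l.+1).
Qed.

End Completion.

(** * Transversality and straightened coordinates *)

Section Straighten.
Context {R : realType} {n : nat}.
Local Notation E n := 'rV[R]_n.
Variables (M : smooth_manifold R n) (h : M -> R) (X : vector_field M) (Phi : R -> M -> M).
Hypotheses (hPhi : is_flow X Phi) (hMS : morse_smale h X Phi).
Let f0 := flow0 hPhi.
Variables (v : M) (hv : crit h v).
Local Notation Wh := (What h Phi v).
Local Notation m := (morse_index h v).
Local Notation gchart := (gchart h v).
Local Notation gvalid := (@gvalid R n M h Phi v).
Local Notation obs := (obs h Phi v).
Variables (G : gchart) (VG : gvalid G) (d0 : E m) (Dd0 : gD G d0).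
Local Notation k := (size (gcs G)).
Hypothesis cd0 : forall i, (i < k)%N -> cx d0 i = 0.
Let s := (gP G d0).1.
Let x0 := (gP G d0).2.
Let Wsx : Wh (s, x0).
Proof. by have := gv_What VG Dd0; rewrite /s /x0; case: (gP G d0). Qed.

(** Moving the end point inside its unstable manifold keeps the breaks [s], so by [gv_lab] all
    boundary coordinates stay zero. A level in [gA] is observed either at a constant point of the
    broken part or through the flow line of the end point. *)
Lemma centered_curve w' q (g : E q -> M) w : sm g w -> g w = x0 -> Wminus Phi w' x0 ->
  nr w (fun y => Wminus Phi w' (g y)) -> exists e : E q -> E m, [/\ cinfv e w, e w = d0 &
    nr w (fun y => [/\ gD G (e y), gP G (e y) = (s, g y) & forall i, (i < k)%N -> cx (e y) i = 0])].
Proof.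
move=> sg gw Wx0 Wg; have W' : nr w (fun y => Wh (s, g y)).
  apply: nrW Wg => y Wy; have [w2 [/= h1 h2 h3 h4]] := Wsx.
  by exists w2; split => //=; rewrite (Wminus_uniq h4 Wx0).
have [OL1 OL2] := gv_L1 VG Dd0.
have Pd0 : gP G d0 = (s, g w) by rewrite gw /s /x0; case: (gP G d0).
rewrite Pd0 in OL1 OL2.
have sf i : idx (gA G) i -> sm (fun y => obs (s, g y) i) w.
  case: i => [a|//] aA; have Wgw := nr_self W'; have [ra av] := avail_gA hPhi hMS hv VG Wgw OL1 aA.
  case: (av) => y [[bp|/flow_lineP [t yE]] hy]; last first.
    have rr : reaches h Phi a (g w) by exists t; rewrite -yE.
    have [|g' [sg' ng']] := @obs_reach _ _ _ _ _ _ hPhi hMS v _ (fun=> True) (fun y => (s, g y)) g w a sg _ ra rr.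
      by apply: nrW W' => z Wz _.
    by apply: sm_eq sg'; apply: nrW ng' => z /(_ I) [_ <-].
  apply: (sm_eq _ (sm_cst y w)); apply: nrW W' => z Wz /=.
  by rewrite -hy (path_pointE hPhi hMS Wz) //; left.
have [nO cL] := gv_smooth VG sf OL1.
exists (fun y => gL G (obs (s, g y))); split => //.
apply: nrW (nrI nO W') => y [Oy Wy]; have [D P] := gv_L2 VG Wy Oy; split => //.
have := gv_lab VG D; have := gv_lab VG Dd0; rewrite P Pd0 /= => -> E1.
set b := [seq _ | _ <- _] in E1; set b' := [seq _ | _ <- _] in E1.
have sb : size b = k by rewrite size_map size_iota.
have sb' : size b' = k by rewrite size_map size_iota.
have bT : b = nseq k true.
  apply: (@eq_from_nth _ true); rewrite sb ?size_nseq // => i ik.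
  by rewrite (nth_map 0%N) ?size_iota // nth_iota // add0n cd0 // eqxx nth_nseq ik.
(* The mask [b'] has length [k] and selects as many labels as [s] has breaks, namely [k]; so it is
   constantly true. *)
have : all id b'.
  rewrite all_count sb' -(size_mask sb') -E1 bT mask_true //.
move=> /allP H i ik; apply/eqP; apply: (H (cx (gL G (obs (s, g y))) i == 0)).
by apply/mapP; exists i => //; rewrite mem_iota.
Qed.

Variables (u : M) (c : chart R n M) (r : R).
Hypotheses (hu : crit h u) (GL : gl_model h X u c r) (cx0 : cdom c x0) (Px0 : Wplus Phi u x0)
  (nx0 : ~ crit h x0) (px0 : nsq (pos_part (morse_index h u)) (cmap c x0) < r ^+ 2 / 4)
  (mx0 : nsq (neg_part (morse_index h u)) (cmap c x0) < r ^+ 2 / 4).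
Local Notation iu := (morse_index h u).
Let Ac := gl_atlas GL.

Lemma stable_curve q (g : E q -> M) w : sm g w -> g w = x0 -> nr w (fun y => Wplus Phi u (g y)) ->
  nr w (fun y => forall j, (j < iu)%N -> cx (cmap c (g y)) j = 0).
Proof.
move=> sg gw Pg; have cg : cdom c (g w) by rewrite gw.
have [nc sc] := sm_chart sg Ac cg.
have np : nr w (fun y => nsq (pos_part iu) (cmap c (g y)) < r ^+ 2 / 4).
  by apply: (cinf_lt (cinf_nsq _ sc)); rewrite /= gw.
have nm : nr w (fun y => nsq (neg_part iu) (cmap c (g y)) < r ^+ 2 / 4).
  by apply: (cinf_lt (cinf_nsq _ sc)); rewrite /= gw.
apply: nrW (nrI (nrI Pg nc) (nrI np nm)) => y [[Py cy] [py my]] j ju.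
have /nsq0 H := gl_Wplus hPhi hMS Ac (gl_r0 GL) (gl_cE GL) (gl_Hh GL) (gl_HX GL) cy Py py my.
have jn : (j < n)%N := leq_trans ju (morse_index_le h u).
by rewrite (cx_lt _ jn); apply: H.
Qed.

(* The coordinates in which the blow-up at [u] takes place: the boundary
   coordinates of a chart, the level of the end point and its unstable
   coordinates at [u]. Transversality of W^-_w and W^+_u makes them independent
   on the stratum W^-_w, and hence nearby. *)
Definition straight (gN : E m -> M) (d : E m) (i : nat) : R :=
  if (i < k)%N then cx d i else if i == k then h (gN d) else cx (cmap c (gN d)) (i - k.+1).

Section Rank.
Variables (gN : E m -> M) (sgN : sm gN d0) (gN0 : gN d0 = x0)
  (ngN : nr d0 (fun d => gD G d -> (gP G d).2 = gN d)).
Local Notation p := (k.+1 + iu)%N.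
Let Fs (d : E m) : E p := \row_(i < p) straight gN d i.

Lemma straight_cinf i : cinf (fun d => straight gN d i) d0.
Proof.
rewrite /straight; case: (i < k)%N; first by apply: (cinf_cx (f := id)); exact: cinfv_id.
case: (i == k); first exact: (smooth_function_smf (h_smooth hMS)) erefl sgN.
have cg : cdom c (gN d0) by rewrite gN0.
by have [_] := sm_chart sgN Ac cg; exact: cinf_cx.
Qed.

Let Fs_cinf : cinfv Fs d0. Proof. by apply: cinfv_row => j; exact: straight_cinf. Qed.

(** Velocities of curves in the stratum lie in the image of the differential, with vanishing
    boundary components. *)
Let curve_image w' (g : E 1 -> M) : sm g 0 -> g 0 = x0 -> Wminus Phi w' x0 ->
  nr 0 (fun y => Wminus Phi w' (g y)) -> exists x : E m, x *m jacobian Fs d0 =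
   jacobian (fun w => \row_(i < p) (if (i < k)%N then 0 else if val i == k then h (g w) else cx (cmap c (g w)) (i - k.+1))) 0.
Proof.
move=> sg g0 Wx Wg; have [e [ce e0 ne]] := centered_curve sg g0 Wx Wg.
have E1 : jacobian e 0 *m jacobian Fs d0 = jacobian (Fs \o e) 0 by rewrite jacobian_comp ?e0.
exists (jacobian e 0); rewrite E1; apply: jacobian_eq.
have ne2 : nr 0 (fun y => gD G (e y) -> (gP G (e y)).2 = gN (e y)).
  by apply: (cinfv_nr_pre ce (P := fun d => gD G d -> (gP G d).2 = gN d)); rewrite e0.
apply: nrW (nrI ne ne2) => y [[De Pe ze] /(_ De)]; rewrite Pe /= => gE.
apply/rowP => i; rewrite !mxE /straight -gE; case: ifP => // ik; exact: ze.
Qed.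

Let partial1 (f : E 1 -> R) i : partial i f 0 = derive1 (fun t : R => f (t *: delta_mx 0 0)) 0.
Proof. by rewrite (ord1 i) /partial; congr (derive1 _ 0); apply/funext => t; rewrite add0r. Qed.

(** The flow line of [x0] lies in both the unstable manifold of [w'] and the stable manifold of [u]:
    it moves neither the boundary coordinates nor the unstable coordinates at [u], only the level,
    at the rate X(h). *)
Let flow_image : exists (x : E m) (a : R), a != 0 /\ x *m jacobian Fs d0 = \row_(i < p) (if val i == k then a else 0).
Proof.
have [w' [/= _ _ _ Wx]] := Wsx.
have sg : sm (fun w : E 1 => Phi (w 0 0) x0) 0.
  by apply: (flow_sm hPhi (sm_cst x0 0)); exact: cinf_coord.
have g0 : Phi ((0 : E 1) 0 0) x0 = x0 by rewrite mxE f0.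
have [|x xE] := curve_image sg g0 Wx.
  by apply: nrT => y; exact: Wminus_flow.
exists x, (lie_derivative h X c x0); split.
  by rewrite lt_eqF // (lie_neg hMS).
rewrite xE; apply/rowP => i; rewrite !mxE.
have st : nr 0 (fun y : E 1 => forall j, (j < iu)%N -> cx (cmap c (Phi (y 0 0) x0)) j = 0).
  by apply: (stable_curve sg g0); apply: nrT => y; exact: Wplus_flow.
case: ifP => [/eqP ik|ik].
  rewrite partial1; have := h_flow_derive hPhi hMS (x := x0) (t := 0) Ac.
  rewrite f0 => /(_ cx0) [_ <-]; rewrite -derive1E; congr (derive1 _ 0); apply/funext => t.
  transitivity (h (Phi ((t *: delta_mx 0 0 : E 1) 0 0) x0)); last by rewrite !mxE eqxx mulr1.
  have ik' : i = k :> nat by []. 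
  by rewrite mxE ik' ltnn; case: eqP.
transitivity (partial 0 (fun _ : E 1 => 0 : R) 0).
  apply: nr_partial; apply: nrW st => y st; rewrite mxE ik; case: ifP => // ik'.
  by apply: st; rewrite ltn_subLR ?ltn_ord // ltn_neqAle eq_sym ik leqNgt ik'.
by rewrite partial1 derive1_cst.
Qed.

(** A vector with prescribed unstable coordinates is split by transversality; the summand tangent to
    [Wplus Phi u] has no unstable coordinates, so the one tangent to the stratum carries all of
    them. Its effect on the level is left open. *)
Let transverse_image (t : E p) : exists x : E m,
  (forall i : 'I_p, (k < i)%N -> (x *m jacobian Fs d0) 0 i = t 0 i) /\
  forall i : 'I_p, (i < k)%N -> (x *m jacobian Fs d0) 0 i = 0.
Proof.
have [w' [/= hw' _ _ Wx]] := Wsx.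
have [_ _ _ /(_ w' u hw' hu x0 c Wx Px0 Ac cx0)] := hMS.
move=> /(_ (\row_(j < n) if (j < iu)%N then cx t (k.+1 + j) else 0)) [u1 [u2 [T1 T2 uE]]].
have conv (S : set M) (g : R -> M) a : 0 < a -> g 0 = x0 -> (forall t, `|t| < a -> S (g t) /\ cdom c (g t)) ->
    (forall t (k : nat) (j : 'I_n), `|t| < a -> derivable (derive1n k (fun s : R => cmap c (g s) 0 j : R)) t 1) ->
    sm (fun w : E 1 => g (w 0 0)) 0 /\ nr (0 : E 1) (fun w => S (g (w 0 0))).
  move=> a0 g0 gS gd.
  have n0 : nr (0 : E 1) (fun w => `|w 0 0| < a).
    exists a => // y; rewrite subr0; apply: le_lt_trans; exact: coord_le_norm.
  split; last by apply: nrW n0 => w /gS [].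
  exists c; split => //; first by rewrite mxE g0.
    by apply: nrW n0 => w /gS [].
  move=> j; apply: (curve_cinf a0 (fun t' k' => gd t' k' j)); by rewrite mxE normr0.
have part (g : R -> M) (u' : E n) j : (forall j, derive1 (fun s : R => cmap c (g s) 0 j : R) 0 = u' 0 j) ->
    partial 0 (fun w : E 1 => cmap c (g (w 0 0)) 0 j) 0 = u' 0 j.
  move=> <-; rewrite partial1; congr (derive1 _ 0); apply/funext => t'; by rewrite !mxE mulr1.
have u20 (j : 'I_n) : (j < iu)%N -> u2 0 j = 0.
  case: T2 => g [a [a0 g0 gS gd gu]] ju; have [sg nS] := conv _ g a a0 g0 gS gd.
  rewrite -(part g u2 j gu); transitivity (partial 0 (fun _ : E 1 => 0 : R) 0).
    apply: nr_partial; have := stable_curve sg _ nS; rewrite mxE => /(_ g0).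
    by apply: nrW => y /(_ j ju); rewrite cxE.
  by rewrite partial1 derive1_cst.
case: T1 => g [a [a0 g0 gS gd gu]]; have [sg nS] := conv _ g a a0 g0 gS gd.
have [|x xE] := curve_image sg _ Wx nS; first by rewrite mxE.
exists x; split=> i ki; rewrite xE mxE; last first.
  transitivity (partial 0 (fun _ : E 1 => 0 : R) 0); last by rewrite partial1 derive1_cst.
  by congr partial; apply/funext => y; rewrite mxE ki.
have iu' : (i - k.+1 < iu)%N by rewrite ltn_subLR ?ltn_ord.
have jn : (i - k.+1 < n)%N := leq_trans iu' (morse_index_le h u).
have -> : (fun y : E 1 => (\row_i (if (i < k)%N then 0 else if val i == k then h (g (y 0 0)) else
    cx (cmap c (g (y 0 0))) (i - k.+1))) 0 i) = (fun y : E 1 => cmap c (g (y 0 0)) 0 (Ordinal jn)).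
  by apply/funext => y; rewrite mxE ltnNge ltnW //= gtn_eqF // (cx_lt _ jn).
rewrite (part g u1 _ gu); have := congr1 (fun z : E n => z 0 (Ordinal jn)) uE.
by rewrite !mxE /= u20 // addr0 iu' => <-; rewrite subnKC // cxE.
Qed.

(** Solved block by block: [z] fixes the boundary coordinates, [xt] corrects the unstable ones
    without disturbing these, and a multiple of [xf] finally corrects the level. *)
Lemma straight_rank (t : E p) : exists x : E m, x *m jacobian Fs d0 = t.
Proof.
pose z : E m := \row_(i < m) if (i < k)%N then cx t i else 0.
have Fz (x : E m) (i : 'I_p) : (i < k)%N -> (x *m jacobian Fs d0) 0 i = cx x i.
  move=> ik; have im : (i < m)%N := leq_trans ik (gv_size VG).
  rewrite mulmx_jacobian // mxE.
  have -> : (fun y => Fs y 0 i) = lform (fun j => (j == Ordinal im)%:R).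
    apply/funext => y; rewrite mxE /straight ik /lform (bigD1 (Ordinal im)) //= eqxx mulr1.
    by rewrite big1 ?addr0 ?(cx_lt _ im) // => j /negPf ->; rewrite mulr0.
  rewrite [LHS](derive_val (is_derive := lform_derive _ _ _)) /lform (bigD1 (Ordinal im)) //= eqxx mulr1.
  by rewrite big1 ?addr0 ?(cx_lt _ im) // => j /negPf ->; rewrite mulr0.
have [xt [Ht1 Ht2]] := transverse_image (t - z *m jacobian Fs d0).
have [xf [a [a0 Hf]]] := flow_image.
have kp : (k < p)%N by rewrite leq_addr.
pose b := (t 0 (Ordinal kp) - ((z + xt) *m jacobian Fs d0) 0 (Ordinal kp)) / a.
exists (z + xt + b *: xf); rewrite mulmxDl -scalemxAl Hf; apply/rowP => i.
rewrite mxE [X in _ + X]mxE [X in _ + _ * X]mxE; have [ik|ik|ik] := ltngtP (val i) k.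
- by rewrite mulr0 addr0 mulmxDl mxE Ht2 // addr0 Fz // (cx_lt _ (leq_trans ik (gv_size VG))) mxE ik cxE.
- have E1 : (t - z *m jacobian Fs d0) 0 i = t 0 i - (z *m jacobian Fs d0) 0 i.
    by rewrite [LHS]mxE [X in _ + X]mxE.
  by rewrite mulr0 addr0 mulmxDl mxE Ht1 // E1 addrC subrK.
have -> : i = Ordinal kp by apply: val_inj.
by rewrite /b divfK // addrC subrK.
Qed.

End Rank.

(** The independent functions are completed to a local diffeomorphism. The inequality is part of the
    same rank count: it leaves room for one more boundary coordinate, and for [k = 0] it is the drop
    of the index along a trajectory. *)
Lemma gchart_straighten : (k.+1 + iu <= m)%N /\ exists (F : E m -> E m) (gN : E m -> M),
  [/\ sm gN d0, gN d0 = x0, nr d0 (fun d => gD G d -> (gP G d).2 = gN d),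
     cinfv F d0 /\ jacobian F d0 \in unitmx &
     forall d i, (i < k.+1 + iu)%N -> cx (F d) i = straight gN d i].
Proof.
have [gN [sgN ngN']] := gv_obs VG (i := None) Dd0 I.
have ngN : nr d0 (fun d => gD G d -> (gP G d).2 = gN d) by apply: nrW ngN' => d H /H [].
have gN0 : gN d0 = x0 by rewrite -(nr_self ngN).
set p := (k.+1 + iu)%N; pose Fs (d : E m) : E p := \row_(i < p) straight gN d i.
have sF : cinfv Fs d0 by apply: cinfv_row => j; exact: (straight_cinf sgN gN0).
have [pm [C uC HC]] := unit_completion (straight_rank sgN gN0 ngN).
split => //; pose F (d : E m) : E m := \row_(i < m) if (i < p)%N then straight gN d i else (d *m C) 0 i.
exists F, gN; split => //; last first.
  by move=> d i ip; rewrite (cx_lt _ (leq_trans ip pm)) mxE ip.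
split.
  apply: cinfv_row => j; case: (j < p)%N; first exact: (straight_cinf sgN gN0).
  by apply: (cinfv_mulmx C); exact: cinfv_id.
suff -> : jacobian F d0 = C by [].
apply/matrixP => i j; have [jp|jp] := ltnP j p.
  rewrite (HC i (Ordinal jp) j) // !mxE; congr (partial i _ d0); apply/funext => y.
  by rewrite !mxE jp.
transitivity (jacobian (fun y : E m => y *m C) d0 i j); last by rewrite jacobian_mulmx.
rewrite [LHS]mxE [RHS]mxE; congr (partial i _ d0); apply/funext => y.
by rewrite mxE ltnNge jp.
Qed.

End Straighten.

(** * Blow-up at a critical point *)

Section BlowUp.
Context {R : realType} {n : nat}.
Local Notation E n := 'rV[R]_n.
Variables (M : smooth_manifold R n) (h : M -> R) (X : vector_field M) (Phi : R -> M -> M).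
Hypotheses (hPhi : is_flow X Phi) (hMS : morse_smale h X Phi).
Local Notation broken := (broken M).
Let f0 := flow0 hPhi.

Definition dot (P : pred 'I_n) (y z : E n) : R := \sum_(j < n | P j) y 0 j * z 0 j.

Lemma dot_nsq P y : dot P y y = nsq P y.
Proof. by apply: eq_bigr => j _; rewrite expr2. Qed.

Lemma dot_scale (P : pred 'I_n) (y y' z : E n) (a : R) : (forall j, P j -> y 0 j = a * y' 0 j) -> dot P y z = a * dot P y' z.
Proof. by move=> H; rewrite /dot mulr_sumr; apply: eq_bigr => j Pj; rewrite H // mulrA. Qed.

Lemma nsq_scale (P : pred 'I_n) (y y' : E n) (a : R) : (forall j, P j -> y 0 j = a * y' 0 j) -> nsq P y = a ^+ 2 * nsq P y'.
Proof. by move=> H; rewrite /nsq mulr_sumr; apply: eq_bigr => j Pj; rewrite H // exprMn. Qed.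

Lemma cinf_dot q P (f g : E q -> E n) w : cinfv f w -> cinfv g w -> cinf (fun w => dot P (f w) (g w)) w.
Proof. by move=> sf sg; apply: (cinf_big _ (f := fun j w => f w 0 j * g w 0 j)) => j _; exact: cinfM. Qed.

Lemma glm_flow u c r (y : E n) t : gl_model h X u c r -> cimg c y -> 0 <= t ->
  nsq (neg_part (morse_index h u)) (hyp_flow (morse_index h u) t y) +
  nsq (pos_part (morse_index h u)) y < r ^+ 2 ->
  Phi t (cinv c y) = cinv c (hyp_flow (morse_index h u) t y).
Proof.
move=> GL cy t0 H; apply: (@gl_flow _ _ _ _ _ _ hPhi _ _ (gl_atlas GL) (gl_HX GL) _ t) => //; last by rewrite t0 lexx.
move=> s /andP[s0 st]; apply/(gl_cimg h u (gl_cE GL)); apply: le_lt_trans H.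
rewrite !nsq_hyp_neg nsq_hyp_pos lerD //.
  apply: ler_wpM2r; first exact: nsq_ge0.
  by rewrite lerXn2r ?nnegrE ?expR_ge0 // ler_expR.
by rewrite ler_piMl ?nsq_ge0 // expR_sq_le1.
Qed.

(** A trajectory starting near [u] can leave the chart only after sinking to the level
    [h u - 3 / 16 * r ^ 2] ([gl_exit]); as long as it is above, it is given by the linear flow. *)
Lemma glm_follow u c r x t : gl_model h X u c r -> cdom c x -> 0 <= t ->
  nsq (pos_part (morse_index h u)) (cmap c x) < r ^+ 2 / 4 ->
  nsq (neg_part (morse_index h u)) (cmap c x) < r ^+ 2 / 4 ->
  h u - 3 / 16 * r ^+ 2 < h (Phi t x) ->
  Phi t x = cinv c (hyp_flow (morse_index h u) t (cmap c x)) /\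
  cimg c (hyp_flow (morse_index h u) t (cmap c x)).
Proof.
move=> GL cx t0 px mx hx; have Ac := gl_atlas GL; have r2 : 0 < r ^+ 2 by rewrite exprn_gt0 // (gl_r0 GL).
have [m0|m0] := eqVneq (nsq (neg_part (morse_index h u)) (cmap c x)) 0.
  have lt : nsq (neg_part (morse_index h u)) (hyp_flow (morse_index h u) t (cmap c x)) +
      nsq (pos_part (morse_index h u)) (cmap c x) < r ^+ 2.
    by rewrite nsq_hyp_neg m0 mulr0 add0r; lra.
  split; first by rewrite -(glm_flow GL (cimg_cmap cx) t0 lt) cinvK.
  apply/(gl_cimg h u (gl_cE GL)); apply: le_lt_trans lt; rewrite lerD2l nsq_hyp_pos.
  by rewrite ler_piMl ?nsq_ge0 // expR_sq_le1.
have [|T [T0 HT hT]] := gl_exit hPhi Ac (gl_r0 GL) (gl_cE GL) (gl_Hh GL) (gl_HX GL) cx _ px.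
  by rewrite lt_def m0 nsq_ge0.
apply: HT; rewrite t0 leNgt; apply/negP => /ltW Tt.
have := h_flow_le hPhi hMS x Tt; lra.
Qed.

Lemma glm_nbhs u c r e : gl_model h X u c r -> crit h u -> 0 < e -> nbhs u (fun z => [/\ cdom c z,
  nsq (pos_part (morse_index h u)) (cmap c z) < e & nsq (neg_part (morse_index h u)) (cmap c z) < e]).
Proof.
move=> GL hu e0; have Ac := gl_atlas GL; have cu := gl_cdom GL; have c0 := gl_crit Ac cu hu (gl_Hh GL).
have N P : nr (0 : E n) (fun y => nsq P y < e).
  apply: (cinf_lt (cinf_nsq P (cinfv_id 0))).
  by rewrite /nsq big1 // => j _; rewrite mxE expr0n.
have H P : nbhs u (fun z => nsq P (cmap c z) < e) by apply: (cmap_nbhs (P := fun y => nsq P y < e) Ac cu); rewrite c0; exact: N.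
by apply: filterS (filterI (cdom_nbhs Ac cu) (filterI (H (pos_part (morse_index h u))) (H (neg_part (morse_index h u))))) => z [? [? ?]].
Qed.

Lemma Wplus_late u x (U : set M) : Wplus Phi u x -> nbhs u U -> exists2 T, 0 <= T & U (Phi T x).
Proof.
move=> Wx /Wx [T [_ HT]]; exists (Num.max 0 T + 1); first by rewrite addr_ge0 // le_max lexx.
by apply: HT; rewrite ltr_pwDr // le_max lexx orbT.
Qed.

Lemma Wminus_early u x (U : set M) : Wminus Phi u x -> nbhs u U -> exists2 T, 0 <= T & U (Phi (- T) x).
Proof.
move=> Wx /Wx [T [_ HT]]; exists (Num.max 0 (- T) + 1); first by rewrite addr_ge0 // le_max lexx.
by apply: HT; rewrite ltrNl ltr_pwDr // le_max lexx orbT.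
Qed.

(** In backward time [x] enters the unstable disc, and the disc is then transported forward to
    [x]. *)
Lemma gchart_base v x : crit h v -> Wminus Phi v x -> exists (G : gchart h v) d,
  [/\ gvalid Phi G, gD G d, gcs G = [::] & gP G d = ([::], x)].
Proof.
move=> hv Wx; have [c [r GL]] := gl_model_ex hMS hv; have Ac := gl_atlas GL.
have e0 : 0 < r ^+ 2 / 4 by rewrite divr_gt0 // exprn_gt0 // (gl_r0 GL).
have [T T0 [cy py my]] := Wminus_early Wx (glm_nbhs GL hv e0).
set y := cmap c (Phi (- T) x) in py my *.
have p0 : nsq (pos_part (morse_index h v)) y = 0.
  exact: (gl_Wminus hPhi hMS Ac (gl_r0 GL) (gl_cE GL) (gl_Hh GL) (gl_HX GL) cy (Wminus_flow hPhi _ Wx)).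
exists (gflow Phi (gl_disc h v c r) T), (emb _ y); split => //.
- by apply: (gflow_valid hPhi hMS T0); exact: (gl_disc_valid hPhi hMS hv GL).
- by split => //=; rewrite emb_proj // (nsq_predT _ (morse_index h v)) p0 addr0.
- by rewrite /= emb_proj // cinvK // -(flowD hPhi) addNr f0.
Qed.

(** In a chart of unbroken paths from [w] there are no boundary coordinates, and the rank count of
    [gchart_straighten] reads [morse_index h u < morse_index h w]. *)
Lemma traj_crit_lt u w x : crit h u -> crit h w -> Wminus Phi w x -> Wplus Phi u x -> ~ crit h x ->
  crit_lt h u w.
Proof.
move=> hu hw Wx Px nx; split; last first.
  by apply: (@lt_trans _ _ (h (Phi 0 x))); [exact: (Wplus_gt hPhi hMS)|exact: (Wminus_lt hPhi hMS)].
have [c [r GL]] := gl_model_ex hMS hu.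
have e0 : 0 < r ^+ 2 / 4 by rewrite divr_gt0 // exprn_gt0 // (gl_r0 GL).
have [T T0 [cy py my]] := Wplus_late Px (glm_nbhs GL hu e0).
have [G [d [VG Dd Gs GP]]] := gchart_base hw (Wminus_flow hPhi T Wx).
have E1 : (gP G d).2 = Phi T x by rewrite GP.
have A1 i : (i < size (gcs G))%N -> cx d i = 0 by rewrite Gs.
have [] := @gchart_straighten _ _ _ _ _ _ hPhi hMS w hw G VG d Dd A1 u c r hu GL; rewrite ?E1 //.
- exact: Wplus_flow.
- exact: (flow_ncrit hPhi hMS).
- by rewrite Gs.
Qed.

Section Blow.
Variables (v : M) (hv : crit h v).
Local Notation Wh := (What h Phi v).
Local Notation m := (morse_index h v).
Local Notation obs := (obs h Phi v).
Variables (G : gchart h v) (VG : gvalid Phi G) (d0 : E m) (Dd0 : gD G d0).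
Local Notation k := (size (gcs G)).
Hypothesis cd0 : forall i, (i < k)%N -> cx d0 i = 0.
Let x0 := (gP G d0).2.
Variables (u : M) (c : chart R n M) (r : R).
Hypotheses (hu : crit h u) (GL : gl_model h X u c r) (cx0 : cdom c x0) (Px0 : Wplus Phi u x0)
  (nx0 : ~ crit h x0) (px0 : nsq (pos_part (morse_index h u)) (cmap c x0) < r ^+ 2 / 4)
  (mx0 : nsq (neg_part (morse_index h u)) (cmap c x0) < r ^+ 2 / 4).
Local Notation iu := (morse_index h u).
Local Notation a := (h x0).
Local Notation p := (k.+1 + iu)%N.
Hypothesis ra : regular h a.
Variables (F S : E m -> E m) (gN : E m -> M) (dl ep et : R).
Hypotheses (pm : (p <= m)%N) (gN0 : gN d0 = x0)
  (HF : forall d i, (i < p)%N -> cx (F d) i = straight G c gN d i)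
  (Hd : forall d, `|d - d0| < dl -> [/\ cinfv F d, sm gN d /\ cdom c (gN d),
      nsq (pos_part iu) (cmap c (gN d)) < r ^+ 2 / 4 /\ nsq (neg_part iu) (cmap c (gN d)) < r ^+ 2 / 4,
      0 < nsq (pos_part iu) (cmap c (gN d)) & (gD G d -> (gP G d).2 = gN d) /\ S (F d) = d])
  (He : forall y, `|y - F d0| < ep -> [/\ cinfv S y, F (S y) = y, gV G (S y) & `|S y - d0| < dl])
  (dl0 : 0 < dl) (ep0 : 0 < ep) (et0 : 0 < et) (etr : et <= r ^+ 2 / 4)
  (etu : forall b, critval h b -> `|b - h u| < et -> b = h u).
Let Ac := gl_atlas GL.

(* With [S] the inverse of the straightened coordinates [F] and [rho] the new
   boundary coordinate [cx d k], the path [d] crosses the level [a] above [u] at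
   the point with unstable coordinates [rho y] and some stable coordinates [z],
   and it ends at the point with coordinates [(y, rho z)]. These two points are on
   the same flow line if [0 < rho], while the path breaks at [u] if [rho = 0].
   Conversely [rho] is read off the observations as the ratio of the stable
   coordinates. *)
Definition bl_pre (d : E m) : E m := \row_(i < m)
  if (i < k)%N then cx d i else if val i == k then a else if (i < p)%N then cx d k * cx d i else cx d i.
Definition bl_neg (d : E m) : E n := \row_(j < n) if (j < iu)%N then cx d (k.+1 + j) else 0.
Definition bl_end (d : E m) : E n := \row_(j < n)
  if (j < iu)%N then cx d (k.+1 + j) else cx d k * cmap c (gN (S (bl_pre d))) 0 j.
Definition bl_V (d : E m) : Prop :=
  [/\ `|bl_pre d - F d0| < ep, nsq (neg_part iu) (bl_neg d) < et & `|cx d k| < 1].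
Definition bl_P (d : E m) : broken * M :=
  let q := gP G (S (bl_pre d)) in
  (if cx d k == 0 then rcons q.1 (flow_line Phi q.2, u) else q.1, cinv c (bl_end d)).
Definition bl_mid (y : option R -> M) : E m := gL G (set_end y (y (Some a))).
(** The stable coordinates at the end are [rho] times those at the entrance; the scalar product
    extracts [rho] smoothly, without choice of a nonzero coordinate, and makes sense for points that
    do not come from a path. *)
Definition bl_ratio (y : option R -> M) : R :=
  dot (pos_part iu) (cmap c (y None)) (cmap c (gN (bl_mid y))) /
  nsq (pos_part iu) (cmap c (gN (bl_mid y))).
Definition bl_O (y : option R -> M) : Prop :=
  [/\ gO G (set_end y (y (Some a))), `|bl_mid y - d0| < dl /\ `|F (bl_mid y) - F d0| < ep,
      [/\ cdom c (y None), nsq (pos_part iu) (cmap c (y None)) < r ^+ 2 / 4 &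
          nsq (neg_part iu) (cmap c (y None)) < et], `|bl_ratio y| < 1 &
      forall b, b \in a :: gA G -> h (y None) < b].
Definition bl_L (y : option R -> M) : E m := \row_(i < m)
  if (i < k)%N then cx (F (bl_mid y)) i else if val i == k then bl_ratio y else
  if (i < p)%N then cx (cmap c (y None)) (i - k.+1) else cx (F (bl_mid y)) i.

Definition blow : gchart h v :=
  GChart (rcons (gcs G) u) bl_V bl_P (a :: gA G) bl_O bl_L.

Let km : (k < m)%N. Proof. by apply: leq_trans pm; rewrite leq_addr. Qed.
Let iun : (iu <= n)%N. Proof. exact: morse_index_le. Qed.

Lemma cx_pre d i : (i < m)%N -> cx (bl_pre d) i =
  if (i < k)%N then cx d i else if i == k then a else if (i < p)%N then cx d k * cx d i else cx d i.
Proof. by move=> im; rewrite (cx_lt _ im) mxE. Qed.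

Lemma cx_F d : [/\ forall i, (i < k)%N -> cx (F d) i = cx d i, cx (F d) k = h (gN d) &
  forall j : 'I_n, (j < iu)%N -> cx (F d) (k.+1 + j) = cmap c (gN d) 0 j].
Proof.
split.
- move=> i ik; rewrite HF /straight ?ik //.
  exact: leq_trans ik (leq_trans (leqnSn k) (leq_addr _ _)).
- by rewrite HF /straight ?ltnn ?eqxx // leq_addr.
- move=> j ju; rewrite HF /straight ?ltn_add2l // ltnNge (leq_trans (leqnSn k)) ?leq_addr //=.
  by rewrite gtn_eqF ?leq_addr // addKn cxE.
Qed.

(** Here [e] is the path that stops at the level [a] above [u], with the old boundary coordinates;
    its end point is the entrance into the chart at [u]. *)
Lemma blow_fact d : gD blow d -> let e := S (bl_pre d) in
  [/\ gD G e /\ `|e - d0| < dl, F e = bl_pre d /\ (forall i, (i < k)%N -> cx e i = cx d i),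
      (gP G e).2 = gN e /\ h (gN e) = a,
      0 <= cx d k < 1 /\ (forall j : 'I_n, (j < iu)%N -> cmap c (gN e) 0 j = cx d k * bl_end d 0 j) &
      [/\ nsq (neg_part iu) (bl_end d) < et,
          nsq (pos_part iu) (bl_end d) = cx d k ^+ 2 * nsq (pos_part iu) (cmap c (gN e)) &
          cimg c (bl_end d)]].
Proof.
move=> [[bp bn bk] bz] e; have [cS FS VS dS] := He bp; have [cF [sg cg] [pg mg] pg0 [HP _]] := Hd dS.
have [F1 F2 F3] := cx_F e; rewrite FS in F1 F2 F3.
have k0 : 0 <= cx d k by apply: bz; rewrite /= size_rcons.
have k1 : cx d k < 1 by move: bk; rewrite ger0_norm.
have ez i : (i < k)%N -> cx e i = cx d i.
  by move=> ik; rewrite -F1 // cx_pre ?ik // (ltn_trans ik km).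
have De : gD G e by split => // i ik; rewrite ez //; apply: bz; rewrite /= size_rcons ltnS ltnW.
have nn : nsq (neg_part iu) (bl_end d) = nsq (neg_part iu) (bl_neg d).
  by apply: eq_bigr => j; rewrite /neg_part => ju; rewrite !mxE ju.
have pp : nsq (pos_part iu) (bl_end d) = cx d k ^+ 2 * nsq (pos_part iu) (cmap c (gN e)).
  by apply: nsq_scale => j; rewrite /pos_part => ju; rewrite mxE ltnNge ju.
split => //.
- by split; [exact: HP|rewrite -F2 cx_pre // ltnn eqxx].
- split; first by rewrite k0.
  move=> j ju; rewrite -F3 // cx_pre; last by rewrite (leq_trans _ pm) // ltn_add2l.
  rewrite ltnNge (leq_trans (leqnSn k)) ?leq_addr //= gtn_eqF ?leq_addr // ltn_add2l ju.
  by rewrite mxE ju.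
- split; rewrite ?nn //; apply/(gl_cimg h u (gl_cE GL)); rewrite nn pp.
  have : cx d k ^+ 2 * nsq (pos_part iu) (cmap c (gN e)) <= nsq (pos_part iu) (cmap c (gN e)).
    by rewrite ler_piMl ?nsq_ge0 // expr_le1 // ltW.
  have : 0 < r ^+ 2 by rewrite exprn_gt0 // (gl_r0 GL).
  by have := etr; lra.
Qed.

Lemma expR_lnN (x : R) : 0 < x -> expR (- ln x) = x^-1.
Proof. by move=> x0'; rewrite expRN lnK. Qed.

(** The linear flow turns [(rho y, z)] into [(y, rho z)] within the time [- ln rho], which is
    nonnegative as [rho < 1]. *)
Lemma blow_pos d : gD blow d -> cx d k != 0 -> let e := S (bl_pre d) in
  exists t, bl_P d = ((gP G e).1, Phi t (gP G e).2).
Proof.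
move=> Dd k0 e; have [[De de] [Fe ez] [P2 ha] [/andP[kge klt] neg] [nn pp cE]] := blow_fact Dd.
have [_ [_ cg] [pg mg] pg0 _] := Hd de.
have kp : 0 < cx d k by rewrite lt_def k0.
exists (- ln (cx d k)); rewrite /bl_P (negPf k0) -/e; congr (_, _).
have t0 : 0 <= - ln (cx d k) by rewrite oppr_ge0 ln_le0 // ltW.
have hE : hyp_flow iu (- ln (cx d k)) (cmap c (gN e)) = bl_end d.
  apply/rowP => j; rewrite mxE opprK lnK // expR_lnN //; case: ifP => ju.
    by rewrite neg // mulKf.
  by rewrite mxE ju.
rewrite P2 -[X in Phi _ X](cinvK Ac cg) (glm_flow GL (cimg_cmap cg) t0) hE //.
have : 0 < r ^+ 2 by rewrite exprn_gt0 // (gl_r0 GL).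
by have := etr; lra.
Qed.

Lemma blow_zero d : gD blow d -> cx d k = 0 -> let e := S (bl_pre d) in
  [/\ bl_P d = (rcons (gP G e).1 (flow_line Phi (gP G e).2, u), cinv c (bl_end d)),
      Wplus Phi u (gP G e).2, ~ crit h (gP G e).2 & Wminus Phi u (cinv c (bl_end d))].
Proof.
move=> Dd k0 e; have [[De de] [Fe ez] [P2 ha] [_ neg] [nn pp cE]] := blow_fact Dd.
have [_ [_ cg] [pg mg] pg0 _] := Hd de.
split; first by rewrite /bl_P k0 eqxx.
- rewrite P2 -(cinvK Ac cg); apply: (glm_stable hPhi hu GL (cimg_cmap cg)).
  by apply: big1 => j ju; rewrite neg // k0 mul0r expr0n.
- by rewrite P2 => cg'; apply: ra; exists (gN e).
- by apply: (glm_unstable hPhi hu GL cE); rewrite pp k0 expr0n mul0r.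
Qed.

Lemma blow_What d : gD blow d -> Wh (bl_P d).
Proof.
move=> Dd; have [[De de] _ _ _ _] := blow_fact Dd; have := gv_What VG De.
have [k0|k0] := eqVneq (cx d k) 0; last first.
  have [t ->] := blow_pos Dd k0; case: (gP G _) => s x; exact: (What_flow hPhi).
have [-> Pu nc Wu] := blow_zero Dd k0; case: (gP G _) Pu nc => s x /= Pu nc Wp.
apply: (What_rcons Wp _ hu Pu Wu) => w hw Wx.
by apply: (@traj_crit_lt u w x).
Qed.

Lemma blow_obs d b : gD blow d -> cx d k != 0 \/ h u < b -> let e := S (bl_pre d) in
  path_point h Phi v (bl_P d) b = path_point h Phi v (gP G e) b /\
  (available h Phi v b (bl_P d) <-> available h Phi v b (gP G e)).
Proof.
move=> Dd kb e; have [[De de] _ _ _ _] := blow_fact Dd; have := gv_What VG De.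
have [k0|k0] := eqVneq (cx d k) 0; last first.
  have [t ->] := blow_pos Dd k0; rewrite -/e; case: (gP G e) => s x _ /=.
  by split; [exact: (path_point_flow h hPhi)|exact: (available_flow h hPhi)].
have ub : h u < b by case: kb; rewrite ?k0 ?eqxx.
have [-> Pu nc Wu] := blow_zero Dd k0; rewrite -/e in Pu nc *; case: (gP G e) Pu nc => s x /= Pu nc Wp.
exact: (break_h hPhi hMS Wp nc Pu hu Wu erefl ub).
Qed.

Lemma a_gt : h u < a.
Proof. by have := Wplus_gt hPhi hMS 0 Px0 nx0; rewrite f0. Qed.

Lemma cinfv_pre d : cinfv bl_pre d.
Proof.
have C i : cinf (fun d : E m => cx d i) d by apply: (cinf_cx (f := id)); exact: cinfv_id.
apply: cinfv_row => i; case: (i < k)%N; first exact: C.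
case: (val i == k); first exact: cinfC.
by case: (i < p)%N; [apply: cinfM|]; exact: C.
Qed.

Lemma blow_smooth_end d : bl_V d -> cinfv (fun d => S (bl_pre d)) d /\ cinfv bl_end d.
Proof.
move=> [bp _ _]; have [cS _ _ dS] := He bp; have cSp := cinfv_comp cS (cinfv_pre d).
split => //.
have C i : cinf (fun d : E m => cx d i) d by apply: (cinf_cx (f := id)); exact: cinfv_id.
apply: cinfv_row => j; case: (j < iu)%N; first exact: C.
apply: cinfM; first exact: C.
have [_ [sg cg] _ _ _] := Hd dS.
by have [_ cc] := sm_chart (sm_comp sg cSp) Ac cg; exact: cc.
Qed.

(** Levels above [u], and all levels if [rho] is nonzero, are read from the entrance path. For
    [rho = 0] the others are met on the flow line of the end point, and this description persists
    for nearby paths, whether or not they break at [u]. *)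
Lemma blow_gobs d i : gD blow d -> avail h Phi v (bl_P d) i -> exists g, sm g d /\
  nr d (fun d' => gD blow d' -> avail h Phi v (bl_P d') i /\ obs (bl_P d') i = g d').
Proof.
move=> Dd; have [Vd zd] := Dd; have [cS cend] := blow_smooth_end Vd.
have [[De de] _ _ _ [_ _ cE]] := blow_fact Dd.
have sx : sm (fun d => cinv c (bl_end d)) d by exact: sm_cinv.
case: i => [b|_]; last by exists (fun d => cinv c (bl_end d)); split => //; exact: nrT.
move=> [rb av]; have [kb|kb] := pselect (cx d k != 0 \/ h u < b).
  have [e1 e2] := blow_obs Dd kb; have ae : avail h Phi v (gP G (S (bl_pre d))) (Some b).
    by split => //; exact/e2.
  have [g [sg ng]] := gv_obs VG De ae.
  exists (fun d => g (S (bl_pre d))); split; first exact: (sm_comp sg cS).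
  have n2 : nr d (fun d' => cx d' k != 0 \/ h u < b).
    case: kb => kb; last by apply: nrT => d'; right.
    apply: nrW (cinf_neq0 (cinf_cx k (cinfv_id d)) kb) => d' ?; by left.
  apply: nrW (nrI n2 (cinfv_nr_pre cS ng)) => d' [kb' H] Dd'.
  have [[De' _] _ _ _ _] := blow_fact Dd'; have [[_ h1] h2] := H De'.
  have [e1' e2'] := blow_obs Dd' kb'.
  by split; [split => //; exact/e2'|rewrite /= e1'].
have k0 : cx d k = 0 by apply/eqP; apply: contrapT => /negP k0; apply: kb; left.
apply: (@obs_reach _ _ _ _ _ _ hPhi hMS v _ (gD blow) bl_P (fun d => cinv c (bl_end d))) => //.
  by apply: nrT => d' Dd'; split => //; exact: blow_What.
have Wp := blow_What Dd; have [bE Pu nc Wu] := blow_zero Dd k0; rewrite bE in Wp av.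
have [//|[s [x [u' [[_ _ _ _ Wu'] ub]]]]] := available_dec hPhi hMS hv Wp av rb.
by case: kb; right; rewrite (Wminus_uniq Wu Wu').
Qed.

Lemma blow_h d : gD blow d -> [/\ cdom c (cinv c (bl_end d)), h (cinv c (bl_end d)) < a &
  h u - et < h (cinv c (bl_end d))].
Proof.
move=> Dd; have [[De de] [Fe ez] [P2 ha] [/andP[k0 k1] neg] [nn pp cE]] := blow_fact Dd.
have [_ [_ cg] _ pg0 _] := Hd de.
have := gl_h (gl_Hh GL) (cimg_cmap cg); rewrite (cinvK Ac cg) => hg.
have nq : nsq (neg_part iu) (cmap c (gN (S (bl_pre d)))) = cx d k ^+ 2 * nsq (neg_part iu) (bl_end d).
  exact: nsq_scale.
split; first exact: cimg_cdom.
  rewrite -ha hg (gl_h (gl_Hh GL) cE) nq pp.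
  have A0 := nsq_ge0 (neg_part iu) (bl_end d).
  set A := nsq _ (bl_end d) in A0 *; set B := nsq _ (cmap c _) in pg0 *.
  (* [A] is the unstable square norm at the end and [B] the stable one at the entrance; by the
     normal form [a] exceeds the level of the end by half of this product. *)
  have : 0 < (1 - cx d k ^+ 2) * (A + B).
    by rewrite mulr_gt0 // ?subr_gt0 ?expr_lt1 // ltr_wpDl.
  by lra.
rewrite (gl_h (gl_Hh GL) cE).
have A0 := nsq_ge0 (neg_part iu) (bl_end d); have B0 := nsq_ge0 (pos_part iu) (bl_end d).
by move: et0 nn; lra.
Qed.

Lemma blow_L1 d : gD blow d -> bl_O (obs (bl_P d)) /\ bl_L (obs (bl_P d)) = d.
Proof.
move=> Dd; have [Vd zd] := Dd; have [bp bn bk] := Vd; have [_ _ _ dS] := He bp.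
have [[De de] [Fe ez] [P2 ha] [/andP[k0 k1] neg] [nn pp cE]] := blow_fact Dd.
have [_ [_ cg] [pg mg] pg0 _] := Hd de.
have [cd hlt hgt] := blow_h Dd; set e := S (bl_pre d) in De de Fe ez P2 ha neg pp cg pg mg pg0 dS *.
have Wp := gv_What VG De; have [K1 L1] := gv_L1 VG De.
have ya : path_point h Phi v (bl_P d) a = gN e.
  have [-> _] := blow_obs Dd (or_intror a_gt); rewrite -/e -ha -P2.
  by case: (gP G e) Wp => s x; exact: path_point_end.
set y := obs (bl_P d); have yaE : y (Some a) = gN e by exact: ya.
have [|K2 L2] := gv_ext VG (y := obs (gP G e)) (y' := set_end y (y (Some a))) _ K1.
  case=> [b bA|_]; last by rewrite -[LHS]/((gP G e).2) -[RHS]/(y (Some a)) yaE P2.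
  have ab : a < b by have := gv_A2 VG K1 bA; rewrite /= P2 ha.
  by have [e1 _] := blow_obs Dd (or_intror (lt_trans a_gt ab)); exact: esym e1.
have mE : bl_mid y = e by rewrite /bl_mid -L2.
have xE : cmap c (y None) = bl_end d by rewrite /= cmapK.
have rE : bl_ratio y = cx d k.
  rewrite /bl_ratio mE xE; rewrite (@dot_scale _ _ (cmap c (gN e)) _ (cx d k)).
    by rewrite dot_nsq mulfK // gt_eqF.
  by move=> j; rewrite /pos_part => ju; rewrite mxE ltnNge ju.
split.
  split; rewrite ?mE ?rE ?Fe //.
    split; rewrite ?xE // pp.
    have : cx d k ^+ 2 * nsq (pos_part iu) (cmap c (gN e)) <= nsq (pos_part iu) (cmap c (gN e)).
      by rewrite ler_piMl ?nsq_ge0 // expr_le1 // ltW.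
    by move: pg; lra.
  move=> b; rewrite inE => /orP[/eqP ->|bA]; first exact: hlt.
  by apply: lt_trans hlt _; have := gv_A2 VG K1 bA; rewrite /= P2 ha.
apply: cx_eq => i im; rewrite (cx_lt _ im) mxE mE rE xE Fe cx_pre //=.
case: ltngtP => [//|ki|->//]; case: ifP => ip; last by rewrite ip.
have jn : (i - k.+1 < n)%N by rewrite ltn_subLR //; apply: leq_trans ip _; rewrite leq_add2l.
by rewrite (cx_lt _ jn) mxE /= ltn_subLR // ip subnKC.
Qed.

(** The path is truncated at the level [a]. Either it continues unbroken, and the linear flow
    relates entrance and end with [rho = expR (- t)]; or it breaks, and then the break is at [u], it
    is the last one, and [rho = 0]. *)
Lemma blow_L2 q : Wh q -> bl_O (obs q) -> gD blow (bl_L (obs q)) /\ bl_P (bl_L (obs q)) = q.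
Proof.
case: q => s x Wp; set y := obs (s, x); move=> [Oy [dy ey] [cx' px mx] ry Hy].
have xa : h x < a by apply: Hy; rewrite inE eqxx.
have av : a < h v.
  have := gv_What VG Dd0; have := nx0; rewrite /x0; case: (gP G d0) => s' x' /= nc [w [_ /crit_le_h wv _ Wx']].
  by apply: lt_le_trans wv; have := Wminus_lt hPhi hMS 0 Wx' nc; rewrite f0.
have aa : available h Phi v a (s, x) by apply: (regular_available hPhi hMS hv Wp ra); rewrite ltW.
have [s' [mm [W' hm mE agr ct]]] := truncate hPhi hMS hv Wp aa ra.
have yaE : y (Some a) = mm by [].
have [|K1 L1] := gv_ext VG (y' := obs (s', mm)) _ Oy.
  case=> [b bA|_] //; have ab : a < b by have := gv_A2 VG Oy bA; rewrite /= -mE hm.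
  by have [/= -> _] := agr b (ltW ab).
have [De Pe] := gv_L2 VG W' K1; rewrite -L1 in De Pe.
have eE : bl_mid y = gL G (set_end y (y (Some a))) by [].
rewrite -eE in De Pe; set e := bl_mid y in De Pe dy ey eE.
have [cF [sg cg] [pg mg] pg0 [HP SF]] := Hd dy.
have gE : gN e = mm by rewrite -HP // Pe.
set Q := cmap c (gN e) in pg mg pg0; have [F1 F2 F3] := cx_F e.
have xm : h x = h u - 2^-1 * nsq (neg_part iu) (cmap c x) + 2^-1 * nsq (pos_part iu) (cmap c x).
  have cxx : cdom c x := cx'.
  by have := gl_h (gl_Hh GL) (cimg_cmap cxx); rewrite (cinvK Ac cxx).
have xu : h u - et < h x.
  by have := nsq_ge0 (pos_part iu) (cmap c x); move: et0 mx; rewrite xm /=; lra.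
have r20 : 0 < r ^+ 2 by rewrite exprn_gt0 // (gl_r0 GL).
have xr : h u - 3 / 16 * r ^+ 2 < h x.
  by have := nsq_ge0 (pos_part iu) (cmap c x); move: etr mx; rewrite xm /=; lra.
have [A B C D] : [/\ forall j : 'I_n, (j < iu)%N -> Q 0 j = bl_ratio y * cmap c x 0 j,
    forall j : 'I_n, (iu <= j)%N -> cmap c x 0 j = bl_ratio y * Q 0 j, 0 <= bl_ratio y &
    s = if bl_ratio y == 0 then rcons s' (flow_line Phi mm, u) else s'].
  case: ct => [[ss [t xE]]|[u1 [s'' [hu1 Pu1 sE [xu1 Wu1] u2]]]].
    have t0 : 0 <= t.
      rewrite leNgt; apply/negP => /ltW t0; have := h_flow_le hPhi hMS mm t0.
      by rewrite f0 -xE hm leNgt xa.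
    have [|fE fc] := glm_follow GL cg t0 pg mg; first by rewrite gE -xE.
    have cE : cmap c x = hyp_flow iu t Q by rewrite xE -gE fE cmapK.
    have rE : bl_ratio y = expR (- t).
      rewrite /bl_ratio -/e /= -/Q cE (@dot_scale _ _ Q _ (expR (- t))).
        by rewrite dot_nsq mulfK // gt_eqF.
      by move=> j; rewrite /pos_part => ju; rewrite mxE ltnNge ju.
    rewrite rE; split => //; rewrite ?expR_ge0 ?gt_eqF ?expR_gt0 //.
    - by move=> j ju; rewrite cE mxE ju mulrA -expRD addNr expR0 mul1r.
    - by move=> j ju; rewrite cE mxE ltnNge ju.
  have cm : cdom c mm by rewrite -gE.
  (* An entrance with nonzero unstable part would sink to [h u - 3 / 16 * r ^ 2], which is below
     [h x], whereas a trajectory ending at [u1] stays above [h u1 >= h x]. *)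
  have m0 : nsq (neg_part iu) Q = 0.
    apply/eqP; rewrite eq_le nsq_ge0 andbT leNgt; apply/negP => m0.
    have [|T [T0 HT hT]] := gl_exit hPhi Ac (gl_r0 GL) (gl_cE GL) (gl_Hh GL) (gl_HX GL) cg _ pg.
      by rewrite m0.
    by have := Wplus_ge hPhi hMS T Pu1; rewrite -gE; lra.
  have uu1 : u = u1.
    apply: (Wplus_uniq _ Pu1); rewrite -gE -(cinvK Ac cg).
    exact: (glm_stable hPhi hu GL (cimg_cmap cg)).
  (* Another break would have a critical value below [h u] but not below [h x], that is, within [et]
     of [h u]. *)
  have s0' : s'' = [::].
    apply: contrapT => /u2 [w [hw xw wu]]; rewrite -uu1 in wu.
    have : h w = h u by apply: etu; [exists w|rewrite ltr0_norm; lra].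
    by move=> E'; rewrite E' ltxx in wu.
  have Wx : Wminus Phi u x by rewrite uu1; exact: Wu1.
  have mr : nsq (neg_part iu) (cmap c x) < r ^+ 2 / 4 by move: etr mx => /=; lra.
  have p0 := gl_Wminus hPhi hMS Ac (gl_r0 GL) (gl_cE GL) (gl_Hh GL) (gl_HX GL) cx' Wx px mr.
  have r0 : bl_ratio y = 0.
    rewrite /bl_ratio -/e /= (@dot_scale _ _ Q _ 0) ?mul0r // => j pj.
    by rewrite mul0r; exact: nsq0 p0 j pj.
  rewrite r0 eqxx; split => //.
  - by move=> j ju; rewrite mul0r; exact: nsq0 m0 j ju.
  - by move=> j ju; rewrite mul0r; exact: nsq0 p0 j ju.
  - by rewrite sE s0' cats1 -uu1.
set d := bl_L y.
have cL i : (i < m)%N -> cx d i = if (i < k)%N then cx (F e) i else if i == k then bl_ratio y else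
    if (i < p)%N then cx (cmap c x) (i - k.+1) else cx (F e) i.
  by move=> im; rewrite (cx_lt _ im) mxE.
have dk : cx d k = bl_ratio y by rewrite cL // ltnn eqxx.
have dj (j : 'I_n) : (j < iu)%N -> cx d (k.+1 + j) = cmap c x 0 j.
  move=> ju; rewrite cL; last by rewrite (leq_trans _ pm) // ltn_add2l.
  rewrite ltnNge (leq_trans (leqnSn k)) ?leq_addr //= gtn_eqF ?leq_addr // ltn_add2l ju.
  by rewrite addKn cxE.
have bE : bl_pre d = F e.
  apply: cx_eq => i im; rewrite cx_pre // dk; case: (ltngtP i k) => ik.
  - by rewrite cL // ik.
  - case: ifP => ip; last by rewrite cL // ltnNge ltnW //= gtn_eqF // ip.
    have jn : (i - k.+1 < n)%N by rewrite ltn_subLR //; apply: leq_trans ip _; rewrite leq_add2l.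
    have ju : (Ordinal jn < iu)%N by rewrite /= ltn_subLR.
    by have := F3 _ ju; have := dj _ ju; rewrite /= subnKC // => -> ->; rewrite -A.
  - by rewrite ik F2 gE hm.
have Se : S (bl_pre d) = e by rewrite bE.
have endE : bl_end d = cmap c x.
  apply/rowP => j; rewrite mxE Se -/Q dk; case: ifP => ju; first exact: dj.
  by rewrite B // leqNgt ju.
split; last by rewrite /bl_P Se Pe endE cinvK // dk D.
split.
  split; rewrite ?bE ?dk //; rewrite (_ : nsq _ _ = nsq (neg_part iu) (cmap c x)) //.
  by apply: eq_bigr => j; rewrite /neg_part => ju; rewrite mxE ju dj.
move=> i; rewrite /= size_rcons ltnS leq_eqVlt => /orP[/eqP ->|ik]; first by rewrite dk.
rewrite cL ?ik ?(ltn_trans ik km) // F1 //; by case: De => _; apply.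
Qed.

Lemma blow_lab d : gD blow d -> map snd (bl_P d).1 =
  mask [seq cx d i == 0 | i <- iota 0 (size (rcons (gcs G) u))] (rcons (gcs G) u).
Proof.
move=> Dd; have [[De _] [_ ez] _ _ _] := blow_fact Dd.
rewrite size_rcons -[k.+1]addn1 iotaD map_cat /= cats1 add0n mask_rcons ?size_map ?size_iota //.
have -> : [seq cx d i == 0 | i <- iota 0 k] = [seq cx (S (bl_pre d)) i == 0 | i <- iota 0 k].
  by apply/eq_in_map => i; rewrite mem_iota add0n => /andP[_ ik]; rewrite ez.
rewrite -(gv_lab VG De) /bl_P /=; case: eqP => _ /=; last by rewrite cats0.
by rewrite map_rcons cats1.
Qed.

Lemma blow_gsmooth q (f : option R -> E q -> M) w : (forall i, idx (a :: gA G) i -> sm (f i) w) ->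
  bl_O (f^~ w) -> nr w (fun w' => bl_O (f^~ w')) /\ cinfv (fun w' => bl_L (f^~ w')) w.
Proof.
move=> sf [Oy [dy ey] [cy py my] ry Hy].
pose f' i w := set_end (f^~ w) (f (Some a) w) i.
have sa : sm (f (Some a)) w by apply: sf; rewrite /= inE eqxx.
have sN : sm (f None) w by exact: sf.
have sf' i : idx (gA G) i -> sm (f' i) w.
  by case: i => [b|//] ib; apply: sf; rewrite /= inE; apply/orP; right.
have [nO cm] := gv_smooth VG sf' Oy.
have cm' : cinfv (fun w => bl_mid (f^~ w)) w by exact: cm.
have [cF [sg cg] [pg mg] pg0 _] := Hd dy.
have cFm : cinfv (fun w => F (bl_mid (f^~ w))) w by exact: (cinfv_comp cF cm').
have [_ cQ'] := sm_chart (sm_comp sg cm') Ac cg.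
have cQ : cinfv (fun w => cmap c (gN (bl_mid (f^~ w)))) w by exact: cQ'.
have [ncx ccx'] := sm_chart sN Ac cy.
have ccx : cinfv (fun w => cmap c (f None w)) w by exact: ccx'.
have cr : cinf (fun w => bl_ratio (f^~ w)) w.
  apply: cinfM; first exact: cinf_dot.
  by apply: cinfV; [exact: cinf_nsq|rewrite gt_eqF].
split; last first.
  apply: cinfv_row => i; case: (i < k)%N; first exact: cinf_cx.
  case: (val i == k) => //.
  by case: (i < p)%N; exact: cinf_cx.
have n1 : nr w (fun w' => `|bl_mid (f^~ w') - d0| < dl).
  exact: (cinfv_nr_pre cm' (P := fun z => `|z - d0| < dl) (nr_ball dy)).
have n2 : nr w (fun w' => `|F (bl_mid (f^~ w')) - F d0| < ep).
  exact: (cinfv_nr_pre cFm (P := fun z => `|z - F d0| < ep) (nr_ball ey)).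
have n3 := cinf_lt (cinf_nsq (pos_part iu) ccx) py.
have n4 := cinf_lt (cinf_nsq (neg_part iu) ccx) my.
have /andP[rl rh] : -1 < bl_ratio (f^~ w) < 1 by rewrite -ltr_norml.
have n5 := nrI (cinf_gt cr rl) (cinf_lt cr rh).
have n6 : nr w (fun w' => forall b, b \in a :: gA G -> h (f None w') < b).
  by apply: nr_all => b bA; apply: (sm_h_lt hMS sN); exact: Hy.
apply: nrW (nrI (nrI nO (nrI n1 n2)) (nrI (nrI ncx (nrI n3 n4)) (nrI n5 n6))).
by move=> w' [[h1 [h2 h3]] [[h4 [h5 h6]] [[h7 h8] h9]]]; split => //; rewrite ltr_norml h7.
Qed.

Lemma blow_valid : a < h v -> gvalid Phi blow.
Proof.
move=> av; split.
- by rewrite /= size_rcons.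
- move=> d /= [h1 h2 h3].
  have n1 : nr d (fun d => `|bl_pre d - F d0| < ep).
    exact: (cinfv_nr_pre (cinfv_pre d) (P := fun z => `|z - F d0| < ep) (nr_ball h1)).
  have cn : cinfv bl_neg d.
    apply: cinfv_row => j; case: (j < iu)%N; last exact: cinfC.
    by apply: (cinf_cx (f := id)); exact: cinfv_id.
  have n2 := cinf_lt (cinf_nsq (neg_part iu) cn) h2.
  have ck : cinf (fun d : E m => cx d k) d by apply: (cinf_cx (f := id)); exact: cinfv_id.
  have /andP[kl kh] : -1 < cx d k < 1 by rewrite -ltr_norml.
  apply: nrW (nrI n1 (nrI n2 (nrI (cinf_gt ck kl) (cinf_lt ck kh)))) => z [? [? [z1 z2]]].
  by split => //; rewrite ltr_norml z1.
- exact: blow_What.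
- exact: blow_lab.
- exact: blow_gobs.
- exact: blow_L1.
- exact: blow_L2.
- by move=> b; rewrite inE => /orP[/eqP ->|bA]; [split|exact: (gv_A VG)].
- by move=> y b [_ _ _ _ H] /H.
- move=> y y' yy' [Oy [dy ey] cy ry Hy].
  have yN : y None = y' None by exact: yy'.
  have ya : y (Some a) = y' (Some a) by apply: yy'; rewrite /= inE eqxx.
  have [|K1 L1] := gv_ext VG (y' := set_end y' (y' (Some a))) _ Oy.
    by case=> [b bA|_] //; apply: yy'; rewrite /= inE; apply/orP; right.
  have mE : bl_mid y = bl_mid y' by exact: L1.
  have rE : bl_ratio y = bl_ratio y' by rewrite /bl_ratio mE yN.
  by split; [split; rewrite -?mE -?rE -?yN|rewrite /= /bl_L mE rE yN].
- exact: blow_gsmooth.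
Qed.

End Blow.
End BlowUp.

(** * Existence of charts at all broken trajectories *)

Section GchartExistence.
Context {R : realType} {n : nat}.
Local Notation E n := 'rV[R]_n.
Variables (M : smooth_manifold R n) (h : M -> R) (X : vector_field M) (Phi : R -> M -> M).
Hypotheses (hPhi : is_flow X Phi) (hMS : morse_smale h X Phi).
Variables (v : M) (hv : crit h v).
Local Notation Wh := (What h Phi v).
Local Notation m := (morse_index h v).
Let f0 := flow0 hPhi.

Definition gcentered (G : gchart h v) (d : E m) (p : broken M * M) :=
  [/\ gvalid Phi G, gD G d, forall i, (i < size (gcs G))%N -> cx d i = 0 & gP G d = p].

(** The radius [et] is found before [x1], so that a point of the unstable manifold of [u] can
    afterwards be flowed back into the range of the new chart. *)
Lemma gchart_blow (G : gchart h v) d0 s x0 u c r e : gcentered G d0 (s, x0) -> crit h u -> gl_model h X u c r ->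
  cdom c x0 -> nsq (pos_part (morse_index h u)) (cmap c x0) < r ^+ 2 / 4 ->
  nsq (neg_part (morse_index h u)) (cmap c x0) < r ^+ 2 / 4 ->
  Wplus Phi u x0 -> ~ crit h x0 -> 0 < e -> (forall b, critval h b -> `|b - h u| < e -> b = h u) ->
  h x0 < h u + e -> exists2 et, 0 < et <= r ^+ 2 / 4 & forall x1, Wminus Phi u x1 -> cdom c x1 ->
  nsq (pos_part (morse_index h u)) (cmap c x1) < et ->
  nsq (neg_part (morse_index h u)) (cmap c x1) < et ->
  exists G' d', gcentered G' d' (rcons s (flow_line Phi x0, u), x1).
Proof.
move=> [VG Dd0 cd0 Pd0] hu GL cx0 px0 mx0 Px0 nx0 e0 He hx0e.
have x0E : x0 = (gP G d0).2 by rewrite Pd0.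
have sE : s = (gP G d0).1 by rewrite Pd0.
have Ac := gl_atlas GL; have r20 : 0 < r ^+ 2 by rewrite exprn_gt0 // (gl_r0 GL).
have ux0 : h u < h x0 by have := Wplus_gt hPhi hMS 0 Px0 nx0; rewrite f0.
have ra : regular h (h x0).
  move=> cv; have := He _ cv; rewrite ger0_norm ?subr_ge0 ?ltW // => /(_ _)/esym.
  by move=> hh; move: ux0; rewrite hh ?ltxx //; lra.
have av : h x0 < h v.
  have := gv_What VG Dd0; rewrite Pd0 => -[w [/= _ /crit_le_h wv _ Wx]].
  by apply: lt_le_trans wv; have := Wminus_lt hPhi hMS 0 Wx nx0; rewrite f0.
have m0 : nsq (neg_part (morse_index h u)) (cmap c x0) = 0.
  exact: (gl_Wplus hPhi hMS Ac (gl_r0 GL) (gl_cE GL) (gl_Hh GL) (gl_HX GL) cx0 Px0 px0 mx0).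
have p0 : 0 < nsq (pos_part (morse_index h u)) (cmap c x0).
  by have := gl_h (gl_Hh GL) (cimg_cmap cx0); rewrite (cinvK Ac cx0) m0; move: ux0; lra.
rewrite x0E in cx0 px0 mx0 Px0 nx0 p0 m0 ra av ux0 hx0e *.
have [pm [F [gN [sgN gN0 ngN [cF uF] HF]]]] := gchart_straighten hPhi hMS hv VG Dd0 cd0 hu GL cx0 Px0 nx0 px0 mx0.
have [S [cS FS SF]] := inverse_function cF uF.
have cg0 : cdom c (gN d0) by rewrite gN0.
have [ncg ccg] := sm_chart sgN Ac cg0.
have np P b : nsq P (cmap c (gN d0)) < b -> nr d0 (fun d => nsq P (cmap c (gN d)) < b).
  by move=> lt; apply: (cinf_lt (cinf_nsq P ccg)).
have np0 : nr d0 (fun d => 0 < nsq (pos_part (morse_index h u)) (cmap c (gN d))).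
  by apply: (cinf_gt (cinf_nsq _ ccg)); rewrite /= gN0.
rewrite -gN0 in px0 mx0.
have [dl dl0 Hd] := nrI (nrI (cinfv_nr cF) (nrI (sm_nr sgN) ncg)) (nrI (nrI (np _ _ px0) (np _ _ mx0)) (nrI np0 (nrI ngN SF))).
have S0 : S (F d0) = d0 := nr_self SF.
have nV : nr (F d0) (fun y => gV G (S y)).
  by apply: (cinfv_nr_pre cS); rewrite S0; apply: (gv_V VG); case: Dd0.
have nS : nr (F d0) (fun y => `|S y - d0| < dl).
  by apply: (cinfv_nr_pre cS (P := fun z => `|z - d0| < dl)); rewrite S0; exists dl.
have [ep ep0 Hep] := nrI (nrI (cinfv_nr cS) FS) (nrI nV nS).
(* The bound [r ^ 2 / 4] keeps the end points in the chart at [u], and [e] isolates the critical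
   value [h u]. *)
pose et := Num.min (r ^+ 2 / 4) e; have et0 : 0 < et by rewrite lt_min divr_gt0.
have etr : et <= r ^+ 2 / 4 by rewrite ge_min lexx.
have ete : et <= e by rewrite ge_min lexx orbT.
exists et; first by rewrite et0.
move=> x1 W1 cx1 px1 mx1.
set k := size (gcs G); set iu := morse_index h u in pm HF px1 mx1 m0 *; pose p := (k.+1 + iu)%N.
have HB := @blow_valid _ _ _ _ _ _ hPhi hMS v hv G VG d0 Dd0 u c r hu GL Px0 nx0 ra F S gN dl ep et pm HF.
have Hd' d : `|d - d0| < dl -> [/\ cinfv F d, sm gN d /\ cdom c (gN d),
      nsq (pos_part iu) (cmap c (gN d)) < r ^+ 2 / 4 /\ nsq (neg_part iu) (cmap c (gN d)) < r ^+ 2 / 4,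
      0 < nsq (pos_part iu) (cmap c (gN d)) & (gD G d -> (gP G d).2 = gN d) /\ S (F d) = d].
  by move=> /Hd [[h1 [h2 h3]] [[h4 h5] [h6 [h7 h8]]]].
have Hep' y : `|y - F d0| < ep -> [/\ cinfv S y, F (S y) = y, gV G (S y) & `|S y - d0| < dl].
  by move=> /Hep [[h1 h2] [h3 h4]].
have etu b : critval h b -> `|b - h u| < et -> b = h u.
  by move=> cb bu; apply: He => //; exact: lt_le_trans bu ete.
have {HB} := HB Hd' Hep' et0 etr etu av; set G' := blow Phi G d0 u c r F S gN dl ep et => VG'.
(* The centre of the new chart: zero boundary coordinates, including the new one, then the unstable
   coordinates of [x1], and the remaining straightened coordinates of [d0]. *)
pose d1 : E m := \row_(i < m) if (i <= k)%N then 0 else if (i < p)%N then cx (cmap c x1) (i - k.+1) else cx (F d0) i.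
have mr : nsq (neg_part iu) (cmap c x1) < r ^+ 2 / 4 by move: etr mx1; lra.
have pr : nsq (pos_part iu) (cmap c x1) < r ^+ 2 / 4 by move: etr px1; lra.
have p1 := gl_Wminus hPhi hMS Ac (gl_r0 GL) (gl_cE GL) (gl_Hh GL) (gl_HX GL) cx1 W1 pr mr.
have km : (k < m)%N by apply: leq_trans pm; rewrite leq_addr.
have cd i : (i < m)%N -> cx d1 i = if (i <= k)%N then 0 else if (i < p)%N then cx (cmap c x1) (i - k.+1) else cx (F d0) i.
  by move=> im; rewrite (cx_lt _ im) mxE.
have dz i : (i <= k)%N -> cx d1 i = 0.
  by move=> ik; rewrite cd ?ik // (leq_ltn_trans ik km).
have dj (j : 'I_n) : (j < iu)%N -> cx d1 (k.+1 + j) = cmap c x1 0 j.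
  move=> ju; rewrite cd; last by rewrite (leq_trans _ pm) // ltn_add2l.
  by rewrite leqNgt leq_addr /= ltn_add2l ju addKn cxE.
have [F1 F2 F3] := cx_F HF d0.
have bE : bl_pre G d0 u d1 = F d0.
  apply: cx_eq => i im; rewrite (cx_pre G d0 u d1 im); case: (ltngtP i k) => ik.
  - by rewrite (dz i (ltnW ik)) (F1 i ik) (cd0 i ik).
  - case: ifP => ip; last by rewrite cd // leqNgt ik /= ip.
    have jn : (i - k.+1 < n)%N.
      by rewrite ltn_subLR //; apply: leq_trans ip _; rewrite leq_add2l morse_index_le.
    have ju : (Ordinal jn < iu)%N by rewrite /= ltn_subLR.
    have := F3 _ ju; rewrite /= subnKC // => ->; rewrite (dz k (leqnn k)) mul0r gN0.
    by rewrite (nsq0 m0).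
  - by rewrite ik F2 gN0.
have eE : bl_end G d0 u c S gN d1 = cmap c x1.
  apply/rowP => j; rewrite mxE (dz k (leqnn k)) mul0r; case: ifP => ju; first exact: dj.
  by rewrite (nsq0 p1) // /pos_part leqNgt ju.
exists G', d1; split => //.
- split.
    split; rewrite ?bE ?subrr ?normr0 ?dz ?normr0 //.
    rewrite (_ : nsq _ _ = nsq (neg_part iu) (cmap c x1)) //.
    by apply: eq_bigr => j; rewrite /neg_part => ju; rewrite mxE ju dj.
  by move=> i; rewrite /= size_rcons ltnS => ik; rewrite dz.
- by move=> i; rewrite /= size_rcons ltnS => ik; rewrite dz.
- by rewrite /G' /= /bl_P bE S0 eE cinvK // dz // eqxx sE.
Qed.

(** Induction on the breaks from the lower end: the path before the last break is followed down to
    the vicinity of [u], blown up there, and the chart so obtained is carried along the flow to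
    [x]. *)
Lemma gchart_at p : Wh p -> exists G d, gcentered G d p.
Proof.
case: p => s x; elim/last_ind: s x => [|s ou IH] x Wp.
  have [[_ Wx]|[s' [x' [u [/(congr1 size)]]]]] := What_inv hPhi hMS hv Wp; last by rewrite size_rcons.
  have [G [d [VG Dd Gs GP]]] := gchart_base hPhi hMS hv Wx.
  by exists G, d; split => // i; rewrite Gs.
have [[/(congr1 size)]|[s' [x' [u [E1 [Wp' nx'] hu Px Wx]]]]] := What_inv hPhi hMS hv Wp.
  by rewrite size_rcons.
have [c [r GL]] := gl_model_ex hMS hu.
have r4 : 0 < r ^+ 2 / 4 by rewrite divr_gt0 // exprn_gt0 // (gl_r0 GL).
have [e e0 He] := critval_isolated hMS (h u).
have N : nbhs u (fun z => h z < h u + e) by apply: (h_lt hMS); lra.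
have [T T0 [[cy py my] hy]] := Wplus_late Px (filterI (glm_nbhs GL hu r4) N).
have ss' : s = s' by have := E1 => /rcons_inj [].
have [|G [d CG]] := IH (Phi T x'); first by rewrite ss'; exact: (What_flow hPhi).
have [et /andP[et0 etr] H] := gchart_blow CG hu GL cy py my (Wplus_flow hPhi T Px) (flow_ncrit hPhi hMS nx') e0 He hy.
have [T2 T20 [c1 p1 m1]] := Wminus_early Wx (glm_nbhs GL hu et0).
have [G' [d' [VG' Dd' cd' P']]] := H _ (Wminus_flow hPhi _ Wx) c1 p1 m1.
exists (gflow Phi G' T2), d'; split => //; first exact: gflow_valid.
by rewrite /= P' /= -(flowD hPhi) addNr f0 E1 (flow_line_flow hPhi) // ss'.
Qed.

End GchartExistence.

(** * Gluing smooth maps *)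

Section Bump.
Context {R : realType}.
Local Notation E n := 'rV[R]_n.

(** Raises [z <= expR z], for [z = t^-1 / N.+1], to the power [N.+1]. Any pole of [p.[t^-1]] at [0]
    is thereby outweighed. *)
Lemma expR_decay (N : nat) (t : R) : 0 < t -> expR (- t^-1) <= N.+1%:R ^+ N.+1 * t ^+ N.+1.
Proof.
move=> t0; pose s := t^-1; have s0 : 0 < s by rewrite invr_gt0.
have E1 : expR s = expR (s / N.+1%:R) ^+ N.+1.
  by rewrite -expRM_natl mulrC divfK // pnatr_eq0.
have h1 : (s / N.+1%:R) ^+ N.+1 <= expR s.
  rewrite E1 lerXn2r ?nnegrE ?expR_ge0 ?divr_ge0 // ?ltW //.
  by set z := s / _; have := expR_ge1Dx z; lra.
rewrite expRN -/s -exprMn.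
have p0 : 0 < N.+1%:R * t by rewrite mulr_gt0.
rewrite -[leRHS]invrK lef_pV2 ?posrE ?expR_gt0 ?invr_gt0 ?exprn_gt0 //.
by rewrite -exprVn invfM mulrC.
Qed.

Lemma poly_bound (p : {poly R}) : exists K, 0 <= K /\ forall t : R, 0 < t <= 1 -> `|p.[t^-1]| <= K * (t ^+ size p)^-1.
Proof.
exists (\sum_(i < size p) `|p`_i|); split; first by apply: sumr_ge0 => i _.
move=> t /andP[t0 t1]; rewrite horner_coef; apply: le_trans (ler_norm_sum _ _ _) _.
rewrite mulr_suml; apply: ler_sum => i _; rewrite normrM ler_wpM2l //.
rewrite normrX ger0_norm ?invr_ge0 ?(ltW t0) // exprVn lef_pV2 ?posrE ?exprn_gt0 //.
by apply: ler_wiXn2l; rewrite ?(ltW t0) // ltnW.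
Qed.

(* These functions are stable under differentiation. *)
Definition flat (p : {poly R}) (t : R) : R := if 0 < t then p.[t^-1] * expR (- t^-1) else 0.

Lemma flat_small p : exists K, 0 <= K /\ forall t : R, 0 < t <= 1 -> `|flat p t| <= K * t ^+ 2.
Proof.
have [K [K0 HK]] := poly_bound p; pose N := (size p).+1.
exists (K * N.+1%:R ^+ N.+1); split; first by rewrite mulr_ge0 // exprn_ge0.
move=> t t01; have /andP[t0 t1] := t01; rewrite /flat t0 normrM (ger0_norm (expR_ge0 _)).
apply: le_trans (ler_pM (normr_ge0 _) (expR_ge0 _) (HK t t01) (expR_decay N t0)) _.
rewrite le_eqVlt; apply/orP; left; apply/eqP.
have tn : t ^+ size p != 0 by rewrite expf_neq0 // gt_eqF.
have -> : t ^+ N.+1 = t ^+ size p * t ^+ 2 by rewrite /N -addn2 exprD.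
set A := _ ^+ N.+1; set B := t ^+ size p in tn *; field; exact: tn.
Qed.

Lemma flat_derive p (t : R) : is_derive t 1 (flat p) (flat ('X^2 * (p - p^`())) t).
Proof.
have [t0|t0|t0] := ltgtP t 0.
- have -> : flat ('X^2 * (p - p^`())) t = 0 by rewrite /flat ltNge ltW.
  apply: is_derive_eps => e e0; exists (- t); first by rewrite oppr_gt0.
  have F0 z : z <= 0 -> flat p z = 0 by move=> z0; rewrite /flat ltNge z0.
  move=> s st; rewrite !F0; [|exact: ltW|by move: st; rewrite ltr_norml [_ *: _]mulr1; lra].
  by rewrite mulr0 !subr0 normr0 mulr_ge0 // ltW.
- have tn : t != 0 by rewrite gt_eqF.
  have D : is_derive t 1 (fun s : R => p.[s^-1] * expR (- s^-1)) (flat ('X^2 * (p - p^`())) t).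
    have D1 : is_derive t 1 (fun s : R => s^-1) (- t ^- 2).
      by apply: is_derive_eq (is_deriveV tn (is_derive_id t 1)) _; rewrite [_ *: _]mulr1.
    have D2 : is_derive t 1 (fun s : R => p.[s^-1]) (p^`().[t^-1] * - t ^- 2).
      by apply: (@is_derive1_comp _ (fun y => p.[y]) (fun s : R => s^-1)); exact: is_derive_poly.
    have D3 : is_derive t 1 (fun s : R => expR (- s^-1)) (expR (- t^-1) * - - t ^- 2).
      by apply: (@is_derive1_comp _ (@expR R) (fun s : R => - s^-1)); apply: dN.
    apply: is_derive_eq (dM D2 D3) _.
    rewrite /flat t0 hornerM hornerXn hornerD hornerN.
    by set a := p.[_]; set b := p^`().[_]; set e := expR _; field.
  apply: (near_eq_is_derive _ D); exists t => // s; rewrite /= /flat => st.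
  by have -> : 0 < s by move: st; rewrite /ball_ /= ltr_norml; lra.
- rewrite t0 {2}/flat ltxx; have [K [K0 HK]] := flat_small p.
  apply: is_derive_eps => e e0; exists (Num.min 1 (e / (K + 1))).
    by rewrite lt_min ltr01 divr_gt0 // ltr_wpDl.
  move=> s; rewrite lt_min => /andP[s1 se]; rewrite add0r [_ *: _]mulr1 mulr0 subr0 {2}/flat ltxx subr0.
  have [s0|s0] := ltP 0 s; last by rewrite /flat ltNge s0 /= normr0 mulr_ge0 // ltW.
  rewrite (ger0_norm (ltW s0)) in s1 se *.
  apply: le_trans (HK s _) _; first by rewrite s0 ltW.
  rewrite expr2 mulrA; apply: ler_wpM2r; first exact: ltW.
  by move: se; rewrite ltr_pdivlMr ?ltr_wpDl //; lra.
Qed.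

Lemma flat_cinf p (w : E 1) : cinf (fun w : E 1 => flat p (w 0 0)) w.
Proof.
have D k : exists q, derive1n k (flat p) = flat q.
  elim: k => [|k [q IH]]; first by exists p.
  exists ('X^2 * (q - q^`())); apply/funext => t.
  by rewrite derive1nS IH derive1E; have [_ ->] := flat_derive q t.
have w1 : `|w 0 0| < `|w 0 0| + 1 by rewrite ltrDl.
apply: (curve_cinf (a := `|w 0 0| + 1)) w1; first by rewrite ltr_wpDl.
by move=> t k _; have [q ->] := D k; have [] := flat_derive q t.
Qed.

Definition step (t : R) : R := flat 1 t / (flat 1 t + flat 1 (1 - t)).

Lemma flat1_ge0 t : 0 <= flat 1 t.
Proof. by rewrite /flat; case: ifP => // _; rewrite hornerC mul1r expR_ge0. Qed.

Lemma flat1_gt0 t : 0 < t -> 0 < flat 1 t.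
Proof. by move=> t0; rewrite /flat t0 hornerC mul1r expR_gt0. Qed.

Lemma step_den t : 0 < flat 1 t + flat 1 (1 - t).
Proof.
have [t0|t0] := ltP 0 t; first by rewrite ltr_wpDr ?flat1_ge0 ?flat1_gt0.
by rewrite ltr_wpDl ?flat1_ge0 ?flat1_gt0 // subr_gt0; lra.
Qed.

Lemma step1 t : 1 <= t -> step t = 1.
Proof.
move=> t1; have := step_den t; rewrite /step.
have -> : flat 1 (1 - t) = 0 by rewrite /flat subr_gt0 ltNge t1.
by rewrite addr0 => t0; rewrite divff // gt_eqF.
Qed.

Lemma step0 t : t <= 0 -> step t = 0.
Proof. by move=> t0; rewrite /step {1}/flat ltNge t0 mul0r. Qed.

Lemma cinf_step q (f : E q -> R) w : cinf f w -> cinf (fun w => step (f w)) w.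
Proof.
move=> sf; have C (g : E q -> R) : cinf g w -> cinf (fun w => flat 1 (g w)) w.
  move=> sg; have sg' : cinfv (fun w => \row_(j < 1) g w) w by apply: cinfv_row.
  by apply: cinf_ext (cinf_comp (flat_cinf 1 _) sg') => y; rewrite /= mxE.
have D : cinf (fun w => flat 1 (f w) + flat 1 (1 - f w)) w.
  by apply: cinfD; apply: C => //; apply: cinfB => //; exact: cinfC.
by apply: cinfM; [exact: C|apply: cinfV => //; rewrite gt_eqF // step_den].
Qed.

(** [4 - 3 z ^ 2] is at least [1] for [|z| <= 1] and negative for [|z| >= 3 / 2]: the bump is [1] on
    the cube of radius [r] and vanishes near each point at distance [2 r] or more. The square avoids
    the absolute value, which is not smooth. *)
Definition bump q (y0 : E q) (r : R) (y : E q) : R :=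
  \prod_(j < q) step (4 - 3 * ((y 0 j - y0 0 j) / r) ^+ 2).

Lemma bump_cinf q (y0 : E q) r y : cinf (bump y0 r) y.
Proof.
apply: cinf_prod => j _; apply: cinf_step; apply: cinfB; first exact: cinfC.
have c1 : cinf (fun y : E q => (y 0 j - y0 0 j) / r) y.
  by apply: cinfM; [apply: cinfB; [exact: cinf_coord|exact: cinfC]|exact: cinfC].
by apply: cinfM; [exact: cinfC|apply: cinf_ext (cinfM c1 c1) => z; rewrite expr2].
Qed.

Lemma bump1 q (y0 y : E q) r : 0 < r -> `|y - y0| < r -> bump y0 r y = 1.
Proof.
move=> r0 yr; apply: big1 => j _; apply: step1.
have : `|(y 0 j - y0 0 j) / r| < 1.
  rewrite normrM normfV (gtr0_norm r0) ltr_pdivrMr // mul1r.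
  by apply: le_lt_trans yr; rewrite -coordB coord_le_norm.
set z := _ / r => z1; have : z ^+ 2 <= 1 by rewrite -[z ^+ 2]ger0_norm ?sqr_ge0 // normrX expr_le1 // ltW.
lra.
Qed.

Lemma bump0 q (y0 y : E q) r : 0 < r -> 2 * r <= `|y - y0| -> nr y (fun z => bump y0 r z = 0).
Proof.
move=> r0 yr.
have [j jr] : exists j, 2 * r <= `|y 0 j - y0 0 j|.
  apply: contrapT => H; move: yr; apply/negP; rewrite -ltNge; apply: norm_lt_coord; first by rewrite mulr_gt0.
  by move=> j; rewrite ltNge coordB; apply/negP => jr; apply: H; exists j.
exists (r / 2); first by rewrite divr_gt0.
move=> z zy; rewrite /bump (bigD1 j) //= step0 ?mul0r //.
have h1 : `|z 0 j - y 0 j| < r / 2 by rewrite -coordB; apply: le_lt_trans zy; exact: coord_le_norm.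
have h2 : 3 / 2 <= `|(z 0 j - y0 0 j) / r|.
  rewrite normrM normfV (gtr0_norm r0) ler_pdivlMr //.
  have := ler_distD (z 0 j) (y 0 j) (y0 0 j); rewrite [`|y 0 j - z 0 j|]distrC.
  by move: jr h1; set a := `|_ - _|; set b := `|_ - _|; set c := `|_ - _|; lra.
have : 9 / 4 <= ((z 0 j - y0 0 j) / r) ^+ 2.
  rewrite -[_ ^+ 2]ger0_norm ?sqr_ge0 // normrX.
  have -> : 9 / 4 = (3 / 2) ^+ 2 :> R by field.
  by rewrite lerXn2r ?nnegrE.
lra.
Qed.

End Bump.

Section Gluing.
Context {R : realType}.
Local Notation E n := 'rV[R]_n.

(** The extension [g] may depend on the point [y]; [smooth_on_local] glues such extensions into
    one. *)
Definition rel_cinfv n m (D : set (E n)) (f : E n -> E m) (y : E n) :=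
  exists g, cinfv g y /\ nr y (fun z => D z -> f z = g z).

Lemma rational_cube n (x : E n) (e : R) : 0 < e -> exists (c : 'rV[rat]_n) (r : rat),
  [/\ 0 < (ratr r : R), `|x - map_mx ratr c| < ratr r & ratr r * 3 < e].
Proof.
move=> e0; have [r] := rat_in_itvoo (divr_gt0 e0 (ltr0n R 3)); rewrite in_itv /= => /andP[r0 re].
have H j : exists q : rat, ratr q \in `](x 0 j - ratr r), (x 0 j + ratr r)[.
  by apply: rat_in_itvoo; rewrite ltrBlDr -addrA ltrDl addr_gt0.
exists (\row_j xget 0 [set q : rat | ratr q \in `](x 0 j - ratr r), (x 0 j + ratr r)[]), r; split => //.
  apply: norm_lt_coord => // j; rewrite !mxE; case: xgetP => [q _|]; last by have [q Hq] := H j => /(_ q).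
  by rewrite /= in_itv /= ltr_norml; lra.
by rewrite -ltr_pdivlMr.
Qed.

(* A partition of unity [bump_j * \prod_(i < j) (1 - bump_i)] subordinate to
   countably many rational cubes; the sum is locally finite since it
   telescopes to 1 as soon as one of the bumps equals 1. *)
Lemma smooth_on_local n m (O : set (E n)) (f : E n -> E m) :
  (forall y, O y -> rel_cinfv O f y) -> smooth_on O f.
Proof.
move=> H.
(* A cube is good if a single extension of [f] is valid on the cube of twice the radius, outside of
   which the bump vanishes. *)
pose good (i : 'rV[rat]_n * rat) (g : E n -> E m) := 0 < (ratr i.2 : R) /\
  forall z, `|z - map_mx ratr i.1| < 2 * ratr i.2 -> cinfv g z /\ (O z -> f z = g z).
pose ix (k : nat) : 'rV[rat]_n * rat := odflt (0, 0) (unpickle k).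
pose ctr k : E n := map_mx ratr (ix k).1; pose rad k : R := ratr (ix k).2.
pose G k := xget (fun=> 0) [set g | good (ix k) g].
pose ok k := `[< exists g, good (ix k) g >].
have Gok k : ok k -> good (ix k) (G k).
  by move=> /asboolP [g Hg]; rewrite /G; case: xgetP => [g' _ //|/(_ g)].
pose chi k (y : E n) : R := if ok k then bump (ctr k) (rad k) y else 0.
pose psi k (y : E n) := chi k y * \prod_(i < k) (1 - chi i y).
pose core k (y : E n) := ok k /\ `|y - ctr k| < rad k.
have chi1 k y : core k y -> chi k y = 1.
  by move=> [okk yk]; rewrite /chi okk bump1 //; have [] := Gok k okk.
have chiC k y : cinf (chi k) y by rewrite /chi; case: (ok k); [exact: bump_cinf|exact: cinfC].
have psiC k y : cinf (psi k) y.
  by apply: cinfM => //; apply: cinf_prod => i _; apply: cinfB => //; exact: cinfC.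
have psi0 k N y : core N y -> (N < k)%N -> psi k y = 0.
  by move=> cN Nk; rewrite /psi (bigD1 (Ordinal Nk)) //= (chi1 N y cN) subrr mul0r mulr0.
have psiS N y : \sum_(k < N) psi k y = 1 - \prod_(k < N) (1 - chi k y).
  elim: N => [|N IH]; first by rewrite !big_ord0 subrr.
  by rewrite big_ord_recr /= IH [in RHS]big_ord_recr /= /psi; ring.
have psi1 N y : core N y -> \sum_(k < N.+1) psi k y = 1.
  by move=> cN; rewrite psiS big_ord_recr /= (chi1 N y cN) subrr mulr0 subr0.
have coreO N y : core N y -> nr y (core N).
  by move=> [okN yN]; apply: nrW (nr_ball yN) => z zN.
have psiG k j y : cinf (fun y => psi k y * G k y 0 j) y.
  have [okk|nok] := boolP (ok k); last first.
    apply: (@cinf_ext _ _ (fun=> 0)); last exact: cinfC.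
    by move=> z; rewrite /psi /chi (negPf nok) !mul0r.
  have [r0 HG] := Gok k okk.
  have [yk|yk] := ltP `|y - ctr k| (2 * rad k).
    by apply: cinfM => //; have [] := HG y yk.
  apply: (@cinf_eq _ _ (fun=> 0)); last exact: cinfC.
  by apply: nrW (bump0 r0 yk) => z z0; rewrite /psi /chi okk z0 !mul0r.
pose sumg N (y : E n) : E m := \row_j \sum_(k < N.+1) psi k y * G k y 0 j.
have sum_ind N N' y : core N y -> core N' y -> sumg N y = sumg N' y.
  wlog NN : N N' / (N <= N')%N.
    by move=> W c1 c2; case/orP: (leq_total N N') => h; [exact: W|apply/esym; exact: W].
  move=> c1 _; apply/rowP => j; rewrite !mxE.
  rewrite -(subnKC NN) -addSn big_split_ord /= [X in _ = _ + X]big1 ?addr0 // => i _.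
  by rewrite (psi0 _ N) ?mul0r // ltnS leq_addr.
pose V := [set y | exists N, core N y].
pose nx y := xget 0%N [set N | core N y].
have nxP y : V y -> core (nx y) y.
  by move=> [N cN]; rewrite /nx; case: xgetP => [N' _ //|/(_ N)].
have OV : O `<=` V.
  move=> y Oy; have [g [cg fg]] := H y Oy; have [e e0 He] := nrI (cinfv_nr cg) fg.
  have [c [r [r0 yr re]]] := rational_cube y e0.
  exists (pickle (c, r)); have E1 : ix (pickle (c, r)) = (c, r) by rewrite /ix pickleK.
  split; last by rewrite /ctr /rad E1.
  apply/asboolP; exists g; rewrite E1; split => // z zr; apply: He.
  have -> : z - y = (z - map_mx ratr c) - (y - map_mx ratr c) by rewrite opprB addrA subrK.
  by apply: le_lt_trans (ler_normB _ _) _; move: zr yr re => /=; lra.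
exists (fun y => sumg (nx y) y); split.
  exists V; split => //.
    by apply/nr_open => y [N cN]; apply: nrW (coreO N y cN) => z cz; exists N.
  move=> k j; move: k; apply: cinf_Ck => y Vy.
  pose N := nx y; have cN := nxP y Vy.
  apply: (@cinf_eq _ _ (fun y => sumg N y 0 j)).
    by apply: nrW (coreO N y cN) => z cz; rewrite (sum_ind N (nx z)) //; apply: nxP; exists N.
  apply: (@cinf_ext _ _ (fun y => \sum_(k < N.+1) psi k y * G k y 0 j)); first by move=> z; rewrite mxE.
  by apply: cinf_big.
move=> y Oy; have cN := nxP y (OV y Oy); apply/rowP => j; rewrite mxE.
transitivity (\sum_(k < (nx y).+1) psi k y * f y 0 j); first by rewrite -mulr_suml psi1 // mul1r.
apply: eq_bigr => k _; have [okk|nok] := boolP (ok k); last first.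
  by rewrite /psi /chi (negPf nok) !mul0r.
have [r0 HG] := Gok k okk; have [yk|yk] := ltP `|y - ctr k| (2 * rad k).
  by have [_ /(_ Oy) ->] := HG y yk.
by rewrite /psi /chi okk (nr_self (bump0 r0 yk)) !mul0r.
Qed.

End Gluing.

(** * Smooth maps between manifolds *)

Section RelativeSmoothness.
Context {R : realType}.
Local Notation E n := 'rV[R]_n.

Lemma rel_cinfv_comp n m p (D : set (E n)) (D' : set (E m)) (f : E n -> E m) (f' : E m -> E p) y :
  rel_cinfv D f y -> D y -> nr y (fun z => D z -> D' (f z)) -> rel_cinfv D' f' (f y) ->
  rel_cinfv D (f' \o f) y.
Proof.
move=> [g [cg fg]] Dy DD' [g' [cg' fg']]; have fy : f y = g y := nr_self fg Dy.
rewrite fy in cg' fg'; exists (g' \o g); split; first exact: cinfv_comp.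
apply: nrW (nrI (nrI fg DD') (cinfv_nr_pre cg fg')) => z [[h1 h2] h3] Dz /=.
by rewrite -h3 -?h1 //; exact: h2.
Qed.

Lemma rel_cinfv_eq n m (D D' : set (E n)) (f f' : E n -> E m) y :
  nr y (fun z => D' z -> D z /\ f' z = f z) -> rel_cinfv D f y -> rel_cinfv D' f' y.
Proof.
move=> H [g [cg fg]]; exists g; split => //.
by apply: nrW (nrI H fg) => z [h1 h2] D'z; have [Dz ->] := h1 D'z; exact: h2.
Qed.

Lemma rel_cinfv_cinfv n m (D : set (E n)) (f : E n -> E m) y : cinfv f y -> rel_cinfv D f y.
Proof. by move=> cf; exists f; split => //; exact: nrT. Qed.

Lemma smooth_on_rel n m (D : set (E n)) (f : E n -> E m) y : smooth_on D f -> D y -> rel_cinfv D f y.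
Proof.
move=> [g [[V [oV DV Vg]] fg]] Dy; exists g; split; last by apply: nrT => z /fg.
by move=> j; exists V; split => //; exact: DV.
Qed.

End RelativeSmoothness.

Section LocalSmoothness.
Context {R : realType}.
Local Notation E n := 'rV[R]_n.

Section OneManifold.
Context {n : nat} {D : set (E n)}.
Variable N : manifold D.

Lemma cimg_mem (T : Type) (c : chart R n T) x : cdom c x -> cimg c (cmap c x).
Proof. by exists x. Qed.

Lemma mf_chart c : atlas N c -> chart_of D c.
Proof. by have [H _ _ _] := matlas N; exact: H. Qed.

Lemma mf_at (x : N) : exists2 c, atlas N c & cdom c x.
Proof. by have [_ H _ _] := matlas N; exact: H. Qed.

Lemma mf_compat c d : atlas N c -> atlas N d -> compatible c d.
Proof. by have [_ _ H _] := matlas N; exact: H. Qed.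

Lemma chart_cinvK (T : topologicalType) (c : chart R n T) x : chart_of D c -> cdom c x -> cinv c (cmap c x) = x.
Proof. by move=> [_ _ H _ _]; exact: H. Qed.

Lemma chart_cdom (T : topologicalType) (c : chart R n T) y : chart_of D c -> cimg c y ->
  cdom c (cinv c y) /\ cmap c (cinv c y) = y.
Proof. by move=> [_ _ H _ _] [x cx <-]; rewrite H. Qed.

Lemma chart_nr (T : topologicalType) (c : chart R n T) x (U : set T) : chart_of D c -> cdom c x -> nbhs x U ->
  nr (cmap c x) (fun z => cimg c z -> U (cinv c z)).
Proof.
move=> Cc cx Ux; have [_ _ cK _ /subspace_continuousP/(_ (cmap c x) (cimg_mem cx))] := Cc.
have Ux' : nbhs (cinv c (cmap c x)) U by rewrite cK.
by move=> /(_ U Ux') /nrP; apply: nrW => z h /h.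
Qed.

Lemma chart_nbhs (T : topologicalType) (c : chart R n T) x (P : E n -> Prop) : chart_of D c -> cdom c x ->
  nr (cmap c x) P -> nbhs x (fun z => P (cmap c z)).
Proof.
move=> [oc _ _ /subspace_continuousP H _] cx /nrP NP.
have := H x cx _ NP; rewrite /nbhs /= /within /= => H1.
have oc' : nbhs x (cdom c) by exact: open_nbhs_nbhs.
by apply: filterS (filterI H1 oc') => z [h cz]; exact: h.
Qed.

Lemma chart_img (T : topologicalType) (c : chart R n T) y : chart_of D c -> cimg c y -> D y /\ nr y (fun z => D z -> cimg c z).
Proof.
move=> [_ [W oW ->] _ _ _] [Wy Dy]; split => //.
by apply: nrW ((nr_open W).1 oW y Wy) => z Wz Dz; split.
Qed.

Lemma chart_nr_nbhs (T : topologicalType) (c : chart R n T) x (U : set T) : chart_of D c -> cdom c x ->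
  nr (cmap c x) (fun z => cimg c z -> U (cinv c z)) -> nbhs x U.
Proof.
move=> Cc cx H; have [oc _ _ _ _] := Cc; have oc' : nbhs x (cdom c) by exact: open_nbhs_nbhs.
apply: filterS (filterI (chart_nbhs Cc cx H) oc') => z [h cz].
by have := h (cimg_mem cz); rewrite (chart_cinvK Cc cz).
Qed.

Lemma mf_transition c d x : atlas N c -> atlas N d -> cdom c x -> cdom d x ->
  rel_cinfv (cimg c) (cmap d \o cinv c) (cmap c x).
Proof.
move=> Ac Ad cx dx; have [H _] := mf_compat Ac Ad; have Cc := mf_chart Ac; have Cd := mf_chart Ad.
have [od _ _ _ _] := Cd; have Ud : nbhs x (cdom d) by exact: open_nbhs_nbhs.
apply: rel_cinfv_eq (smooth_on_rel H _); last by exists x.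
apply: nrW (chart_nr Cc cx Ud) => z h cz; split => //.
have [cz1 cz2] := chart_cdom Cc cz; exists (cinv c z) => //; split => //; exact: h.
Qed.

End OneManifold.

Section TwoManifolds.
Context {n m : nat} {D : set (E n)} {D' : set (E m)}.
Variables (N : manifold D) (P : manifold D').

Definition lsm (f : N -> P) (x : N) : Prop := {for x, continuous f} /\
  forall c d, atlas N c -> atlas P d -> cdom c x -> cdom d (f x) ->
    rel_cinfv (cimg c) (cmap d \o f \o cinv c) (cmap c x).

(** Other charts only add transition maps to the composition, so one pair of charts suffices;
    continuity is recovered from that of the local extension. *)
Lemma lsm_ex (f : N -> P) (x : N) c d : atlas N c -> atlas P d -> cdom c x -> cdom d (f x) ->
  nr (cmap c x) (fun z => cimg c z -> cdom d (f (cinv c z))) ->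
  rel_cinfv (cimg c) (cmap d \o f \o cinv c) (cmap c x) -> lsm f x.
Proof.
move=> Ac Ad cx dfx nd sf; have Cc := mf_chart Ac; have Cd := mf_chart Ad.
have fE : (cmap d \o f \o cinv c) (cmap c x) = cmap d (f x) by rewrite /= (chart_cinvK Cc cx).
split.
  move=> U Uf; apply: (chart_nr_nbhs Cc cx).
  have [g [cg fg]] := sf; have gx : g (cmap c x) = cmap d (f x).
    by rewrite -(nr_self fg (cimg_mem cx)).
  have H := chart_nr Cd dfx Uf; rewrite -gx in H.
  apply: nrW (nrI (nrI nd fg) (cinfv_nr_pre cg H)) => z [[h1 h2] h3] cz.
  rewrite -h2 //= in h3; have := h3 (cimg_mem (h1 cz)).
  by rewrite (chart_cinvK Cd (h1 cz)).
move=> c' d' Ac' Ad' c'x d'fx; have Cc' := mf_chart Ac'; have Cd' := mf_chart Ad'.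
have T1 := mf_transition Ac' Ac c'x cx; have T2 := mf_transition Ad Ad' dfx d'fx.
have [oc _ _ _ _] := Cc; have Uc : nbhs x (cdom c) by exact: open_nbhs_nbhs.
have n1 := chart_nr Cc' c'x Uc.
have nx : nbhs x (fun z => cdom d (f z)) by exact: (chart_nr_nbhs Cc cx).
have n2 := chart_nr Cc' c'x nx.
have E1 : (cmap c \o cinv c') (cmap c' x) = cmap c x by rewrite /= (chart_cinvK Cc' c'x).
have S1 : rel_cinfv (cimg c') ((cmap d \o f \o cinv c) \o (cmap c \o cinv c')) (cmap c' x).
  apply: (rel_cinfv_comp (D' := cimg c) T1); first exact: cimg_mem.
    by apply: nrW n1 => z h /h; exact: cimg_mem.
  by rewrite E1.
have E2 : ((cmap d \o f \o cinv c) \o (cmap c \o cinv c')) (cmap c' x) = cmap d (f x).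
  by rewrite -fE /=; congr (cmap d (f (cinv c _))); exact: E1.
have n12 := nrI n1 n2.
have S2 : rel_cinfv (cimg c') ((cmap d' \o cinv d) \o ((cmap d \o f \o cinv c) \o (cmap c \o cinv c'))) (cmap c' x).
  apply: (rel_cinfv_comp (D' := cimg d) S1); first exact: cimg_mem.
    apply: nrW n12 => z [h1 h2] cz /=; rewrite (chart_cinvK Cc (h1 cz)).
    by apply: cimg_mem; exact: h2.
  by rewrite E2.
apply: rel_cinfv_eq S2; apply: nrW n12 => z [h1 h2] cz; split => //=.
by rewrite (chart_cinvK Cc (h1 cz)) (chart_cinvK Cd (h2 cz)).
Qed.

Lemma lsm_eq (f g : N -> P) x : nbhs x (fun y => f y = g y) -> lsm f x -> lsm g x.
Proof.
move=> fg [cf sf]; have [c Ac cx] := mf_at x; have [d Ad dfx] := mf_at (f x).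
have fgx : f x = g x := nbhs_singleton fg.
have Cc := mf_chart Ac; have [od _ _ _ _] := mf_chart Ad.
have nd : nbhs x (fun y => cdom d (f y)) by apply: cf; exact: open_nbhs_nbhs.
have nfg := nrI (chart_nr Cc cx fg) (chart_nr Cc cx nd).
apply: (lsm_ex Ac Ad cx); rewrite -?fgx //.
  by apply: nrW nfg => z [h1 h2] cz; rewrite -(h1 cz); exact: h2.
by apply: rel_cinfv_eq (sf c d Ac Ad cx dfx); apply: nrW nfg => z [h1 h2] cz; split => //=; rewrite (h1 cz).
Qed.

(** [smooth_map] asks for one extension of each local expression on its whole domain; the pointwise
    extensions are glued by [smooth_on_local]. *)
Lemma smooth_mapP (U : set N) (f : N -> P) : (forall x, U x -> lsm f x) -> smooth_map U f.
Proof.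
move=> H; split; first by move=> x /H [].
move=> c d Ac Ad; apply: smooth_on_local => _ [x [[Ux cx] dx] <-].
have [_ sf] := H x Ux; apply: rel_cinfv_eq (sf c d Ac Ad cx dx).
by apply: nrT => z [y [[_ cy] _] <-]; split => //; exact: cimg_mem.
Qed.

Lemma smooth_map_lsm (U : set N) (f : N -> P) x : smooth_map U f -> nbhs x U -> lsm f x.
Proof.
move=> [cf sf] Ux; have Ux' := nbhs_singleton Ux; split; first exact: cf.
move=> c d Ac Ad cx dx; have Cc := mf_chart Ac; have [od _ _ _ _] := mf_chart Ad.
have nd : nbhs x (fun y => cdom d (f y)) by apply: cf => //; exact: open_nbhs_nbhs.
apply: rel_cinfv_eq (smooth_on_rel (sf c d Ac Ad) _); last by exists x.
apply: nrW (chart_nr Cc cx (filterI Ux nd)) => z h cz; split => //.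
have [cz1 cz2] := chart_cdom Cc cz; have [h1 h2] := h cz.
by exists (cinv c z).
Qed.

End TwoManifolds.

Lemma lsm_comp n m p (D : set (E n)) (D' : set (E m)) (D2 : set (E p)) (N : manifold D) (P : manifold D')
  (Q : manifold D2) (f : N -> P) (g : P -> Q) x : lsm f x -> lsm g (f x) -> lsm (g \o f) x.
Proof.
move=> [cf sf] [cg sg].
have [c Ac cx] := mf_at x; have [d Ad dx] := mf_at (f x); have [b Ab bx] := mf_at (g (f x)).
have Cc := mf_chart Ac; have Cd := mf_chart Ad; have [od _ _ _ _] := Cd; have [ob _ _ _ _] := mf_chart Ab.
have nb0 : nbhs (f x) (fun y => cdom b (g y)) by apply: cg; exact: open_nbhs_nbhs.
have nb : nbhs x (fun z => cdom b (g (f z))) := cf _ nb0.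
have nd : nbhs x (fun y => cdom d (f y)) by apply: cf; exact: open_nbhs_nbhs.
have nn := nrI (chart_nr Cc cx nb) (chart_nr Cc cx nd).
apply: (lsm_ex Ac Ab cx) => //; first by apply: nrW nn => z [h _] /h.
have S : rel_cinfv (cimg c) ((cmap b \o g \o cinv d) \o (cmap d \o f \o cinv c)) (cmap c x).
  apply: (rel_cinfv_comp (D' := cimg d) (sf c d Ac Ad cx dx)); first exact: cimg_mem.
    by apply: nrW nn => z [_ h] cz; apply: cimg_mem; exact: h.
  by rewrite /= (chart_cinvK Cc cx); exact: sg.
apply: rel_cinfv_eq S; apply: nrW nn => z [_ h] cz; split => //=.
by rewrite (chart_cinvK Cd) //; exact: h.
Qed.

End LocalSmoothness.

(** * Manifolds from families of charts *)

(* [T] with the topology for which the charts in [C] are homeomorphisms onto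
   open subsets of the orthant. *)
Definition atlas_space (R : realType) (m : nat) (T : Type) (C : set (chart R m T)) : Type := T.

Section AtlasTopology.
Context {R : realType} {m : nat} {T : Type}.
Local Notation E n := 'rV[R]_n.
Variable C : set (chart R m T).

Definition lopen (U : set T) := forall c x, C c -> cdom c x -> U x ->
  nr (cmap c x) (fun y => orthant y -> U (cinv c y)).

Lemma lopenT : lopen setT.
Proof. by move=> c x _ _ _; exact: nrT. Qed.

Lemma lopenI : setI_closed lopen.
Proof.
move=> A B oA oB c x Cc cx [Ax Bx].
by apply: nrW (nrI (oA c x Cc cx Ax) (oB c x Cc cx Bx)) => y [h1 h2] Oy; split; [exact: h1|exact: h2].
Qed.

Lemma lopen_bigU (I : Type) (f : I -> set T) : (forall i, lopen (f i)) -> lopen (\bigcup_i f i).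
Proof.
move=> H c x Cc cx [i _ fx]; apply: nrW (H i c x Cc cx fx) => y h Oy.
by exists i => //; exact: h.
Qed.

HB.instance Definition _ := gen_eqMixin (atlas_space C).
HB.instance Definition _ := gen_choiceMixin (atlas_space C).
HB.instance Definition _ := isOpenTopological.Build (atlas_space C) lopenT lopenI lopen_bigU.

(** The conditions on charts are local, at a single point. [gc_sep] is responsible for the Hausdorff
    property, [gc_count] for paracompactness. *)
Record good_charts : Prop := GoodCharts {
  gc_img : forall c x, C c -> cdom c x ->
    [/\ orthant (cmap c x), cinv c (cmap c x) = x & nr (cmap c x) (fun y => orthant y -> cimg c y)];
  gc_cover : forall x, exists2 c, C c & cdom c x;
  gc_trans : forall c d x, C c -> C d -> cdom c x -> cdom d x ->
    nr (cmap c x) (fun y => orthant y -> cdom d (cinv c y)) /\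
    rel_cinfv (@orthant R m) (cmap d \o cinv c) (cmap c x);
  gc_sep : forall x y, x <> y -> exists A B, [/\ lopen A, lopen B, A x, B y & A `&` B = set0];
  gc_count : exists F : nat -> chart R m T, forall x, exists2 k, C (F k) & cdom (F k) x }.

Hypothesis GC : good_charts.
Local Notation TC := (atlas_space C).

Lemma open_lopen (U : set TC) : open U <-> lopen U.
Proof. by []. Qed.

Lemma gc_cinvK c x : C c -> cdom c x -> cinv c (cmap c x) = x.
Proof. by move=> Cc cx; have [] := gc_img GC Cc cx. Qed.

Lemma gc_cimg c y : C c -> cimg c y -> [/\ orthant y, cdom c (cinv c y) & cmap c (cinv c y) = y].
Proof. by move=> Cc [x cx <-]; have [h1 h2 _] := gc_img GC Cc cx; rewrite h2. Qed.

(** The points near which the property holds in the chart [c] form a set that is open in every other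
    chart, by the transition maps; so one chart suffices to recognize a neighbourhood. *)
Lemma gc_nbhs c (x : TC) U : C c -> cdom c x -> nr (cmap c x) (fun y => orthant y -> U (cinv c y)) -> nbhs x U.
Proof.
move=> Cc cx H; pose B : set TC := [set z | cdom c z /\ nr (cmap c z) (fun y => orthant y -> U (cinv c y))].
have oB : open B.
  apply/open_lopen => d z Cd dz [cz Bz]; have [h1 [g [cg gE]]] := gc_trans GC Cd Cc dz cz.
  have [Oz zK _] := gc_img GC Cd dz.
  have gz : g (cmap d z) = cmap c z by rewrite -(nr_self gE Oz) /= zK.
  have := cinfv_nr_pre cg (P := fun w => nr w (fun y => orthant y -> U (cinv c y))).
  rewrite gz => /(_ (nr_nr Bz)) h2.
  apply: nrW (nrI (nrI h1 gE) h2) => y [[k1 k2] k3] Oy; split; first exact: k1.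
  by rewrite -k2 in k3.
have sB : B `<=` U.
  move=> z [cz Bz]; have [Oz zK _] := gc_img GC Cc cz.
  by have := nr_self Bz Oz; rewrite zK.
by apply: filterS sB _; apply: open_nbhs_nbhs; split.
Qed.

Lemma gc_nr c (x : TC) U : C c -> cdom c x -> nbhs x U -> nr (cmap c x) (fun y => orthant y -> U (cinv c y)).
Proof.
move=> Cc cx; rewrite nbhsE => -[B [oB Bx] BU].
by apply: nrW ((open_lopen B).1 oB c x Cc cx Bx) => y h /h /BU.
Qed.

Lemma orthant_nr_ex (W : set (E m)) : (forall y, W y -> orthant y /\ nr y (fun z => orthant z -> W z)) ->
  exists2 O : set (E m), open O & W = O `&` @orthant R m.
Proof.
move=> H; exists [set y | nr y (fun z => orthant z -> W z)].
  by apply/nr_open => y; exact: nr_nr.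
apply/seteqP; split=> y; first by move=> /H [].
by move=> [/= /nr_self].
Qed.

Lemma gc_chart (c : chart R m TC) : C c -> chart_of (@orthant R m) c.
Proof.
move=> Cc; split.
- by apply/open_lopen => d x Cd dx cx; have [] := gc_trans GC Cd Cc dx cx.
- apply: orthant_nr_ex => y [x cx <-]; have [h1 h2 h3] := gc_img GC Cc cx; by split.
- by move=> x cx; exact: gc_cinvK.
- apply/subspace_continuousP => x cx U Ux; rewrite /nbhs /= /within /=.
  apply: (gc_nbhs (U := fun z => cdom c z -> U (cmap c z)) Cc cx).
  have [_ _ h3] := gc_img GC Cc cx; have h4 : nr (cmap c x) U by apply/nrP.
  apply: nrW (nrI h3 h4) => y [k1 k2] Oy _.
  by have [_ _ ->] := gc_cimg Cc (k1 Oy).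
- apply/subspace_continuousP => y cy U Uy; apply/nrP; have [Oy dy yK] := gc_cimg Cc cy.
  have := gc_nr Cc dy Uy; rewrite yK; apply: nrW => z h cz.
  by have [Oz _ _] := gc_cimg Cc cz; exact: h.
Qed.

Definition max_atlas : set (chart R m TC) :=
  [set c | chart_of (@orthant R m) c /\ forall d : chart R m TC, C d -> compatible c d].

Lemma chart_open_nbhs (c : chart R m TC) x : chart_of (@orthant R m) c -> cdom c x -> nbhs x (cdom c).
Proof. by move=> [oc _ _ _ _] cx; exact: open_nbhs_nbhs. Qed.

(** Near each point the change of charts factors through a chart of [C]; the local extensions are
    then glued. *)
Lemma max_compat c c' : max_atlas c -> max_atlas c' ->
  smooth_on (cmap c @` (cdom c `&` cdom c')) (cmap c' \o cinv c).
Proof.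
move=> [Cc Hc] [Cc' Hc']; apply: smooth_on_local => _ [x [cx c'x] <-].
have [d Cd dx] := gc_cover GC x; have [S1 _] := Hc d Cd; have [_ S2] := Hc' d Cd.
have Kd := gc_chart Cd.
have n1 := chart_nr Cc cx (chart_open_nbhs Kd dx).
have n2 := chart_nr Cc cx (chart_open_nbhs Cc' c'x).
have xK := chart_cinvK Cc cx.
have T1 : rel_cinfv (cmap c @` (cdom c `&` cdom c')) (cmap d \o cinv c) (cmap c x).
  apply: rel_cinfv_eq (smooth_on_rel S1 _); last by exists x.
  apply: nrW n1 => z h [w [cw _] wz]; split => //; exists w => //; split => //.
  by rewrite -(chart_cinvK Cc cw) wz; apply: h; exists w.
have T2 : rel_cinfv (cmap d @` (cdom c' `&` cdom d)) (cmap c' \o cinv d) ((cmap d \o cinv c) (cmap c x)).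
  by apply: (smooth_on_rel S2); rewrite /= xK; exists x.
have T3 := rel_cinfv_comp T1 _ _ T2.
apply: rel_cinfv_eq (T3 _ _).
- apply: nrW n1 => z h [w [cw c'w] wz]; split; first by exists w.
  by rewrite /= -wz (chart_cinvK Cc cw) (chart_cinvK Kd) // -(chart_cinvK Cc cw) wz; apply: h; exists w.
- by exists x.
- apply: nrW n1 => z h [w [cw c'w] wz]; exists w; last by rewrite /= -wz (chart_cinvK Cc cw).
  by split => //; rewrite -(chart_cinvK Cc cw) wz; apply: h; exists w.
Qed.

Lemma gc_max c : C c -> max_atlas c.
Proof.
move=> Cc; split; first exact: gc_chart.
have S c1 c2 : C c1 -> C c2 -> smooth_on (cmap c1 @` (cdom c1 `&` cdom c2)) (cmap c2 \o cinv c1).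
  move=> C1 C2; apply: smooth_on_local => _ [x [c1x c2x] <-].
  have [_ S12] := gc_trans GC C1 C2 c1x c2x.
  apply: rel_cinfv_eq S12; apply: nrT => z [w [c1w _] <-]; split => //.
  by have [] := gc_img GC C1 c1w.
move=> d Cd; split; first exact: S.
by rewrite setIC; exact: S.
Qed.

Lemma gc_maximal : maximal_atlas (@orthant R m) max_atlas.
Proof.
split.
- by move=> c [].
- by move=> x; have [c Cc cx] := gc_cover GC x; exists c => //; exact: gc_max.
- move=> c d Ac Ad; split; first exact: max_compat.
  by rewrite setIC; exact: max_compat.
- by move=> c Cc H; split => // d /gc_max; exact: H.
Qed.

Lemma gc_hausdorff : hausdorff_space TC.
Proof.
move=> x y cl; apply: contrapT => /(gc_sep GC) [A [B [oA oB Ax By AB]]].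
have [z [Az Bz]] : A `&` B !=set0.
  by apply: cl; apply: open_nbhs_nbhs; split => //; exact/open_lopen.
by have : set0 z by rewrite -AB.
Qed.

Lemma orthant_closed : closed (@orthant R m).
Proof.
rewrite -openC; apply/nr_open => y /= ny.
have [i yi] : exists i, y 0 i < 0.
  by apply: contrapT => H; apply: ny => i; rewrite leNgt; apply/negP => yi; apply: H; exists i.
have Hc : cinf (fun z : E m => z 0 i) y by exact: cinf_coord.
by apply: nrW (cinf_lt Hc yi) => z zi Oz; have := Oz i; rewrite leNgt zi.
Qed.

Lemma gc_closed_cube (c : chart R m TC) q r : C c ->
  (forall y, `|y - q| <= r -> orthant y -> cimg c y) ->
  closed [set x : TC | cdom c x /\ `|cmap c x - q| <= r].
Proof.
move=> Cc H; have -> : [set x : TC | cdom c x /\ `|cmap c x - q| <= r] = cinv c @` (cball q r `&` @orthant R m).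
  apply/seteqP; split=> x.
    move=> [cx xr]; have [h1 h2 _] := gc_img GC Cc cx; exists (cmap c x) => //; by split.
  by move=> [y [yr Oy] <-]; have [_ h1 h2] := gc_cimg Cc (H y yr Oy); split => //; rewrite h2.
apply: compact_closed; first exact: gc_hausdorff.
have Kc : compact (cball q r) := compact_convex_compact (cball_compact_convex q r).
apply: continuous_compact; last first.
  apply: (subclosed_compact _ Kc) => [|y []//].
  by apply: closedI; [apply: compact_closed => //; exact: norm_hausdorff|exact: orthant_closed].
have [_ _ _ _ cc] := gc_chart Cc.
by apply: continuous_subspaceW cc => y [yr Oy]; exact: H.
Qed.

(* With [A_i `<=` F_i `<=` B_i] ([A_i], [B_i] open, [F_i] closed, concentric
   cubes in charts), the sets [B_i] minus the [F_j], [j < i], form a locally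
   finite cover, since [A_i] only meets the first of them. *)
Lemma gc_paracompact : paracompact TC.
Proof.
move=> Cv oCv cvT; have [F HF] := gc_count GC.
pose ix (i : nat) : nat * ('rV[rat]_m * rat) := odflt (0%N, (0, 0)) (unpickle i).
pose ch i := F (ix i).1; pose ctr i : E m := map_mx ratr (ix i).2.1; pose rad i : R := ratr (ix i).2.2.
pose ok i := [/\ C (ch i), 0 < rad i, forall y, `|y - ctr i| <= 2 * rad i -> orthant y -> cimg (ch i) y &
  exists2 U, Cv U & forall y, `|y - ctr i| < 2 * rad i -> orthant y -> U (cinv (ch i) y)].
pose A i : set TC := [set x | ok i /\ (cdom (ch i) x /\ `|cmap (ch i) x - ctr i| < rad i)].
pose K i : set TC := [set x | ok i /\ (cdom (ch i) x /\ `|cmap (ch i) x - ctr i| <= rad i)].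
pose B i : set TC := [set x | ok i /\ (cdom (ch i) x /\ `|cmap (ch i) x - ctr i| < 2 * rad i)].
have oball i r : ok i -> open [set x : TC | cdom (ch i) x /\ `|cmap (ch i) x - ctr i| < r].
  move=> [Cc _ _ _]; rewrite openE => x [cx xr]; apply: (gc_nbhs Cc cx).
  have [_ _ h] := gc_img GC Cc cx.
  by apply: nrW (nrI h (nr_ball xr)) => y [h1 h2] Oy; have [_ k1 k2] := gc_cimg Cc (h1 Oy); rewrite /= k2.
have oA i : open (A i).
  have [ki|ki] := pselect (ok i).
    have -> : A i = [set x : TC | cdom (ch i) x /\ `|cmap (ch i) x - ctr i| < rad i].
      by apply/seteqP; split=> x; [case|].
    exact: oball.
  by have -> : A i = set0 by apply/seteqP; split=> x // [].
have oB i : open (B i).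
  have [ki|ki] := pselect (ok i).
    have -> : B i = [set x : TC | cdom (ch i) x /\ `|cmap (ch i) x - ctr i| < 2 * rad i].
      by apply/seteqP; split=> x; [case|].
    exact: oball.
  by have -> : B i = set0 by apply/seteqP; split=> x // [].
have cK i : closed (K i).
  have [ki|ki] := pselect (ok i); last first.
    by have -> : K i = set0; [apply/seteqP; split=> x // []|exact: closed0].
  have -> : K i = [set x : TC | cdom (ch i) x /\ `|cmap (ch i) x - ctr i| <= rad i].
    by apply/seteqP; split=> x; [case|].
  have [Cc r0 H _] := ki; apply: gc_closed_cube => // y yr; apply: H.
  by move: yr r0; lra.
have AK i : A i `<=` K i by move=> x [ki [cx xr]]; split => //; split => //; exact: ltW.
have KB i : K i `<=` B i.
  by move=> x [ki [cx xr]]; split => //; split => //; have [_ r0 _ _] := ki; move: xr r0; lra.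
have covA x : exists i, A i x.
  have [U CvU Ux] : exists2 U, Cv U & U x.
    by have : setT x by []; rewrite -cvT => -[U ? ?]; exists U.
  have [k Ck kx] := HF x; have [_ xK h1] := gc_img GC Ck kx.
  have h2 : nr (cmap (F k) x) (fun y => orthant y -> U (cinv (F k) y)).
    by apply: (gc_nr Ck kx); apply: open_nbhs_nbhs; split => //; exact: oCv.
  have [e e0 He] := nrI h1 h2; have [q [r [r0 xr re]]] := rational_cube (cmap (F k) x) e0.
  have E1 : ix (pickle (k, (q, r))) = (k, (q, r)) by rewrite /ix pickleK.
  have close y : `|y - map_mx ratr q| <= 2 * ratr r -> `|y - cmap (F k) x| < e.
    move=> yr; have -> : y - cmap (F k) x = (y - map_mx ratr q) - (cmap (F k) x - map_mx ratr q).
      by rewrite opprB addrA subrK.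
    by apply: le_lt_trans (ler_normB _ _) _; move: yr xr re; lra.
  exists (pickle (k, (q, r))); rewrite /A /ok /ch /ctr /rad E1 /=; split => //; split => //.
    by move=> y /close /He [h _]; exact: h.
  by exists U => // y /ltW /close /He [_ h]; exact: h.
pose V i : set TC := B i `\` \bigcup_(j in [set j | (j < i)%N]) K j.
exists (V @` [set i | ok i]); split.
- move=> _ [i _ <-]; rewrite /V setDE; apply: openI => //; rewrite openC; apply: closed_bigcup => //.
- rewrite -subTset => x _; have ex : exists i, `[< B i x >].
    by have [i Ai] := covA x; exists i; apply/asboolP/KB/AK.
  case: (ex_minnP ex) => i /asboolP Bi mi.
  exists (V i); first by exists i => //; case: Bi.
  by split => // -[j /= ji Kj]; have := mi j; rewrite leqNgt ji => H; have := H (asboolT (KB j x Kj)).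
- move=> _ [i ki <-].
  have [Cc _ _ [U CvU HU]] := ki; exists U => // y [[_ [cy yr]] _].
  by have [Oy yK _] := gc_img GC Cc cy; rewrite -yK; exact: HU.
- move=> x; have [N AN] := covA x; exists (A N); first by apply: open_nbhs_nbhs.
  apply: (@sub_finite_set _ _ (V @` `I_N.+1)); last by apply: finite_image; exact: finite_II.
  move=> _ [[i _ <-] [y [[_ nK] Ay]]]; exists i => //=; rewrite ltnS leqNgt; apply/negP => Ni.
  by apply: nK; exists N => //; exact: AK.
Qed.

Definition build_manifold : orthant_manifold R m :=
  @Manifold R m (@orthant R m) TC max_atlas gc_hausdorff gc_paracompact gc_maximal.

End AtlasTopology.

(** * The manifold of broken trajectories *)

Section GchartTopology.
Context {R : realType} {n : nat}.
Local Notation E n := 'rV[R]_n.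
Variables (M : smooth_manifold R n) (h : M -> R) (X : vector_field M) (Phi : R -> M -> M).
Hypotheses (hPhi : is_flow X Phi) (hMS : morse_smale h X Phi).
Variables (v : M) (hv : crit h v).
Local Notation Wh := (What h Phi v).
Local Notation obs := (obs h Phi v).
Local Notation avail := (avail h Phi v).

(** The observations of a family of paths parametrized by [D] are replaced by plots that do not
    refer to [D]. By [gv_ext] the chart reads the same coordinates from them, and [gv_smooth]
    applies to plots. *)
Lemma gread (G : gchart h v) q (D : set (E q)) (f : E q -> broken M * M) w : gvalid Phi G ->
  (forall i, idx (gA G) i -> exists g, sm g w /\ nr w (fun z => D z -> obs (f z) i = g z)) ->
  D w -> gO G (obs (f w)) -> exists g, [/\ cinfv g w, g w = gL G (obs (f w)) &
    nr w (fun z => D z -> gO G (obs (f z)) /\ gL G (obs (f z)) = g z)].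
Proof.
move=> VG H Dw Ow.
have [F HF] : {F : option R -> E q -> M & forall i, idx (gA G) i ->
    sm (F i) w /\ nr w (fun z => D z -> obs (f z) i = F i z)}.
  apply: (choice (P := fun i g => idx (gA G) i -> sm g w /\ nr w (fun z => D z -> obs (f z) i = g z))) => i.
  have [/H [g Hg]|ni] := pselect (idx (gA G) i); first by exists g.
  by exists (fun=> v) => ?; case: ni.
have sF i (ii : idx (gA G) i) : sm (F i) w := (HF i ii).1.
have Fw i (ii : idx (gA G) i) : obs (f w) i = F i w := nr_self (HF i ii).2 Dw.
have [Ow' Lw] := gv_ext VG Fw Ow; have [nO cL] := gv_smooth VG sF Ow'.
exists (fun z => gL G (F^~ z)); split => //.
have nall : nr w (fun z => forall i, idx (gA G) i -> D z -> obs (f z) i = F i z).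
  have h1 := (HF None isT).2.
  have h2 : nr w (fun z => forall a, a \in gA G -> D z -> obs (f z) (Some a) = F (Some a) z).
    by apply: nr_all => a aA; exact: (HF (Some a) aA).2.
  by apply: nrW (nrI h1 h2) => z [k1 k2] [a|]; [exact: k2|move=> _; exact: k1].
apply: nrW (nrI nO nall) => z [h1 h2] Dz.
have [k1 k2] := gv_ext VG (y := F^~ z) (y' := obs (f z)) (fun i ii => esym (h2 i ii Dz)) h1.
by rewrite -k2.
Qed.

(* Any family of maps into R^n indexed by [idx A] factors through the family of
   the [slice (slot A i)], which thus plays the role of a universal plot. *)
Definition slice s (k : 'I_s) (z : E (s * n)) : E n := row k (vec_mx z).

Lemma slice_cinfv s (k : 'I_s) z : cinfv (slice k) z.
Proof.
move=> j; have C : cinf (fun z : E (s * n) => z 0 (mxvec_index k j)) z by exact: cinf_coord.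
by apply: cinf_ext C => y; rewrite /slice !mxE.
Qed.

Definition slots (A : seq R) : seq (option R) := None :: map Some A.

Lemma mem_slots A i : (i \in slots A) = idx A i.
Proof. by case: i => [a|]; rewrite inE //= mem_map // => x y []. Qed.

Definition slot A (i : option R) : 'I_(size (slots A)) := inord (index i (slots A)).

Definition gather A (f : option R -> E n) : E (size (slots A) * n) :=
  mxvec (\matrix_(k < size (slots A)) f (nth None (slots A) k)).

Lemma slice_gather A f i : idx A i -> slice (slot A i) (gather A f) = f i.
Proof.
rewrite -mem_slots => ii; rewrite /slice /gather mxvecK rowK /slot inordK ?nth_index //.
by have := ii; rewrite -index_mem.
Qed.

Lemma gather_norm A f g e : 0 < e -> (forall i, idx A i -> `|f i - g i| < e) ->
  `|gather A f - gather A g| < e.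
Proof.
move=> e0 H; apply: norm_lt_coord => // j; rewrite /gather -linearB /=.
case/mxvec_indexP: j => k l; rewrite mxvecE !mxE -coordB.
apply: le_lt_trans (coord_le_norm _ _) _; apply: H; rewrite -mem_slots; exact: mem_nth.
Qed.

Lemma chart_plot q (c : chart R n M) (g : E q -> E n) w : atlas M c -> cimg c (g w) -> cinfv g w ->
  sm (fun z => cinv c (g z)) w.
Proof. by move=> Ac cg sg; exact: sm_cinv. Qed.

(** The product of charts of M at the finitely many points [y0 i] concerned provides plots;
    smoothness of [gL] along them gives continuity in all these points jointly. *)
Lemma gopen (G : gchart h v) (y0 : option R -> M) e : gvalid Phi G -> gO G y0 -> 0 < e ->
  exists U : option R -> set M, (forall i, idx (gA G) i -> nbhs (y0 i) (U i)) /\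
   forall y, (forall i, idx (gA G) i -> U i (y i)) -> gO G y /\ `|gL G y - gL G y0| < e.
Proof.
move=> VG O0 e0; pose A := gA G.
have [c Hc] : {c : option R -> chart R n M & forall i, atlas M (c i) /\ cdom (c i) (y0 i)}.
  by apply: (choice (P := fun i c => atlas M c /\ cdom c (y0 i))) => i; have [c Ac cx] := atlas_at (y0 i); exists c.
pose z0 := gather A (fun i => cmap (c i) (y0 i)).
pose f i z := cinv (c i) (slice (slot A i) z).
have fz y i : idx A i -> cdom (c i) (y i) -> f i (gather A (fun i => cmap (c i) (y i))) = y i.
  by move=> ii cy; rewrite /f slice_gather // cinvK //; have [] := Hc i.
have sf i : idx A i -> sm (f i) z0.
  move=> ii; have [Ac cy] := Hc i; apply: chart_plot => //; last exact: slice_cinfv.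
  by rewrite slice_gather //; exact: cimg_cmap.
have [|Oz Lz] := gv_ext VG (y := y0) (y' := f^~ z0) _ O0.
  by move=> i ii; rewrite fz //; have [] := Hc i.
have [nO cL] := gv_smooth VG sf Oz.
have nL : nr z0 (fun z => `|gL G (f^~ z) - gL G y0| < e).
  by apply: (cinfv_nr_pre cL (P := fun w => `|w - gL G y0| < e)); rewrite -Lz; exists e.
have [d d0 Hd] := nrI nO nL.
exists (fun i => [set x | cdom (c i) x /\ `|cmap (c i) x - cmap (c i) (y0 i)| < d]); split.
  move=> i ii; have [Ac cy] := Hc i; apply: chart_ball_nbhs => //.
  by rewrite subrr normr0.
move=> y Hy; have [|h1 h2] := Hd (gather A (fun i => cmap (c i) (y i))).
  by apply: gather_norm => // i /Hy [].
have [i ii|k1 k2] := gv_ext VG (y' := y) _ h1; first by have [cy _] := Hy i ii; exact: fz.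
by rewrite -k2.
Qed.

Lemma level_point_lsm b (x : M) : ~ crit h x -> reaches h Phi b x ->
  nbhs x (reaches h Phi b) /\ lsm (level_point h Phi b : M -> M) x.
Proof.
move=> nx rx; have [c Ac cx] := atlas_at x; have cxi := cimg_cmap cx.
have sc : sm (fun z => cinv c z) (cmap c x) by apply: chart_plot => //; exact: cinfv_id.
have xK := cinvK Ac cx.
have nx' : ~ crit h (cinv c (cmap c x)) by rewrite xK.
have rx' : reaches h Phi b (cinv c (cmap c x)) by rewrite xK.
have [n1 s1] := level_point_sm hPhi hMS sc nx' rx'.
have H : nbhs x (reaches h Phi b).
  have := cmap_nbhs Ac cx n1 => n2; apply: filterS (filterI n2 (cdom_nbhs Ac cx)) => z [k1 cz].
  by move: k1; rewrite cinvK.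
split => //; have [d Ad dx] := atlas_at (level_point h Phi b x).
have [|nd cd] := sm_chart s1 Ad; first by rewrite xK.
apply: (lsm_ex Ac Ad cx dx); first by apply: nrW nd.
exact: rel_cinfv_cinfv.
Qed.

Lemma level_point_nbhs b (x : M) (U : set M) : ~ crit h x -> reaches h Phi b x ->
  nbhs (level_point h Phi b x) U -> nbhs x (fun z => reaches h Phi b z /\ U (level_point h Phi b z)).
Proof.
move=> nx rx Ux; have [h1 [h2 _]] := level_point_lsm nx rx.
by apply: filterI => //; exact: h2.
Qed.

Lemma broken_points_flow w s w' y t : crit h w -> is_broken h Phi w s w' -> broken_points w s y ->
  broken_points w s (Phi t y).
Proof.
elim: s w => [|[l u] s IH] w hw /=; first by move=> _ ->; rewrite (flow_crit hPhi hMS).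
move=> [hu _ [x _ ->] Bu] [->|[/flow_lineP [t' ->]|By]].
- by left; rewrite (flow_crit hPhi hMS).
- by right; left; apply/flow_lineP; exists (t' + t); rewrite (flowD hPhi).
- by right; right; exact: IH.
Qed.

Lemma path_up p a b : Wh p -> available h Phi v a p -> reaches h Phi b (path_point h Phi v p a) ->
  available h Phi v b p /\ path_point h Phi v p b = level_point h Phi b (path_point h Phi v p a).
Proof.
move=> Wp aa rb; have [py _] := path_pointP hPhi hMS Wp aa; have hb := level_pointP rb.
have pl : prolonged_path Phi v p (level_point h Phi b (path_point h Phi v p a)).
  have [w [_ _ Bw _]] := Wp; case: py => [By|/flow_lineP [t ->]]; first by left; exact: broken_points_flow Bw By.
  by right; apply/flow_lineP; rewrite /level_point -(flowD hPhi); eexists; reflexivity.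
by split; [exists (level_point h Phi b (path_point h Phi v p a))|rewrite -{1}hb (path_pointE hPhi hMS)].
Qed.

Lemma obs_up p i b : Wh p -> avail p i -> reaches h Phi b (obs p i) ->
  available h Phi v b p /\ path_point h Phi v p b = level_point h Phi b (obs p i).
Proof.
case: i => [a|] Wp; first by move=> [_ aa]; exact: path_up.
by move=> _ rx; case: p Wp rx => s x Wp rx; exact: reaches_available.
Qed.

End GchartTopology.

(** * Second countability of M *)

Section CountableBasis.
Context {R : realType} {n : nat}.
Variables (M : smooth_manifold R n) (h : M -> R) (X : vector_field M) (Phi : R -> M -> M).
Hypotheses (hPhi : is_flow X Phi) (hMS : morse_smale h X Phi).

(** Since [h] is proper, M is the union of the compact sets [|h| <= j], each covered by finitely
    many charts. *)
Lemma countable_charts (x0 : M) : exists F : nat -> chart R n M,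
  forall x, exists k, atlas M (F k) /\ cdom (F k) x.
Proof.
have [c Hc] : {c : M -> chart R n M & forall x, atlas M (c x) /\ cdom (c x) x}.
  by apply: (choice (P := fun x c => atlas M c /\ cdom c x)) => x; have [c Ac cx] := atlas_at x; exists c.
have fin j : exists s : seq M, forall x, - j%:R <= h x <= j%:R -> exists2 y, y \in s & cdom (c y) x.
  have cc : compact [set x : M | - j%:R <= h x <= j%:R] by exact: (slab_compact hMS).
  apply: contrapT => H.
  pose Q (s : seq M) := [set x : M | - j%:R <= h x <= j%:R /\ forall y, y \in s -> ~ cdom (c y) x].
  pose F := filter_from [set: seq M] Q.
  have PF : ProperFilter F.
    apply: filter_from_proper; last first.
      move=> s _; apply: contrapT => N; apply: H; exists s => x Hx; apply: contrapT => Hy.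
      apply: N; exists x; split => // y ys cy; apply: Hy; by exists y.
    apply: filter_from_filter; first by exists [::].
    move=> s s' _ _; exists (s ++ s') => // x [Hx Hy].
    by split; split => // y ys; apply: Hy; rewrite mem_cat ys ?orbT.
  have [|y [_ cl]] := cc F PF; first by exists [::] => // x [].
  have [cAy cy] := Hc y.
  have FQ : F (Q [:: y]) by exists [:: y].
  have [x [[_ Qx] cx]] := cl _ _ FQ (cdom_nbhs cAy cy).
  by apply: (Qx y) => //; rewrite inE.
have [s Hs] := choice fin.
pose F k := let p := odflt (0%N, 0%N) (unpickle k) : nat * nat in c (nth x0 (s p.1) p.2).
exists F => x; pose j := Num.bound `|h x|.
have [|y ys cy] := Hs j x.
  by rewrite -ler_norml; apply/ltW/archi_boundP/normr_ge0.
exists (pickle (j, index y (s j))); rewrite /F pickleK /= nth_index //; split => //.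
by have [] := Hc y.
Qed.

Lemma countable_basis (x0 : M) : exists B : nat -> set M, forall (x : M) (U : set M), nbhs x U -> exists k, nbhs x (B k) /\ B k `<=` U.
Proof.
have [F HF] := countable_charts x0.
pose ix (i : nat) : nat * ('rV[rat]_n * rat) := odflt (0%N, (0, 0)) (unpickle i).
exists (fun i => [set z | cdom (F (ix i).1) z /\ `|cmap (F (ix i).1) z - map_mx ratr (ix i).2.1| < ratr (ix i).2.2]).
move=> x U Ux; have [k [Ak kx]] := HF x.
have : nr (cmap (F k) x) (fun y => U (cinv (F k) y)).
  by apply: cinv_nr => //; [exact: cimg_cmap|rewrite cinvK].
move=> [e e0 He]; have [q [r [r0 xr re]]] := rational_cube (cmap (F k) x) e0.
exists (pickle (k, (q, r))); rewrite /ix pickleK /=; split; first exact: chart_ball_nbhs.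
move=> z [cz zr]; rewrite -(cinvK Ak cz); apply: He.
have -> : cmap (F k) z - cmap (F k) x = (cmap (F k) z - map_mx ratr q) - (cmap (F k) x - map_mx ratr q).
  by rewrite opprB addrA subrK.
by apply: le_lt_trans (ler_normB _ _) _; move: zr xr re r0; lra.
Qed.

End CountableBasis.

Section WhatManifold.
Context {R : realType} {n : nat}.
Local Notation E n := 'rV[R]_n.
Variables (M : smooth_manifold R n) (h : M -> R) (X : vector_field M) (Phi : R -> M -> M).
Hypotheses (hPhi : is_flow X Phi) (hMS : morse_smale h X Phi).
Variables (v : M) (hv : crit h v).
Local Notation Wh := (What h Phi v).
Local Notation m := (morse_index h v).
Local Notation obs := (obs h Phi v).
Local Notation avail := (avail h Phi v).

Definition What_type : Type := {p : broken M * M | Wh p}.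
Implicit Types (x : What_type).

Lemma sval_inj x (y : What_type) : sval x = sval y -> x = y.
Proof. by case: x y => [p Wp] [q Wq] /= pq; subst q; congr exist; exact: Prop_irrelevance. Qed.

Definition to_What x (q : broken M * M) : What_type :=
  match pselect (Wh q) with left H => exist _ q H | right _ => x end.

Lemma to_WhatE x q : Wh q -> sval (to_What x q) = q.
Proof. by rewrite /to_What; case: pselect. Qed.

Definition gshift (G : gchart h v) (d0 : E m) (dl : R) : E m :=
  \row_(i < m) if (i < size (gcs G))%N then 0 else dl - cx d0 i.

(* The free coordinates of a chart are translated so as to be positive. *)
Definition nchart (G : gchart h v) (d0 : E m) (dl : R) x : chart R m What_type :=
  Chart [set y | gO G (obs (sval y)) /\ `|gL G (obs (sval y)) - d0| < dl]
    (fun y => gL G (obs (sval y)) + gshift G d0 dl)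
    (fun z => to_What x (gP G (z - gshift G d0 dl))).

Definition nvalid (G : gchart h v) (d0 : E m) (dl : R) := [/\ gvalid Phi G, gD G d0,
  forall i, (i < size (gcs G))%N -> cx d0 i = 0, 0 < dl & forall d, `|d - d0| < dl -> gV G d].

Definition ncharts : set (chart R m What_type) :=
  [set c | exists G d0 dl x, nvalid G d0 dl /\ c = nchart G d0 dl x].

Section OneChart.
Variables (G : gchart h v) (d0 : E m) (dl : R) (x0 : What_type).
Hypothesis NV : nvalid G d0 dl.
Let c := nchart G d0 dl x0.
Let tau := gshift G d0 dl.

Lemma cx_tau i : (i < m)%N -> cx tau i = if (i < size (gcs G))%N then 0 else dl - cx d0 i.
Proof. by move=> im; rewrite (cx_lt _ im) mxE. Qed.

Lemma cxB (y z : E m) i : cx (y - z) i = cx y i - cx z i.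
Proof. by have [im|im] := ltnP i m; rewrite ?(cx_lt _ im) ?mxE // !cx_out // subr0. Qed.

Lemma nchart_D y : orthant y -> `|y - tau - d0| < dl -> gD G (y - tau).
Proof.
move=> Oy yd; have [VG Dd0 cd0 dl0 HV] := NV; split; first exact: HV.
move=> i ik; have im : (i < m)%N := leq_trans ik (gv_size VG).
by rewrite cxB cx_tau // ik subr0 (cx_lt _ im); exact: Oy.
Qed.

Lemma nchart_orthant d : gD G d -> `|d - d0| < dl -> orthant (d + tau).
Proof.
move=> [_ zd] dd i; rewrite -cxE; have [VG Dd0 cd0 dl0 HV] := NV.
have -> : cx (d + tau) i = cx d i + cx tau i by rewrite !cxE mxE.
rewrite cx_tau //; case: ltnP => ik; first by rewrite addr0; exact: zd.
have := le_lt_trans (cx_le_norm (d - d0) i) dd; rewrite cxB ltr_norml; lra.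
Qed.

Lemma nchart_inv y : orthant y -> `|y - tau - d0| < dl ->
  [/\ sval (cinv c y) = gP G (y - tau), cdom c (cinv c y) & cmap c (cinv c y) = y].
Proof.
move=> Oy yd; have [VG Dd0 cd0 dl0 HV] := NV; have D := nchart_D Oy yd.
have E1 : sval (cinv c y) = gP G (y - tau) by rewrite /= to_WhatE //; exact: gv_What.
have [h1 h2] := gv_L1 VG D; split => //.
  by rewrite /= to_WhatE ?h2 //; exact: gv_What.
by rewrite /= to_WhatE ?h2 ?subrK //; exact: gv_What.
Qed.

Lemma nchart_map x : cdom c x -> [/\ gD G (gL G (obs (sval x))), gP G (gL G (obs (sval x))) = sval x,
  orthant (cmap c x), cinv c (cmap c x) = x & `|cmap c x - tau - d0| < dl].
Proof.
move=> [Ox dx]; have [VG Dd0 cd0 dl0 HV] := NV; have [D P] := gv_L2 VG (svalP x) Ox.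
split => //.
- exact: nchart_orthant.
- apply: sval_inj; rewrite /= to_WhatE ?addrK ?P //; exact: svalP.
- by rewrite /= addrK.
Qed.

Lemma nchart_near x : cdom c x -> nr (cmap c x) (fun y => `|y - tau - d0| < dl).
Proof.
move=> cx; have [_ _ _ _ xd] := nchart_map cx.
have := nr_ball xd => -[e e0 He]; exists e => // y ye; apply: He.
by rewrite opprB addrA subrK.
Qed.

Lemma nchart_img x : cdom c x -> nr (cmap c x) (fun y => orthant y -> cimg c y).
Proof.
move=> cx; apply: nrW (nchart_near cx) => y yd Oy; have [_ h1 h2] := nchart_inv Oy yd.
by exists (cinv c y).
Qed.

Lemma obs_local x i : cdom c x -> avail (sval x) i -> exists g, sm g (cmap c x) /\
  nr (cmap c x) (fun z => orthant z -> avail (sval (cinv c z)) i /\ obs (sval (cinv c z)) i = g z).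
Proof.
move=> cx av; have [D P Ox xK xd] := nchart_map cx; have [VG _ _ _ _] := NV.
have av' : avail (gP G (gL G (obs (sval x)))) i by rewrite P.
have [g [sg ng]] := gv_obs VG D av'.
have E1 : cmap c x - tau = gL G (obs (sval x)) by rewrite /= addrK.
have ct : cinfv (fun z : E m => z - tau) (cmap c x) by apply: cinfvB; [exact: cinfv_id|exact: cinfv_cst].
exists (fun z => g (z - tau)); split; first by apply: (sm_comp (g := fun z => z - tau)); rewrite ?E1.
have ng' : nr (cmap c x) (fun z => gD G (z - tau) -> avail (gP G (z - tau)) i /\ obs (gP G (z - tau)) i = g (z - tau)).
  apply: (cinfv_nr_pre ct (P := fun d => gD G d -> avail (gP G d) i /\ obs (gP G d) i = g d)).
  by rewrite E1.
apply: nrW (nrI ng' (nchart_near cx)) => z [h1 h2] Oz; have [-> _ _] := nchart_inv Oz h2.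
by apply: h1; exact: nchart_D.
Qed.

End OneChart.

Lemma nchart_at x : exists G d0 dl, nvalid G d0 dl /\ cdom (nchart G d0 dl x) x /\ gL G (obs (sval x)) = d0.
Proof.
have [G [d0 [VG Dd0 cd0 P]]] := gchart_at hPhi hMS hv (svalP x).
have [dl dl0 HV] := gv_V VG Dd0.1; have [h1 h2] := gv_L1 VG Dd0; rewrite P in h1 h2.
by exists G, d0, dl; split => //; split => //; split => //=; rewrite h2 subrr normr0.
Qed.

(** The coordinates of the second chart are read, by [gread], from the observations of the paths
    parametrized by the first. *)
Lemma ncharts_trans c d x : ncharts c -> ncharts d -> cdom c x -> cdom d x ->
  nr (cmap c x) (fun y => orthant y -> cdom d (cinv c y)) /\
  rel_cinfv (@orthant R m) (cmap d \o cinv c) (cmap c x).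
Proof.
move=> [G [d0 [dl [x0 [NV ->]]]]] [G' [d0' [dl' [x0' [NV' ->]]]]] cx dx.
have [D P Ox xK xd] := nchart_map NV cx; have [Ox' xd'] := dx; have [VG' _ _ _ _] := NV'.
have [||g [cg gw ng]] := @gread _ _ _ h Phi v G' _ (@orthant R m)
   (fun z => sval (cinv (nchart G d0 dl x0) z)) (cmap (nchart G d0 dl x0) x) VG' _ Ox _.
  move=> i ii; have av : avail (sval x) i.
    by case: i ii => [a|] // aA; exact: (avail_gA hPhi hMS hv VG' (svalP x) Ox' aA).
  have [g [sg ng]] := obs_local NV cx av.
  by exists g; split => //; apply: nrW ng => z H /H [].
  by rewrite xK.
have nd : nr (cmap (nchart G d0 dl x0) x) (fun z => `|g z - d0'| < dl').
  apply: (cinfv_nr_pre cg (P := fun z => `|z - d0'| < dl')); apply: nr_ball.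
  by rewrite gw xK.
split.
  by apply: nrW (nrI ng nd) => z [H zd] Oz; have [h1 h2] := H Oz; split => //; rewrite h2.
exists (fun z => g z + gshift G' d0' dl'); split.
  by apply: cinfvD => //; exact: cinfv_cst.
by apply: nrW ng => z H Oz; have [h1 h2] := H Oz; rewrite /= h2.
Qed.

Lemma lopen_obs i (U : set M) : open U -> lopen ncharts [set x | avail (sval x) i /\ U (obs (sval x) i)].
Proof.
move=> oU c x [G [d0 [dl [x0 [NV ->]]]]] cx [av Ux].
have [_ _ Ox xK _] := nchart_map NV cx.
have [g [sg ng]] := obs_local NV cx av; have [_ gx] := nr_self ng Ox; rewrite xK in gx.
have Ug : nbhs (g (cmap (nchart G d0 dl x0) x)) U by apply: open_nbhs_nbhs; split => //; rewrite -gx.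
by apply: nrW (nrI ng (sm_cts sg Ug)) => z [H Uz] Oz; have [h1 h2] := H Oz; split => //; rewrite h2.
Qed.

(** If all common observations agree, so do the end points; then both paths meet the levels of a
    chart at [x], which recovers the same path from both. *)
Lemma separate x (y : What_type) : x <> y -> exists i, [/\ avail (sval x) i, avail (sval y) i & obs (sval x) i <> obs (sval y) i].
Proof.
move=> xy; apply: contrapT => H; apply: xy.
have same i : avail (sval x) i -> avail (sval y) i -> obs (sval x) i = obs (sval y) i.
  by move=> ax ay; apply: contrapT => ne; apply: H; exists i.
have e2 : (sval x).2 = (sval y).2 := same None I I.
have [G [d0 [dl [NV [[Ox xd] _]]]]] := nchart_at x; have [VG _ _ _ _] := NV.
have [i ii|Oy Ly] := gv_ext VG (y' := obs (sval y)) _ Ox.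
  have av : avail (sval x) i.
    by case: i ii => [a|] // aA; exact: (avail_gA hPhi hMS hv VG (svalP x) Ox aA).
  apply: same => //; case: i ii av => [a|] // aA [ra _]; split => //.
  have := svalP y; case: (sval y) e2 => s y2 /= e2 Wy.
  apply: (regular_available hPhi hMS hv Wy ra); have [_ ->] := gv_A VG aA; rewrite andbT -e2.
  exact: ltW (gv_A2 VG Ox aA).
have [_ P1] := gv_L2 VG (svalP x) Ox; have [_ P2] := gv_L2 VG (svalP y) Oy.
by apply: sval_inj; rewrite -P1 -P2 Ly.
Qed.

Lemma What_self : Wh ([::], v).
Proof. by apply: What_nil => //; exact: (Wminus_self hPhi hMS hv). Qed.

(* A level through which the path can be observed may be replaced by a nearby
   rational level from below. *)
Lemma rational_level x b (U : set M) (B : nat -> set M) :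
  (forall (z : M) (W : set M), nbhs z W -> exists k, nbhs z (B k) /\ B k `<=` W) ->
  regular h b -> h (sval x).2 < b < h v -> nbhs (obs (sval x) (Some b)) U ->
  exists (a : rat) (k : nat), [/\ avail (sval x) (Some (ratr a)), nbhs (obs (sval x) (Some (ratr a))) (B k) &
    forall p, Wh p -> avail p (Some (ratr a)) -> B k (obs p (Some (ratr a))) -> U (obs p (Some b))].
Proof.
move=> HB rb /andP[xb bv] Ub; have [e e0 He] := critval_isolated hMS b.
have mb : Num.max (h (sval x).2) (b - e) < b by rewrite gt_max xb; lra.
have [a] := rat_in_itvoo mb; rewrite in_itv /= gt_max => /andP[/andP[xa ba] ab].
have nc c : critval h c -> ~ ratr a <= c <= b.
  move=> cc /andP[ac cb]; have := He c cc; rewrite ler0_norm; last by lra.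
  by move=> Hc; apply: rb; rewrite -Hc //; lra.
have ra : regular h (ratr a) by move=> cc; apply: (nc _ cc); rewrite lexx ltW.
have Wx := svalP x.
have av t : regular h t -> h (sval x).2 <= t < h v -> available h Phi v t (sval x).
  by case: (sval x) Wx => s z Wz; exact: regular_available.
have aa : available h Phi v (ratr a) (sval x) by apply: av => //; rewrite (ltW xa) (lt_trans ab).
have ab' : available h Phi v b (sval x) by apply: av => //; rewrite (ltW xb).
have [r1 _ l1 _] := path_connect hPhi hMS hv Wx aa ab' ra rb (ltW ab) nc.
have [_ ha] := path_pointP hPhi hMS Wx aa.
have nx : ~ crit h (path_point h Phi v (sval x) (ratr a)) by move=> cc; apply: ra; exists (path_point h Phi v (sval x) (ratr a)).
have Ul : nbhs (level_point h Phi b (path_point h Phi v (sval x) (ratr a))) U by rewrite l1.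
have [k [Bk sB]] := HB _ _ (level_point_nbhs hPhi hMS nx r1 Ul).
exists a, k; split => // p Wp [_ ap] /sB [r2 U2].
by have [_ /= ->] := path_up hPhi hMS hv Wp ap r2.
Qed.

(** A box prescribes basic open sets of M for finitely many observations at rational levels, so
    there are countably many boxes. For each box contained in the domain of some chart one such
    chart is chosen; every path has such a box by [gopen] and [rational_level]. *)
Lemma ncharts_countable : exists F : nat -> chart R m What_type, forall x, exists2 k, ncharts (F k) & cdom (F k) x.
Proof.
have [B HB] := countable_basis hMS v; pose xv : What_type := exist _ _ What_self.
have [G0 [e0 [r0 [NV0 _]]]] := nchart_at xv.
pose box (s : seq (option rat * nat)) (p : broken M * M) := forall o k, (o, k) \in s ->
  avail p (omap ratr o) /\ B k (obs p (omap ratr o)).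
pose Q s := [set c | ncharts c /\ forall x, box s (sval x) -> cdom c x].
have [T HT] : {T : nat -> chart R m What_type & forall j, Q (odflt [::] (unpickle j)) !=set0 -> Q (odflt [::] (unpickle j)) (T j)}.
  apply: (choice (P := fun j c => Q (odflt [::] (unpickle j)) !=set0 -> Q (odflt [::] (unpickle j)) c)) => j.
  have [[c Qc]|nQ] := pselect (Q (odflt [::] (unpickle j)) !=set0); first by exists c.
  by exists (nchart G0 e0 r0 xv).
exists T => x.
suff [s [[c Qc] bx]] : exists s, (Q s !=set0) /\ box s (sval x).
  by have := HT (pickle s); rewrite pickleK => /(_ (ex_intro _ c Qc)) [h1 h2]; exists (pickle s) => //; exact: h2.
have [G [d0 [dl [NV [cx Lx]]]]] := nchart_at x; have [Ox xd] := cx; have [VG _ _ dl0 _] := NV.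
have [U [HU1 HU2]] := gopen VG Ox dl0.
have [k0 [Bk0 sB0]] := HB _ _ (HU1 None isT).
have [F HF] : {F : R -> rat * nat & forall b, b \in gA G -> [/\ avail (sval x) (Some (ratr (F b).1)),
    nbhs (obs (sval x) (Some (ratr (F b).1))) (B (F b).2) &
    forall p, Wh p -> avail p (Some (ratr (F b).1)) -> B (F b).2 (obs p (Some (ratr (F b).1))) -> U (Some b) (obs p (Some b))]}.
  apply: (choice (P := fun b ak => b \in gA G -> [/\ avail (sval x) (Some (ratr ak.1)),
    nbhs (obs (sval x) (Some (ratr ak.1))) (B ak.2) &
    forall p, Wh p -> avail p (Some (ratr ak.1)) -> B ak.2 (obs p (Some (ratr ak.1))) -> U (Some b) (obs p (Some b))])) => b.
  have [bA|nb] := boolP (b \in gA G); last by exists (0, 0%N).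
  have [rb bv] := gv_A VG bA; have xb := gv_A2 VG Ox bA.
  have [|a [k H]] := @rational_level x b (U (Some b)) B HB rb _ (HU1 (Some b) bA); first by rewrite xb.
  by exists (a, k).
exists ((None, k0) :: [seq (Some (F b).1, (F b).2) | b <- gA G]); split.
  exists (nchart G d0 dl x); split; first by exists G, d0, dl, x.
  move=> y by_; have [|Oy Ly] := HU2 (obs (sval y)); last by split => //; rewrite -Lx.
  case=> [b|] ib; last by apply: sB0; have [] := by_ None k0; rewrite ?inE ?eqxx.
  have [_ _ H] := HF b ib; have [|av Bv] := by_ (Some (F b).1) (F b).2.
    by rewrite inE; apply/orP; right; apply/mapP; exists b.
  by apply: H => //; exact: svalP.
move=> o k; rewrite inE => /orP[/eqP [-> ->]|/mapP [b bA [-> ->]]]; first by split => //; exact: nbhs_singleton Bk0.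
by have [h1 h2 _] := HF b bA; split => //; exact: nbhs_singleton h2.
Qed.

Lemma ncharts_good : good_charts ncharts.
Proof.
split.
- move=> c x [G [d0 [dl [x0 [NV ->]]]]] cx; have [_ _ Ox xK _] := nchart_map NV cx.
  by split => //; exact: nchart_img.
- move=> x; have [G [d0 [dl [NV [cx _]]]]] := nchart_at x.
  by exists (nchart G d0 dl x) => //; exists G, d0, dl, x.
- exact: ncharts_trans.
- move=> x y /separate [i [ax ay ne]].
  have := @mhausdorff _ _ _ M; rewrite open_hausdorff => /(_ (obs (sval x) i) (obs (sval y) i)).
  case; first exact/eqP.
  move=> [A B] /= [/set_mem Ax /set_mem By] [oA oB /eqP AB].
  exists [set z | avail (sval z) i /\ A (obs (sval z) i)], [set z | avail (sval z) i /\ B (obs (sval z) i)].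
  split => //; [exact: lopen_obs|exact: lopen_obs|].
  apply/seteqP; split=> z // [[_ Az] [_ Bz]].
  by have : (A `&` B) (obs (sval z) i) by []; rewrite AB.
- exact: ncharts_countable.
Qed.

Definition What_manifold : orthant_manifold R m := build_manifold ncharts_good.
Definition What_proj (x : What_manifold) : broken M * M := sval (x : What_type).

End WhatManifold.

(** * Boundary strata *)

Section Corners.
Context {R : realType}.
Local Notation E n := 'rV[R]_n.

Lemma norm_tdelta q (i : 'I_q) (t : R) : `|t *: delta_mx 0 i : E q| <= `|t|.
Proof. by rewrite normrZ ler_piMr // norm_delta. Qed.

Lemma cinf_eps_delta q (f : E q -> R) y i e : cinf f y -> 0 < e -> exists2 d, 0 < d & forall t, `|t| < d ->
  `|f (y + t *: delta_mx 0 i) - f y - t * partial i f y| <= e * `|t|.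
Proof.
move=> cf e0; have [d d0 Hd] := cinf_eps cf e0; exists d => // t td.
have := Hd (t *: delta_mx 0 i); rewrite subr0 => /(_ (le_lt_trans (norm_tdelta i t) td)).
rewrite linearZ /= lform_delta => H; apply: le_trans H _.
by rewrite ler_pM2l // norm_tdelta.
Qed.

Lemma small0 (a : R) : (forall e, 0 < e -> `|a| <= e) -> a = 0.
Proof.
move=> H; apply/eqP; rewrite -normr_eq0 eq_le normr_ge0 andbT leNgt; apply/negP => a0.
by have := H (`|a| / 2); rewrite divr_gt0 // => /(_ isT); lra.
Qed.

(** Small positive increments stay in the orthant, where the two maps agree; so the differential at
    a corner does not depend on the extension. *)
Lemma jacobian_orthant q p (f g : E q -> E p) y : cinfv f y -> cinfv g y -> orthant y ->
  nr y (fun z => orthant z -> f z = g z) -> jacobian f y = jacobian g y.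
Proof.
move=> cf cg Oy [r r0 fg]; apply/matrixP => i j; apply/eqP; rewrite -subr_eq0; apply/eqP/small0 => e e0.
have e20 : 0 < e / 2 by rewrite divr_gt0.
have [d1 d10 H1] := cinf_eps_delta i (cf j) e20; have [d2 d20 H2] := cinf_eps_delta i (cg j) e20.
pose t := Num.min r (Num.min d1 d2) / 2.
have m0 : 0 < Num.min r (Num.min d1 d2) by rewrite !lt_min r0 d10.
have t0 : 0 < t by rewrite divr_gt0.
have tm : t < Num.min r (Num.min d1 d2) by rewrite /t; lra.
move: tm; rewrite !lt_min => /andP[tr /andP[t1 t2]].
have ta : `|t| = t by rewrite gtr0_norm.
have := H1 t; have := H2 t; rewrite ta => /(_ t2) h2 /(_ t1) h1.
have Ey : orthant (y + t *: delta_mx 0 i).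
  by move=> l; rewrite !mxE addr_ge0 ?mulr_ge0 // ltW.
have E1 : f (y + t *: delta_mx 0 i) = g (y + t *: delta_mx 0 i).
  by apply: fg => //; rewrite addrC addKr; apply: le_lt_trans (norm_tdelta i t) _; rewrite ta.
have E2 : f y = g y by apply: fg; rewrite ?subrr ?normr0.
rewrite E1 E2 in h1; rewrite !mxE.
move: h1 h2; set A := g _ 0 j - _; set a := partial _ _ _; set b := partial _ _ _ => h1 h2.
have : `|t * (a - b)| <= e * t.
  have -> : t * (a - b) = (A - t * b) - (A - t * a) by ring.
  by apply: le_trans (ler_normB _ _) _; lra.
by rewrite normrM ta mulrC ler_pM2r.
Qed.

(** As [y 0 i > 0], increments of both signs stay in the orthant, and [y] is a minimum along the
    [i]-th coordinate line. *)
Lemma partial_min q (f : E q -> R) y i : cinf f y -> orthant y -> 0 < y 0 i -> f y = 0 ->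
  nr y (fun z => orthant z -> 0 <= f z) -> partial i f y = 0.
Proof.
move=> cf Oy yi fy [r r0 Hf]; apply: small0 => e e0.
have [d d0 H] := cinf_eps_delta i cf e0; pose t := Num.min (y 0 i) (Num.min r d) / 2.
have m0 : 0 < Num.min (y 0 i) (Num.min r d) by rewrite !lt_min yi r0.
have t0 : 0 < t by rewrite divr_gt0.
have tm : t < Num.min (y 0 i) (Num.min r d) by rewrite /t; lra.
move: tm; rewrite !lt_min => /andP[ty /andP[tr td]].
have ta : `|t| = t by rewrite gtr0_norm.
have pos s : `|s| = t -> 0 <= f (y + s *: delta_mx 0 i).
  move=> st; apply: Hf; first by rewrite addrC addKr; apply: le_lt_trans (norm_tdelta i s) _; rewrite st.
  move=> l; rewrite !mxE /=; have [->|li] := eqVneq l i; last by rewrite mulr0 addr0.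
  by rewrite mulr1; have := lerNnormlW (lexx `|s|); rewrite st; lra.
have h1 := H t; have h2 := H (- t); rewrite normrN ta fy !subr0 in h1 h2.
have p1 := pos t ta; have p2 := pos (- t) (etrans (normrN t) ta).
have {h1} := h1 td; have {h2} := h2 td; rewrite !ler_norml.
move=> /andP[_ k2] /andP[_ k1].
have u1 : - partial i f y <= e by rewrite -(ler_pM2l t0); lra.
have u2 : partial i f y <= e by rewrite -(ler_pM2l t0); lra.
by apply/andP; split; lra.
Qed.

Definition zeros q (y : E q) : {set 'I_q} := [set i | y 0 i == 0]%SET.

(** The Jacobian is invertible, so some permutation [s] gives a product without zero factor in its
    determinant. If the coordinate [j] of [g] vanishes at [y], its partial derivatives vanish in all
    directions in which [y] has a positive coordinate ([partial_min]); hence the coordinate of [y]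
    matched with [j] is zero. *)
Lemma zeros_le q (g g' : E q -> E q) y : cinfv g y -> cinfv g' (g y) -> orthant y ->
  nr y (fun z => orthant z -> orthant (g z) /\ g' (g z) = z) -> (#|zeros (g y)| <= #|zeros y|)%N.
Proof.
move=> cg cg' Oy H; have JJ : jacobian g y *m jacobian g' (g y) = 1%:M.
  rewrite -jacobian_comp // -(jacobian_id y); apply: jacobian_orthant => //; [exact: cinfv_comp|exact: cinfv_id|].
  by apply: nrW H => z h /h [].
have [uJ _] := mulmx1_unit JJ.
have [s Hs] : exists s : {perm 'I_q}, forall i, jacobian g y i (s i) != 0.
  apply: contrapT => N; move: uJ; rewrite unitmxE unitfE /determinant big1 ?eqxx // => s _.
  have [i /negPn/eqP Ji] : exists i, ~~ (jacobian g y i (s i) != 0).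
    apply: contrapT => N2; apply: N; exists s => i; apply: contrapT => /negP Ji; apply: N2; by exists i.
  by rewrite (bigD1 i) //= Ji mul0r mulr0.
have sub : zeros (g y) \subset (s @: zeros y)%SET.
  apply/fintype.subsetP => j; rewrite inE => /eqP gj; apply/imsetP; exists (s^-1%g j); last by rewrite permKV.
  rewrite inE; apply/negPn/negP => yi.
  have yp : 0 < y 0 (s^-1%g j) by rewrite lt_def yi; exact: Oy.
  have := Hs (s^-1%g j); rewrite permKV mxE (partial_min (cg j)) ?eqxx //.
  by apply: nrW H => z h /h [Og _]; exact: Og.
by apply: leq_trans (subset_leq_card sub) _; exact: leq_imset_card.
Qed.

Lemma chart_orthant m (T : topologicalType) (c : chart R m T) x : chart_of (@orthant R m) c -> cdom c x -> orthant (cmap c x).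
Proof. by move=> Cc cx; have [] := chart_img Cc (cimg_mem cx). Qed.

Lemma zeros_chart m (N : orthant_manifold R m) c d (x : N) : atlas N c -> atlas N d -> cdom c x -> cdom d x ->
  (#|zeros (cmap d x)| <= #|zeros (cmap c x)|)%N.
Proof.
move=> Ac Ad cx dx; have Cc := mf_chart Ac; have Cd := mf_chart Ad.
have [g [cg gE]] := mf_transition Ac Ad cx dx; have [g' [cg' gE']] := mf_transition Ad Ac dx cx.
have xK := chart_cinvK Cc cx; have xK' := chart_cinvK Cd dx.
have gx : g (cmap c x) = cmap d x by rewrite -(nr_self gE (cimg_mem cx)) /= xK.
rewrite -gx in cg' *; have [Oc nO] := chart_img Cc (cimg_mem cx).
apply: (zeros_le cg cg') => //.
have [od _ _ _ _] := Cd; have Ud : nbhs x (cdom d) by exact: open_nbhs_nbhs.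
have nd := chart_nr Cc cx Ud.
have ng' : nr (cmap c x) (fun z => cimg d (g z) -> cmap c (cinv d (g z)) = g' (g z)).
  by apply: (cinfv_nr_pre cg (P := fun w => cimg d w -> cmap c (cinv d w) = g' w)); rewrite gx.
apply: nrW (nrI (nrI nO nd) (nrI gE ng')) => z [[h1 h2] [h3 h4]] Oz; have cz := h1 Oz.
have dz := h2 cz; have gz := h3 cz; rewrite /= in gz; rewrite -gz in h4 *.
split; first exact: (chart_orthant Cd).
have [_ zK] := chart_cdom Cc cz.
by rewrite -h4 ?(chart_cinvK Cd dz) //; exact: cimg_mem.
Qed.

Lemma boundaryP m (N : orthant_manifold R m) k c (x : N) : atlas N c -> cdom c x ->
  boundary N k x <-> #|zeros (cmap c x)| = k.
Proof.
move=> Ac cx; split=> [[d [Ad dx <-]]|ck]; last by exists c; split.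
by apply/eqP; rewrite eqn_leq; apply/andP; split; exact: zeros_chart.
Qed.

Lemma card_zeros q (y : E q) : #|zeros y| = count (fun i => cx y i == 0) (iota 0 q).
Proof.
rewrite /zeros cardsE cardE size_filter -val_enum_ord count_map enumT.
by apply: eq_count => i; rewrite /= unfold_in cxE.
Qed.

End Corners.

Section Plots.
Context {R : realType} {n p : nat}.
Local Notation E n := 'rV[R]_n.
Variables (D : set (E p)) (P : manifold D) (M : smooth_manifold R n).

Lemma lsm_plot (F : P -> M) x c : lsm F x -> atlas P c -> cdom c x ->
  exists g, sm g (cmap c x) /\ nr (cmap c x) (fun z => cimg c z -> F (cinv c z) = g z).
Proof.
move=> [cF sF] Ac cx; have [d Ad dx] := mf_at (F x); have Cc := mf_chart Ac; have Cd := mf_chart Ad.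
have [g [cg gE]] := sF c d Ac Ad cx dx; have xK := chart_cinvK Cc cx.
have gx : g (cmap c x) = cmap d (F x) by rewrite -(nr_self gE (cimg_mem cx)) /= xK.
exists (cinv d \o g); split; first by apply: sm_cinv => //; rewrite gx; exact: cimg_mem.
have [od _ _ _ _] := Cd; have Ud : nbhs x (fun z => cdom d (F z)) by apply: cF; exact: open_nbhs_nbhs.
apply: nrW (nrI gE (chart_nr Cc cx Ud)) => z [h1 h2] cz /=.
by rewrite -(h1 cz) /= (chart_cinvK Cd) //; exact: h2.
Qed.

Lemma plot_lsm (F : P -> M) x c g : atlas P c -> cdom c x -> sm g (cmap c x) ->
  nr (cmap c x) (fun z => cimg c z -> F (cinv c z) = g z) -> lsm F x.
Proof.
move=> Ac cx sg ng; have Cc := mf_chart Ac; have xK := chart_cinvK Cc cx.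
have gx : g (cmap c x) = F x by rewrite -(nr_self ng (cimg_mem cx)) xK.
have [d Ad dx] := mf_at (F x); rewrite -gx in dx; have [nd cd] := sm_chart sg Ad dx.
rewrite gx in dx; apply: (lsm_ex Ac Ad cx dx).
  by apply: nrW (nrI ng nd) => z [h1 h2] cz; rewrite h1.
by exists (cmap d \o g); split => //; apply: nrW ng => z h1 cz; rewrite /= h1.
Qed.

End Plots.

Section WhatProperties.
Context {R : realType} {n : nat}.
Local Notation E n := 'rV[R]_n.
Variables (M : smooth_manifold R n) (h : M -> R) (X : vector_field M) (Phi : R -> M -> M).
Hypotheses (hPhi : is_flow X Phi) (hMS : morse_smale h X Phi).
Variables (v : M) (hv : crit h v).
Local Notation Wh := (What h Phi v).
Local Notation m := (morse_index h v).
Local Notation obs := (obs h Phi v).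
Local Notation avail := (avail h Phi v).
Local Notation N := (What_manifold hPhi hMS hv).
Local Notation e := (@What_proj R n M h X Phi hPhi hMS v hv).

Lemma What_projP (x : N) : Wh (e x).
Proof. exact: svalP. Qed.

Lemma nchart_atlas G d0 dl x0 : nvalid Phi G d0 dl -> atlas N (@nchart R n M h Phi v G d0 dl x0).
Proof. by move=> NV; apply: (gc_max (ncharts_good hPhi hMS hv)); exists G, d0, dl, x0. Qed.

Lemma nchart_cimg G d0 dl x0 z : nvalid Phi G d0 dl -> cimg (@nchart R n M h Phi v G d0 dl x0) z -> orthant z.
Proof. by move=> NV [x cx <-]; have [] := nchart_map NV cx. Qed.

Lemma obs_lsm i (x : N) : avail (e x) i -> lsm (fun y : N => obs (e y) i) x.
Proof.
move=> av; have [G [d0 [dl [NV [cx _]]]]] := nchart_at hPhi hMS hv x.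
have [g [sg ng]] := obs_local NV cx av.
apply: (plot_lsm (nchart_atlas x NV) cx sg); apply: nrW ng => z H cz.
by have [_] := H (nchart_cimg NV cz).
Qed.

(** A chart reads nothing but the end point and regular levels between it and [h v]. *)
Lemma lsm_into p (D : set (E p)) (P : manifold D) (f : P -> N) x : lsm (fun y => (e (f y)).2) x ->
  (forall b, regular h b -> h (e (f x)).2 < b < h v -> lsm (fun y => path_point h Phi v (e (f y)) b) x) ->
  lsm f x.
Proof.
move=> S0 Sb; have [c Ac cx] := mf_at x; have Cc := mf_chart Ac; have xK := chart_cinvK Cc cx.
have [G [d0 [dl [NV [cf _]]]]] := nchart_at hPhi hMS hv (f x); have [Of df] := cf; have [VG _ _ _ _] := NV.
have [|||g [cg gw ng]] := @gread _ _ _ h Phi v G _ (cimg c) (fun z => e (f (cinv c z))) (cmap c x) VG.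
- case=> [b bA|_]; last by have [g [sg ng]] := lsm_plot S0 Ac cx; exists g.
  have [rb bv] := gv_A VG bA; have xb := gv_A2 VG Of bA.
  by have [|g [sg ng]] := lsm_plot (Sb b rb _) Ac cx; [rewrite xb|exists g].
- exact: cimg_mem.
- by rewrite xK.
have nd : nr (cmap c x) (fun z => `|g z - d0| < dl).
  by apply: (cinfv_nr_pre cg (P := fun z => `|z - d0| < dl)); apply: nr_ball; rewrite gw xK.
apply: (lsm_ex Ac (nchart_atlas (f x) NV) cx cf).
  by apply: nrW (nrI ng nd) => z [H zd] cz; have [h1 h2] := H cz; split => //; rewrite h2.
exists (fun z => g z + gshift G d0 dl); split; first by apply: cinfvD => //; exact: cinfv_cst.
by apply: nrW ng => z H cz; have [h1 h2] := H cz; rewrite /= h2.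
Qed.

Lemma nchart_zero G d0 dl x0 x (i : 'I_m) : nvalid Phi G d0 dl -> cdom (@nchart R n M h Phi v G d0 dl x0) x ->
  (cmap (@nchart R n M h Phi v G d0 dl x0) x 0 i == 0) = (i < size (gcs G))%N && (cx (gL G (obs (sval x))) i == 0).
Proof.
move=> NV [_ xd]; rewrite !mxE [cx (gL _ _) i]cxE; case: ltnP => ik /=; first by rewrite addr0.
have := le_lt_trans (cx_le_norm _ i) xd; rewrite cxE !mxE ltr_norml [cx d0 i]cxE => H.
by apply/negbTE; rewrite gt_eqF //; move: H; rewrite /=; lra.
Qed.

Lemma nchart_label G d0 dl x0 x : nvalid Phi G d0 dl -> cdom (@nchart R n M h Phi v G d0 dl x0) x ->
  map snd (sval x).1 = mask [seq cx (gL G (obs (sval x))) i == 0 | i <- iota 0 (size (gcs G))] (gcs G).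
Proof. by move=> NV cdx; have [D P _ _ _] := nchart_map NV cdx; have [VG _ _ _ _] := NV; have := gv_lab VG D; rewrite P. Qed.

(** The free coordinates are positive thanks to [gshift], and the boundary coordinates vanish
    exactly for the breaks. *)
Lemma zeros_size G d0 dl x0 x : nvalid Phi G d0 dl -> cdom (@nchart R n M h Phi v G d0 dl x0) x ->
  #|zeros (cmap (@nchart R n M h Phi v G d0 dl x0) x)| = size (sval x).1.
Proof.
move=> NV cdx; have [VG _ _ _ _] := NV; have := nchart_label NV cdx => /(congr1 size); rewrite size_map => ->.
have E0 i : (i < m)%N -> (cx (cmap (@nchart R n M h Phi v G d0 dl x0) x) i == 0) =
    (i < size (gcs G))%N && (cx (gL G (obs (sval x))) i == 0).
  by move=> im; rewrite (cx_lt _ im) (nchart_zero _ NV cdx).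
rewrite size_mask ?size_map ?size_iota // count_map card_zeros.
have -> : iota 0 m = iota 0 (size (gcs G)) ++ iota (size (gcs G)) (m - size (gcs G)).
  by rewrite -[X in iota 0 X](subnKC (gv_size VG)) iotaD.
rewrite count_cat [X in (_ + X)%N](_ : _ = 0%N) ?addn0.
  by apply: eq_in_count => i; rewrite mem_iota add0n => /andP[_ ik] /=; rewrite E0 ?ik ?(leq_trans ik (gv_size VG)).
apply/eqP; rewrite -leqn0 leqNgt -has_count; apply/hasPn => i; rewrite mem_iota subnKC ?(gv_size VG) // => /andP[ki im].
by rewrite E0 // ltnNge ki.
Qed.

Lemma What_boundary k (x : N) : boundary N k x <-> size (e x).1 = k.
Proof.
have [G [d0 [dl [NV [cx _]]]]] := nchart_at hPhi hMS hv x.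
by rewrite (boundaryP k (nchart_atlas x NV) cx) (zeros_size NV cx).
Qed.

Lemma What_boundary_image k : (1 <= k)%N -> e @` boundary N k =
  \bigcup_(w in [set w | crit h w /\ crit_lt h w v]) (Bboundary h Phi k.-1 v w `*` Wminus Phi w).
Proof.
move=> k1; apply/seteqP; split=> p.
  move=> [x /What_boundary kx <-]; have [w [hw wv Bw Ww]] := What_projP x; exists w.
    split => //; case: wv => // wv; rewrite wv in Bw.
    by move: kx k1; rewrite (is_broken_refl Bw) => <-.
  by split => //; split => //; rewrite kx prednK.
move=> [w [hw wv] [[Bw sz] Ww]]; have Wp : Wh p by exists w; split => //; left.
exists (exist _ p Wp : N) => //; apply/What_boundary; by rewrite /What_proj /= sz prednK.
Qed.

Lemma What_boundary0 : e @` boundary N 0 = [set [::]] `*` Wminus Phi v.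
Proof.
apply/seteqP; split=> p.
  move=> [x /What_boundary /size0nil kx <-]; have [w [hw wv Bw Ww]] := What_projP x.
  rewrite kx in Bw; have vw : v = w := Bw.
  by rewrite -vw in Ww; split.
move=> [/= p1 Wp]; have Wp' : Wh p by exists v; split => //; [right|rewrite p1].
by exists (exist _ p Wp' : N) => //; apply/What_boundary; rewrite /What_proj /= p1.
Qed.

Lemma What_endpoint_smooth : smooth_map setT (fun x : N => (e x).2 : M).
Proof. by apply: smooth_mapP => x _; exact: (@obs_lsm None). Qed.

End WhatProperties.

(** * The canonical structure *)

Section Flatten.
Context {R : realType} {n : nat} {I : finType}.
Local Notation E n := 'rV[R]_n.

Definition stack (f : I -> E n) : E (#|I| * n) := mxvec (\matrix_(k < #|I|) f (enum_val k)).

Lemma slice_stack f i : slice (enum_rank i) (stack f) = f i.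
Proof. by rewrite /slice mxvecK rowK enum_rankK. Qed.

Lemma stack_coord f k l : stack f 0 (mxvec_index k l) = f (enum_val k) 0 l.
Proof. by rewrite mxvecE mxE. Qed.

Lemma stack_cinfv q (G : I -> E q -> E n) y : (forall i, cinfv (G i) y) -> cinfv (fun z => stack (G^~ z)) y.
Proof.
move=> H j; case/mxvec_indexP: j => k l; apply: cinf_ext (H (enum_val k) l) => z.
by rewrite stack_coord.
Qed.

Lemma stack_jacobian q (G : I -> E q -> E n) y (u : E q) :
  u *m jacobian (fun z => stack (G^~ z)) y = 0 <-> forall i, u *m jacobian (G i) y = 0.
Proof.
have K k l : (u *m jacobian (fun z => stack (G^~ z)) y) 0 (mxvec_index k l) = (u *m jacobian (G (enum_val k)) y) 0 l.
  rewrite !mxE; apply: eq_bigr => j _; rewrite !mxE; congr (_ * partial _ _ _).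
  by apply/funext => z; rewrite stack_coord.
split=> [H i|H]; last by apply/rowP => j; case/mxvec_indexP: j => k l; rewrite K H !mxE.
by apply/rowP => l; rewrite -(enum_rankK i) -K H !mxE.
Qed.

End Flatten.

(** * Embeddings by finitely many observations *)

Section Embedding.
Context {R : realType} {n : nat}.
Variables (M : smooth_manifold R n) (h : M -> R) (X : vector_field M) (Phi : R -> M -> M).
Hypotheses (hPhi : is_flow X Phi) (hMS : morse_smale h X Phi).
Variables (v : M) (hv : crit h v).
Local Notation m := (morse_index h v).
Local Notation obs := (obs h Phi v).
Local Notation avail := (avail h Phi v).
Local Notation N := (What_manifold hPhi hMS hv).
Local Notation e := (@What_proj R n M h X Phi hPhi hMS v hv).

Variables (I : finType) (lv : I -> option R) (i0 : I) (U : set N).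
Let F i (x : N) : M := obs (e x) (lv i).
Hypotheses (lv0 : lv i0 = None) (oU : open U) (avU : forall x i, U x -> avail (e x) (lv i)).
Hypothesis upU : forall x b, U x -> regular h b -> h (e x).2 < b < h v ->
  exists i, reaches h Phi b (F i x).

(** [ib] selects, for each level of the chart, a component of the embedding from which this level is
    reached along the flow. *)
Lemma lift_level G d0 dl (x : N) : U x -> nvalid Phi G d0 dl -> cdom (@nchart R n M h Phi v G d0 dl x) x ->
  exists ib : R -> I, forall b, b \in gA G -> regular h b /\ reaches h Phi b (F (ib b) x).
Proof.
move=> Ux [VG _ _ _ _] [Ox _].
have [ib H] : {ib : R -> I & forall b, b \in gA G -> regular h b /\ reaches h Phi b (F (ib b) x)}.
  apply: (choice (P := fun b i => b \in gA G -> regular h b /\ reaches h Phi b (F i x))) => b.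
  have [bA|nb] := boolP (b \in gA G); last by exists i0.
  have [rb bv] := gv_A VG bA; have xb := gv_A2 VG Ox bA.
  by have [|i h1] := upU Ux rb; [rewrite xb|exists i].
by exists ib.
Qed.

(* The components [y] of an embedding determine the observations of a path
   through the flow. *)
Definition lift_obs (ib : R -> I) (y : I -> M) (i : option R) : M :=
  if i is Some b then level_point h Phi b (y (ib b)) else y i0.

Lemma lift_obsE ib x i : U x -> (forall b, i = Some b -> reaches h Phi b (F (ib b) x)) ->
  obs (e x) i = lift_obs ib (F^~ x) i.
Proof.
move=> Ux; case: i => [b|_]; last by rewrite /= /F lv0.
move=> /(_ b erefl) r; have [_ H2] := obs_up hPhi hMS hv (What_projP x) (avU (ib b) Ux) r; exact: H2.
Qed.

Lemma components_smooth i : smooth_map U (F i).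
Proof. by apply: smooth_mapP => x Ux; apply: obs_lsm; exact: avU. Qed.

Lemma components_inj : set_inj U (fun x i => F i x).
Proof.
move=> x y /set_mem Ux /set_mem Uy Fxy.
have Fi i : F i x = F i y by have := congr1 (fun f => f i) Fxy.
have [G [d0 [dl [NV [cdx _]]]]] := nchart_at hPhi hMS hv x; have [VG _ _ _ _] := NV; have [Ox _] := cdx.
have [ib Hib] := lift_level Ux NV cdx.
have [i ii|Oy Ly] := gv_ext VG (y' := obs (e y)) _ Ox.
  have HF : F^~ x = F^~ y by exact/funext.
  have K z : U z -> F^~ z = F^~ x -> obs (e z) i = lift_obs ib (F^~ z) i.
    move=> Uz zx; apply: lift_obsE => // b bi; have [|_ h1] := Hib b; first by move: ii; rewrite bi.
    by have := congr1 (fun f => f (ib b)) zx => /= ->.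
  by rewrite [LHS](K x) // [RHS](K y) // HF.
have [_ P1] := gv_L2 VG (What_projP x) Ox; have [_ P2] := gv_L2 VG (What_projP y) Oy.
by apply: sval_inj; rewrite -[LHS]P1 -[RHS]P2 Ly.
Qed.

(** The chart at [x] is continuous in finitely many observations ([gopen]), and these depend
    continuously on the components through the flow. [Q] is the largest set with the required trace
    on the image, so only its interior has to be examined. *)
Lemma components_topology (V : set N) : open V -> V `<=` U ->
  exists2 O : set (prod_topology (fun _ : I => M)), open O & V = U `&` [set x | O (F^~ x)].
Proof.
move=> oV VU; pose Q : set (prod_topology (fun _ : I => M)) := [set z | forall y, U y -> F^~ y = z -> V y].
exists (Q°); first exact: open_interior.
apply/seteqP; split=> x; last by move=> [Ux /interior_subset]; apply.
move=> Vx; have Ux := VU x Vx; split => //=.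
have [G [d0 [dl [NV [cdx Lx]]]]] := nchart_at hPhi hMS hv x; have [VG _ _ dl0 _] := NV; have [Ox _] := cdx.
have [ib Hib] := lift_level Ux NV cdx.
have Vx' : nbhs x V by exact: open_nbhs_nbhs.
have Cc := mf_chart (nchart_atlas hPhi hMS hv x NV).
have [r r0 Hr] := chart_nr Cc cdx Vx'.
have m0 : 0 < Num.min r dl by rewrite lt_min r0.
have [W [W1 W2]] := gopen VG Ox m0.
have FF : Filter (nbhs (F^~ x : prod_topology (fun _ : I => M))) := @nbhs_filter _ _.
have pc (i : I) (B : set M) : nbhs (F i x) B -> nbhs (F^~ x : prod_topology (fun _ : I => M)) [set z | B (z i)].
  by move=> Bx; apply: (@proj_continuous I (fun _ => M) i (F^~ x)).
have n0 : nbhs (F^~ x : prod_topology (fun _ : I => M)) [set z | W None (z i0)].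
  by apply: pc; rewrite /F lv0; exact: W1.
have n1 : nbhs (F^~ x : prod_topology (fun _ : I => M)) [set z | forall b, b \in gA G ->
     reaches h Phi b (z (ib b)) /\ W (Some b) (level_point h Phi b (z (ib b)))].
  suff K (s : seq R) : {subset s <= gA G} -> nbhs (F^~ x : prod_topology (fun _ : I => M)) [set z | forall b,
      b \in s -> reaches h Phi b (z (ib b)) /\ W (Some b) (level_point h Phi b (z (ib b)))] by exact: K.
  elim: s => [|b s IH] sG; first by apply: filterS filterT.
  have bG : b \in gA G by apply: sG; rewrite mem_head.
  have {}IH := IH (fun a (H : a \in s) => sG a (mem_behead (s := b :: s) H)).
  have [rb r1] := Hib b bG.
  have H2 : nbhs (F^~ x : prod_topology (fun _ : I => M)) [set z |
      reaches h Phi b (z (ib b)) /\ W (Some b) (level_point h Phi b (z (ib b)))].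
    apply: (pc (ib b) (fun z => reaches h Phi b z /\ W (Some b) (level_point h Phi b z))).
    apply: (level_point_nbhs hPhi hMS) => //; first exact: (regular_ncrit hPhi hMS rb).
    by have := W1 (Some b) bG; rewrite (@lift_obsE ib x (Some b)) // => b' [<-].
  by apply: filterS (filterI H2 IH) => z [h1 h2] b'; rewrite inE => /predU1P[->|/h2].
apply: filterS (filterI n0 n1) => z [h0 h1] y Uy yz; rewrite -yz in h0 h1.
have [|Oy Ly] := W2 (obs (e y)).
  case=> [b|] ib'; last by move: h0; rewrite /F /= lv0.
  have [r1 w1] := h1 b ib'; have [_ l1] := Hib b ib'.
  by rewrite (@lift_obsE ib y (Some b)) // => b' [<-].
rewrite lt_min in Ly; case/andP: Ly => Ly1 Ly2; rewrite [gL G (obs (e x))]Lx in Ly2.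
have cy : cdom (@nchart R n M h Phi v G d0 dl x) y by split.
rewrite -(chart_cinvK Cc cy); apply: Hr; last exact: cimg_mem.
by rewrite /= opprD addrACA subrr addr0.
Qed.

(** On the orthant the coordinates [g] of a chart at [x] factor as [Lam \o zeta], where [zeta]
    stacks the extensions [G i] and [Lam] is smooth on a full neighbourhood. A vector killed by all
    differentials of the [G i] is thus killed by the invertible Jacobian of [g]. *)
Lemma components_immersion : injective_differentials U F.
Proof.
move=> x c d G Ux Ac cx Hd HG u uG; have Cc := mf_chart Ac; have xK := chart_cinvK Cc cx.
have [Gc [d0 [dl [NV [cdx Lx]]]]] := nchart_at hPhi hMS hv x; have [VG _ _ dl0 _] := NV; have [Ox _] := cdx.
have [ib Hib] := lift_level Ux NV cdx.
set c0 := @nchart R n M h Phi v Gc d0 dl x in cdx; have Ac0 : atlas N c0 := nchart_atlas hPhi hMS hv x NV.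
have Cc0 := mf_chart Ac0; set y0 := cmap c x.
have [Oy0 nO] := chart_img Cc (cimg_mem cx).
have Ux' : nbhs x U by exact: open_nbhs_nbhs.
have cG i : cinfv (G i) y0.
  have [[V [oV OV VG']] _] := HG i; move=> j; exists V; split => //.
  by apply: OV; exists x => //; split => //; have [] := Hd i.
have nG i : nr y0 (fun z => orthant z -> cmap (d i) (F i (cinv c z)) = G i z /\ cdom (d i) (F i (cinv c z))).
  have [_ GE] := HG i; have [Adi dix] := Hd i.
  have cF : {for x, continuous (F i)} by have [+ _] := obs_lsm (avU i Ux).
  have [odi _ _ _ _] := mf_chart Adi.
  have Fx : nbhs x (fun z => cdom (d i) (F i z)) by apply: cF; exact: open_nbhs_nbhs.
  apply: nrW (nrI nO (chart_nr Cc cx (filterI Ux' Fx))) => z [h1 h2] Oz.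
  have cz := h1 Oz; have [k1 k2] := h2 cz; split => //; rewrite -GE //.
  by have [a1 a2] := chart_cdom Cc cz; exists (cinv c z).
pose zeta z := stack (G^~ z); have cz : cinfv zeta y0 by exact: stack_cinfv.
pose th i w := cinv (d i) (slice (enum_rank i) w).
have thz i : th i (zeta y0) = F i x.
  have [E1 E2] := nr_self (nG i) Oy0; rewrite xK in E1 E2.
  by rewrite /th slice_stack -E1 (chart_cinvK (mf_chart (proj1 (Hd i))) E2).
have sth i : sm (th i) (zeta y0).
  have [Adi dix] := Hd i; apply: chart_plot => //; last exact: slice_cinfv.
  have [E1 E2] := nr_self (nG i) Oy0; rewrite xK in E1 E2.
  by rewrite slice_stack -E1; exact: cimg_mem.
have slo i : idx (gA Gc) i -> sm (fun w => lift_obs ib (th^~ w) i) (zeta y0).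
  case: i => [b|] ii; last exact: sth.
  have [rb r1] := Hib b ii.
  by have [] := level_point_sm hPhi hMS (sth (ib b)) (a := b); rewrite ?thz //; exact: regular_ncrit rb r1.
have [i ii|Oz _] := gv_ext VG (y := obs (e x)) (y' := fun i => lift_obs ib (th^~ (zeta y0)) i) _ Ox.
  rewrite [LHS](lift_obsE (ib := ib) Ux); last by move=> b bi; have [|_ h1] := Hib b; first by move: ii; rewrite bi.
  by congr (lift_obs ib _ i); apply/funext => k; rewrite thz.
have [_ cL] := gv_smooth VG slo Oz.
pose Lam w := gL Gc (fun i => lift_obs ib (th^~ w) i) + gshift Gc d0 dl.
have cLam : cinfv Lam (zeta y0) by apply: cinfvD => //; exact: cinfv_cst.
have [g [cg gE]] := mf_transition Ac Ac0 cx cdx; have [g' [cg' gE']] := mf_transition Ac0 Ac cdx cx.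
have gx : g y0 = cmap c0 x by rewrite -(nr_self gE (cimg_mem cx)) /= xK.
have J1 : jacobian g y0 = jacobian (Lam \o zeta) y0.
  apply: jacobian_orthant => //; first exact: cinfv_comp.
  have nall : nr y0 (fun z => forall i : I, orthant z -> th i (zeta z) = F i (cinv c z)).
    have := nr_all (s := enum I) (w := y0) (P := fun i z => orthant z -> th i (zeta z) = F i (cinv c z)).
    move=> H; apply: nrW (H _) => [z k i Oz'|i _]; first by apply: k => //; rewrite mem_enum.
    apply: nrW (nG i) => z k Oz'; have [k1 k2] := k Oz'.
    by rewrite /th slice_stack -k1 (chart_cinvK (mf_chart (proj1 (Hd i)))).
  have nreach : nr y0 (fun z => forall b, b \in gA Gc -> reaches h Phi b (th (ib b) (zeta z))).
    apply: nr_all => b bA; have [rb r1] := Hib b bA.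
    apply: (cinfv_nr_pre cz (P := fun w => reaches h Phi b (th (ib b) w))).
    by have [] := level_point_sm hPhi hMS (sth (ib b)) (a := b); rewrite ?thz //; exact: regular_ncrit rb r1.
  have [oc0 _ _ _ _] := Cc0; have U0 : nbhs x (cdom c0) by exact: open_nbhs_nbhs.
  apply: nrW (nrI (nrI nO gE) (nrI (nrI nall nreach) (chart_nr Cc cx (filterI Ux' U0)))) => z.
  move=> [[k1 k2] [[k3 k4] k5]] Oz'; have ciz := k1 Oz'; rewrite -k2 //= /Lam; have [Uz c0z] := k5 ciz.
  congr (_ + _); have [Oc _] := c0z.
  apply: (proj2 (gv_ext VG _ Oc)) => i ii; rewrite [LHS](lift_obsE (ib := ib) Uz).
    by congr (lift_obs ib _ i); apply/funext => k; rewrite k3.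
  move=> b bi; have bA : b \in gA Gc by move: ii; rewrite bi.
  by rewrite -k3 //; exact: k4.
have J2 : jacobian g y0 *m jacobian g' (g y0) = 1%:M.
  rewrite -jacobian_comp ?gx // -(jacobian_id y0); apply: jacobian_orthant => //.
  - by apply: cinfv_comp; rewrite ?gx.
  - exact: cinfv_id.
  have [oc0 _ _ _ _] := Cc0; have U0 : nbhs x (cdom c0) by exact: open_nbhs_nbhs.
  have ng' : nr y0 (fun z => cimg c0 (g z) -> cmap c (cinv c0 (g z)) = g' (g z)).
    by apply: (cinfv_nr_pre cg (P := fun w => cimg c0 w -> cmap c (cinv c0 w) = g' w)); rewrite gx.
  apply: nrW (nrI (nrI nO gE) (nrI ng' (chart_nr Cc cx U0))) => z [[k1 k2] [k3 k4]] Oz'.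
  have ciz := k1 Oz'; have c0z := k4 ciz; have k2z := k2 ciz; rewrite /= in k2z; rewrite -k2z in k3.
  rewrite /= -k2z -k3; last exact: cimg_mem.
  by rewrite (chart_cinvK Cc0 c0z); have [_] := chart_cdom Cc ciz.
have z0 : u *m jacobian zeta y0 = 0 by apply/stack_jacobian.
rewrite -[u]mulmx1 -J2 mulmxA J1 jacobian_comp // mulmxA z0 !mul0mx //.
Qed.

Lemma components_embedding (Y : I -> set M) : (forall x i, U x -> Y i (F i x)) -> smooth_embedding U F Y.
Proof.
move=> HY; split => //; [exact: components_smooth|exact: components_immersion|exact: components_inj|].
exact: components_topology.
Qed.

End Embedding.

(** * The levels of the maps \hat J *)

Section Levels.
Context {R : realType} {n : nat}.
Variables (M : smooth_manifold R n) (h : M -> R) (X : vector_field M) (Phi : R -> M -> M).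
Hypotheses (hPhi : is_flow X Phi) (hMS : morse_smale h X Phi).
Variables (v : M) (hv : crit h v).
Local Notation Wh := (What h Phi v).
Local Notation obs := (obs h Phi v).
Local Notation avail := (avail h Phi v).

(** How small [eps] has to be for \hat J; with the closed inequality the levels [a + eps] and
    [a - eps] themselves are regular. *)
Definition fine (s : seq R) (eps : R) := 0 < eps /\
  forall a b, a \in s -> critval h b -> `|b - a| <= eps -> b = a.

Lemma fine_near s : \forall eps \near 0^'+, fine s eps.
Proof.
suff [e0 e00 He] : exists2 e0, 0 < e0 & forall a b, a \in s -> critval h b -> `|b - a| < e0 -> b = a.
  near=> eps; split; first by near: eps; exact: nbhs_right_gt.
  move=> a b aS cb ab; apply: He => //; apply: le_lt_trans ab _.
  by near: eps; exact: nbhs_right_lt.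
elim: s => [|a s [e0 e00 He]]; first by exists 1.
have [e1 e10 He1] := critval_isolated hMS a.
exists (Num.min e0 e1); first by rewrite lt_min e00.
move=> a' b; rewrite inE => /predU1P[->|aS] cb; rewrite lt_min => /andP[h1 h2]; first exact: He1.
exact: He.
Unshelve. all: by end_near. Qed.

Lemma available_above p a : Wh p -> regular h a -> a < h v ->
  (forall b, critval h b -> ~ a <= b <= h p.2) -> available h Phi v a p.
Proof.
case: p => s x Wp ra av nb; have [xa|ax] := leP (h x) a.
  by apply: (regular_available hPhi hMS hv Wp ra); rewrite xa.
by have [] := reaches_available hPhi hMS Wp (descend hPhi hMS (ltW ax) nb).
Qed.

Lemma connect_end p b : Wh p -> regular h b -> h p.2 < b < h v ->
  (forall d, critval h d -> ~ h p.2 <= d <= b) -> reaches h Phi b p.2.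
Proof.
case: p => s x Wp rb /= /andP[xb bv] nd.
have rx : regular h (h x) by move=> cx; apply: (nd _ cx); rewrite lexx ltW.
have av : available h Phi v (h x) (s, x) by apply: (regular_available hPhi hMS hv Wp rx); rewrite lexx (lt_trans xb).
have avb : available h Phi v b (s, x) by apply: (regular_available hPhi hMS hv Wp rb); rewrite (ltW xb).
by have [+ _ _ _] := path_connect hPhi hMS hv Wp av avb rx rb (ltW xb) nd; rewrite (path_point_end hPhi hMS).
Qed.

Lemma slab_up_end c p b : Wh p -> slab h c p.2 -> regular h b -> h p.2 < b < h v -> b < c -> reaches h Phi b p.2.
Proof.
move=> Wp sc rb xbv bc; apply: connect_end => // d cd /andP[xd db].
by have := slab_noncritical sc cd (le_lt_trans db bc); rewrite ltNge xd.
Qed.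

Lemma slab_top p : Wh p -> slab h (h v) p.2 -> Wminus Phi v p.2.
Proof.
move=> [w [hw [[_ wv]|<-] _ Ww]] // sc; have cw : critval h (h w) by exists w.
by have := slab_noncritical sc cw wv; rewrite ltNge (Wminus_h hPhi hMS Ww).
Qed.

Section Slab.
Variables (c : R) (cs : seq R) (eps : R).
Hypotheses (cc : critval h c) (cv : c < h v) (csE : forall a, a \in cs <-> critval h a /\ c < a < h v).
Hypothesis (fe : fine (c :: cs) eps).
Local Notation ls := (levels cs c eps).
Definition level_of (ls : seq R) (i : option 'I_(size ls)) : option R := omap (fun j : 'I_(size ls) => nth 0 ls j) i.

(** [h v] is a critical value as well, so it is further than [eps] away from [a]. *)
Lemma fine_shift a t : a \in c :: cs -> `|t| <= eps -> t != 0 -> regular h (a + t) /\ a + t < h v.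
Proof.
have [e0 He] := fe; move=> aS te t0; split.
  move=> ct; have := He a _ aS ct; rewrite addrAC subrr add0r => /(_ te) /eqP.
  by rewrite -subr_eq0 addrAC subrr add0r (negbTE t0).
have av : a < h v by move: aS; rewrite inE => /predU1P[->//|/csE [_ /andP[]]].
rewrite ltNge; apply/negP => vt; have := ler_norm t => lt.
have := He a (h v) aS; rewrite ger0_norm ?subr_ge0 ?(ltW av) // => H.
have := H (ex_intro2 _ _ v hv erefl); move: av vt te lt => av vt te lt.
by move=> K; have := K ltac:(lra); lra.
Qed.

Lemma mem_levels l : l \in ls -> exists a t, [/\ a \in c :: cs, l = a + t, `|t| = eps & t < 0 -> a != c].
Proof.
have [e0 _] := fe; rewrite /levels mem_rcons inE => /predU1P[->|].
  by exists c, eps; rewrite mem_head gtr0_norm //; split => //; rewrite ltNge ltW.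
move=> /flatten_mapP [a aS]; have aS' : a \in c :: cs by rewrite inE aS orbT.
have ac : a != c by move: aS => /csE [_ /andP[ca _]]; rewrite gt_eqF.
by rewrite !inE => /orP[/eqP ->|/eqP ->]; [exists a, eps|exists a, (- eps)]; rewrite ?normrN gtr0_norm.
Qed.

Lemma level_nth a : a \in c :: cs -> exists i : 'I_(size ls), nth 0 ls i = a + eps.
Proof.
move=> aS; have H : a + eps \in ls.
  rewrite /levels mem_rcons inE; move: aS; rewrite inE => /predU1P[->|aS]; first by rewrite eqxx.
  by apply/orP; right; apply/flatten_mapP; exists a => //; rewrite mem_head.
have il : (index (a + eps)%R ls < size ls)%N by rewrite index_mem.
by exists (Ordinal il); rewrite /= nth_index.
Qed.

(** A critical value between the level [a + t] and the end point is at most [c], by the choice of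
    the slab, hence it lies within [eps] of [a] and equals [a]. This forces [a = c] and [t < 0], but
    no level below [c] is in the list. *)
Lemma levels_avail p i : Wh p -> slab h c p.2 -> avail p (@level_of ls i).
Proof.
case: i => [j|] // Wp sc; have [a [t [aS /= lE te tc]]] := mem_levels (mem_nth 0 (ltn_ord j)); rewrite lE.
have [e0 He] := fe; have t0 : t != 0 by rewrite -normr_eq0 te gt_eqF.
have [|rt tv] := fine_shift aS _ t0; first by rewrite te.
split => //; apply: available_above => // b cb /andP[tb bx].
have [bc|cb'] := leP b c; last by have := slab_noncritical_gt sc cb cb'; rewrite ltNge bx.
have ac : c <= a by move: aS; rewrite inE => /predU1P[->//|/csE [_ /andP[/ltW]]].
have ba : b = a.
  apply: (He a b aS cb); rewrite ler0_norm; last by lra.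
  by have := lerNnormlW (lexx `|t|); rewrite te; lra.
have tn : t < 0 by rewrite lt_neqAle t0 /=; lra.
by have /eqP := tc tn; apply; lra.
Qed.

(** Below [c] the level is reached from the end point. Otherwise let [a] be the largest of [c] and
    [cs] below [b]: there is no critical value between [a + eps] and [b], in either order, and the
    flow connects the two levels. *)
Lemma levels_up p b : Wh p -> slab h c p.2 -> regular h b -> h p.2 < b < h v ->
  exists i, reaches h Phi b (obs p (@level_of ls i)).
Proof.
move=> Wp sc rb /andP[xb bv]; have [bc|cb] := leP b c.
  have bc' : b < c by rewrite lt_neqAle bc andbT; apply/eqP => bE; apply: rb; rewrite bE.
  by exists None; apply: (slab_up_end Wp sc rb _ bc'); rewrite xb.
have [a [aS ab amax]] : exists a, [/\ a \in c :: cs, a < b & forall a', a' \in c :: cs -> a' < b -> a' <= a].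
  elim: cs => [|d s [a [aS ab H]]]; first by exists c; rewrite mem_head; split => // a'; rewrite inE => /eqP ->.
  have sub a' : a' \in [:: c, d & s] -> a' = d \/ a' \in c :: s.
    by rewrite !inE => /or3P[->|/eqP ->|->]; rewrite ?orbT; [right|left|right].
  have [db|bd] := ltP d b; last first.
    exists a; split => //; first by move: aS; rewrite !inE => /orP[->|->]; rewrite ?orbT.
    by move=> a' /sub [->|/H //]; lra.
  exists (Num.max a d); split; last 2 first.
  - by rewrite gt_max ab.
  - by move=> a' /sub [->|/H {}H] a'b; rewrite le_max ?lexx ?orbT // H.
  by case: (leP a d) => _; move: aS; rewrite !inE ?eqxx ?orbT // => /orP[->|->]; rewrite ?orbT.
have [i iE] := level_nth aS; exists (Some i); rewrite /= iE.
have [e0 He] := fe; have [||rl lv] := @fine_shift a eps aS; rewrite ?gtr0_norm ?gt_eqF //.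
have := levels_avail (Some i) Wp sc; rewrite /= iE => -[_ al].
have ba : available h Phi v b p by case: p Wp sc xb al => s x Wp *; apply: (regular_available hPhi hMS hv Wp rb); rewrite ltW.
have ca : c <= a by move: aS; rewrite inE => /predU1P[->//|/csE [_ /andP[/ltW]]].
have [lb|bl] := leP (a + eps) b.
  have [] := path_connect hPhi hMS hv Wp al ba rl rb lb => // d cd /andP[ld db].
  have db' : d < b by rewrite lt_neqAle db andbT; apply/eqP => dE; apply: rb; rewrite -dE.
  have dS : d \in c :: cs by rewrite inE; apply/orP; right; apply/csE; split => //; lra.
  by have := amax d dS db'; lra.
have [|] := path_connect hPhi hMS hv Wp ba al rb rl (ltW bl) => // d cd /andP[bd dl].
have := He a d aS cd; rewrite ger0_norm; last by lra.
by move=> H; have := H ltac:(lra); lra.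
Qed.

End Slab.

Local Notation N := (What_manifold hPhi hMS hv).
Local Notation e := (@What_proj R n M h X Phi hPhi hMS v hv).

Lemma What_slab_open c : open (What_slab h (e : N -> _) c).
Proof.
rewrite openE => x sx; have [cn _] := @obs_lsm R n M h X Phi hPhi hMS v hv None x I.
exact: (cn _ (slab_near hMS sx)).
Qed.

Lemma What_canonical : canonical_structure h Phi v (e : N -> _).
Proof.
split.
- split => //; first by move=> x _; exact: What_projP.
    by move=> x y _ _; exact: sval_inj.
  by move=> p Wp; exists (exist _ p Wp : N).
- by move=> c _ _; exact: What_slab_open.
- have := @components_embedding R n M h X Phi hPhi hMS v hv unit (fun=> None) tt (What_slab h (e : N -> _) (h v))
    erefl (@What_slab_open (h v)) (fun _ _ _ => I).
  move=> H; apply: H => [x b sx rb /andP[xb bv]|x _ sx]; last exact: slab_top (What_projP x) sx.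
  by exists tt; apply: (slab_up_end (What_projP x) sx rb _ bv); rewrite xb.
- move=> c cs cc cv _ csE; apply: filterS (fine_near (c :: cs)) => eps fe.
  have := @components_embedding R n M h X Phi hPhi hMS v hv _ (@level_of (levels cs c eps)) None
    (What_slab h (e : N -> _) c) erefl (@What_slab_open c).
  have av (x : N) i : What_slab h (e : N -> _) c x -> avail (e x) (@level_of (levels cs c eps) i).
    by move=> sx; exact: (levels_avail cv csE fe i (What_projP x) sx).
  move=> /(_ av) H; have {H} H := H _ (@J_target _ _ _ h c (levels cs c eps)) _.
  have -> : (fun i (x : N) => @J_map _ _ _ h Phi v (levels cs c eps) i (e x)) =
      fun i x => obs (e x) (@level_of (levels cs c eps) i) by apply/funext => -[].
  apply: H => [x b sx rb xbv|x [j|] sx //]; first exact: (levels_up cc cv csE fe (What_projP x) sx rb xbv).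
  by have [_ aj] := av x (Some j) sx; have [_] := path_pointP hPhi hMS (What_projP x) aj.
Qed.

End Levels.

Lemma continuous_into_product (T M : topologicalType) (I : eqType) (G : T -> prod_topology (fun _ : I => M)) x :
  (forall i, {for x, continuous (fun z => G z i)}) -> {for x, continuous G}.
Proof.
move=> H; apply/cvg_sup => i A; rewrite nbhsE => -[B [[C oC <-] Cx] BA].
by apply: filterS BA _; apply: (H i C); exact: open_nbhs_nbhs.
Qed.

(** * Uniqueness of the canonical structure *)

Section Uniqueness.
Context {R : realType} {n : nat}.
Local Notation E n := 'rV[R]_n.
Variables (M : smooth_manifold R n) (h : M -> R) (X : vector_field M) (Phi : R -> M -> M).
Hypotheses (hPhi : is_flow X Phi) (hMS : morse_smale h X Phi).
Variables (v : M) (hv : crit h v).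
Local Notation Wh := (What h Phi v).
Local Notation m := (morse_index h v).
Local Notation obs := (obs h Phi v).
Local Notation avail := (avail h Phi v).
Local Notation N := (What_manifold hPhi hMS hv).
Local Notation e := (@What_proj R n M h X Phi hPhi hMS v hv).

(** By compactness the interval is covered by finitely many intervals in each of which only the
    centre can be a critical value. *)
Lemma critvals_between c : exists cs : seq R, sorted (fun a b => b < a) cs /\
  forall a, a \in cs <-> critval h a /\ c < a < h v.
Proof.
have [r Hr] : {r : R -> R & forall a, 0 < r a /\ forall b, critval h b -> `|b - a| < r a -> b = a}.
  by apply: (choice (P := fun a r => 0 < r /\ forall b, critval h b -> `|b - a| < r -> b = a)) => a;
     have [r r0 H] := critval_isolated hMS a; exists r.
have [s Hs] : exists s : seq R, forall t, c <= t <= h v -> exists2 a, a \in s & `|t - a| < r a.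
  apply: contrapT => H.
  pose Q (s : seq R) := [set t : R | c <= t <= h v /\ forall a, a \in s -> ~ `|t - a| < r a].
  have PF : ProperFilter (filter_from [set: seq R] Q).
    apply: filter_from_proper; last first.
      move=> s _; apply: contrapT => K; apply: H; exists s => t Ht; apply: contrapT => Hy.
      by apply: K; exists t; split => // a aS ta; apply: Hy; exists a.
    apply: filter_from_filter; first by exists [::].
    move=> s s' _ _; exists (s ++ s') => // t [Ht Hy].
    by split; split => // a aS; apply: Hy; rewrite mem_cat aS ?orbT.
  have [|a [_ cl]] := @segment_compact R c (h v) _ PF.
    by exists [::] => // t [ht _] /=; rewrite in_itv.
  have [r0 _] := Hr a.
  have Fa : filter_from [set: seq R] Q (Q [:: a]) by exists [:: a].
  have [t [[_ Qt] ta]] := cl _ _ Fa (nbhsx_ballx a (r a) r0).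
  by apply: (Qt a); [rewrite inE|rewrite distrC].
pose s' := [seq a <- s | `[< critval h a /\ c < a < h v >]].
exists (rev (sort <=%O (undup s'))); split.
  by rewrite rev_sorted sort_lt_sorted undup_uniq.
move=> a; rewrite mem_rev mem_sort mem_undup mem_filter; split=> [/andP[/asboolP]//|[ca /andP[ac av]]].
rewrite asboolT ?ac //=; have [|b bs ab] := Hs a; first by rewrite !ltW.
by have [_ /(_ a ca ab) ->] := Hr b.
Qed.

Section Canonical.
Variables (q : nat) (D : set (E q)) (N' : manifold D) (e' : N' -> broken M * M).
Hypothesis can : canonical_structure h Phi v e'.

Lemma canonical_What y : Wh (e' y).
Proof. by have [[H _ _] _ _ _] := can; exact: H. Qed.

(** Brings the top slab and the lower ones into one form. The third clause, by which the end point
    alone decides about membership in [U], serves to prove continuity of maps into [N']. *)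
Lemma canonical_local y : exists (I : finType) (lv : I -> option R) (U : set N') (Y : I -> set M), [/\ open U /\ U y,
  smooth_embedding U (fun i z => obs (e' z) (lv i) : M) Y,
  nbhs (e' y).2 (fun x => forall z, (e' z).2 = x -> U z),
  (exists i, lv i = None) /\ forall z i, U z -> avail (e' z) (lv i) &
  forall b, regular h b -> h (e' y).2 < b < h v -> exists i, reaches h Phi b (obs (e' y) (lv i))].
Proof.
have Wy := canonical_What y; have [_ oS top low] := can.
have [|c [cc cv sc]] := slab_exists hMS (x := (e' y).2) hv.
  by case: (e' y) Wy => s x Wy; exact: (What_h_le hPhi hMS Wy).
have nb : nbhs (e' y).2 (fun x => forall z, (e' z).2 = x -> What_slab h e' c z).
  by apply: filterS (slab_near hMS sc) => x sx z zx; rewrite /What_slab /= zx.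
move: (cv); rewrite le_eqVlt => /predU1P[cE|cv'].
  exists unit, (fun=> None), (What_slab h e' (h v)), (fun=> Wminus Phi v); rewrite cE in sc nb oS cc cv.
  split => //; first by split => //; exact: oS.
  by move=> b rb /andP[xb bv]; exists tt; apply: (slab_up_end hPhi hMS hv Wy sc rb _ bv); rewrite xb.
have [cs [scs csE]] := critvals_between c.
have [eps [fe em]] := @filter_ex _ _ (at_right_proper_filter 0) _ (filterI (fine_near hMS (c :: cs)) (low c cs cc cv' scs csE)).
exists (option 'I_(size (levels cs c eps))), (@level_of R (levels cs c eps)), (What_slab h e' c), (@J_target _ _ _ h c (levels cs c eps)).
split => //; first by split => //; exact: oS.
- have -> : (fun i z => obs (e' z) (@level_of R (levels cs c eps) i)) =
      (fun i z => @J_map _ _ _ h Phi v (levels cs c eps) i (e' z)) by apply/funext => -[].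
  exact: em.
- split; first by exists None.
  by move=> z i sz; exact: (levels_avail hPhi hMS hv cv' csE fe i (canonical_What z) sz).
- by move=> b rb xbv; exact: (levels_up hPhi hMS hv cc cv' csE fe Wy sc rb xbv).
Qed.

Definition from_canonical (y : N') : N := exist _ (e' y) (canonical_What y).

(** By [lsm_into] only the end point and regular levels above it matter, and these are obtained by
    the flow from the components of the embedding. *)
Lemma from_canonical_smooth y : lsm from_canonical y.
Proof.
have [I [lv [U [Y [[oU Uy] [_ sm _ _ _] _ [[i0 i0N] av] up]]]]] := canonical_local y.
have Uy' : nbhs y U by exact: open_nbhs_nbhs.
have si i := smooth_map_lsm (sm i) Uy'.
apply: lsm_into; first by have := si i0; rewrite i0N.
move=> b rb xbv; have [i ri] := up b rb xbv.
have [nr1 ls1] := level_point_lsm hPhi hMS (regular_ncrit hPhi hMS rb ri) ri.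
have cU : nbhs y (fun z => reaches h Phi b (obs (e' z) (lv i))) by have [ci _] := si i; exact: ci _ nr1.
apply: lsm_eq (lsm_comp (si i) ls1); apply: filterS (filterI cU Uy') => z [rz Uz].
by have [_ ->] := obs_up hPhi hMS hv (canonical_What z) (av z i Uz) rz.
Qed.

End Canonical.

Section Corners.
Variables (q : nat) (N' : orthant_manifold R q) (e' : N' -> broken M * M).
Hypothesis can : canonical_structure h Phi v e'.

(* Near [f x] the local coordinates of [N'] are a smooth function of the
   components of its embedding, by the inverse function theorem applied after
   a left inverse of their differential; and these components are smooth on
   [N]. *)
Lemma to_canonical_smooth (f : N -> N') x : (forall z, e' (f z) = e z) -> lsm f x.
Proof.
move=> fE; have [I [lv [U [Y [[oU Uy] [_ sm im _ top] nb [[i0 i0N] av] _]]]]] := canonical_local can (f x).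
have Uy' : nbhs (f x) U by exact: open_nbhs_nbhs.
have Fs i : lsm (fun z : N => obs (e z) (lv i)) x by apply: obs_lsm; rewrite -fE; exact: av.
(* Open sets near [f x] are cut out of [U] by open conditions on the components, and these are
   continuous on N. *)
have cf : {for x, continuous f}.
  move=> V; rewrite nbhsE => -[V' [oV' V'x] V'V].
  have [|O oO VE] := top (U `&` V') _ (@subIsetl _ _ _); first exact: openI.
  have Ox : O (fun i => obs (e' (f x)) (lv i)) by have : (U `&` V') (f x) by []; rewrite VE => -[].
  have cF : {for x, continuous (fun z : N => (fun i => obs (e z) (lv i)) : prod_topology (fun _ : I => M))}.
    by apply: continuous_into_product => i; have [] := Fs i.
  have n1 : nbhs x (fun z => O (fun i => obs (e z) (lv i))).
    by apply: cF; apply: open_nbhs_nbhs; split => //; rewrite -fE.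
  have n2 : nbhs x (fun z : N => forall y, (e' y).2 = (e z).2 -> U y).
    have [c0 _] := @obs_lsm R n M h X Phi hPhi hMS v hv None x Logic.I.
    by rewrite fE in nb; exact: (c0 _ nb).
  apply: filterS (filterI n1 n2) => z [Oz Uz]; apply: V'V.
  have K : (U `&` V') (f z) by rewrite VE; split; [apply: Uz; rewrite fE|rewrite /= fE].
  by case: K.
have [c Ac cx] := mf_at x; have [c' Ac' cy] := mf_at (f x); have Cc := mf_chart Ac; have Cc' := mf_chart Ac'.
have xK := chart_cinvK Cc cx; have yK := chart_cinvK Cc' cy.
have [d Hd] : {d : I -> chart R n M & forall i, atlas M (d i) /\ cdom (d i) (obs (e' (f x)) (lv i))}.
  by apply: (choice (P := fun i d => atlas M d /\ cdom d (obs (e' (f x)) (lv i)))) => i;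
     have [d0 A0 x0] := mf_at (obs (e' (f x)) (lv i)); exists d0.
have [G HG] : {G : I -> E q -> E n & forall i, smooth_extension (overlap U (fun z => obs (e' z) (lv i)) c' (d i))
     (cmap (d i) \o (fun z => obs (e' z) (lv i)) \o cinv c') (G i)}.
  apply: (choice (P := fun i g => smooth_extension (overlap U (fun z => obs (e' z) (lv i)) c' (d i))
     (cmap (d i) \o (fun z => obs (e' z) (lv i)) \o cinv c') g)) => i.
  by have [_ H] := sm i; have [Ad _] := Hd i; exact: H.
have cG i : cinfv (G i) (cmap c' (f x)).
  have [[V [oV OV VG']] _] := HG i; move=> j; exists V; split => //.
  by apply: OV; exists (f x) => //; split => //; have [] := Hd i.
have cz := stack_cinfv cG; set zeta := (fun z => stack (G^~ z)) in cz.
have rf : row_free (jacobian zeta (cmap c' (f x))).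
  rewrite -kermx_eq0; apply/eqP/row_matrixP => k; rewrite row0.
  apply: (im (f x) c' d G Uy Ac' cy Hd HG) => i.
  by apply: (proj1 (stack_jacobian _ _ _)); rewrite -row_mul mulmx_ker row0.
pose B := pinvmx (jacobian zeta (cmap c' (f x))).
have cB : cinfv (fun z => zeta z *m B) (cmap c' (f x)) by exact: cinfv_mulmx.
have [|psi [cpsi _ npsi]] := inverse_function cB.
  rewrite (_ : jacobian _ _ = 1%:M) ?unitmx1 //.
  have CB : cinfv (fun y => y *m B) (zeta (cmap c' (f x))) by apply: cinfv_mulmx; exact: cinfv_id.
  by rewrite (jacobian_comp CB cz) jacobian_mulmx mulmxVp.
have [oc' _ _ _ _] := Cc'; have ny : nbhs x (fun z => cdom c' (f z)) by apply: cf; exact: open_nbhs_nbhs.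
apply: (lsm_ex Ac Ac' cx cy); first exact: (chart_nr Cc cx ny).
have [g Hg] : {g : I -> E m -> E n & forall i, cinfv (g i) (cmap c x) /\
    nr (cmap c x) (fun z => cimg c z -> cmap (d i) (obs (e (cinv c z)) (lv i)) = g i z)}.
  apply: (choice (P := fun i g => cinfv g (cmap c x) /\
    nr (cmap c x) (fun z => cimg c z -> cmap (d i) (obs (e (cinv c z)) (lv i)) = g z))) => i.
  have [_ H] := Fs i; have [Ad dx] := Hd i; rewrite fE in dx.
  by have [g [h1 h2]] := H c (d i) Ac Ad cx dx; exists g.
have dn i : nbhs x (fun z => cdom (d i) (obs (e z) (lv i))).
  have [Ad dx] := Hd i; rewrite fE in dx; have [od _ _ _ _] := mf_chart Ad.
  by have [ci _] := Fs i; apply: ci; exact: open_nbhs_nbhs.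
have nE : nr (cmap c x) (fun z => forall i, i \in enum I -> cimg c z ->
    cdom (d i) (obs (e (cinv c z)) (lv i)) /\ cmap (d i) (obs (e (cinv c z)) (lv i)) = g i z).
  by apply: nr_all => i _; have [_ gi] := Hg i; apply: nrW (nrI gi (chart_nr Cc cx (dn i))) => z [h1 h2] cz'; split;
    [exact: h2|exact: h1].
have eqz z : cimg c z -> U (f (cinv c z)) -> cdom c' (f (cinv c z)) -> (forall i, i \in enum I -> cimg c z ->
    cdom (d i) (obs (e (cinv c z)) (lv i)) /\ cmap (d i) (obs (e (cinv c z)) (lv i)) = g i z) ->
    zeta (cmap c' (f (cinv c z))) = stack (g^~ z).
  move=> ciz Uz cz' H; rewrite /zeta; congr stack; apply/funext => i; have [_ <-] := HG i.
    by rewrite /= (chart_cinvK Cc' cz') fE; have [|_ ->] := H i _ ciz; rewrite ?mem_enum.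
  exists (f (cinv c z)) => //; split => //; rewrite /= fE.
  by have [|h1 _] := H i _ ciz; rewrite ?mem_enum.
have ez : stack (g^~ (cmap c x)) = zeta (cmap c' (f x)).
  have /= n0 := nr_self nE; have := eqz _ (cimg_mem cx); rewrite xK in n0 *.
  by move=> /(_ Uy cy n0) ->.
have cg : cinfv (fun z => stack (g^~ z)) (cmap c x) by apply: stack_cinfv => i; have [] := Hg i.
exists (fun z => psi (stack (g^~ z) *m B)); split.
  apply: (cinfv_comp (f := psi) (g := fun z => stack (g^~ z) *m B)); last exact: cinfv_mulmx.
  by rewrite ez.
have np := cf _ (chart_nbhs Cc' cy npsi).
have n3 : nbhs x (fun z => U (f z)) := cf _ Uy'.
have n4 : nbhs x (fun z => psi (zeta (cmap c' (f z)) *m B) = cmap c' (f z)) := np.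
apply: nrW (nrI nE (chart_nr Cc cx (filterI n4 (filterI n3 ny)))) => z [h1 h2] ciz.
by have [h3 [h4 h5]] := h2 ciz; rewrite /= -{1}h3 /= (eqz z ciz h4 h5 h1).
Qed.

Lemma What_unique : exists f : N -> N', diffeomorphism f /\ forall x, e' (f x) = e x.
Proof.
have [[_ ei es] _ _ _] := can.
have [f fE] : {f : N -> N' & forall x, e' (f x) = e x}.
  by apply: (choice (P := fun x y => e' y = e x)) => x; have [y _ <-] := es _ (What_projP x); exists y.
exists f; split => //; split; first by apply: smooth_mapP => x _; exact: to_canonical_smooth.
exists (from_canonical can); split => [x|y|]; first by apply: sval_inj; exact: fE.
  by apply: ei; rewrite ?in_setT ?fE.
by apply: smooth_mapP => y _; exact: from_canonical_smooth.
Qed.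

End Corners.

End Uniqueness.

(** * Faces *)

Section CoordinateFace.
Context {R : realType} {m p : nat}.
Local Notation E n := 'rV[R]_n.
Variable s : 'I_p -> 'I_m.
Hypothesis s_inj : injective s.

Definition face_proj (y : E m) : E p := \row_l y 0 (s l).
Definition face_incl (z : E p) : E m := \row_i if [pick l | s l == i] is Some l then z 0 l else 0.

Lemma face_inclE z l : face_incl z 0 (s l) = z 0 l.
Proof. by rewrite mxE; case: pickP => [l' /eqP /s_inj ->|/(_ l)]; rewrite ?eqxx. Qed.

Lemma face_incl0 z i : i \notin codom s -> face_incl z 0 i = 0.
Proof. by move=> ni; rewrite mxE; case: pickP => // l /eqP li; rewrite -li codom_f in ni. Qed.

Lemma face_inclK : cancel face_incl face_proj.
Proof. by move=> z; apply/rowP => l; rewrite mxE face_inclE. Qed.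

Lemma face_projK (y : E m) : (forall i, i \notin codom s -> y 0 i = 0) -> face_incl (face_proj y) = y.
Proof.
move=> H; apply/rowP => i; have [/codomP [l ->]|ni] := boolP (i \in codom s).
  by rewrite face_inclE mxE.
by rewrite face_incl0 ?H.
Qed.

Lemma face_proj_cinfv y : cinfv face_proj y.
Proof. by move=> l; apply: cinf_ext (cinf_coord y (s l)) => z; rewrite mxE. Qed.

Lemma face_incl_cinfv z : cinfv face_incl z.
Proof.
move=> i; have [/codomP [l ->]|ni] := boolP (i \in codom s).
  by apply: cinf_ext (cinf_coord z l) => y; rewrite face_inclE.
by apply: cinf_ext (cinfC 0 z) => y; rewrite face_incl0.
Qed.

Lemma face_incl_orthant z : orthant z -> orthant (face_incl z).
Proof.
move=> Oz i; have [/codomP [l ->]|ni] := boolP (i \in codom s); last by rewrite face_incl0.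
by rewrite face_inclE.
Qed.

Lemma face_proj_orthant y : orthant y -> orthant (face_proj y).
Proof. by move=> Oy l; rewrite mxE. Qed.

End CoordinateFace.

(** * The manifold structure of a face *)

Section Subface.
Context {R : realType} {m p : nat}.
Variables (N : orthant_manifold R m) (F : set N).

(** [s] lists the coordinates along the face, and the remaining ones are its equations. *)
Definition adapted (c : chart R m N) (s : 'I_p -> 'I_m) := [/\ atlas N c, injective s &
  forall z, cdom c z -> (F z <-> forall i, i \notin codom s -> cmap c z 0 i = 0)].

Variable charts : nat -> chart R m N.
Hypothesis charts_cover : forall y, F y -> exists k s, cdom (charts k) y /\ adapted (charts k) s.
Variable x0 : N.
Hypothesis Fx0 : F x0.

Definition face_type : Type := {y : N | F y}.

Lemma face_type_inj (x y : face_type) : sval x = sval y -> x = y.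
Proof. by case: x y => [a Fa] [b Fb] /= ab; subst b; congr exist; exact: Prop_irrelevance. Qed.

Definition to_face (y : N) : face_type := match pselect (F y) with left H => exist _ y H | right _ => exist _ x0 Fx0 end.

Lemma to_faceE y : F y -> sval (to_face y) = y.
Proof. by rewrite /to_face; case: pselect. Qed.

Definition face_chart (c : chart R m N) s : chart R p face_type :=
  Chart [set q | cdom c (sval q)] (fun q => face_proj s (cmap c (sval q))) (fun z => to_face (cinv c (face_incl s z))).

Definition face_charts : set (chart R p face_type) := [set fc | exists c s, adapted c s /\ fc = face_chart c s].

Lemma face_chart_cmap c s x : adapted c s -> cdom c (sval x) ->
  face_incl s (cmap (face_chart c s) x) = cmap c (sval x).
Proof. by move=> [_ si H] cx; apply: face_projK => //; apply/(H _ cx); exact: svalP. Qed.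

Lemma face_chart_cinv c s z : adapted c s -> cimg c (face_incl s z) ->
  [/\ sval (cinv (face_chart c s) z) = cinv c (face_incl s z), cdom c (sval (cinv (face_chart c s) z)) &
     cmap (face_chart c s) (cinv (face_chart c s) z) = z].
Proof.
move=> [Ac si H] cz; have [c1 c2] := chart_cdom (mf_chart Ac) cz.
have Fz : F (cinv c (face_incl s z)) by apply/(H _ c1) => i ni; rewrite c2 face_incl0.
have E1 : sval (cinv (face_chart c s) z) = cinv c (face_incl s z) by rewrite /= to_faceE.
by split; rewrite ?E1 //= to_faceE // c2 face_inclK.
Qed.

Lemma face_chart_nr c s x (P : N -> Prop) : adapted c s -> cdom c (sval x) -> nbhs (sval x) P ->
  nr (cmap (face_chart c s) x) (fun z => orthant z -> cimg c (face_incl s z) /\ P (cinv c (face_incl s z))).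
Proof.
move=> A cx Px; have [Ac si _] := A; have Cc := mf_chart Ac; have E1 := face_chart_cmap A cx.
have [_ n1] := chart_img Cc (cimg_mem cx).
have n2 := nrI n1 (chart_nr Cc cx Px); rewrite -E1 in n2.
apply: nrW (cinfv_nr_pre (face_incl_cinfv si _) n2) => z [h1 h2] Oz.
have ci := h1 (face_incl_orthant si Oz); split => //; exact: h2.
Qed.

Lemma face_open (A : set N) : open A -> lopen face_charts [set q : face_type | A (sval q)].
Proof.
move=> oA fc x [c [s [Ad ->]]] cx Ax; have Ax' : nbhs (sval x) A by exact: open_nbhs_nbhs.
apply: nrW (face_chart_nr Ad cx Ax') => z H Oz; have [h1 h2] := H Oz.
by have [E1 _ _] := face_chart_cinv Ad h1; rewrite /= in E1 *; rewrite E1.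
Qed.

Lemma face_good : good_charts face_charts.
Proof.
split.
- move=> fc x [c [s [A ->]]] cx; have [Ac si H] := A; have Cc := mf_chart Ac.
  have E1 := face_chart_cmap A cx; split.
  + by apply: face_proj_orthant; exact: (chart_orthant Cc cx).
  + apply: face_type_inj; have [|-> _ _] := @face_chart_cinv c s (cmap (face_chart c s) x) A; rewrite E1; first exact: cimg_mem.
    exact: (chart_cinvK Cc cx).
  + have nT : nbhs (sval x) [set: N] by exact: filterT.
    apply: nrW (face_chart_nr A cx nT) => z K Oz; have [h1 _] := K Oz.
    have [_ h3 h4] := face_chart_cinv A h1; by exists (cinv (face_chart c s) z).
- move=> x; have [k [s [kx A]]] := charts_cover (svalP x).
  by exists (face_chart (charts k) s) => //; exists (charts k), s.
- move=> fc fd x [c [s [A ->]]] [d [s' [A' ->]]] cx dx; have [Ac si H] := A; have [Ad si' H'] := A'.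
  have Cc := mf_chart Ac; have E1 := face_chart_cmap A cx.
  have [od _ _ _ _] := mf_chart Ad; have dx' : nbhs (sval x) (cdom d) by exact: open_nbhs_nbhs.
  have n1 := face_chart_nr A cx dx'.
  split; first by apply: nrW n1 => z K Oz; have [h1 h2] := K Oz; have [E2 _ _] := face_chart_cinv A h1;
    rewrite /= in E2 *; rewrite E2.
  have [g [cg gE]] := mf_transition Ac Ad cx dx; rewrite -E1 in cg gE.
  exists (fun z => face_proj s' (g (face_incl s z))); split.
    apply: (cinfv_comp (f := face_proj s') (g := fun z => g (face_incl s z))); first exact: face_proj_cinfv.
    by apply: (cinfv_comp (f := g)) => //; exact: face_incl_cinfv.
  apply: nrW (nrI n1 (cinfv_nr_pre (face_incl_cinfv si _) gE)) => z [K1 K2] Oz; have [h1 h2] := K1 Oz.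
  by have [E2 _ _] := face_chart_cinv A h1; rewrite -K2 //= in E2 *; rewrite E2.
- move=> x y xy; have := @mhausdorff _ _ _ N; rewrite open_hausdorff => /(_ (sval x) (sval y)).
  case; first by apply/eqP => K; apply: xy; exact: face_type_inj.
  move=> [A B] /= [/set_mem Ax /set_mem By] [oA oB /eqP AB].
  exists [set q : face_type | A (sval q)], [set q : face_type | B (sval q)]; split => //; [exact: face_open|exact: face_open|].
  by apply/seteqP; split=> z // [Az Bz]; have : (A `&` B) (sval z) by []; rewrite AB.
- have [s Hs] : {s : nat -> 'I_p -> 'I_m & forall k, (exists s, adapted (charts k) s) -> adapted (charts k) (s k)}.
    apply: (choice (P := fun k s => (exists s, adapted (charts k) s) -> adapted (charts k) s)) => k.
    have [[s As]|nA] := pselect (exists s, adapted (charts k) s); first by exists s.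
    by have [k0 [s0 _]] := charts_cover Fx0; exists s0.
  exists (fun k => face_chart (charts k) (s k)) => x; have [k [s' [kx A]]] := charts_cover (svalP x).
  by exists k => //; exists (charts k), (s k); split => //; apply: Hs; exists s'.
Qed.

Definition subface : orthant_manifold R p := build_manifold face_good.
Definition subface_incl (q : subface) : N := sval (q : face_type).

Lemma subface_range : range subface_incl = F.
Proof.
apply/seteqP; split=> [_ [q _ <-]|y Fy]; first exact: svalP.
by exists (exist _ y Fy : subface).
Qed.

Lemma subface_lsm q : lsm subface_incl q.
Proof.
have [k [s [kx A]]] := charts_cover (svalP q); have [Ac si H] := A; set c := charts k in A Ac H kx.
have Aq : atlas subface (face_chart c s) by apply: (gc_max face_good); exists c, s.
have nT : nbhs (sval q) [set: N] by exact: filterT.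
have n1 := face_chart_nr A kx nT.
have im z : cimg (face_chart c s) z -> orthant z.
  by move=> [x cx <-]; apply: face_proj_orthant; exact: (chart_orthant (mf_chart Ac)).
apply: (lsm_ex Aq Ac) => //.
  apply: nrW n1 => z K cz; have [h1 _] := K (im z cz); by have [_ h2 _] := face_chart_cinv A h1.
exists (face_incl s); split; first exact: face_incl_cinfv.
apply: nrW n1 => z K cz; have [h1 _] := K (im z cz); have [E1 _ _] := face_chart_cinv A h1.
have [_ c2] := chart_cdom (mf_chart Ac) h1.
by rewrite /= /subface_incl; rewrite /= in E1; rewrite E1.
Qed.

(** An adapted chart of N followed by the projection to the coordinates in [s] is a smooth left
    inverse of the inclusion. *)
Lemma subface_immersion : injective_differentials setT (fun _ : unit => subface_incl).
Proof.
move=> x c d G _ Ac cx Hd HG u uG; have Cc := mf_chart Ac; have xK := chart_cinvK Cc cx.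
have [Ad dx] := Hd tt; have Cd := mf_chart Ad; have [[V [oV OV VG]] GE] := HG tt.
have [k [s [kx A]]] := charts_cover (svalP x); have [Ak si H] := A; set b := charts k in A Ak H kx.
have Aq : atlas subface (face_chart b s) by apply: (gc_max face_good); exists b, s.
have [tau [ct tE]] := mf_transition Ad Ak dx kx.
have [psi [cp pE]] := mf_transition Aq Ac kx cx.
have [Oy0 nO] := chart_img Cc (cimg_mem cx).
have Oimg : overlap setT subface_incl c (d tt) (cmap c x) by exists x.
have cG : cinfv (G tt) (cmap c x) by move=> j; exists V; split => //; exact: OV.
have Gx : G tt (cmap c x) = cmap (d tt) (sval x) by rewrite -GE //= xK.
have tx : tau (G tt (cmap c x)) = cmap b (sval x) by rewrite Gx -(nr_self tE (cimg_mem dx)) /= (chart_cinvK Cd dx).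
rewrite -Gx in ct tE; pose eta z := face_proj s (tau (G tt z)).
have etax : eta (cmap c x) = cmap (face_chart b s) x by rewrite /eta tx.
have ctG : cinfv (fun z => tau (G tt z)) (cmap c x) by exact: (cinfv_comp (f := tau)).
have cpt : cinfv (fun w => face_proj s (tau w)) (G tt (cmap c x)).
  by apply: (cinfv_comp (f := face_proj s)) => //; exact: face_proj_cinfv.
have cL : cinfv (fun w => psi (face_proj s (tau w))) (G tt (cmap c x)).
  by apply: (cinfv_comp (f := psi)) => //; rewrite -[face_proj _ _]/(eta _) etax.
have JJ : jacobian (G tt) (cmap c x) *m jacobian (fun w => psi (face_proj s (tau w))) (G tt (cmap c x)) = 1%:M.
  rewrite -(jacobian_comp cL cG) -(jacobian_id (cmap c x)); apply: jacobian_orthant => //.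
  - exact: (cinfv_comp (f := fun w => psi (face_proj s (tau w)))).
  - exact: cinfv_id.
  have [cj _] := subface_lsm x; have [od _ _ _ _] := Cd; have [ob _ _ _ _] := mf_chart Ak.
  have nd : nbhs x (fun z => (cdom (d tt) `&` cdom b) (subface_incl z)).
    by apply: cj; apply: open_nbhs_nbhs; split => //; exact: openI.
  have ce : cinfv eta (cmap c x) := cinfv_comp (f := fun w => face_proj s (tau w)) cpt cG.
  have n1 := cinfv_nr_pre cG tE.
  have n2 : nr (cmap c x) (fun z => cimg (face_chart b s) (eta z) -> (cmap c \o cinv (face_chart b s)) (eta z) = psi (eta z)).
    by apply: (cinfv_nr_pre ce (P := fun w => cimg (face_chart b s) w -> (cmap c \o cinv (face_chart b s)) w = psi w)); rewrite etax.
  apply: nrW (nrI (nrI nO (chart_nr Cc cx nd)) (nrI n1 n2)) => z [[k1 k2] [k3 k4]] Oz.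
  have cz := k1 Oz; have [dz bz] := k2 cz; have [cz1 cz2] := chart_cdom Cc cz.
  have Gz : G tt z = cmap (d tt) (subface_incl (cinv c z)) by rewrite -GE //; exists (cinv c z).
  have tz : tau (G tt z) = cmap b (subface_incl (cinv c z)).
    by rewrite -k3 Gz /=; [rewrite (chart_cinvK Cd dz)|exact: cimg_mem].
  have ez : eta z = cmap (face_chart b s) (cinv c z) by rewrite /eta tz.
  rewrite /= -[face_proj _ _]/(eta z) -k4 ez; last exact: cimg_mem.
  by rewrite /= -[to_face _]/(cinv (face_chart b s) _) (gc_cinvK face_good) //; exists b, s.
by rewrite -[u]mulmx1 -JJ mulmxA uG mul0mx.
Qed.

Lemma subface_embedding : smooth_embedding setT (fun _ : unit => subface_incl) (fun _ => F).
Proof.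
split.
- by move=> x _ _; exact: svalP.
- by move=> _; apply: smooth_mapP => x _; exact: subface_lsm.
- exact: subface_immersion.
- move=> x y _ _ /(congr1 (fun f => f tt)); exact: face_type_inj.
move=> V oV _; pose Q : set (prod_topology (fun _ : unit => N)) := [set z | forall q, (fun _ => subface_incl q) = z -> V q].
exists (Q°); first exact: open_interior.
apply/seteqP; split=> x; last by move=> [_ /interior_subset]; apply.
move=> Vx; split => //=; have [k [s [kx A]]] := charts_cover (svalP x); have [Ak si H] := A; set b := charts k in A Ak H kx.
have Fb : face_charts (face_chart b s) by exists b, s.
have Vx' : nbhs x V by exact: open_nbhs_nbhs.
have nV := gc_nr Fb kx Vx'.
have W1 : nbhs (sval x) (fun y => cdom b y /\ (orthant (face_proj s (cmap b y)) -> V (cinv (face_chart b s) (face_proj s (cmap b y))))).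
  have [ob _ _ _ _] := mf_chart Ak; apply: filterI; first exact: open_nbhs_nbhs.
  apply: (chart_nbhs (P := fun w => orthant (face_proj s w) -> V (cinv (face_chart b s) (face_proj s w))) (mf_chart Ak) kx).
  exact: (cinfv_nr_pre (face_proj_cinfv s _) nV).
have FF : Filter (nbhs ((fun _ => subface_incl x) : prod_topology (fun _ : unit => N))) := @nbhs_filter _ _.
have pc : nbhs ((fun _ => subface_incl x) : prod_topology (fun _ : unit => N)) [set z | cdom b (z tt) /\
    (orthant (face_proj s (cmap b (z tt))) -> V (cinv (face_chart b s) (face_proj s (cmap b (z tt)))))].
  exact: (@proj_continuous unit (fun _ => N) tt (fun _ => subface_incl x) _ W1).
apply: filterS pc => z Hz q qz; rewrite -qz in Hz; have [bq Vq] := Hz.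
rewrite -[q](gc_cinvK face_good Fb bq); apply: Vq; apply: face_proj_orthant; exact: (chart_orthant (mf_chart Ak) bq).
Qed.

End Subface.

(** * The faces of \hat W^-_v *)

Section Faces.
Context {R : realType} {n : nat}.
Local Notation E n := 'rV[R]_n.
Variables (M : smooth_manifold R n) (h : M -> R) (X : vector_field M) (Phi : R -> M -> M).
Hypotheses (hPhi : is_flow X Phi) (hMS : morse_smale h X Phi).
Variables (v : M) (hv : crit h v).
Local Notation m := (morse_index h v).
Local Notation N := (What_manifold hPhi hMS hv).
Local Notation e := (@What_proj R n M h X Phi hPhi hMS v hv).
Local Notation nc := (@nchart R n M h Phi v).

Lemma broken_labels (w w' : M) s : is_broken h Phi w s w' ->
  uniq (map snd s) /\ forall u, u \in map snd s -> h u < h w.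
Proof.
elim: s w => [|[l u] s IH] w //= [_ [_ uw] _ /IH [us H]].
rewrite us andbT; split; first by apply/negP => /H; rewrite ltxx.
by move=> u'; rewrite inE => /predU1P[->//|/H h1]; exact: lt_trans uw.
Qed.

Lemma mask_zeros (T : Type) (s : seq T) (d : E m) : (forall i, (i < size s)%N -> cx d i = 0) ->
  mask [seq cx d i == 0 | i <- iota 0 (size s)] s = s.
Proof.
move=> H; rewrite (_ : map _ _ = nseq (size s) true) ?mask_true //.
apply: (@eq_from_nth _ false); rewrite ?size_map ?size_iota ?size_nseq // => i ik.
by rewrite (nth_map 0%N) ?size_iota // nth_iota // nth_nseq ik H // eqxx.
Qed.

Lemma nvalid_uniq (G : gchart h v) d0 dl : nvalid Phi G d0 dl -> uniq (gcs G).
Proof.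
move=> [VG Dd0 cd0 _ _]; have [w [_ _ /broken_labels [+ _] _]] := gv_What VG Dd0.
by rewrite (gv_lab VG Dd0) mask_zeros.
Qed.

(** The labels of a chart centred at [x] are exactly the breaks of [x]. A nearby path breaks at a
    subsequence of them, hence at all of them if the number of breaks is the same. *)
Lemma label_local k x : boundary N k x ->
  nbhs x (fun z => boundary N k z -> map snd (e z).1 = map snd (e x).1).
Proof.
move=> bx; have [G [d0 [dl [NV [cx Lx]]]]] := nchart_at hPhi hMS hv x.
have Ac := nchart_atlas hPhi hMS hv x NV; have [oc _ _ _ _] := mf_chart Ac.
have [_ _ cd0 _ _] := NV; have lx : map snd (e x).1 = gcs G.
  by rewrite /What_proj (nchart_label NV cx) Lx mask_zeros.
have cn : nbhs x (cdom (nc G d0 dl x)) by exact: open_nbhs_nbhs.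
apply: filterS cn => z cz bz; rewrite lx; apply/eqP.
have sub : subseq (map snd (e z).1) (gcs G) by rewrite /What_proj (nchart_label NV cz) mask_subseq.
have [_ <-] := size_subseq_leqif sub; rewrite -lx !size_map.
by rewrite (proj1 (@What_boundary R n M h X Phi hPhi hMS v hv k z) bz) (proj1 (@What_boundary R n M h X Phi hPhi hMS v hv k x) bx).
Qed.

Lemma label_component k x y : connected_component (boundary N k) x y -> map snd (e y).1 = map snd (e x).1.
Proof.
move=> cy; have cc := @component_connected _ (boundary N k) x; set C := connected_component _ _ in cy cc.
have CB : C `<=` boundary N k by exact: connected_component_sub.
have Cx : C x by apply: connected_component_refl; have [A [Ax AB _] _] := cy; exact: AB.
pose P (b : bool) := [set z | (map snd (e z).1 == map snd (e x).1) = b].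
pose U b : set N := [set z | boundary N k z -> P b z]°.
have CU b : C `&` U b = C `&` P b.
  apply/seteqP; split=> z [Cz Pz]; split => //; first by have /interior_subset := Pz; apply; exact: CB.
  apply: filterS (label_local (CB _ Cz)) => w H /H wz; by rewrite /P /= wz.
have Pall : C `&` P true = C.
  apply: cc; first by exists x; split => //; rewrite /P /= eqxx.
    by exists (U true); [exact: open_interior|rewrite CU].
  exists (~` U false); first by apply: open_closedC; exact: open_interior.
  apply/seteqP; split=> z [Cz Pz]; split => //.
    by move=> Uz; have : (C `&` U false) z by []; rewrite CU => -[_]; rewrite /P /= in Pz *; rewrite Pz.
  rewrite /P /=; apply: contrapT => nz; apply: Pz.
  have K : (C `&` P false) z by split => //; rewrite /P /=; exact/negbTE/negP.
  by move: K; rewrite -CU => -[].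
have : (C `&` P true) y by rewrite Pall.
by move=> [_ /eqP].
Qed.

Section Segment.
Variables (G : gchart h v) (d0 : E m) (dl : R) (x0 : What_type h Phi v).
Hypothesis NV : nvalid Phi G d0 dl.
Local Notation c := (nc G d0 dl x0 : chart R m N).
Variables (y z : N).
Hypotheses (cy : cdom c y) (cz : cdom c z) (yz : forall i, cmap c y 0 i = 0 -> cmap c z 0 i = 0).
Let w t := cmap c z + t *: (cmap c y - cmap c z).

Lemma segment_cimg t : 0 < t <= 1 -> [/\ cdom c (cinv c (w t)), cmap c (cinv c (w t)) = w t &
  zeros (w t) = zeros (cmap c y)].
Proof.
move=> /andP[t0 t1]; have [_ _ Oy _ yd] := nchart_map NV cy; have [_ _ Oz _ zd] := nchart_map NV cz.
have wE i : w t 0 i = (1 - t) * cmap c z 0 i + t * cmap c y 0 i by rewrite !mxE; ring.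
have Ow : orthant (w t) by move=> i; rewrite wE addr_ge0 // mulr_ge0 ?subr_ge0 ?Oy ?Oz // ltW.
have wd : `|w t - gshift G d0 dl - d0| < dl.
  have -> : w t - gshift G d0 dl - d0 = (1 - t) *: (cmap c z - gshift G d0 dl - d0) + t *: (cmap c y - gshift G d0 dl - d0).
    by apply/rowP => i; rewrite !mxE; ring.
  apply: le_lt_trans (ler_normD _ _) _; rewrite !normrZ (gtr0_norm t0) ger0_norm ?subr_ge0 //.
  move: yd zd; set a := `|_|; set b := `|_| => ad bd; clear -ad bd t0 t1.
  by nra.
have [_ h1 h2] := nchart_inv x0 NV Ow wd; split => //.
apply/setP => i; rewrite !inE wE; have [y0|y0] := eqVneq (cmap c y 0 i) 0.
  by rewrite y0 (yz y0) !mulr0 addr0 eqxx.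
have yp : 0 < cmap c y 0 i by rewrite lt_def y0 Oy.
by rewrite gt_eqF // ltr_wpDl ?mulr_gt0 ?mulr_ge0 ?subr_ge0 ?Oz.
Qed.

Lemma segment_near t r : 0 < r -> exists2 d, 0 < d & forall s, `|s - t| < d -> `|w s - w t| < r.
Proof.
move=> r0; have V0 := normr_ge0 (cmap c y - cmap c z); set V := `|_| in V0.
have V1 : 0 < 1 + V by lra.
exists (r / (1 + V)); first by rewrite divr_gt0.
move=> s; rewrite ltr_pdivlMr // => H.
have -> : w s - w t = (s - t) *: (cmap c y - cmap c z) by apply/rowP => i; rewrite !mxE; ring.
rewrite normrZ -/V; apply: le_lt_trans H; rewrite ler_wpM2l //; lra.
Qed.

(** The image of the chart is convex, so it contains the segment from [z] to [y]; apart from [z],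
    its points have the same zero coordinates as [y]. It therefore stays in the component of [y] and
    accumulates at [z]. *)
Lemma segment_component k x : connected_component (boundary N k) x y ->
  closure (connected_component (boundary N k) x) z.
Proof.
move=> xy; have by_ : boundary N k y := connected_component_sub xy.
have Ac := nchart_atlas hPhi hMS hv x0 NV; have Cc := mf_chart Ac.
have ky : #|zeros (cmap c y)| = k := (boundaryP k Ac cy).1 by_.
pose A : set N := (fun t => cinv c (w t)) @` `]0, 1].
have AC : A `<=` connected_component (boundary N k) x.
  rewrite (same_connected_component xy); apply: connected_component_max.
  - exists 1; first by rewrite /= in_itv /= ltr01 lexx.
    by rewrite /w scale1r addrC subrK; exact: (chart_cinvK Cc cy).
  - move=> _ [t /= t01 <-]; rewrite in_itv /= in t01; have [h1 h2 h3] := segment_cimg t01.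
    by apply/(boundaryP k Ac h1); rewrite h2 h3.
  apply: connected_continuous_connected; first exact/connected_intervalP/interval_is_interval.
  apply/subspace_continuousP => t /= t01 U Ux; rewrite in_itv /= in t01; have [h1 h2 _] := segment_cimg t01.
  have [r r0 Hr] := chart_nr Cc h1 Ux; rewrite h2 in Hr.
  have [d dp Hd] := segment_near t r0.
  rewrite /nbhs /= /within /=; apply/nbhs_ballP; exists d => // s; rewrite /ball /= distrC => /Hd sd s01.
  rewrite in_itv /= in s01; apply: Hr => //; have [k1 k2 _] := segment_cimg s01.
  by rewrite -k2; exact: cimg_mem.
move=> U Uz; have [r r0 Hr] := chart_nr Cc cz Uz.
have [d dp Hd] := segment_near 0 r0; have w0 : w 0 = cmap c z by rewrite /w scale0r addr0.
pose t := Num.min 1 (d / 2); have t01 : 0 < t <= 1 by rewrite lt_min ltr01 divr_gt0 // ge_min lexx.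
have td : `|t - 0| < d.
  rewrite subr0 gtr0_norm; last by case/andP: t01.
  by rewrite gt_min; apply/orP; right; lra.
have [k1 k2 _] := segment_cimg t01; exists (cinv c (w t)); split.
  by apply: AC; exists t; rewrite //= in_itv.
by apply: Hr; [rewrite -w0; exact: Hd|rewrite -k2; exact: cimg_mem].
Qed.

End Segment.

(** The critical points in [gcs G] are distinct, so labels determine the vanishing coordinates. The
    points of the component near a point of the face all carry the label of [y], and their common
    zeros pass to the closure; the converse is the segment argument. *)
Lemma face_adapted k (F : set N) G d0 dl x0 z0 : is_face k F -> nvalid Phi G d0 dl ->
  F z0 -> cdom (nc G d0 dl x0) z0 -> exists s : 'I_(m - k) -> 'I_m, adapted F (nc G d0 dl x0) s.
Proof.
move=> [x bx ->] NV Fz0 cz0; set c : chart R m N := nc G d0 dl x0 in cz0 *.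
have Ac : atlas N c := nchart_atlas hPhi hMS hv x0 NV; have Cc := mf_chart Ac.
have [oc _ _ _ _] := Cc; have cn : nbhs z0 (cdom c) by exact: open_nbhs_nbhs.
have [y [xy cy]] := Fz0 _ cn; have by_ : boundary N k y := connected_component_sub xy.
have ky : #|zeros (cmap c y)| = k := (boundaryP k Ac cy).1 by_.
have kc : #|~: zeros (cmap c y)| = (m - k)%N by rewrite cardsCs finset.setCK ky card_ord.
pose s (l : 'I_(m - k)) : 'I_m := enum_val (cast_ord (esym kc) l).
exists s; split => //; first by move=> l l' /enum_val_inj /cast_ord_inj.
have sE i : (i \notin codom s) = (i \in zeros (cmap c y)).
  rewrite -[RHS]negbK; congr (~~ _); rewrite -finset.in_setC; apply/codomP/idP => [[l ->]|ni]; first exact: enum_valP.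
  by exists (cast_ord kc (enum_rank_in ni i)); rewrite /s cast_ordK enum_rankK_in.
move=> z cz; split=> [Fz i|H]; last first.
  apply: (@segment_component G d0 dl x0 NV y z cy cz _ k x xy) => i yi; apply: H.
  by rewrite sE inE; exact/eqP.
rewrite sE => iz; apply/eqP/negPn/negP => zi.
have [_ _ Oz _ _] := nchart_map NV cz.
have zp : 0 < cmap c z 0 i by rewrite lt_def zi; exact: Oz.
have Hc : cinf (fun w : E m => w 0 i) (cmap c z) by exact: cinf_coord.
have nz := chart_nbhs Cc cz (cinf_gt Hc zp).
have ocz : nbhs z (cdom c) by exact: open_nbhs_nbhs.
have [y2 [xy2 [y2i cy2]]] := Fz _ (filterI nz ocz).
have lab : map snd (e y2).1 = map snd (e y).1 by rewrite (label_component xy) (label_component xy2).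
have zero_lab y' (j : 'I_m) : cdom c y' -> (cmap c y' 0 j == 0) = (j < size (gcs G))%N && (nth v (gcs G) j \in map snd (e y').1).
  move=> cy'; rewrite (nchart_zero j NV cy') /What_proj (nchart_label NV cy'); case: ltnP => //= jk.
  by rewrite in_mask ?(nvalid_uniq NV) // mem_nth // index_uniq ?(nvalid_uniq NV) // (nth_map 0%N) ?size_iota // nth_iota.
move: iz; rewrite inE zero_lab // -lab -zero_lab // gt_eqF //.
Qed.

Lemma What_corners : manifold_with_corners N.
Proof.
move=> k F km FF; have [T HT] := ncharts_countable hPhi hMS hv.
have [x bx FE] := FF; have Fx : F x by rewrite FE; apply: subset_closure; exact: connected_component_refl.
have cov y : F y -> exists i s, cdom (T i : chart R m N) y /\ @adapted R m (m - k) N F (T i) s.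
  move=> Fy; have [i [G [d0 [dl [x1 [NV TE]]]]] cy] := HT y; rewrite TE in cy.
  by have [s A] := face_adapted FF NV Fy cy; exists i, s; rewrite TE.
exists (subface cov Fx), (@subface_incl _ _ _ _ _ _ cov _ Fx); split; first exact: subface_range.
exact: subface_embedding.
Qed.

End Faces.

Theorem theorem4p4 (R : realType) (n : nat) (M : smooth_manifold R n)
    (h : M -> R) (X : vector_field M) (Phi : R -> M -> M)
    (hPhi : is_flow X Phi) (hMS : morse_smale h X Phi)
    (v : M) (hv : crit h v) :
  exists (N : orthant_manifold R (morse_index h v)) (e : N -> broken M * M),
    [/\ (* (i) *)
        [/\ canonical_structure h Phi v e,
            manifold_with_corners N &
            forall (n' : nat) (N' : orthant_manifold R n')
                   (e' : N' -> broken M * M),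
              canonical_structure h Phi v e' ->
              exists f : N -> N', diffeomorphism f /\ forall x, e' (f x) = e x],
        (* (ii) *)
        [/\ forall k : nat, (1 <= k <= morse_index h v)%N ->
              e @` boundary N k =
                \bigcup_(w in [set w | crit h w /\ crit_lt h w v])
                  (Bboundary h Phi k.-1 v w `*` Wminus Phi w),
            forall k : nat, (1 <= k <= morse_index h v)%N ->
              trivIset [set w | crit h w /\ crit_lt h w v]
                (fun w => Bboundary h Phi k.-1 v w `*` Wminus Phi w) &
            e @` boundary N 0 = [set [::]] `*` Wminus Phi v] &
        (* (iii) *)
        smooth_map setT (fun x => (e x).2)].
Proof.
exists (What_manifold hPhi hMS hv), (@What_proj R n M h X Phi hPhi hMS v hv).
split; last exact: What_endpoint_smooth.
  split; [exact: What_canonical|exact: What_corners|].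
  by move=> n' N' e' can; exact: What_unique.
split; [|move=> k _|exact: What_boundary0].
  by move=> k /andP[k1 _]; exact: What_boundary_image.
(* The end point of a path determines [w], so the strata are disjoint. *)
by move=> u w [hu _] [hw _] [p [[_ Wu] [_ Ww]]]; exact: (Wminus_uniq Wu Ww).
Qed.
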